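(* Let $0<a_+<a_-$ and let $\rho:[0,1]\to[0,\infty)$ be measurable with $\int_0^1 s^{-\epsilon_0}\rho(s)\,ds<\infty$ for some $\epsilon_0>0$. Let $c(x)=a_-x$ for $0<x<1$ and $c(x)=a_+x$ for $x\ge 1$, let $(T_t)_{t\ge0}$ be the associated growth-fragmentation semigroup, and let $\lambda=\int_0^1(1-s)\rho(s)\,ds$. 1. If $$a_+<-\int_0^1\log(s)\,\rho(s)\,ds<a_-,$$ then there exist a probability measure $\nu(dx)$ on $(0,\infty)$ and $\epsilon>0$ such that for every continuous compactly supported function $f:(0,\infty)\to\mathbb{R}$ and every $x>0$, $$e^{-\lambda t}T_tf(x)=\langle\nu,f\rangle+o(e^{-\epsilon t})\quad\text{as }t\to\infty .$$ 2. If at least one of the two inequalities $a_+<-\int_0^1\log(s)\rho(s)\,ds$ and $-\int_0^1\log(s)\rho(s)\,ds<a_-$ does not hold, then the Malthusian behaviour fails, i.e. there do not exist $\alpha\in\mathbb{R}$, a nonzero Radon measure $\nu$ on $(0,\infty)$ and a function $h:(0,\infty)\to(0,\infty)$ such that for every continuous compactly supported $f:(0,\infty)\to\mathbb{R}$ and every $x>0$, $\lim_{t\to\infty}e^{-\alpha t}T_tf(x)=h(x)\langle\nu,f\rangle$.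
   Context: Notation: $\langle\mu,g\rangle=\int g\,d\mu$. The growth-fragmentation operator is $$\mathcal{A}f(x)=c(x)f'(x)+\int_0^1\big(f(sx)-sf(x)\big)\rho(s)\,ds,\qquad x>0,$$ defined for smooth compactly supported $f$, say, and $(T_t)_{t\ge0}$ is the positive semigroup generated by $\mathcal{A}$. It is given by the Feynman–Kac representation $$T_tf(x)=x\,\mathbb{E}_x\Big(\mathcal{E}_t\,\frac{f(X_t)}{X_t}\Big),\qquad \mathcal{E}_t=\exp\Big(\int_0^t\frac{c(X_s)}{X_s}\,ds\Big),$$ where $X$ (starting from $x$ under $\mathbb{P}_x$, with expectation $\mathbb{E}_x$) is the Markov process on $(0,\infty)$ with generator $$\mathcal{G}f(x)=c(x)f'(x)+\int_0^1\big(f(sx)-f(x)\big)s\rho(s)\,ds.$$ Concretely, $X$ follows the flow $\dot x=c(x)$ between jumps, jumps occur at constant rate $K=\int_0^1s\rho(s)\,ds<\infty$, and at a jump time $X$ is multiplied by an independent random factor $s\in(0,1)$ with law $K^{-1}s\rho(s)\,ds$ (no jumps if $K=0$). *)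

(* Defs.v *)
From HB Require Import structures.
From mathcomp Require Import all_boot all_order all_algebra.
From mathcomp Require Import all_classical all_reals all_analysis.
Set Implicit Arguments.
Unset Strict Implicit.
Unset Printing Implicit Defensive.
Import Order.TTheory GRing.Theory Num.Theory.
Import numFieldNormedType.Exports.
Local Open Scope classical_set_scope.
Local Open Scope ring_scope.

(* Objects living on (0, +oo) are represented by objects on R: functions are
   only ever evaluated at positive points, and measures on (0, +oo) are Borel
   measures on R that do not charge its complement. *)

Definition speed (R : realType) (a_p a_m : R) (x : R) : R :=
  if x < 1 then a_m * x else a_p * x.

(* As c may be discontinuous, the equation x' = c(x) is understood in integrated
   (Caratheodory) form; [phi x t] is the position at time t when started at x. *)
Definition is_flow (R : realType) (c : R -> R) (phi : R -> R -> R) : Prop :=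
  forall x : R, 0 < x ->
    {within `[0, +oo[, continuous (phi x)} /\
    forall t : R, 0 <= t -> 0 < phi x t /\
      phi x t = x + \int[lebesgue_measure]_(s in `[0, t]) c (phi x s).

Definition mutually_independent d (Omega : measurableType d) (R : realType)
    (P : probability Omega R) (I : choiceType) (X : I -> {RV P >-> R}) : Prop :=
  forall (s : seq I) (A : I -> set R), uniq s ->
    (forall i, measurable (A i)) ->
    P (\bigcap_(i in [set` s]) (X i @^-1` A i)) =
    (\prod_(i <- s) P (X i @^-1` A i))%E.

Definition jump_rate (R : realType) (rho : R -> R) : R :=
  \int[lebesgue_measure]_(s in `[0, 1]) (s * rho s).

Section process.
Context d (Omega : measurableType d) (R : realType) (P : probability Omega R).
Variables (rho : R -> R) (tau sigma : nat -> {RV P >-> R}).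

(* [tau n] is the waiting time before the (n+1)-st jump and [sigma n] is the
   factor of that jump.  When K = 0 there is no jump, and nothing is required of
   the laws. *)
Record jump_mechanism : Prop := JumpMechanism {
  waiting_time_gt0 : forall n w, 0 < tau n w ;
  factor_itv : forall n w, 0 < sigma n w < 1 ;
  waiting_time_law : 0 < jump_rate rho -> forall n A, measurable A ->
    distribution P (tau n) A = exponential_prob (jump_rate rho) A ;
  factor_law : 0 < jump_rate rho -> forall n A, measurable A ->
    distribution P (sigma n) A =
    (\int[lebesgue_measure]_(s in A `&` `[0%R, 1%R])
       ((jump_rate rho)^-1 * (s * rho s))%:E)%E ;
  jumps_independent : mutually_independent
    (fun i : nat + nat => match i with inl n => tau n | inr n => sigma n end)
}.

Definition jump_time (n : nat) (w : Omega) : R := \sum_(i < n) tau i w.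

(* The default value 0 is used when K = 0, and otherwise only on the null event
   where infinitely many jump times are at most t. *)
Definition jump_count (t : R) (w : Omega) : nat :=
  if 0 < jump_rate rho
  then xget 0%N [set n | jump_time n w <= t < jump_time n.+1 w] else 0%N.

Variable phi : R -> R -> R.

Fixpoint post_jump (x : R) (n : nat) (w : Omega) : R :=
  if n is m.+1 then sigma m w * phi (post_jump x m w) (tau m w) else x.

Definition process (x t : R) (w : Omega) : R :=
  let n := jump_count t w in phi (post_jump x n w) (t - jump_time n w).

Variable c : R -> R.

Definition multiplicative_functional (x t : R) (w : Omega) : R :=
  expR (\int[lebesgue_measure]_(s in `[0, t])
          (c (process x s w) / process x s w)).

Definition gf_semigroup (t : R) (f : R -> R) (x : R) : R :=
  x * fine 'E_P[fun w => multiplicative_functional x t w *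
                         (f (process x t w) / process x t w)].

End process.

Definition Cc_pos (R : realType) (f : R -> R) : Prop :=
  {in `]0, +oo[, continuous f} /\
  exists2 A : set R, compact A /\ A `<=` `]0, +oo[%classic &
    forall x : R, 0 < x -> ~ A x -> f x = 0.

Definition pairing (R : realType) (nu : {measure set R -> \bar R}) (f : R -> R) : R :=
  \int[nu]_(x in `]0, +oo[) f x.

(* On (0, +oo) a Borel measure finite on compact sets is automatically regular. *)
Definition radon_pos (R : realType) (nu : {measure set R -> \bar R}) : Prop :=
  nu `]-oo, 0]%classic = 0%E /\
  forall A : set R, compact A -> A `<=` `]0, +oo[%classic -> (nu A < +oo)%E.

(* Submission.v *)
(** In the coordinate y = ln x the flow has speed a_p above 0 and a_m below 0, and
    jumps are additive with law J, the image of rho(s) ds under ln.  Conditioning on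
    the jump times and factors, the exponential functional turns the law of the
    factors into J, and exp (- lambda t) T_t becomes the Markov semigroup [sg] of the
    process with jump measure J, written as the minimal solution of the renewal
    equation; super- and subsolutions of that equation bound [sg] from above and below.

    If a_p < m < a_m, then cosh (q y) is a Lyapunov function for small q, and a single
    jump from just above 0 followed by a second passage through 0 spreads the position
    over an interval, which yields a Doeblin condition on bounded sets.  A weighted
    oscillation contraction (Harris' theorem) then gives exponential convergence.

    Otherwise set b = lambda - alpha, so that exp (b t) sg_t f has a positive limit.
    Boundedness forces b >= 0.  Far inside a half line where the speed is a, the bumps
    exp (q y) cos (k (y - y0)) grow at rate a q - L + int exp (q xi) cos (k xi) J(dxi),
    and letting k tend to 0 produces a real q with a q - L + int exp (q xi) J(dxi) <= - b.
    Then exp (q y) is a supersolution with a strict gain on the other half line (for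
    b = 0 one takes q small and loses an arbitrarily small constant), and telescoping
    shows that the sums of exp (b j) sg_j over that gain grow sublinearly, contradicting
    the positive limit. *)
Require Import Defs.
From HB Require Import structures.
From mathcomp Require Import all_boot all_order all_algebra.
From mathcomp Require Import all_classical all_reals all_analysis.
From mathcomp Require Import measurable_realfun ring lra.
Set Implicit Arguments.
Unset Strict Implicit.
Unset Printing Implicit Defensive.
Import Order.TTheory GRing.Theory Num.Theory.
Import numFieldNormedType.Exports.
Local Open Scope classical_set_scope.
Local Open Scope ring_scope.

(** Why the change of law works: the integral of [c(X) / X] is the displacement of [ln X] due to the
    flow, that is, the net displacement minus the sum of the [ln sigma]. Hence [x * E_t / X_t] is
    the product of the inverse factors, which cancels the size bias of [s rho(s) ds / K]; what
    remains is [exp((L - K) t) = exp(lambda t)], with [L] the mass of [J]. Uniqueness of bounded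
    solutions of the renewal equation gives conservativity and the semigroup law; unbounded
    functions are cut into bounded layers. The Doeblin condition rests on the two speeds being
    different: with equal speeds the final position would not depend on the time of the jump. In the
    negative part [alpha] is arbitrary and the moment hypothesis covers exponents [q >= - eps0]
    only, so no exponential may be assumed integrable beforehand. The bumps see only jumps of length
    at most [1 / k], and the finiteness of the limiting integral comes out of the growth bound. For
    [b > 0] the sign of [q] is forced by the tangent of the moment function at 0; this is where the
    failing inequality enters. *)

Definition image_measure d1 d2 (T1 : measurableType d1) (T2 : measurableType d2)
    (R : realType) (m : {measure set T1 -> \bar R}) (f : T1 -> T2)
    (mf : measurable_fun [set: T1] f) : {measure set T2 -> \bar R} :=
  measure_function_pushforward__canonical__measure_function_Measure m mf.

Lemma image_measureE d1 d2 (T1 : measurableType d1) (T2 : measurableType d2)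
    (R : realType) (m : {measure set T1 -> \bar R}) (f : T1 -> T2)
    (mf : measurable_fun [set: T1] f) A : image_measure m mf A = m (f @^-1` A).
Proof. by []. Qed.

Lemma ge0_integral_image d1 d2 (T1 : measurableType d1) (T2 : measurableType d2)
    (R : realType) (m : {measure set T1 -> \bar R}) (f : T1 -> T2)
    (mf : measurable_fun [set: T1] f) (h : T2 -> \bar R) :
  measurable_fun [set: T2] h -> (forall y, 0 <= h y)%E ->
  (\int[image_measure m mf]_y h y = \int[m]_x h (f x))%E.
Proof.
move=> mh h0; have := @ge0_integral_pushforward _ _ _ _ _ _ mf m setT h.
by rewrite preimage_setT => ->.
Qed.

(** * Densities and affine changes of variable for nonnegative integrands *)

Section measure_tools.
Context {R : realType}.
Notation mu := (@lebesgue_measure R).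
Import HBNNSimple.

(** Both sides commute with increasing limits of simple functions, and on the indicator of a level
    set the identity is the hypothesis on [nu]. *)
Lemma ge0_integral_density d (T : measurableType d)
    (m nu : {measure set T -> \bar R}) (g : T -> R) (f : T -> \bar R) :
  measurable_fun setT g -> (forall x, 0 <= g x) ->
  (forall A, measurable A -> nu A = \int[m]_(x in A) (g x)%:E)%E ->
  measurable_fun setT f -> (forall x, 0 <= f x)%E ->
  (\int[nu]_x f x = \int[m]_x (f x * (g x)%:E))%E.
Proof.
move=> mg g0 nuE mf f0.
have mgE : measurable_fun setT (EFin \o g) by exact/measurable_EFinP.
pose f_ := nnsfun_approx measurableT mf.
transitivity (lim (\int[nu]_x (f_ n x)%:E @[n --> \oo])%E).
  rewrite -monotone_convergence//=.
  - by apply: eq_integral => x _; apply/esym/cvg_lim => //=; exact: cvg_nnsfun_approx.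
  - by move=> n; exact/measurable_EFinP/measurable_funTS.
  - by move=> n x _; rewrite lee_fin.
  - by move=> x _ a b ab; rewrite lee_fin; exact/lefP/nd_nnsfun_approx.
transitivity (lim (\int[m]_x ((f_ n x)%:E * (g x)%:E) @[n --> \oo])%E); last first.
  rewrite -monotone_convergence//=.
  - apply: eq_integral => x _; apply/cvg_lim => //=.
    by apply: cvgeZr => //; exact: cvg_nnsfun_approx.
  - move=> n; apply: emeasurable_funM => //.
    exact/measurable_EFinP/measurable_funTS.
  - by move=> n x _; rewrite mule_ge0// lee_fin.
  - move=> x _ a b ab; rewrite lee_wpmul2r// lee_fin//.
    exact/lefP/nd_nnsfun_approx.
apply: congr_lim; apply/funext => n /=.
under [LHS]eq_integral do rewrite fimfunE -fsumEFin//.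
rewrite [LHS]ge0_integral_fsum//; last 2 first.
  - by move=> r; exact/measurable_EFinP/measurableT_comp.
  - by move=> k x _; rewrite EFinM nnfun_muleindic_ge0.
under [RHS]eq_integral.
  move=> x xD; rewrite fimfunE -fsumEFin// ge0_mule_fsuml; last first.
    by move=> r; rewrite EFinM nnfun_muleindic_ge0.
  over.
rewrite [RHS]ge0_integral_fsum//; last 2 first.
  - move=> r; apply: emeasurable_funM => //.
    exact/measurable_EFinP/measurableT_comp.
  - by move=> k x _; apply: mule_ge0; rewrite ?lee_fin// -lee_fin EFinM nnfun_muleindic_ge0.
apply: eq_fsbigr => r _.
have mr : measurable (f_ n @^-1` [set r]) by exact: measurable_sfunP.
rewrite integralZl_indic_nnsfun//= integral_indic// setIT nuE//.
have [r0|r0] := leP 0 r; last first.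
  rewrite preimage_nnfun0// integral_set0 mule0.
  by apply/esym/integral0_eq => x _; rewrite indic0 mulr0 mul0e.
under [RHS]eq_integral do rewrite EFinM -muleA.
rewrite ge0_integralZl//; last 2 first.
- apply: emeasurable_funM => //; exact/measurable_EFinP/measurable_indic.
- by move=> x _; rewrite mule_ge0// lee_fin.
congr (_ * _)%E; rewrite integral_mkcond; apply: eq_integral => x _.
by rewrite patchE indicE; case: ifP => _; rewrite ?mul1e ?mul0e.
Qed.

(** Lebesgue measure is determined by its values on half-open intervals, so the scaled image measure
    is computed only there. *)
Lemma lebesgue_measure_affine (c b : R) (A : set R) : 0 < c -> measurable A ->
  (c%:E * mu ((fun r => c * r + b)%R @^-1` A))%E = mu A.
Proof.
move=> c0 mA.
have mphi : measurable_fun setT ((fun r => c * r + b)%R : measurableTypeR R -> measurableTypeR R).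
  by apply: measurable_funD => //; exact: measurable_funM.
pose m : {measure set (measurableTypeR R) -> \bar R} := mscale (NngNum (ltW c0)) (image_measure mu mphi).
transitivity (m A); first by [].
apply/esym/(@lebesgue_measure_unique _ m) => //= _ [[x y]] _ <-.
rewrite /m /mscale/= image_measureE.
have -> : (fun r => c * r + b) @^-1` [set` `]x, y]] =
    [set` `](x - b) / c, (y - b) / c]].
  apply/seteqP; split => r /=; rewrite !in_itv/= ltr_pdivrMr// ler_pdivlMr//.
    by rewrite ltrBlDr lerBrDr (mulrC r).
  by rewrite ltrBlDr lerBrDr (mulrC r).
rewrite [LHS]lebesgue_measure_itv [X in (_ * X)%E]lebesgue_measure_itv/= !lte_fin ltr_pM2r ?invr_gt0// ltrD2r.
case: ifP => xy; last by rewrite mule0.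
  by rewrite -!EFinB -EFinM; congr EFin; field; lra.
exact: mphi.
Qed.

Lemma ge0_integral_affine (c b : R) (f : R -> \bar R) : 0 < c ->
  measurable_fun setT f -> (forall x, 0 <= f x)%E ->
  (c%:E * \int[mu]_r f (c * r + b)%R = \int[mu]_r f r)%E.
Proof.
move=> c0 mf f0.
have mphi : measurable_fun setT ((fun r => c * r + b)%R : measurableTypeR R -> measurableTypeR R).
  by apply: measurable_funD => //; exact: measurable_funM.
pose m : {measure set (measurableTypeR R) -> \bar R} := mscale (NngNum (ltW c0)) (image_measure mu mphi).
transitivity (\int[m]_r f r)%E; last first.
  by apply: eq_measure_integral => A mA _; exact: lebesgue_measure_affine.
rewrite ge0_integral_mscale//= (ge0_integral_image _ mphi)//.
Qed.

Lemma ge0_integral_shift (b : R) (f : R -> \bar R) :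
  measurable_fun setT f -> (forall x, 0 <= f x)%E ->
  (\int[mu]_r f (r + b)%R = \int[mu]_r f r)%E.
Proof.
move=> mf f0; rewrite -(@ge0_integral_affine 1 b f)// mul1e.
by under [RHS]eq_integral do rewrite mul1r.
Qed.

Lemma ge0_integral_opp (f : R -> \bar R) :
  measurable_fun setT f -> (forall x, 0 <= f x)%E ->
  (\int[mu]_r f (- r)%R = \int[mu]_r f r)%E.
Proof.
have mopp : measurable_fun setT (-%R : measurableTypeR R -> measurableTypeR R).
  by [].
move=> mf f0; transitivity (\int[image_measure mu mopp]_r f r)%E.
  by rewrite (ge0_integral_image _ mopp).
by apply: eq_measure_integral => A mA _; exact: lebesgue_measureN.
Qed.

End measure_tools.

(** * The fundamental theorem of calculus as an integral inequality *)

Section ftc_inequalities.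
Context {R : realType}.
Notation mu := (@lebesgue_measure R).

Lemma integral_derive (H dH : R -> R) (T : R) : 0 <= T ->
  (forall r : R, is_derive r (1 : R) H (dH r)) -> continuous dH ->
  (\int[mu]_(r in `[0%R, T]) (dH r)%:E = (H T - H 0)%:E)%E.
Proof.
move=> T0 HdH cdH; have cH : continuous H.
  move=> r; apply: differentiable_continuous.
  by apply/derivable1_diffP; have [] := HdH r.
move: T0; rewrite le_eqVlt => /orP[/eqP <-|T0].
  by rewrite set_itv1 integral_set1 subrr.
rewrite (@continuous_FTC2 _ _ H)//.
- exact: continuous_subspaceT.
- split.
  + by move=> r _; have [] := HdH r.
  + exact/cvg_at_right_filter/cH.
  + exact/cvg_at_left_filter/cH.
- by move=> r _; rewrite derive1E; exact: derive_val.
Qed.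

Lemma integral_deriveN (H dH : R -> R) (T : R) : 0 <= T ->
  (forall r : R, is_derive r (1 : R) H (dH r)) -> continuous dH ->
  ((H 0)%:E = \int[mu]_(r in `[0%R, T]) (- dH r)%:E + (H T)%:E)%E.
Proof.
move=> T0 HdH cdH.
have HN : forall r : R, is_derive r (1 : R) (fun r => - H r) (- dH r).
  by move=> r; exact: is_deriveN.
have cN : continuous (fun r => - dH r) by move=> r; apply: cvgN; exact: cdH.
rewrite (integral_derive T0 HN cN) -EFinD; congr EFin; ring.
Qed.

(** The form in which generator inequalities are used: [H] is a candidate bound followed along a
    trajectory and discounted by survival, [k] is the contribution of the jumps. *)
Lemma integral_le_derive (H dH : R -> R) (k : R -> \bar R) (T : R) : 0 <= T ->
  (forall r : R, is_derive r (1 : R) H (dH r)) -> continuous dH ->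
  measurable_fun (`[0, T] : set R) k ->
  (forall r, 0 <= r <= T -> (0 <= k r <= (- dH r)%:E)%E) ->
  (\int[mu]_(r in `[0%R, T]) k r + (H T)%:E <= (H 0)%:E)%E.
Proof.
move=> T0 HdH cdH mk kle; rewrite [leRHS](integral_deriveN T0 HdH cdH).
rewrite leeD2r//; apply: ge0_le_integral => //.
- by move=> r; rewrite /= in_itv/= => /kle/andP[].
- apply/measurable_EFinP/measurable_funTS; apply: continuous_measurable_fun.
  by move=> r; apply: cvgN; exact: cdH.
- by move=> r; rewrite /= in_itv/= => /kle/andP[].
Qed.

(** Counterpart for subsolutions. As [- dH] may change sign while [k] is nonnegative, [k] is
    compared with the positive part of [- dH]. *)
Lemma integral_ge_derive (H dH : R -> R) (k : R -> \bar R) (T : R) : 0 <= T ->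
  (forall r : R, is_derive r (1 : R) H (dH r)) -> continuous dH ->
  measurable_fun (`[0, T] : set R) k ->
  (forall r, 0 <= r <= T -> (0 <= k r)%E /\ ((- dH r)%:E <= k r)%E) ->
  ((H 0)%:E <= \int[mu]_(r in `[0%R, T]) k r + (H T)%:E)%E.
Proof.
move=> T0 HdH cdH mk kle; rewrite [leLHS](integral_deriveN T0 HdH cdH).
have mdH : measurable_fun (`[0, T] : set R) (fun r => (- dH r)%:E).
  apply/measurable_EFinP/measurable_funTS; apply: continuous_measurable_fun.
  by move=> r; apply: cvgN; exact: cdH.
rewrite leeD2r// integralE; apply: (@le_trans _ _
    (\int[mu]_(r in `[0%R, T]) ((fun r => (- dH r)%:E)^\+ r))%E).
  by rewrite geeDl// oppe_le0; exact: integral_ge0.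
apply: ge0_le_integral => //.
- exact: measurable_funepos.
- move=> r; rewrite /= in_itv/= => /kle[k0 kd].
  by rewrite funeposE ge_max kd k0.
Qed.

End ftc_inequalities.

(** * The flow in the coordinate [ln x] *)

Section flow.
Context {R : realType}.
Variables a_p a_m : R.
Hypotheses (a_p_gt0 : 0 < a_p) (a_p_lt_a_m : a_p < a_m).

Let a_m_gt0 : 0 < a_m. Proof. exact: lt_trans a_p_lt_a_m. Qed.

(** The maximum is the signed time elapsed since the passage through 0. This clock runs at unit
    speed and the minimum is its inverse, so the flow property reduces to addition of times, and
    measurability is immediate. *)
Definition log_flow (t y : R) : R :=
  let z := Num.max (y / a_m) (y / a_p) + t in Num.min (a_m * z) (a_p * z).

Let clockE y : Num.max (y / a_m) (y / a_p) = if 0 <= y then y / a_p else y / a_m.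
Proof.
have -> : y / a_p = y / a_m + y * (a_p^-1 - a_m^-1) by ring.
have h : 0 < a_p^-1 - a_m^-1 by rewrite subr_gt0 ltf_pV2.
case: leP => y0.
  by apply/max_idPr; rewrite lerDl mulr_ge0// ltW.
by apply/max_idPl; rewrite gerDl mulr_le0_ge0 ?ltW.
Qed.

Let unclockE z : Num.min (a_m * z) (a_p * z) = if 0 <= z then a_p * z else a_m * z.
Proof.
by case: leP => z0; [apply/min_idPr|apply/min_idPl]; have := a_p_lt_a_m; nra.
Qed.

Let clockK y : let z := Num.max (y / a_m) (y / a_p) in Num.min (a_m * z) (a_p * z) = y.
Proof.
rewrite /= unclockE clockE; case: (leP 0 y) => y0 /=.
  by rewrite divr_ge0 ?(ltW a_p_gt0)//= mulrC divfK// gt_eqF.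
rewrite ifF; first by rewrite mulrC divfK// gt_eqF.
by apply/negbTE; rewrite -ltNge pmulr_llt0 ?invr_gt0.
Qed.

Let unclockK z : let y := Num.min (a_m * z) (a_p * z) in Num.max (y / a_m) (y / a_p) = z.
Proof.
rewrite /= unclockE clockE; case: (leP 0 z) => z0 /=.
  by rewrite mulr_ge0 ?(ltW a_p_gt0)//= mulrC mulKf// gt_eqF.
rewrite ifF; first by rewrite mulrC mulKf// gt_eqF.
by apply/negbTE; rewrite -ltNge pmulr_rlt0.
Qed.

Lemma log_flow0 y : log_flow 0 y = y.
Proof. by rewrite /log_flow addr0 clockK. Qed.

Lemma log_flowD s t y : log_flow s (log_flow t y) = log_flow (t + s) y.
Proof. by rewrite /log_flow/= unclockK -addrA. Qed.

Lemma log_flow_ge0 t y : 0 <= y -> 0 <= t -> log_flow t y = y + a_p * t.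
Proof.
move=> y0 t0; rewrite /log_flow clockE y0 unclockE ifT.
  by field; rewrite gt_eqF.
by rewrite addr_ge0// divr_ge0// ltW.
Qed.

Lemma log_flow_le0 t y : y <= 0 -> y + a_m * t <= 0 -> log_flow t y = y + a_m * t.
Proof.
move=> y0 t0; rewrite /log_flow clockE.
have -> : (if 0 <= y then y / a_p else y / a_m) = y / a_m.
  case: ifP => // y0'; have -> : y = 0 by apply/le_anti; rewrite y0.
  by rewrite !mul0r.
have E : y / a_m + t = (y + a_m * t) / a_m by field; rewrite gt_eqF.
have H : y / a_m + t <= 0 by rewrite E pmulr_lle0 ?invr_gt0.
by rewrite min_l; [rewrite E mulrC divfK// gt_eqF|have := a_p_lt_a_m; nra].
Qed.

Lemma log_flow_cross t y : y <= 0 -> 0 <= y + a_m * t ->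
  log_flow t y = a_p * (t + y / a_m).
Proof.
move=> y0 t0; have -> : t = - (y / a_m) + (t + y / a_m) by ring.
rewrite -log_flowD.
have E : y + a_m * - (y / a_m) = 0 by field; rewrite gt_eqF.
rewrite (@log_flow_le0 (- (y / a_m)))//; last by rewrite E.
rewrite E log_flow_ge0//; last first.
  have -> : t + y / a_m = (y + a_m * t) / a_m by field; rewrite gt_eqF.
  by rewrite divr_ge0// ltW.
by rewrite add0r; congr (_ * _); ring.
Qed.

Lemma measurable_log_flow : measurable_fun setT (fun x : R * R => log_flow x.1 x.2).
Proof.
rewrite /log_flow.
have mz : measurable_fun setT (fun x : R * R => Num.max (x.2 / a_m) (x.2 / a_p) + x.1).
  apply: measurable_funD => //.
  by apply: measurable_maxr; exact: measurable_funM.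
by apply: measurable_minr; exact: measurable_funM.
Qed.

Lemma measurable_log_flow1 y : measurable_fun setT (log_flow ^~ y).
Proof.
apply: (measurable_comp measurableT _ measurable_log_flow _ (g := fun t => (t, y))) => //.
Qed.

End flow.

(** * Uniqueness for the integrated equation with discontinuous speed *)

Section speed_flow.
Context {R : realType}.
Notation mu := (@lebesgue_measure R).
Variables (a_p a_m x : R) (u : R -> R).
Hypotheses (a_p_gt0 : 0 < a_p) (a_p_lt_a_m : a_p < a_m) (x_gt0 : 0 < x).
Hypothesis u_cont : {within `[0, +oo[, continuous u}.
Hypothesis u_eq : forall t, 0 <= t -> 0 < u t /\
  u t = x + \int[mu]_(s in `[0, t]) speed a_p a_m (u s).

Let a_m_gt0 : 0 < a_m. Proof. exact: lt_trans a_p_lt_a_m. Qed.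
Let g s := speed a_p a_m (u s).

Let u_cont_itv a b : 0 <= a -> {within `[a, b], continuous u}.
Proof.
move=> a0; apply: continuous_subspaceW u_cont => r /=; rewrite !in_itv/= andbT.
by move=> /andP[ar _]; exact: le_trans ar.
Qed.

Let u_cont_at t : 0 < t -> {for t, continuous u}.
Proof.
move=> t0; have /continuous_within_itvcyP[+ _] := u_cont.
by move=> /(_ t); apply; rewrite in_itv/= t0.
Qed.

Let g_bounds t : 0 <= t -> a_p * u t <= g t <= a_m * u t.
Proof.
move=> t0; have [u0 _] := u_eq t0; rewrite /g /speed.
by case: ifP => _; rewrite lexx ?andbT/= ler_pM2r// ltW.
Qed.

Let g_int a b : 0 <= a -> mu.-integrable `[a, b] (EFin \o g).
Proof.
move=> a0.
have mu_ : measurable_fun (`[a, b] : set R) u.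
  by apply: subspace_continuous_measurable_fun => //; exact: u_cont_itv.
have iu : mu.-integrable `[a, b] (EFin \o u).
  by apply: continuous_compact_integrable; [exact: segment_compact|exact: u_cont_itv].
have iau : mu.-integrable `[a, b] (fun s => (a_m%:E * (u s)%:E)%E).
  exact: integrableZl.
apply: le_integrable iau => //.
  apply/measurable_EFinP; rewrite /g /speed; apply: measurable_fun_if => //.
  - exact: measurable_fun_ltr.
  - by apply: measurable_funM => //; apply: measurable_funS mu_ => // ? [].
  - by apply: measurable_funM => //; apply: measurable_funS mu_ => // ? [].
move=> s /=; rewrite in_itv/= => /andP[as_ _].
have s0 : 0 <= s by exact: le_trans as_.
have [us0 _] := u_eq s0; have /andP[g1 g2] := g_bounds s0.
rewrite lee_fin ger0_norm; last by apply: le_trans g1; rewrite mulr_ge0 ?ltW.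
by rewrite ger0_norm// mulr_ge0 ?ltW.
Qed.

Let u_incr s t : 0 <= s -> s <= t -> u t - u s = \int[mu]_(r in `[s, t]) g r.
Proof.
move=> s0 st; have t0 : 0 <= t by exact: le_trans st.
have [_ ->] := u_eq t0; have [_ ->] := u_eq s0.
rewrite opprD addrACA subrr add0r Rintegral_itvB; last 3 first.
- exact: g_int.
- by rewrite bnd_simp.
- by rewrite bnd_simp.
rewrite Rintegral_itv_obnd_cbnd//; apply: integrableS (g_int t (lexx 0)) => //.
by apply: subset_itvr; rewrite bnd_simp.
Qed.

Let u_ge t : 0 <= t -> x <= u t.
Proof.
move=> t0; have [_ ->] := u_eq t0; rewrite lerDl; apply: Rintegral_ge0 => s /=.
rewrite in_itv/= => /andP[s0 _]; have [us0 _] := u_eq s0.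
have /andP[g1 _] := g_bounds s0.
by apply: le_trans g1; rewrite mulr_ge0// ltW.
Qed.

Let u_lt s t : 0 <= s -> s < t -> u s < u t.
Proof.
move=> s0 st; rewrite -subr_gt0 u_incr// ?(ltW st)//.
apply: (@lt_le_trans _ _ (a_p * x * (t - s))); first by rewrite !mulr_gt0// subr_gt0.
have cE : \int[mu]_(r in `[s, t]) cst (a_p * x) r = a_p * x * (t - s).
  rewrite Rintegral_cst//; congr (_ * _).
  by have /= := @lebesgue_measure_itv R `[s, t]; rewrite lte_fin st => ->.
rewrite -cE; apply: le_Rintegral => //.
- apply: continuous_compact_integrable; first exact: segment_compact.
  by apply: continuous_subspaceT => r; exact: cvg_cst.
- exact: g_int.
- move=> r; rewrite /= in_itv/= => /andP[sr _].
  have r0 : 0 <= r by exact: le_trans sr.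
  have /andP[g1 _] := g_bounds r0; apply: le_trans g1.
  by rewrite ler_pM2l// u_ge.
Qed.

(** Away from the level 1 the speed is continuous along [u], so the integral equation can be
    differentiated. *)
Let u_derive t : 0 < t -> u t != 1 -> is_derive t (1 : R) u (g t).
Proof.
move=> t0 ut1.
have gc : {for t, continuous g}.
  rewrite /g /speed; move: ut1; rewrite neq_lt => /orP[ut1|ut1].
    have : \forall s \near t, a_m * u s = (if u s < 1 then a_m * u s else a_p * u s).
      near=> s; rewrite ifT//; near: s; exact: (u_cont_at t0 (lt_nbhsl ut1)).
    move=> h; rewrite /prop_for /continuous_at ut1.
    apply: cvg_trans (near_eq_cvg h) _.
    by apply: cvgM; [exact: cvg_cst|exact: u_cont_at].
  have : \forall s \near t, a_p * u s = (if u s < 1 then a_m * u s else a_p * u s).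
    near=> s; rewrite ifF//; apply/negbTE; rewrite -leNgt ltW//.
    near: s; exact: (u_cont_at t0 (lt_nbhsr ut1)).
  move=> h; rewrite /prop_for /continuous_at ltNge (ltW ut1)/=.
  apply: cvg_trans (near_eq_cvg h) _.
  by apply: cvgM; [exact: cvg_cst|exact: u_cont_at].
have tt1 : t < t + 1 by rewrite ltrDl.
have [dF F'] := continuous_FTC1_closed tt1 (g_int (t + 1) (lexx 0)) t0 gc.
have uE : \forall s \near t, x + \int[mu]_(r in `[0, s]) g r = u s.
  near=> s; have s0 : 0 <= s by apply: ltW; near: s; exact: lt_nbhsr.
  by have [_ ->] := u_eq s0.
have dxF : is_derive t (1 : R) (fun s => x + \int[mu]_(r in `[0, s]) g r) (g t).
  rewrite -[g t]add0r; apply: is_deriveD.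
  by split; [exact: dF|rewrite -derive1E; exact: F'].
by apply: near_eq_is_derive dxF; rewrite ?oner_eq0.
Unshelve. all: by end_near. Qed.

Let ln_u_slope (a s t : R) : 0 <= s -> s <= t ->
  (forall r, s < r < t -> u r != 1 /\ g r = a * u r) ->
  ln (u t) = ln (u s) + a * (t - s).
Proof.
move=> s0; rewrite le_eqVlt => /orP[/eqP <-|st h]; first by rewrite subrr mulr0 addr0.
have [||r _ E] := @MVT _ (fun r => ln (u r)) (fun r => a) s t st.
- move=> r /[!in_itv]/= /andP[sr rt]; have r0 : 0 < r by exact: le_lt_trans sr.
  have [u1 gE] := h r (introT andP (conj sr rt)).
  have [ur0 _] := u_eq (ltW r0).
  have := is_derive1_comp (is_derive1_ln ur0) (u_derive r0 u1).
  move=> h'; apply: is_derive_eq h' _.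
  by rewrite gE; field; rewrite gt_eqF.
- rewrite continuous_subspace_in => r /[!inE]/=; rewrite in_itv/= => /andP[sr _].
  have [ur0 _] := u_eq (le_trans s0 sr).
  apply: (@continuous_comp (subspace `[s, t]) R R u (@ln R) r).
    exact: (@u_cont_itv s t s0 r).
  exact: continuous_ln.
by rewrite -E addrC subrK.
Qed.

(** The jump of [speed] at 1 does not spoil uniqueness: a solution increases strictly, so it takes
    the value 1 at most once, and [ln u] is affine before and after that time. The lower slope
    determines the crossing time [ts]. *)
Lemma ln_speed_flow t : 0 <= t -> ln (u t) = log_flow a_p a_m t (ln x).
Proof.
have u0x : u 0 = x.
  by have [_ ->] := u_eq (lexx 0); rewrite set_itv1 Rintegral_set1 addr0.
have up s t' : 0 <= s -> 1 <= u s -> s <= t' -> ln (u t') = ln (u s) + a_p * (t' - s).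
  move=> s0 us st; apply: ln_u_slope => // r /andP[sr _].
  have : 1 < u r by apply: le_lt_trans us _; exact: u_lt.
  by move=> h; rewrite gt_eqF// /g /speed ltNge (ltW h).
move=> t0; case: (leP 1 x) => x1.
  rewrite log_flow_ge0// ?ln_ge0//.
  by rewrite (up 0 t)// ?u0x// subr0.
have lx : ln x < 0 by rewrite ln_lt0// x_gt0.
pose ts := - (ln x / a_m).
have ts0 : 0 < ts by rewrite /ts -mulNr divr_gt0// oppr_gt0.
have low t' : 0 <= t' -> u t' <= 1 -> ln (u t') = ln x + a_m * t'.
  move=> t'0 ut; rewrite (ln_u_slope (a := a_m) (lexx 0) t'0) ?u0x ?subr0//.
  move=> r /andP[r0 rt].
  have : u r < 1 by apply: lt_le_trans ut; apply: u_lt => //; exact: ltW.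
  by move=> h; rewrite lt_eqF// /g /speed h.
have hit c : 0 <= c -> u c = 1 -> c = ts.
  move=> c0 uc; have := low c c0; rewrite uc lexx ln1 => /(_ isT) E.
  rewrite /ts; apply: (mulfI (lt0r_neq0 a_m_gt0)).
  rewrite mulrN mulrCA divff ?mulr1 ?gt_eqF//; lra.
have cross r : 0 <= r -> 1 <= u r -> ts <= r.
  move=> r0 ur; have [|c /[!in_itv]/= /andP[c0 cr] uc] := @IVT _ u 0 r 1 r0 (@u_cont_itv 0 r (lexx 0)).
    by rewrite u0x ge_min le_max ltW//= ur orbT.
  by rewrite -(hit c).
(* If [u ts > 1], the level 1 was met by time [ts], and [hit] places this at [ts] itself. If
   [u ts < 1], the lower formula gives [ln (u ts) = 0]. Both are contradictions. *)
have uts : u ts = 1.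
  apply/eqP; rewrite eq_le; apply/andP; split; rewrite leNgt; apply/negP => h.
    have [|c /[!in_itv]/= /andP[c0 cr] uc] := @IVT _ u 0 ts 1 (ltW ts0) (@u_cont_itv 0 ts (lexx 0)).
      by rewrite u0x ge_min le_max ltW//= (ltW h) orbT.
    by move: h; rewrite -(hit c c0 uc) uc ltxx.
  have := low ts (ltW ts0) (ltW h).
  have -> : ln x + a_m * ts = 0 by rewrite /ts; field; rewrite gt_eqF.
  have [p0 _] := u_eq (ltW ts0).
  by have := ln_lt0 (introT andP (conj p0 h)); move=> /[swap] ->; rewrite ltxx.
have am0 : a_m != 0 by rewrite gt_eqF.
case: (leP t ts) => tts.
  rewrite log_flow_le0//; last 2 first.
  - exact: ltW.
  - have -> : 0 = ln x + a_m * ts by rewrite /ts; field.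
    by rewrite lerD2l ler_pM2l.
  apply: low => //; move: tts; rewrite le_eqVlt => /orP[/eqP ->|tts].
    by rewrite uts.
  by rewrite -uts ltW// u_lt.
rewrite log_flow_cross//; last 2 first.
- exact: ltW.
- have -> : 0 = ln x + a_m * ts by rewrite /ts; field.
  by rewrite lerD2l ler_pM2l// ltW.
rewrite (up ts t) ?uts ?ln1 ?add0r//; [|exact: ltW|exact: ltW].
by congr (_ * _); rewrite /ts opprK.
Qed.

End speed_flow.

Lemma flowE (R : realType) (a_p a_m : R) (phi : R -> R -> R) (x t : R) :
  0 < a_p -> a_p < a_m -> is_flow (speed a_p a_m) phi -> 0 < x -> 0 <= t ->
  0 < phi x t /\ ln (phi x t) = log_flow a_p a_m t (ln x).
Proof.
move=> ap am flow x0 t0; have [cphi ephi] := flow x x0.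
split; first by have [] := ephi t t0.
exact: (ln_speed_flow ap am x0 cphi ephi).
Qed.

Local Open Scope ereal_scope.

(** * Renewal operators and the minimal solution of the renewal equation *)

Section operators.
Context {R : realType}.
Notation mu := (@lebesgue_measure R).
Variables (a_p a_m : R) (J : {finite_measure set R -> \bar R}).
Notation Phi := (log_flow a_p a_m).

Definition pos_meas d (T : measurableType d) (f : T -> \bar R) :=
  measurable_fun [set: T] f /\ forall x, 0 <= f x.

Definition rate : R := fine (J setT).

(** Extended by 0 to negative times, so that [flow_op] can integrate over the whole line and
    [nojump] vanishes at negative times; this truncates the renewal equation at the time horizon. *)
Definition survival (r : R) : R := (if 0 <= r then expR (- (rate * r)) else 0)%R.

(** The operators act on functions of a pair (remaining time, position). *)
Definition jump_op (W : R * R -> \bar R) (x : R * R) : \bar R :=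
  \int[J]_xi W (x.1, x.2 + xi)%R.

Definition flow_op (W : R * R -> \bar R) (x : R * R) : \bar R :=
  \int[mu]_r ((survival r)%:E * W (x.1 - r, Phi r x.2)%R).

(** Flow up to the first jump, then jump. As [J] has mass [rate], the density of the jump time
    carries no prefactor. *)
Definition step_op (W : R * R -> \bar R) := flow_op (jump_op W).

Definition nojump (f : R -> \bar R) (x : R * R) : \bar R :=
  (survival x.1)%:E * f (Phi x.1 x.2).

(** Neumann series; the index of summation is the number of jumps. *)
Definition potential (W : R * R -> \bar R) (x : R * R) : \bar R :=
  \sum_(0 <= n <oo) iter n step_op W x.

Definition sg (t : R) (f : R -> \bar R) (y : R) : \bar R :=
  potential (nojump f) (t, y).

Lemma rate_ge0 : (0 <= rate)%R.
Proof. exact: fine_ge0. Qed.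

Lemma rateE : J setT = rate%:E.
Proof. by rewrite /rate fineK// fin_num_measure. Qed.

Lemma survival_ge0 r : (0 <= survival r)%R.
Proof. by rewrite /survival; case: ifP => // _; exact: expR_ge0. Qed.

Lemma measurable_survival : measurable_fun setT survival.
Proof.
apply: measurable_fun_if => //; first exact: measurable_fun_ler.
apply: measurable_funTS; apply: measurableT_comp => //.
apply: measurableT_comp => //; exact: measurable_funM.
Qed.

Lemma pos_meas_comp d d' (T : measurableType d) (U : measurableType d')
    (f : U -> \bar R) (g : T -> U) :
  measurable_fun setT g -> pos_meas f -> pos_meas (fun x => f (g x)).
Proof. by move=> mg [mf f0]; split => //; exact: measurableT_comp. Qed.

Lemma pos_measM d (T : measurableType d) (f g : T -> \bar R) :
  pos_meas f -> pos_meas g -> pos_meas (fun x => f x * g x).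
Proof.
move=> [mf f0] [mg g0]; split; first exact: emeasurable_funM.
by move=> x; exact: mule_ge0.
Qed.

Lemma pos_measD d (T : measurableType d) (f g : T -> \bar R) :
  pos_meas f -> pos_meas g -> pos_meas (fun x => f x + g x).
Proof.
move=> [mf f0] [mg g0]; split; first exact: emeasurable_funD.
by move=> x; exact: adde_ge0.
Qed.

Lemma pos_meas_EFin d (T : measurableType d) (f : T -> R) :
  measurable_fun setT f -> (forall x, (0 <= f x)%R) -> pos_meas (fun x => (f x)%:E).
Proof. by move=> mf f0; split; [exact/measurable_EFinP|move=> x; rewrite lee_fin]. Qed.

Lemma pos_meas_survival : pos_meas (fun r : R => (survival r)%:E).
Proof. by apply: pos_meas_EFin; [exact: measurable_survival|exact: survival_ge0]. Qed.

Lemma pos_meas_int1 d1 d2 (T1 : measurableType d1) (T2 : measurableType d2)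
    (m : {sigma_finite_measure set T2 -> \bar R}) (f : T1 * T2 -> \bar R) :
  pos_meas f -> pos_meas (fun x => \int[m]_y f (x, y)).
Proof.
move=> [mf f0]; split; last by move=> x; exact: integral_ge0.
exact: (measurable_fun_fubini_tonelli_F (m2 := m) f).
Qed.

Lemma pos_meas_series d (T : measurableType d) (f : nat -> T -> \bar R) :
  (forall n, pos_meas (f n)) -> pos_meas (fun x => \sum_(0 <= n <oo) f n x).
Proof.
move=> H; split; last by move=> x; apply: nneseries_ge0 => n _ _; exact: (H n).2.
by apply: ge0_emeasurable_sum => [n x _ _|n _]; [exact: (H n).2|exact: (H n).1].
Qed.

Lemma pos_meas_jump_op W : pos_meas W -> pos_meas (jump_op W).
Proof.
move=> hW; apply: (@pos_meas_int1 _ _ (R * R)%type R J (fun z => W (z.1.1, z.1.2 + z.2)%R)).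
apply: pos_meas_comp hW.
apply/measurable_fun_pair => /=; first exact: measurableT_comp.
apply: measurable_funD => //; exact: measurableT_comp.
Qed.

Lemma measurable_flow_shift (x : R * R) :
  measurable_fun setT (fun r : R => (x.1 - r, Phi r x.2)%R).
Proof.
apply/measurable_fun_pair => /=; first exact: measurable_funB.
exact: measurable_log_flow1.
Qed.

Lemma pos_meas_flow_integrand W x : pos_meas W ->
  pos_meas (fun r : R => (survival r)%:E * W (x.1 - r, Phi r x.2)%R).
Proof.
move=> hW; apply: pos_measM; first exact: pos_meas_survival.
by apply: pos_meas_comp hW; exact: measurable_flow_shift.
Qed.

Lemma pos_meas_flow_op W : pos_meas W -> pos_meas (flow_op W).
Proof.
move=> hW; apply: (@pos_meas_int1 _ _ (R * R)%type (measurableTypeR R) mu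
  (fun z => (survival z.2)%:E * W (z.1.1 - z.2, Phi z.2 z.1.2)%R)).
apply: pos_measM.
  by apply: (pos_meas_comp (g := snd)) pos_meas_survival => //.
apply: pos_meas_comp hW.
apply/measurable_fun_pair => /=.
  by apply: measurable_funB => //; exact: measurableT_comp.
apply: (measurableT_comp (measurable_log_flow a_p a_m) (g := fun z => (z.2, z.1.2))).
apply/measurable_fun_pair => //=; exact: measurableT_comp.
Qed.

Lemma pos_meas_step_op W : pos_meas W -> pos_meas (step_op W).
Proof. by move=> hW; apply: pos_meas_flow_op; exact: pos_meas_jump_op. Qed.

Lemma pos_meas_iter W n : pos_meas W -> pos_meas (iter n step_op W).
Proof. by move=> hW; elim: n => //= n; exact: pos_meas_step_op. Qed.

Lemma pos_meas_potential W : pos_meas W -> pos_meas (potential W).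
Proof. by move=> hW; apply: pos_meas_series => n; exact: pos_meas_iter. Qed.

Lemma pos_meas_nojump f : pos_meas f -> pos_meas (nojump f).
Proof.
move=> hf; apply: pos_measM.
  by apply: (pos_meas_comp (g := fst)) pos_meas_survival => //.
by apply: pos_meas_comp hf; exact: measurable_log_flow.
Qed.

Lemma pos_meas_sg t f : pos_meas f -> pos_meas (sg t f).
Proof.
move=> hf; have h := pos_meas_potential (pos_meas_nojump hf).
exact: (pos_meas_comp (pair1_measurable t) h).
Qed.

Local Hint Resolve survival_ge0 : core.

Lemma eq_flow_op W1 W2 : W1 =1 W2 -> flow_op W1 =1 flow_op W2.
Proof. by move=> h; rewrite (_ : W1 = W2)//; exact/funext. Qed.

Lemma eq_step_op W1 W2 : W1 =1 W2 -> step_op W1 =1 step_op W2.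
Proof. by move=> h; rewrite (_ : W1 = W2)//; exact/funext. Qed.

Lemma le_jump_op W1 W2 : pos_meas W1 -> pos_meas W2 ->
  (forall x, W1 x <= W2 x) -> forall x, jump_op W1 x <= jump_op W2 x.
Proof.
move=> h1 h2 h x.
have c W : pos_meas W -> pos_meas (fun xi : R => W (x.1, x.2 + xi)%R).
  move=> hW; apply: pos_meas_comp hW.
  by apply/measurable_fun_pair => //=; exact: measurable_funD.
apply: ge0_le_integral => //.
- by move=> xi _; exact: h1.2.
- exact: (c _ h1).1.
- exact: (c _ h2).1.
Qed.

Lemma le_flow_op W1 W2 : pos_meas W1 -> pos_meas W2 ->
  (forall x, W1 x <= W2 x) -> forall x, flow_op W1 x <= flow_op W2 x.
Proof.
move=> h1 h2 h x; apply: ge0_le_integral => //.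
- by move=> r _; exact: (pos_meas_flow_integrand x h1).2.
- exact: (pos_meas_flow_integrand x h1).1.
- exact: (pos_meas_flow_integrand x h2).1.
- by move=> r _; rewrite lee_wpmul2l// lee_fin.
Qed.

Lemma le_step_op W1 W2 : pos_meas W1 -> pos_meas W2 ->
  (forall x, W1 x <= W2 x) -> forall x, step_op W1 x <= step_op W2 x.
Proof.
move=> h1 h2 h; apply: le_flow_op; [exact: pos_meas_jump_op..|].
exact: le_jump_op.
Qed.

Lemma jump_opD W1 W2 x : pos_meas W1 -> pos_meas W2 ->
  jump_op (fun x => W1 x + W2 x) x = jump_op W1 x + jump_op W2 x.
Proof.
have c W : pos_meas W -> pos_meas (fun xi : R => W (x.1, x.2 + xi)%R).
  move=> hW; apply: pos_meas_comp hW.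
  by apply/measurable_fun_pair => //=; exact: measurable_funD.
move=> h1 h2; apply: ge0_integralD => //.
- by move=> xi _; exact: h1.2.
- exact: (c _ h1).1.
- by move=> xi _; exact: h2.2.
- exact: (c _ h2).1.
Qed.

Lemma flow_opD W1 W2 x : pos_meas W1 -> pos_meas W2 ->
  flow_op (fun x => W1 x + W2 x) x = flow_op W1 x + flow_op W2 x.
Proof.
move=> h1 h2; rewrite /flow_op -ge0_integralD//.
- apply: eq_integral => r _; rewrite ge0_muleDr//; [exact: h1.2|exact: h2.2].
- by move=> r _; exact: (pos_meas_flow_integrand x h1).2.
- exact: (pos_meas_flow_integrand x h1).1.
- by move=> r _; exact: (pos_meas_flow_integrand x h2).2.
- exact: (pos_meas_flow_integrand x h2).1.
Qed.

Lemma step_op0 x : step_op (fun=> 0) x = 0.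
Proof.
apply: integral0_eq => r _; rewrite /jump_op integral0_eq ?mule0//.
Qed.

Lemma step_opD W1 W2 x : pos_meas W1 -> pos_meas W2 ->
  step_op (fun x => W1 x + W2 x) x = step_op W1 x + step_op W2 x.
Proof.
move=> h1 h2; rewrite /step_op -flow_opD; [|exact: pos_meas_jump_op..].
by apply: eq_flow_op => z; exact: jump_opD.
Qed.

Lemma step_opZ (c : R) W x : pos_meas W -> (0 <= c)%R ->
  step_op (fun x => c%:E * W x) x = c%:E * step_op W x.
Proof.
move=> hW c0; rewrite /step_op /flow_op.
have hJ := pos_meas_jump_op hW.
rewrite -ge0_integralZl//.
- apply: eq_integral => r _; rewrite muleCA; congr (_ * _).
  rewrite /jump_op ge0_integralZl//.
    apply: (pos_meas_comp (f := W) (g := fun xi : R => ((x.1 - r, Phi r x.2).1, (x.1 - r, Phi r x.2).2 + xi)%R) _ hW).1.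
    by apply/measurable_fun_pair => //=; exact: measurable_funD.
  by move=> xi _; exact: hW.2.
- exact: (pos_meas_flow_integrand x hJ).1.
- by move=> r _; exact: (pos_meas_flow_integrand x hJ).2.
Qed.

Lemma step_op_series (W : nat -> R * R -> \bar R) x : (forall n, pos_meas (W n)) ->
  step_op (fun x => \sum_(0 <= n <oo) W n x) x = \sum_(0 <= n <oo) step_op (W n) x.
Proof.
move=> hW; rewrite /step_op /flow_op.
rewrite -integral_nneseries//; last 2 first.
- by move=> n; exact: (pos_meas_flow_integrand x (pos_meas_jump_op (hW n))).1.
- by move=> n r _; exact: (pos_meas_flow_integrand x (pos_meas_jump_op (hW n))).2.
apply: eq_integral => r _.
rewrite nneseriesZl; last by move=> n _; exact: (pos_meas_jump_op (hW n)).2.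
congr (_ * _); rewrite /jump_op integral_nneseries//.
- move=> n; apply: (pos_meas_comp (f := W n) (g := fun xi : R => (x.1 - r, Phi r x.2 + xi)%R) _ (hW n)).1.
  by apply/measurable_fun_pair => //=; exact: measurable_funD.
- by move=> n xi _; exact: (hW n).2.
Qed.

Lemma potentialE W x : pos_meas W ->
  potential W x = W x + step_op (potential W) x.
Proof.
move=> hW; have hn n := pos_meas_iter n hW.
rewrite /potential nneseries_recl//; last by move=> n _; exact: (hn n).2.
congr (_ + _); rewrite step_op_series//.
rewrite -(@nneseries_addn _ (fun k => iter k step_op W x) 1); last first.
  by move=> k; exact: (hn k).2.
by apply: eq_eseriesr => n _; rewrite addn1.
Qed.

Lemma pos_meas_sum d (T : measurableType d) (f : nat -> T -> \bar R) n :
  (forall n, pos_meas (f n)) -> pos_meas (fun x => \sum_(0 <= k < n) f k x).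
Proof.
move=> hf; split; first by apply: emeasurable_sum => k; exact: (hf k).1.
by move=> z; apply: sume_ge0 => k _; exact: (hf k).2.
Qed.

Lemma step_op_sum (W : nat -> R * R -> \bar R) n x : (forall n, pos_meas (W n)) ->
  step_op (fun x => \sum_(0 <= k < n) W k x) x = \sum_(0 <= k < n) step_op (W k) x.
Proof.
move=> hW; elim: n => [|n IH].
  rewrite big_geq//; transitivity (step_op (fun=> 0) x); last exact: step_op0.
  by apply: eq_step_op => z; rewrite big_geq.
rewrite big_nat_recr//= -IH.
transitivity (step_op (fun x => \sum_(0 <= k < n) W k x + W n x) x).
  by apply: eq_step_op => z; rewrite big_nat_recr.
by rewrite step_opD//; exact: pos_meas_sum.
Qed.

(** A supersolution dominates every partial sum of the Neumann series, by induction on the number of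
    terms. *)
Lemma potential_min W V : pos_meas W -> pos_meas V ->
  (forall x, W x + step_op V x <= V x) -> forall x, potential W x <= V x.
Proof.
move=> hW hV h x.
have hn n := pos_meas_iter n hW.
have key n : forall x, \sum_(0 <= k < n) iter k step_op W x <= V x.
  elim: n => [|n IH] {}x; first by rewrite big_geq//; exact: hV.2.
  rewrite big_nat_recl//=; apply: le_trans (h x); rewrite leeD2l//.
  rewrite -(@step_op_sum (fun k => iter k step_op W))//.
  by apply: le_step_op => //; exact: pos_meas_sum.
apply: lime_le; first by apply: is_cvg_nneseries => n _ _; exact: (hn n).2.
exact: nearW.
Qed.

End operators.

(** * Decomposition of the renewal operators along trajectories *)

Section comparison.
Context {R : realType}.
Notation mu := (@lebesgue_measure R).
Variables (a_p a_m : R) (J : {finite_measure set R -> \bar R}).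
Notation Phi := (log_flow a_p a_m).
Notation L := (rate J).
Notation flow_op := (flow_op a_p a_m J).
Notation step_op := (step_op a_p a_m J).
Notation potential := (potential a_p a_m J).
Notation nojump := (nojump a_p a_m J).
Notation sg := (sg a_p a_m J).
Hypotheses (a_p_gt0 : (0 < a_p)%R) (a_p_lt_a_m : (a_p < a_m)%R).

Lemma integral_itv_split (f : R -> \bar R) (S T : R) : (0 <= S)%R -> (0 <= T)%R ->
  pos_meas f ->
  \int[mu]_(r in `[0%R, (S + T)%R]) f r =
  \int[mu]_(r in `[0%R, S]) f r + \int[mu]_(r in `[0%R, T]) f (S + r)%R.
Proof.
move=> S0 T0 [mf f0].
have -> : `[0%R, (S + T)%R]%classic = `[0%R, S]%classic `|` `]S, (S + T)%R]%classic.
  apply/seteqP; split => r /=; rewrite !in_itv/=.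
    move=> /andP[r0 rT]; case: (leP r S)%R => rS; [left|right].
      by rewrite r0.
    by rewrite rT.
  by move=> [/andP[r0 rS]|/andP[rS rT]]; lra.
rewrite ge0_integral_setU//; last 2 first.
- exact: measurable_funTS.
- apply/disj_setPS => r /=; rewrite !in_itv/= => -[/andP[_ h1] /andP[h2 _]].
  by move: h1; rewrite leNgt h2.
congr (_ + _); rewrite integral_mkcond -(ge0_integral_shift S); last 2 first.
- by apply/measurable_restrict => //; exact: measurable_funTS.
- by move=> r; rewrite erestrict_ge0.
rewrite -[RHS]integral_itv_obnd_cbnd; last first.
  by apply: measurable_funTS; apply: measurableT_comp => //; exact: measurable_funD.
rewrite [RHS]integral_mkcond; apply: eq_integral => r _.
rewrite !patchE (addrC S); congr (if _ then _ else _).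
by apply/idP/idP; rewrite !inE/= !in_itv/=; lra.
by rewrite addrC.
Qed.

Lemma integral_survival (f : R -> \bar R) : pos_meas f ->
  \int[mu]_r ((survival J r)%:E * f r) =
  \int[mu]_(r in `[0%R, +oo[) ((expR (- (L * r)))%:E * f r).
Proof.
move=> hf; rewrite [RHS]integral_mkcond; apply: eq_integral => r _.
rewrite patchE /survival; case: ifPn => r0.
  by rewrite ifT// inE/= in_itv/= r0.
by rewrite ifF ?mul0e//; apply/negbTE; rewrite notin_setE/= in_itv/= andbT; exact/negP.
Qed.

Lemma flow_op_trunc (W : R * R -> \bar R) (t y : R) : pos_meas W -> (forall s z, (s < 0)%R -> W (s, z) = 0) ->
  (0 <= t)%R ->
  flow_op W (t, y) = \int[mu]_(r in `[0%R, t]) ((expR (- (L * r)))%:E * W (t - r, Phi r y)%R).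
Proof.
move=> hW W0 t0; rewrite /Submission.flow_op/= [RHS]integral_mkcond; apply: eq_integral => r _.
rewrite patchE /survival; case: (leP 0 r)%R => r0; last first.
  by rewrite mul0e ifF//; apply/negbTE; rewrite notin_setE/= in_itv/= leNgt r0.
case: (leP r t)%R => rt; first by rewrite ifT// inE/= in_itv/= r0.
rewrite W0 ?mule0; last by rewrite subr_lt0.
by rewrite ifF//; apply/negbTE; rewrite notin_setE/= in_itv/= r0 leNgt rt.
Qed.

Lemma flow_op_neg (W : R * R -> \bar R) (t y : R) : pos_meas W -> (forall s z, (s < 0)%R -> W (s, z) = 0) ->
  (t < 0)%R -> flow_op W (t, y) = 0.
Proof.
move=> hW W0 t0; apply: integral0_eq => r _ /=.
rewrite /survival; case: (leP 0 r)%R => r0; last by rewrite mul0e.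
by rewrite W0 ?mule0//; lra.
Qed.

(** Memorylessness of the exponential clock together with the flow property: after time [t],
    [flow_op] restarts from [Phi t y]. *)
Lemma flow_op_split (W : R * R -> \bar R) (t u y : R) : pos_meas W -> (0 <= t)%R ->
  flow_op W ((t + u)%R, y) =
  \int[mu]_(r in `[0%R, t]) ((expR (- (L * r)))%:E * W (t + u - r, Phi r y)%R)
  + (expR (- (L * t)))%:E * flow_op W (u, Phi t y).
Proof.
move=> hW t0; rewrite {1}/Submission.flow_op/=.
have hg : pos_meas (fun r : R => W ((t + u - r)%R, Phi r y)).
  by apply: pos_meas_comp hW; exact: (measurable_flow_shift a_p a_m ((t + u)%R, y)).
have hge : pos_meas (fun r : R => (expR (- (L * r)))%:E * W ((t + u - r)%R, Phi r y)).
  apply: pos_measM hg; apply: pos_meas_EFin; last by move=> r; exact: expR_ge0.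
  apply: measurableT_comp => //; apply: measurableT_comp => //; exact: measurable_funM.
rewrite integral_survival//.
have -> : `[0%R, +oo[%classic = `[0%R, t[%classic `|` `[t, +oo[%classic.
  apply/seteqP; split => r /=; rewrite !in_itv/= !andbT.
    by move=> r0; case: (ltP r t)%R => rt; [left|right]; rewrite ?r0.
  by move=> [/andP[]//|]; lra.
rewrite ge0_integral_setU//; last 3 first.
- by apply: measurable_funTS; exact: hge.1.
- by move=> r _; exact: hge.2.
- apply/disj_setPS => r /=; rewrite !in_itv/= andbT => -[/andP[_ h1] h2].
  by move: h1; rewrite ltNge h2.
rewrite integral_itv_bndo_bndc; last by apply: measurable_funTS; exact: hge.1.
congr (_ + _); rewrite integral_mkcond -(ge0_integral_shift t); last 2 first.
- by apply/measurable_restrict => //; apply: measurable_funTS; exact: hge.1.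
- by move=> r; apply: erestrict_ge0 => z _; exact: hge.2.
have hu := pos_meas_flow_integrand a_p a_m J (u, Phi t y) hW.
rewrite -ge0_integralZl//; last 2 first.
- exact: hu.1.
- by move=> r _; exact: hu.2.
apply: eq_integral => r _ /=; rewrite patchE /survival.
case: (leP 0 r)%R => r0; last first.
  rewrite mul0e mule0 ifF//; apply/negbTE/negP; rewrite inE/= in_itv/= andbT.
  by move=> h; lra.
rewrite ifT; last by rewrite inE/= in_itv/= andbT; lra.
rewrite log_flowD// muleA -EFinM -expRD (addrC t r).
congr (_ * W (_, _)).
  by congr EFin; congr expR; ring.
by ring.
Qed.

(** Gluing: the inequality need only be checked on pieces of trajectory inside one closed half line,
    where the motion is affine. A trajectory crossing 0 is cut at the crossing, and the second
    inequality is discounted by the survival over the first piece. *)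
Lemma along_flow (t0 t1 : R) (G : R * R -> \bar R) (V : R -> R -> R) : pos_meas G ->
  (forall s y T : R, (t0 <= s)%R -> (0 <= y)%R -> (0 <= T)%R -> (s + T <= t1)%R ->
    \int[mu]_(r in `[0%R, T]) ((expR (- (L * r)))%:E * G (s + T - r, y + a_p * r)%R)
    + (expR (- (L * T)) * V s (y + a_p * T))%:E <= (V (s + T) y)%:E) ->
  (forall s y T : R, (t0 <= s)%R -> (y <= 0)%R -> (0 <= T)%R -> (y + a_m * T <= 0)%R -> (s + T <= t1)%R ->
    \int[mu]_(r in `[0%R, T]) ((expR (- (L * r)))%:E * G (s + T - r, y + a_m * r)%R)
    + (expR (- (L * T)) * V s (y + a_m * T))%:E <= (V (s + T) y)%:E) ->
  forall y T : R, (0 <= T)%R -> (t0 + T <= t1)%R ->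
    \int[mu]_(r in `[0%R, T]) ((expR (- (L * r)))%:E * G (t0 + T - r, Phi r y)%R)
    + (expR (- (L * T)) * V t0 (Phi T y))%:E <= (V (t0 + T) y)%:E.
Proof.
have a_m0 : (0 < a_m)%R by exact: lt_trans a_p_lt_a_m.
move=> hG up dn.
have upT (s y T : R) : (t0 <= s)%R -> (0 <= y)%R -> (0 <= T)%R -> (s + T <= t1)%R ->
    \int[mu]_(r in `[0%R, T]) ((expR (- (L * r)))%:E * G (s + T - r, Phi r y)%R)
    + (expR (- (L * T)) * V s (Phi T y))%:E <= (V (s + T) y)%:E.
  move=> hs y0 T0 sT; rewrite log_flow_ge0//; apply: le_trans (up s y T hs y0 T0 sT).
  rewrite leeD2r// le_eqVlt; apply/orP; left; apply/eqP; apply: eq_integral => r.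
  by rewrite inE/= in_itv/= => /andP[r0 _]; rewrite log_flow_ge0.
move=> y T T0 T1; case: (leP 0 y)%R => y0; first exact: upT.
have dnT (s T' : R) : (t0 <= s)%R -> (0 <= T')%R -> (y + a_m * T' <= 0)%R -> (s + T' <= t1)%R ->
    \int[mu]_(r in `[0%R, T']) ((expR (- (L * r)))%:E * G (s + T' - r, Phi r y)%R)
    + (expR (- (L * T')) * V s (Phi T' y))%:E <= (V (s + T') y)%:E.
  move=> hs T0' yT sT; rewrite log_flow_le0// ?(ltW y0)//.
  apply: le_trans (dn s y T' hs (ltW y0) T0' yT sT).
  rewrite leeD2r// le_eqVlt; apply/orP; left; apply/eqP; apply: eq_integral => r.
  rewrite inE/= in_itv/= => /andP[r0 rT]; rewrite log_flow_le0// ?(ltW y0)//.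
  apply: le_trans yT; rewrite lerD2l; exact: ler_wpM2l (ltW a_m0) _ _ rT.
case: (leP (y + a_m * T) 0)%R => yT; first exact: dnT.
(* [S] is the time at which the trajectory reaches 0, [U] is what is left of [T]. *)
pose S := (- (y / a_m))%R; pose U := (T - S)%R.
have S0 : (0 <= S)%R by rewrite /S -mulNr divr_ge0// ?oppr_ge0 ltW.
have yS : (y + a_m * S = 0)%R by rewrite /S; field; rewrite gt_eqF.
have U0 : (0 <= U)%R.
  have -> : U = ((y + a_m * T) / a_m)%R by rewrite /U /S; field; rewrite gt_eqF.
  by rewrite divr_ge0// ltW.
have TE : T = (S + U)%R by rewrite /U; ring.
have PS : Phi S y = 0%R by rewrite log_flow_le0 ?yS// ltW.
rewrite TE integral_itv_split//; last first.
  apply: pos_measM.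
    apply: pos_meas_EFin; last by move=> r; exact: expR_ge0.
    by apply: measurableT_comp => //; apply: measurableT_comp => //; exact: measurable_funM.
  by apply: pos_meas_comp hG; exact: (measurable_flow_shift a_p a_m ((t0 + (S + U))%R, y)).
have t0U : (t0 <= t0 + U)%R by rewrite lerDl.
rewrite (_ : t0 + (S + U) = t0 + U + S)%R; last by ring.
apply: le_trans (dnT _ _ t0U S0 _ _); [|by rewrite yS|by lra].
rewrite -addeA leeD2l//.
have t0U1 : (t0 + U <= t1)%R by lra.
have := upT t0 (Phi S y) U (lexx _); rewrite PS => /(_ (lexx _) U0 t0U1) hU.
have PhiE r : Phi (S + r) y = Phi r 0 by rewrite -log_flowD// PS.
have e0 : 0 <= (expR (- (L * S)))%:E by rewrite lee_fin expR_ge0.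
have := lee_wpmul2l e0 hU; rewrite -EFinM => h.
have mexp : measurable_fun setT (fun r : R => expR (- (L * r))).
  by apply: measurableT_comp => //; apply: measurableT_comp => //; exact: measurable_funM.
have hGU : pos_meas (fun r : R => (expR (- (L * r)))%:E * G (t0 + U - r, Phi r 0)%R).
  apply: pos_measM; first by apply: pos_meas_EFin => // r; exact: expR_ge0.
  by apply: pos_meas_comp hG; exact: (measurable_flow_shift a_p a_m ((t0 + U)%R, 0%R)).
apply: le_trans h; rewrite muleDr//; last exact: fin_num_adde_defl.
rewrite -ge0_integralZl//; last 2 first.
- by apply: measurable_funTS; exact: hGU.1.
- by move=> r _; exact: hGU.2.
rewrite leeD// le_eqVlt; apply/orP; left; apply/eqP.
  apply: eq_integral => r _; rewrite muleA -EFinM -expRD PhiE.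
  by congr (_ * G (_, _)); [congr EFin; congr expR; ring|ring].
rewrite -EFinM mulrA -expRD PhiE; congr EFin; congr (_ * _)%R.
by congr expR; ring.
Qed.

End comparison.

(** * Bounded solutions of the renewal equation, linearity, conservativity *)

Section semigroup.
Context {R : realType}.
Notation mu := (@lebesgue_measure R).
Variables (a_p a_m : R) (J : {finite_measure set R -> \bar R}).
Notation Phi := (log_flow a_p a_m).
Notation L := (rate J).
Notation flow_op := (flow_op a_p a_m J).
Notation jump_op := (jump_op J).
Notation step_op := (step_op a_p a_m J).
Notation potential := (potential a_p a_m J).
Notation nojump := (nojump a_p a_m J).
Notation sg := (sg a_p a_m J).
Hypotheses (a_p_gt0 : (0 < a_p)%R) (a_p_lt_a_m : (a_p < a_m)%R).

Lemma measurable_expRate : measurable_fun setT (fun r : R => expR (- (L * r))).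
Proof.
by apply: measurableT_comp => //; apply: measurableT_comp => //; exact: measurable_funM.
Qed.

Lemma jump_op_neg (V : R * R -> \bar R) : (forall t y : R, (t < 0)%R -> V (t, y) = 0) ->
  forall t y : R, (t < 0)%R -> jump_op V (t, y) = 0.
Proof. by move=> V0 t y t0; apply: integral0_eq => xi _; exact: V0. Qed.

Lemma jump_op_le (V : R * R -> \bar R) (c t y : R) : pos_meas V ->
  (forall y : R, V (t, y) <= c%:E) -> (0 <= c)%R -> jump_op V (t, y) <= (c * L)%:E.
Proof.
move=> hV Vc c0; rewrite /Submission.jump_op/=.
have h : pos_meas (fun xi : R => V (t, y + xi)%R).
  by apply: pos_meas_comp hV; apply/measurable_fun_pair => //=; exact: measurable_funD.
apply: (@le_trans _ _ (\int[J]_xi (cst c%:E xi))).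
  by apply: ge0_le_integral => //; [move=> x _; exact: h.2|exact: h.1].
by have -> := integral_cst J measurableT c%:E; rewrite EFinM -(rateE J).
Qed.

Lemma integral_rate (t : R) : (0 <= t)%R ->
  \int[mu]_(r in `[0%R, t]) (L * expR (- (L * r)))%:E = (1 - expR (- (L * t)))%:E.
Proof.
move=> t0.
have dE (r : R) : is_derive r (1%R : R) (fun r => - expR (- (L * r)))%R (L * expR (- (L * r)))%R.
  apply: is_derive_eq; rewrite !scaler1 /GRing.scale/=; ring.
rewrite (integral_derive t0 dE).
  by rewrite mulr0 oppr0 expR0 opprK addrC.
move=> r; apply: cvgM; first exact: cvg_cst.
apply: continuous_comp; last exact: continuous_expR.
apply: cvgN; apply: cvgM; [exact: cvg_cst|exact: cvg_id].
Qed.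

Lemma step_op_neg (V : R * R -> \bar R) : pos_meas V ->
  (forall t y : R, (t < 0)%R -> V (t, y) = 0) ->
  forall t y : R, (t < 0)%R -> step_op V (t, y) = 0.
Proof.
move=> hV V0 t y t0; apply: flow_op_neg => //; first exact: pos_meas_jump_op.
by move=> s z s0; exact: jump_op_neg.
Qed.

(** On the horizon [t0] a step contracts the supremum norm by the probability of a jump before [t0];
    the maximum covers negative [t0]. *)
Lemma step_op_bound (V : R * R -> \bar R) (t0 c : R) : (0 <= c)%R ->
  pos_meas V -> (forall t y : R, (t < 0)%R -> V (t, y) = 0) ->
  (forall t y : R, (t <= t0)%R -> V (t, y) <= c%:E) ->
  forall t y : R, (t <= t0)%R -> step_op V (t, y) <= (c * Num.max 0 (1 - expR (- (L * t0))))%:E.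
Proof.
move=> c0 hV V0 Vc t y tt0.
have m0 : (0 <= c * Num.max 0 (1 - expR (- (L * t0))))%R.
  by rewrite mulr_ge0// le_max lexx.
case: (ltP t 0)%R => t0'; first by rewrite step_op_neg ?lee_fin.
have hJ := pos_meas_jump_op J hV.
rewrite /Submission.step_op flow_op_trunc//; last exact: jump_op_neg.
have hI := pos_meas_comp (measurable_flow_shift a_p a_m (t, y)) hJ.
apply: (@le_trans _ _ (\int[mu]_(r in `[0%R, t]) (c%:E * (L * expR (- (L * r)))%:E))).
  apply: ge0_le_integral => //.
  - by move=> r _; rewrite mule_ge0// ?lee_fin ?expR_ge0//; exact: hJ.2.
  - apply: measurable_funTS; apply: emeasurable_funM; last exact: hI.1.
    apply/measurable_EFinP; exact: measurable_expRate.
  - apply: measurable_funTS; apply: emeasurable_funM => //.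
    apply/measurable_EFinP/measurable_funM => //; exact: measurable_expRate.
  - move=> r; rewrite /= in_itv/= => /andP[r0 rt].
    rewrite -EFinM mulrA (mulrC _ (expR _)) EFinM lee_wpmul2l ?lee_fin ?expR_ge0//.
    apply: jump_op_le => // z; apply: Vc; lra.
rewrite ge0_integralZl//; last 2 first.
- apply/measurable_EFinP/measurable_funTS/measurable_funM => //.
  exact: measurable_expRate.
- by move=> r _; rewrite lee_fin mulr_ge0 ?expR_ge0 ?rate_ge0.
rewrite integral_rate// -EFinM lee_fin ler_wpM2l// le_max; apply/orP; right.
by rewrite lerD2l lerN2 ler_expR lerN2 ler_wpM2l// rate_ge0.
Qed.

Lemma iter_bound (V : R * R -> \bar R) (t0 c : R) n : (0 <= c)%R ->
  pos_meas V -> (forall t y : R, (t < 0)%R -> V (t, y) = 0) ->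
  (forall t y : R, (t <= t0)%R -> V (t, y) <= c%:E) ->
  [/\ pos_meas (iter n step_op V),
   forall t y : R, (t < 0)%R -> iter n step_op V (t, y) = 0 &
   forall t y : R, (t <= t0)%R ->
     iter n step_op V (t, y) <= (c * Num.max 0 (1 - expR (- (L * t0))) ^+ n)%:E].
Proof.
move=> c0 hV V0 Vc; elim: n => [|n [h1 h2 h3]] /=.
  by split => // t y /Vc; rewrite expr0 mulr1.
split; first exact: pos_meas_step_op.
  exact: step_op_neg.
move=> t y tt0; rewrite exprSr mulrA; apply: step_op_bound => //.
by rewrite mulr_ge0// exprn_ge0// le_max lexx.
Qed.

(** Iterating the inequality [n] times leaves a remainder of size [c (1 - exp(- L t0))^n], which
    tends to 0. Together with [potential_min] this is uniqueness of bounded solutions. *)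
Lemma potential_sub (W V : R * R -> \bar R) (t0 c : R) : (0 <= c)%R ->
  pos_meas W -> pos_meas V -> (forall t y : R, (t < 0)%R -> V (t, y) = 0) ->
  (forall t y : R, (t <= t0)%R -> V (t, y) <= c%:E) ->
  (forall x, V x <= W x + step_op V x) ->
  forall t y : R, (t <= t0)%R -> V (t, y) <= potential W (t, y).
Proof.
move=> c0 hW hV V0 Vc sub t y tt0.
have hn n := pos_meas_iter a_p a_m J n hW.
have key n x : V x <= \sum_(0 <= k < n) iter k step_op W x + iter n step_op V x.
  elim: n x => [|n IH] x; first by rewrite big_geq// add0e.
  rewrite big_nat_recl//= -addeA; apply: le_trans (sub x) _; rewrite leeD2l//.
  rewrite -(@step_op_sum _ _ _ _ (fun k => iter k step_op W))//.
  have hs := pos_meas_sum n hn.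
  have hi := pos_meas_iter a_p a_m J n hV.
  rewrite -step_opD//; apply: le_step_op => //; exact: pos_measD.
have le n : V (t, y) <= potential W (t, y) + (c * Num.max 0 (1 - expR (- (L * t0))) ^+ n)%:E.
  apply: le_trans (key n (t, y)) _; apply: leeD.
    by apply: nneseries_lim_ge => k _ _; exact: (hn k).2.
  by have [_ _] := iter_bound n c0 hV V0 Vc; exact.
have cv : potential W (t, y) + (c * Num.max 0 (1 - expR (- (L * t0))) ^+ n)%:E @[n --> \oo]
    --> potential W (t, y) + 0.
  apply: cvgeD => //; first by rewrite fin_num_adde_defl.
    exact: cvg_cst.
  apply: cvg_EFin; first exact: nearW.
  rewrite (_ : nbhs (0%R : R) = nbhs (c * 0)%R); last by rewrite mulr0.
  apply: cvgM; first exact: cvg_cst.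
  apply: cvg_expr; rewrite ger0_norm ?le_max ?lexx//.
  by rewrite gt_max ltr01 ltrBlDr ltrDl expR_gt0.
rewrite -[leRHS]adde0 -(cvg_lim _ cv)//; apply: lime_ge; last exact: nearW.
by apply/cvg_ex; eexists; exact: cv.
Qed.

Lemma le_sg t f g y : pos_meas f -> pos_meas g -> (forall z, f z <= g z) ->
  sg t f y <= sg t g y.
Proof.
move=> hf hg fg; have hnf := pos_meas_nojump a_p a_m J hf.
have hng := pos_meas_nojump a_p a_m J hg.
apply: lee_nneseries => [n _ _|n _].
  exact: (pos_meas_iter a_p a_m J n hnf).2.
elim: n (t, y) => [|n IH] x /=.
  by rewrite lee_wpmul2l// lee_fin survival_ge0.
by apply: le_step_op => //; exact: pos_meas_iter.
Qed.

Lemma sgD t f g y : pos_meas f -> pos_meas g ->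
  sg t (fun z => f z + g z) y = sg t f y + sg t g y.
Proof.
move=> hf hg; have hnf := pos_meas_nojump a_p a_m J hf.
have hng := pos_meas_nojump a_p a_m J hg.
rewrite -nneseriesD//; last 2 first.
- by move=> n _ _; exact: (pos_meas_iter a_p a_m J n hnf).2.
- by move=> n _ _; exact: (pos_meas_iter a_p a_m J n hng).2.
apply: eq_eseriesr => n _; elim: n (t, y) => [|n IH] x /=.
  by rewrite /Submission.nojump ge0_muleDr//; [exact: hf.2|exact: hg.2].
rewrite -step_opD; [|exact: pos_meas_iter..].
exact: eq_step_op.
Qed.

Lemma sgZ t (c : R) f y : pos_meas f -> (0 <= c)%R ->
  sg t (fun z => c%:E * f z) y = c%:E * sg t f y.
Proof.
move=> hf c0; have hnf := pos_meas_nojump a_p a_m J hf.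
rewrite -nneseriesZl; last by move=> n _; exact: (pos_meas_iter a_p a_m J n hnf).2.
apply: eq_eseriesr => n _; elim: n (t, y) => [|n IH] x /=.
  by rewrite /Submission.nojump muleCA.
rewrite -step_opZ//; last exact: pos_meas_iter.
exact: eq_step_op.
Qed.

Lemma sg_series t (f : nat -> R -> \bar R) y : (forall k, pos_meas (f k)) ->
  sg t (fun z => \sum_(0 <= k <oo) f k z) y = \sum_(0 <= k <oo) sg t (f k) y.
Proof.
move=> hf; have hnf k := pos_meas_nojump a_p a_m J (hf k).
transitivity (\sum_(0 <= n <oo) \sum_(0 <= k <oo) iter n step_op (nojump (f k)) (t, y)).
  apply: eq_eseriesr => n _; elim: n (t, y) => [|n IH] x /=.
    by rewrite /Submission.nojump nneseriesZl// => k _; exact: (hf k).2.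
  rewrite -step_op_series; last by move=> k; exact: pos_meas_iter.
  exact: eq_step_op.
rewrite nneseries_interchange// => n k.
exact: (pos_meas_iter a_p a_m J _ (hnf _)).2.
Qed.

Lemma sg_eq t f g y : (forall z, f z = g z) -> sg t f y = sg t g y.
Proof. by move=> /funext ->. Qed.

Definition future (x : R * R) : \bar R := if (0 <= x.1)%R then 1 else 0.

Lemma pos_meas_future : pos_meas future.
Proof.
split; last by move=> x; rewrite /future; case: ifP.
by apply: measurable_fun_if => //; exact: measurable_fun_ler.
Qed.

Lemma step_op_future x : nojump (cst 1) x + step_op future x = future x.
Proof.
case: x => t y; rewrite /future /Submission.nojump /= /survival mule1.
case: (leP 0 t)%R => t0; last first.
  rewrite add0e step_op_neg//; first exact: pos_meas_future.
  by move=> s z s0; rewrite /future/= leNgt s0.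
rewrite /Submission.step_op flow_op_trunc//; last 2 first.
- by apply: pos_meas_jump_op; exact: pos_meas_future.
- by apply: jump_op_neg => s z s0; rewrite /future/= leNgt s0.
rewrite [X in _ + X](_ : _ = \int[mu]_(r in `[0%R, t]) (L * expR (- (L * r)))%:E).
  by rewrite integral_rate// -EFinD addrC subrK.
apply: eq_integral => r; rewrite inE/= in_itv/= => /andP[r0 rt].
rewrite [(L * expR _)%R]mulrC EFinM; congr (_ * _).
transitivity (\int[J]_xi (cst 1 xi)).
  by rewrite /Submission.jump_op; apply: eq_integral => xi _; rewrite /future/= subr_ge0 rt.
by have -> := integral_cst J measurableT 1; rewrite mul1e; exact: rateE.
Qed.

(** No mass is lost: [future] is a bounded solution of the renewal equation with source
    [nojump (cst 1)], hence equal to its potential. *)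
Lemma sg1 t y : (0 <= t)%R -> sg t (cst 1) y = 1.
Proof.
move=> t0; have h1 : pos_meas (cst 1 : R -> \bar R) by split.
have hn := pos_meas_nojump a_p a_m J h1.
have hfut := pos_meas_future.
have fut1 : future (t, y) = 1 by rewrite /future/= t0.
apply/le_anti/andP; split.
  rewrite -[leRHS]fut1; apply: potential_min => // x.
  by rewrite step_op_future.
rewrite -[leLHS]fut1; apply: (@potential_sub _ _ t 1) => //.
- by move=> s z s0; rewrite /future/= leNgt s0.
- by move=> s z _; rewrite /future; case: ifP => _; rewrite lee_fin.
- by move=> x; rewrite step_op_future.
Qed.

Lemma sg_le_cst t (c : R) f y : (0 <= t)%R -> pos_meas f -> (0 <= c)%R ->
  (forall z, f z <= c%:E) -> sg t f y <= c%:E.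
Proof.
move=> t0 hf c0 fc; have h1 : pos_meas (cst 1 : R -> \bar R) by split.
rewrite -[leRHS]mule1 -(sg1 y t0) -sgZ//; apply: le_sg => //.
  by split => // x; rewrite mule1 lee_fin.
by move=> z; rewrite mule1.
Qed.

Lemma sgE t f y : pos_meas f -> (0 <= t)%R ->
  sg t f y = (expR (- (L * t)))%:E * f (Phi t y) +
    \int[mu]_(r in `[0%R, t])
      ((expR (- (L * r)))%:E * \int[J]_xi sg (t - r) f (Phi r y + xi)).
Proof.
move=> hf t0; have hn := pos_meas_nojump a_p a_m J hf.
have hp := pos_meas_potential a_p a_m J hn.
rewrite /Submission.sg potentialE// {1}/Submission.nojump/= /survival t0; congr (_ + _).
rewrite /Submission.step_op flow_op_trunc//; first exact: pos_meas_jump_op.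
apply: jump_op_neg => s z s0; rewrite /Submission.potential eseries0// => n _ _.
have nj0 : forall s z : R, (s < 0)%R -> nojump f (s, z) = 0.
  by move=> u v u0; rewrite /Submission.nojump/= /survival leNgt u0 mul0e.
elim: n s z s0 => [|n IH]; first exact: nj0.
by apply: step_op_neg => //; exact: pos_meas_iter.
Qed.

End semigroup.

(** * The semigroup property *)

Section semigroup.
Context {R : realType}.
Notation mu := (@lebesgue_measure R).
Variables (a_p a_m : R) (J : {finite_measure set R -> \bar R}).
Notation Phi := (log_flow a_p a_m).
Notation L := (rate J).
Notation flow_op := (flow_op a_p a_m J).
Notation jump_op := (jump_op J).
Notation step_op := (step_op a_p a_m J).
Notation potential := (potential a_p a_m J).
Notation nojump := (nojump a_p a_m J).
Notation sg := (sg a_p a_m J).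
Hypotheses (a_p_gt0 : (0 < a_p)%R) (a_p_lt_a_m : (a_p < a_m)%R).

(** With [u] fixed, [sg (t + u) f] solves in [t] the renewal equation with source [nojump (sg u f)].
    It is bounded, so uniqueness identifies it with [sg t (sg u f)]. *)
Lemma sg_semigroup (t u c : R) f y : pos_meas f -> (0 <= c)%R ->
  (forall z, f z <= c%:E) -> (0 <= t)%R -> (0 <= u)%R ->
  sg (t + u) f y = sg t (sg u f) y.
Proof.
move=> hf c0 fc t0 u0; have hn := pos_meas_nojump a_p a_m J hf.
have hp := pos_meas_potential a_p a_m J hn.
have hu := pos_meas_sg a_p a_m J u hf.
have hnu := pos_meas_nojump a_p a_m J hu.
(* The factor [future] removes the times in [[- u, 0)], where the shifted potential does not
   vanish. *)
pose V (x : R * R) := future x * potential (nojump f) ((x.1 + u)%R, x.2).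
have hV : pos_meas V.
  apply: pos_measM; first exact: pos_meas_future.
  apply: pos_meas_comp hp; apply/measurable_fun_pair => //=.
  exact: measurable_funD.
have V0 : forall s z : R, (s < 0)%R -> V (s, z) = 0.
  by move=> s z s0; rewrite /V /future/= leNgt s0 mul0e.
have VE s z : (0 <= s)%R -> V (s, z) = sg (s + u) f z.
  by move=> s0; rewrite /V /future/= s0 mul1e.
have Veq x : V x = nojump (sg u f) x + step_op V x.
  case: x => s z; case: (leP 0 s)%R => s0; last first.
    by rewrite V0// step_op_neg// adde0 /Submission.nojump/= /survival leNgt s0 mul0e.
  have E1 := flow_op_split J a_p_gt0 a_p_lt_a_m u z (pos_meas_jump_op J hp) s0.
  have E2 := flow_op_trunc a_p a_m J z (pos_meas_jump_op J hV) (jump_op_neg J V0) s0.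
  have E3 : nojump (sg u f) (s, z) = (expR (- (L * s)))%:E *
      (nojump f (u, Phi s z) + step_op (potential (nojump f)) (u, Phi s z)).
    by rewrite -potentialE// [LHS]/Submission.nojump/= /survival s0.
  have E4 : nojump f ((s + u)%R, z) = (expR (- (L * s)))%:E * nojump f (u, Phi s z).
    rewrite /Submission.nojump/= /survival addr_ge0// u0 log_flowD// muleA -EFinM -expRD.
    by congr (_%:E * _); congr expR; ring.
  have E5 : sg (s + u) f z = nojump f ((s + u)%R, z) + flow_op (jump_op (potential (nojump f))) ((s + u)%R, z).
    by rewrite /Submission.sg potentialE.
  have n0 : 0 <= nojump f (u, Phi s z) by exact: hn.2.
  have s0' : 0 <= step_op (potential (nojump f)) (u, Phi s z).
    exact: (pos_meas_step_op a_p a_m J hp).2.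
  rewrite VE// E5 E3 E4 E1 (ge0_muleDr _ n0 s0') /Submission.step_op E2.
  rewrite addeCA [RHS]addeC; congr (_ + _).
  apply: eq_integral => r; rewrite inE/= in_itv/= => /andP[r0 rs].
  congr (_ * _); rewrite /Submission.jump_op/=; apply: eq_integral => xi _.
  rewrite VE ?subr_ge0// /Submission.sg (_ : s + u - r = s - r + u)%R//; ring.
rewrite -VE//; apply/le_anti/andP; split.
  apply: (@potential_sub _ _ _ _ _ _ t c) => //.
  - move=> s z st; case: (leP 0 s)%R => s0; last by rewrite V0// lee_fin.
    by rewrite VE//; apply: sg_le_cst => //; exact: addr_ge0.
  - by move=> x; rewrite -Veq.
by apply: potential_min => // x; rewrite -Veq.
Qed.

End semigroup.

(** * Independence of a variable from a family, and integration of independent variables *)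

Lemma eq_measure_prod d1 d2 (T1 : measurableType d1) (T2 : measurableType d2)
    (R : realType) (m1 m2 : {measure set (T1 * T2) -> \bar R}) :
  m1 setT < +oo ->
  (forall A B, measurable A -> measurable B -> m1 (A `*` B) = m2 (A `*` B)) ->
  forall D, measurable D -> m1 D = m2 D.
Proof.
move=> fin eqr; pose G := [set A `*` B | A in (@measurable _ T1) & B in (@measurable _ T2)].
apply: (@measure_unique _ _ _ G (fun=> setT)) => //.
- exact: measurable_prod_measurableType.
- move=> _ _ [A1 mA1 [B1 mB1 <-]] [A2 mA2 [B2 mB2 <-]].
  exists (A1 `&` A2); first exact: measurableI.
  by exists (B1 `&` B2); [exact: measurableI|rewrite setXI].
- by move=> _; exists setT => //; exists setT => //; rewrite setXTT.
- by rewrite bigcup_const//; exists 0%N.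
- by move=> _ [A mA [B mB <-]]; exact: eqr.
Qed.

Section independence.
Context d (Omega : measurableType d) (R : realType) (P : probability Omega R).
Context (I : choiceType) (X : I -> {RV P >-> R}).

Definition jointly (s : seq I) (B : I -> set R) : set Omega :=
  \bigcap_(i in [set` s]) (X i @^-1` B i).

(** Independence of [V] from the variables indexed by [U], tested on finite cylinders. [U] loses one
    index each time a variable is absorbed into [V], which suits induction along the jump chain. *)
Definition independent_from d' (T : measurableType d') (V : Omega -> T) (U : pred I) :=
  forall (A : set T) (s : seq I) (B : I -> set R), measurable A -> uniq s ->
    all U s -> (forall i, measurable (B i)) ->
    P (V @^-1` A `&` jointly s B) = P (V @^-1` A) * \prod_(i <- s) P (X i @^-1` B i).

Lemma measurable_jointly s B : (forall i, measurable (B i)) -> measurable (jointly s B).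
Proof.
move=> mB; rewrite /jointly bigcap_seq; apply: bigsetI_measurable => i _.
by rewrite -[X in measurable X]setTI; exact: measurable_funP.
Qed.

Lemma independent_from_cst d' (T : measurableType d') (x : T) :
  mutually_independent X -> independent_from (cst x) predT.
Proof.
move=> indX A s B mA us _ mB; rewrite preimage_cst; case: ifPn => _.
  by rewrite setTI probability_setT mul1e; exact: indX.
by rewrite set0I measure0 mul0e.
Qed.

Lemma independent_from_comp d1 d2 (T1 : measurableType d1) (T2 : measurableType d2)
    (V : Omega -> T1) (g : T1 -> T2) U : measurable_fun setT g ->
  independent_from V U -> independent_from (g \o V) U.
Proof.
move=> mg indV A s B mA us sU mB; rewrite comp_preimage; apply: indV => //.
by rewrite -[X in measurable X]setTI; exact: mg.
Qed.

Lemma independent_from_rect d' (T : measurableType d') (V : Omega -> T) (U : pred I)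
    i A C s B : independent_from V U -> U i -> measurable A -> measurable C -> uniq s ->
  all [pred j | U j & j != i] s -> (forall i, measurable (B i)) ->
  P ((fun w => (V w, X i w)) @^-1` (A `*` C) `&` jointly s B) =
  P (V @^-1` A) * P (X i @^-1` C) * \prod_(j <- s) P (X j @^-1` B j).
Proof.
move=> indV Ui mA mC us sU mB.
pose B' j := if j == i then C else B j.
have mB' j : measurable (B' j) by rewrite /B'; case: ifP.
have is_ : i \notin s.
  by apply/negP => /(allP sU) /=; rewrite eqxx andbF.
have allU : all U (i :: s).
  by rewrite /= Ui; apply/allP => j /(allP sU) /andP[].
have us' : uniq (i :: s) by rewrite /= is_.
have := indV A (i :: s) B' mA us' allU mB'.
rewrite big_cons {2}/B' eqxx muleA.
have -> : \prod_(j <- s) P (X j @^-1` B' j) = \prod_(j <- s) P (X j @^-1` B j).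
  apply: eq_big_seq => j js; rewrite /B' ifF//; apply/negbTE.
  by apply: contraNneq is_ => <-.
move=> <-; congr (P _); apply/seteqP; split => w /=.
  move=> [[VA XC] h]; split => // j /=; rewrite inE => /orP[/eqP ->|js].
    by rewrite /B' eqxx.
  rewrite /B' ifF; first exact: h.
  by apply/negbTE; apply: contraNneq is_ => <-.
move=> [VA h]; split.
  by split => //; have := h i; rewrite /B' eqxx; apply; rewrite /= mem_head.
move=> j js; have := h j; rewrite /B' ifF; first by apply; rewrite /= inE (_ : j \in s)// orbT.
by apply/negbTE; apply: contraNneq is_ => <-.
Qed.

(** For a fixed cylinder both sides are finite measures in the event about [(V, X i)], so rectangles
    suffice; on a rectangle the constraint on [X i] is moved into the cylinder. *)
Lemma independent_from_pair d' (T : measurableType d') (V : Omega -> T) (U : pred I) i :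
  measurable_fun setT V -> independent_from V U -> U i ->
  independent_from (fun w => (V w, X i w)) [pred j | U j & j != i].
Proof.
move=> mV indV Ui D s B mD us sU mB.
have mVX : measurable_fun setT (fun w => (V w, X i w)) by exact/measurable_fun_pair.
have mE := measurable_jointly s mB.
have pE : P (jointly s B) = \prod_(j <- s) P (X j @^-1` B j).
  have := indV setT s B measurableT us; rewrite preimage_setT setTI probability_setT mul1e.
  by apply => //; apply/allP => j /(allP sU) /andP[].
pose m1 := image_measure (mrestr P mE) mVX.
pose p := NngNum (fine_ge0 (measure_ge0 P (jointly s B))).
pose m2 := mscale p (image_measure P mVX).
have pfin : P (jointly s B) \is a fin_num by rewrite fin_num_measure.
have p_num : (p%:num)%:E = P (jointly s B) by rewrite /p/= fineK.
have m2E F : m2 F = P ((fun w => (V w, X i w)) @^-1` F) * P (jointly s B).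
  by rewrite muleC -p_num.
rewrite -pE -m2E; apply: (@eq_measure_prod _ _ T R R m1 m2) => //.
  apply: (@le_lt_trans _ _ 1); last exact: ltry.
  by apply: probability_le1; apply: measurableI => //; rewrite preimage_setT.
move=> A C mA mC; apply: etrans (esym (m2E _)); rewrite pE.
transitivity (P ((fun w => (V w, X i w)) @^-1` (A `*` C) `&` jointly s B)) => //.
rewrite (independent_from_rect indV)//; congr (_ * _).
have := @independent_from_rect _ _ V U i A C [::] B indV Ui mA mC isT isT mB.
by rewrite big_nil mule1 /jointly set_nil bigcap_set0 setIT => ->.
Qed.

(** The joint law of [(V, X i)] is the product of the marginals, so [X i] is integrated out with [V]
    frozen. *)
Lemma integral_independent d' (T : measurableType d') (V : Omega -> T) (U : pred I) i
    (f : T * R -> \bar R) :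
  measurable_fun setT V -> independent_from V U -> U i -> pos_meas f ->
  \int[P]_w f (V w, X i w) =
  \int[P]_w \int[distribution P (X i)]_x f (V w, x).
Proof.
move=> mV indV Ui [mf f0].
have mVX : measurable_fun setT (fun w => (V w, X i w)) by exact/measurable_fun_pair.
pose V' : {mfun Omega >-> T} := mfun_Sub (mem_set mV : V \in mfun).
transitivity (\int[image_measure P mVX]_z f z); first by rewrite ge0_integral_image.
transitivity (\int[distribution P V' \x distribution P (X i)]_z f z).
  apply: eq_measure_integral => D mD _; apply: eq_measure_prod => //.
    apply: (@le_lt_trans _ _ 1); last exact: ltry.
    by apply: probability_le1; rewrite preimage_setT.
  move=> A C mA mC; apply: etrans (esym (product_measure1E _ _ mA mC)).
  have := @independent_from_rect _ _ V U i A C [::] (fun=> setT) indV Ui mA mC isT isT (fun=> measurableT).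
  by rewrite big_nil mule1 /jointly set_nil bigcap_set0 setIT => h; exact: h.
rewrite fubini_tonelli1// ge0_integral_distribution//.
  exact: (measurable_fun_fubini_tonelli_F (m2 := distribution P (X i)) f).
by move=> y; exact: integral_ge0.
Qed.

End independence.

(** * Measures with a density and their image under the logarithm *)

Section density.
Context d (T : measurableType d) (R : realType) (m : {measure set T -> \bar R}).
Variable g : T -> R.
Hypotheses (mg : measurable_fun setT g) (g0 : forall s, (0 <= g s)%R).

Definition density (A : set T) : \bar R := \int[m]_(s in A) (g s)%:E.

Let density0 : density set0 = 0.
Proof. by rewrite /density integral_set0. Qed.

Let density_ge0 A : 0 <= density A.
Proof. by apply: integral_ge0 => s _; rewrite lee_fin. Qed.

Let density_sigma_additive : semi_sigma_additive density.
Proof.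
move=> /= F mF tF mUF; rewrite /density; apply: cvg_toP.
  apply: ereal_nondecreasing_is_cvgn => i j ij.
  apply: lee_sum_nneg_natr => // k _ _; apply: integral_ge0 => /= x Fkx.
  by rewrite lee_fin.
rewrite ge0_integral_bigcup//=.
- by apply/measurable_EFinP/measurable_funTS.
- by move=> x _; rewrite lee_fin.
Qed.

HB.instance Definition _ := isMeasure.Build _ _ _
  density density0 density_ge0 density_sigma_additive.

Definition density_measure : {measure set T -> \bar R} := density.

Lemma integral_density_measure f : pos_meas f ->
  \int[density_measure]_x f x = \int[m]_x (f x * (g x)%:E).
Proof. by move=> [mf f0]; exact: ge0_integral_density. Qed.

End density.

Section log_jump_law.
Context {R : realType}.
Notation mu := (@lebesgue_measure R).
Variable g : R -> R.
Hypotheses (mg : measurable_fun setT g) (g0 : forall s, (0 <= g s)%R).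
Hypothesis g_fin : \int[mu]_s (g s)%:E < +oo.

Let image : {measure set R -> \bar R} :=
  image_measure (density_measure mu mg g0) (@measurable_ln R).

Definition log_density (A : set R) : \bar R := image A.

HB.instance Definition _ := Measure.copy log_density image.

Let log_density_fin : fin_num_fun log_density.
Proof.
by apply: lty_fin_num_fun; exact: g_fin.
Qed.

HB.instance Definition _ := @Measure_isFinite.Build _ _ _ log_density log_density_fin.

Definition log_jump_law : {finite_measure set R -> \bar R} := log_density.

Lemma integral_log_jump_law f : pos_meas f ->
  \int[log_jump_law]_xi f xi = \int[mu]_s (f (ln s) * (g s)%:E).
Proof.
move=> hf; transitivity (\int[image]_xi f xi); first exact: eq_measure_integral.
rewrite /image ge0_integral_image; [|exact: hf.1|exact: hf.2].
rewrite integral_density_measure//.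
by apply: pos_meas_comp hf; exact: measurable_ln.
Qed.

End log_jump_law.

(** * The jump chain and the change of measure *)

Section jump_chain.
Context d (Omega : measurableType d) (R : realType) (P : probability Omega R).
Notation mu := (@lebesgue_measure R).
Variables (a_p a_m K : R) (g : R -> R) (tau sigma : nat -> {RV P >-> R}).
Hypotheses (a_p_gt0 : (0 < a_p)%R) (a_p_lt_a_m : (a_p < a_m)%R) (K_gt0 : (0 < K)%R).
Hypotheses (mg : measurable_fun setT g) (g0 : forall s, (0 <= g s)%R).
Hypothesis g_supp : forall s, (s <= 0)%R -> g s = 0%R.
Hypothesis g_fin : \int[mu]_s (g s)%:E < +oo.
Hypothesis tau_law : forall n A, measurable A ->
  distribution P (tau n) A = exponential_prob K A.
Hypothesis sigma_law : forall n A, measurable A ->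
  distribution P (sigma n) A = \int[mu]_(s in A) (K^-1 * (s * g s))%:E.

Let X (i : nat + nat) : {RV P >-> R} :=
  match i with inl n => tau n | inr n => sigma n end.

Hypothesis indep : mutually_independent X.

Notation J := (log_jump_law mg g0 g_fin).
Notation L := (rate J).
Notation Phi := (log_flow a_p a_m).

(** [mu] lives on [measurableTypeR R] and [nu] on [R]; the identity map transports one to the
    other. *)
Lemma integral_lebesgue_density (nu : {measure set R -> \bar R}) (h : R -> R) f :
  measurable_fun setT h -> (forall x, (0 <= h x)%R) ->
  (forall A, measurable A -> nu A = \int[mu]_(x in A) (h x)%:E) ->
  pos_meas f -> \int[nu]_x f x = \int[mu]_x (f x * (h x)%:E).
Proof.
move=> mh h0 nuE [mf f0].
have mid : measurable_fun setT (idfun : R -> measurableTypeR R) by exact: measurable_id.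
have H := @ge0_integral_density R _ (measurableTypeR R) mu (image_measure nu mid) h f mh h0 nuE mf f0.
by rewrite -H (ge0_integral_image nu mid).
Qed.

(** The components are the time of the last jump, the logarithmic position just after it, and the
    product of the inverse factors so far, used as a weight. *)
Definition chain_step (z : R * R * R) (r s : R) : R * R * R :=
  (z.1.1 + r, Phi r z.1.2 + ln s, z.2 * expR (- ln s))%R.

Fixpoint chain (y : R) (n : nat) (w : Omega) : R * R * R :=
  if n is k.+1 then chain_step (chain y k w) (tau k w) (sigma k w) else (0, y, 1)%R.

Lemma measurable_chain_step :
  measurable_fun setT (fun z : R * R * R * R * R => chain_step z.1.1 z.1.2 z.2).
Proof.
apply/measurable_fun_pair; last first.
  rewrite /=; apply: measurable_funM; first by apply: measurableT_comp => //; exact: measurableT_comp.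
  apply: measurableT_comp => //; apply: measurableT_comp => //.
  exact: (measurableT_comp (@measurable_ln R)).
apply/measurable_fun_pair.
  apply: measurable_funD; last exact: measurableT_comp.
  by do 3 apply: measurableT_comp => //.
apply: measurable_funD; last exact: (measurableT_comp (@measurable_ln R)).
apply: (measurableT_comp (measurable_log_flow a_p a_m) (g := fun z => (z.1.2, z.1.1.1.2))).
apply/measurable_fun_pair; first exact: measurableT_comp.
by do 3 apply: measurableT_comp => //.
Qed.

Lemma measurable_chain y n : measurable_fun setT (chain y n).
Proof.
elim: n => [|n IH] /=; first exact: measurable_cst.
apply: (measurableT_comp measurable_chain_step (g := fun w => (chain y n w, tau n w, sigma n w))).
by apply/measurable_fun_pair => //; exact/measurable_fun_pair.
Qed.

Lemma independent_from_sub d' (T : measurableType d') (V : Omega -> T)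
    (U U' : pred (nat + nat)) : subpred U' U ->
  independent_from X V U -> independent_from X V U'.
Proof.
move=> UU h A s B mA us sU mB; apply: h => //.
by apply/allP => i /(allP sU) /UU.
Qed.

Definition later (n : nat) : pred (nat + nat) :=
  fun i => match i with inl k => (n <= k)%N | inr k => (n <= k)%N end.

Lemma chain_independent y n : independent_from X (chain y n) (later n).
Proof.
elim: n => [|n IH] /=.
  by apply: independent_from_sub (independent_from_cst _ indep).
have mz := measurable_chain y n.
have h1 := @independent_from_pair _ _ _ P _ X _ _ (chain y n) (later n) (inl n) mz IH (leqnn n).
have mz1 : measurable_fun setT (fun w => (chain y n w, X (inl n) w)).
  exact/measurable_fun_pair.
have h2 := independent_from_pair mz1 h1 (i := inr n) (introT andP (conj (leqnn n) isT)).
apply: (independent_from_sub _ (independent_from_comp measurable_chain_step h2)).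
move=> [k|k] /= nk; rewrite /later /=.
  by rewrite (ltnW nk)/= andbT; apply: contraTneq nk => -[->]; rewrite ltnn.
by rewrite (ltnW nk)/=; apply: contraTneq nk => -[->]; rewrite ltnn.
Qed.

Lemma integral_tau n f : pos_meas f ->
  \int[distribution P (tau n)]_r f r =
  \int[mu]_r (f r * (exponential_pdf K r)%:E).
Proof.
move=> hf; apply: integral_lebesgue_density => //.
- exact: measurable_exponential_pdf.
- by move=> r; apply: exponential_pdf_ge0; exact: ltW.
- by move=> A mA; have := tau_law n mA.
Qed.

Lemma integral_sigma n f : pos_meas f ->
  \int[distribution P (sigma n)]_s f s =
  \int[mu]_s (f s * (K^-1 * (s * g s))%:E).
Proof.
move=> hf; apply: (@integral_lebesgue_density (distribution P (sigma n))
  (fun s => K^-1 * (s * g s))%R) => //.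
- by apply: measurable_funM => //; exact: measurable_funM.
- move=> s; rewrite mulr_ge0 ?invr_ge0 ?(ltW K_gt0)//.
  by case: (leP s 0)%R => s0; [rewrite g_supp// mulr0|rewrite mulr_ge0// ltW].
- by move=> A mA; have := sigma_law n mA.
Qed.

(** The weight [z.2] undoes the size bias of the factors, and the exponential turns the jump rate
    [K] into [L]. The absolute value keeps the expression nonnegative on arbitrary triples. *)
Definition weighted (W : R * R -> \bar R) (t : R) (z : R * R * R) : \bar R :=
  (`|z.2| * expR (- (L - K) * z.1.1))%:E * W (t - z.1.1, z.1.2)%R.

Lemma pos_meas_weighted W t : pos_meas W -> pos_meas (weighted W t).
Proof.
move=> hW; apply: pos_measM.
  apply: pos_meas_EFin; last by move=> z; rewrite mulr_ge0 ?expR_ge0.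
  apply: measurable_funM; first by apply: measurableT_comp.
  apply: measurableT_comp => //; apply: measurable_funM => //.
  exact: measurableT_comp.
apply: pos_meas_comp hW; apply/measurable_fun_pair.
  by apply: measurable_funB => //; exact: measurableT_comp.
exact: measurableT_comp.
Qed.

(** The factor [s] of the size-biased law cancels the new weight [1 / s], which leaves [J] up to the
    constant [K^-1]. For [s <= 0], where [ln] takes a default value, the density [g] is 0. *)
Lemma integral_weighted_sigma W t z r n : pos_meas W ->
  \int[distribution P (sigma n)]_s weighted W t (chain_step z r s) =
  (K^-1 * (`|z.2| * expR (- (L - K) * (z.1.1 + r))))%:E *
    jump_op J W (t - z.1.1 - r, Phi r z.1.2)%R.
Proof.
move=> hW.
have hstep : measurable_fun setT (chain_step z r).
  apply: (measurableT_comp measurable_chain_step (g := fun s => (z, r, s))).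
  by apply/measurable_fun_pair.
rewrite integral_sigma; last exact: pos_meas_comp (pos_meas_weighted t hW).
have hsh : pos_meas (fun xi : R => W ((t - z.1.1 - r)%R, (Phi r z.1.2 + xi)%R)).
  by apply: pos_meas_comp hW; apply/measurable_fun_pair => //=; exact: measurable_funD.
rewrite /jump_op/= integral_log_jump_law//.
have hl : pos_meas (fun s : R => W ((t - z.1.1 - r)%R, (Phi r z.1.2 + ln s)%R) * (g s)%:E).
  apply: pos_measM; last exact: pos_meas_EFin.
  by apply: (pos_meas_comp (g := @ln R)) hsh; exact: measurable_ln.
rewrite -ge0_integralZl//; last 3 first.
- exact: hl.1.
- by move=> s _; exact: hl.2.
- by rewrite lee_fin !mulr_ge0 ?expR_ge0 ?invr_ge0 ?(ltW K_gt0).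
apply: eq_integral => s _; rewrite /weighted /chain_step/=.
case: (leP s 0)%R => s0; first by rewrite g_supp// !mulr0 !mule0.
rewrite (opprD z.1.1 r) (addrA t) normrM (ger0_norm (expR_ge0 _)) expRN lnK ?posrE//.
rewrite muleAC -EFinM [RHS]muleCA -EFinM [RHS]muleC; congr (_%:E * _).
by field; rewrite !gt_eqF.
Qed.

(** The waiting time density [K exp(- K r)] absorbs the constant [K^-1], and the tilt
    [exp(- (L - K) r)] turns [exp(- K r)] into the survival [exp(- L r)]. *)
Lemma integral_weighted_step W t z n : pos_meas W ->
  \int[distribution P (tau n)]_r \int[distribution P (sigma n)]_s
    weighted W t (chain_step z r s) = weighted (step_op a_p a_m J W) t z.
Proof.
move=> hW.
have hJ := pos_meas_jump_op J hW.
under eq_integral do rewrite integral_weighted_sigma//.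
have hsh := pos_meas_comp (measurable_flow_shift a_p a_m (t - z.1.1, z.1.2)%R) hJ.
have mexp : measurable_fun setT (fun r : R => expR (- (L - K) * (z.1.1 + r)))%R.
  apply: measurableT_comp => //; apply: measurable_funM => //; exact: measurable_funD.
rewrite integral_tau; last first.
  apply: pos_measM => //; apply: pos_meas_EFin.
    by apply: measurable_funM => //; exact: measurable_funM.
  by move=> r; rewrite !mulr_ge0 ?expR_ge0 ?invr_ge0 ?(ltW K_gt0).
have hfi := pos_meas_flow_integrand a_p a_m J (t - z.1.1, z.1.2)%R hJ.
have c0 : 0 <= (`|z.2| * expR (- (L - K) * z.1.1))%:E by rewrite lee_fin mulr_ge0 ?expR_ge0.
rewrite /weighted /step_op /flow_op.
apply: (etrans _ (ge0_integralZl mu measurableT hfi.1 (fun r _ => hfi.2 r) c0)).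
apply: eq_integral => r _ /=; rewrite /survival.
case: (leP 0 r)%R => r0; last by rewrite lt0_exponential_pdf// !mul0e !mule0.
rewrite exponential_pdfE//.
rewrite muleAC -EFinM [RHS]muleA -EFinM; congr (_%:E * _).
transitivity (`|z.2| * (expR (- (L - K) * (z.1.1 + r)) * expR (- K * r)))%R.
  by field; rewrite gt_eqF.
rewrite -mulrA -!expRD; congr (_ * expR _)%R; ring.
Qed.

Lemma integral_chain_step y n (f : R * R * R * R * R -> \bar R) : pos_meas f ->
  \int[P]_w f (chain y n w, tau n w, sigma n w) =
  \int[P]_w \int[distribution P (tau n)]_r \int[distribution P (sigma n)]_s
    f (chain y n w, r, s).
Proof.
move=> hf; have mz := measurable_chain y n.
have hz := @chain_independent y n.
have h1 := @independent_from_pair _ _ _ P _ X _ _ (chain y n) (later n) (inl n) mz hz (leqnn n).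
have mz1 : measurable_fun setT (fun w => (chain y n w, X (inl n) w)).
  exact/measurable_fun_pair.
have U2 : [pred j | later n j & j != inl n] (inr n) by rewrite /= leqnn.
rewrite (integral_independent mz1 h1 U2 hf).
have hF := pos_meas_int1 (distribution P (sigma n)) hf.
exact: (integral_independent (i := inl n) mz hz (leqnn n) hF).
Qed.

(** The last jump is integrated out first, so the step is applied to the innermost argument of
    [iter] and the induction must hold for all [W]. *)
Lemma integral_weighted_chain W t y n : pos_meas W ->
  \int[P]_w weighted W t (chain y n w) = iter n (step_op a_p a_m J) W (t, y).
Proof.
elim: n W => [|n IH] W hW.
  rewrite [LHS](eq_integral (cst (W (t, y)))).
    have -> := integral_cst P measurableT (W (t, y)).
    by rewrite -[RHS]mule1; congr (_ * _); exact: probability_setT.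
  by move=> w _; rewrite /weighted/= normr1 mulr0 expR0 subr0 mul1r mul1e.
rewrite iterSr -IH; last exact: pos_meas_step_op.
rewrite (@integral_chain_step y n (fun z => weighted W t (chain_step z.1.1 z.1.2 z.2))).
  by apply: eq_integral => w _; exact: integral_weighted_step.
by apply: pos_meas_comp (pos_meas_weighted t hW); exact: measurable_chain_step.
Qed.

End jump_chain.

(** * Integrands that are measurable only off a null set *)

Section nonmeasurable.
Import HBNNSimple.

(** The Feynman-Kac integrand is known to agree with a measurable function only off the explosion
    event. The integral of a nonnegative function is a supremum over simple functions below it, and
    these can be compared off the null set [N]. *)
Lemma ae_eq_integral_nonmeas d (T : measurableType d) (R : realType)
    (m : {measure set T -> \bar R}) (N : set T) (f g : T -> \bar R) :
  measurable N -> m N = 0 -> pos_meas g -> (forall x, 0 <= f x) ->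
  (forall x, ~ N x -> f x = g x) -> \int[m]_x f x = \int[m]_x g x.
Proof.
move=> mN N0 [mg g0] f0 fg; apply/le_anti/andP; split.
  rewrite ge0_integralTE//; apply: ge_ereal_sup => _ [h /= hf <-].
  rewrite -integralT_nnsfun.
  rewrite [leLHS](ge0_negligible_integral mN)//; last 2 first.
  - exact/measurable_EFinP.
  - by move=> x _; rewrite lee_fin.
  rewrite [leRHS](ge0_negligible_integral mN)//.
  apply: ge0_le_integral => //.
  - exact: measurableD.
  - by move=> x _; rewrite lee_fin.
  - exact/measurable_EFinP/measurable_funTS.
  - exact: measurable_funTS.
  - by move=> x [_ Nx]; rewrite -fg.
rewrite [leLHS](ge0_negligible_integral mN)//.
rewrite integral_mkcond ge0_integralTE; last first.
  by move=> x; rewrite patchE; case: ifP.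
rewrite ge0_integralTE//; apply: le_ereal_sup => _ [h /= hg <-].
exists h => // x; apply: le_trans (hg x) _; rewrite patchE.
case: ifPn => [|_]; last exact: f0.
by rewrite inE => -[_ Nx]; rewrite fg.
Qed.

End nonmeasurable.

(** * Displacement along the flow, and the tail of a waiting time *)

Section flow_displacement.
Context {R : realType}.
Notation mu := (@lebesgue_measure R).
Variables a_p a_m : R.
Hypotheses (a_p_gt0 : (0 < a_p)%R) (a_p_lt_a_m : (a_p < a_m)%R).
Notation Phi := (log_flow a_p a_m).

Definition log_speed (y : R) : R := if (y < 0)%R then a_m else a_p.

Lemma measurable_log_speed : measurable_fun setT log_speed.
Proof. by apply: measurable_fun_if => //; exact: measurable_fun_ltr. Qed.

Let a_m_gt0 : (0 < a_m)%R. Proof. exact: lt_trans a_p_lt_a_m. Qed.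

Lemma log_speed_ge0 y : (0 <= log_speed y)%R.
Proof. by rewrite /log_speed; case: ifP => _; exact: ltW. Qed.

Lemma pos_meas_log_speed y : pos_meas (fun r : R => (log_speed (Phi r y))%:E).
Proof.
apply: pos_meas_EFin => [|r]; last exact: log_speed_ge0.
by apply: measurableT_comp; [exact: measurable_log_speed|exact: measurable_log_flow1].
Qed.

(** In the logarithmic coordinate [c(x) / x] is the speed itself, so between jumps the exponent of
    the functional is a displacement. The motion is cut at the passage through 0. *)
Lemma integral_log_speed y T : (0 <= T)%R ->
  \int[mu]_(r in `[0%R, T]) (log_speed (Phi r y))%:E = (Phi T y - y)%:E.
Proof.
have cst_int (a T' : R) : (0 <= T')%R -> \int[mu]_(r in `[0%R, T']) (cst a%:E r) = (a * T')%:E.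
  move=> T0; rewrite integral_cst// EFinM; congr (_ * _).
  have /= -> := @lebesgue_measure_itv R `[0%R, T'].
  rewrite lte_fin; case: ltgtP T0 => // [_|<-] _; last by [].
  by rewrite oppr0 adde0.
have up y' T' : (0 <= y')%R -> (0 <= T')%R ->
    \int[mu]_(r in `[0%R, T']) (log_speed (Phi r y'))%:E = (Phi T' y' - y')%:E.
  move=> y0 T0; rewrite log_flow_ge0// addrAC subrr add0r -cst_int//.
  apply: eq_integral => r; rewrite inE/= in_itv/= => /andP[r0 _].
  by rewrite log_flow_ge0// /log_speed ltNge addr_ge0// mulr_ge0// ltW.
move=> T0; case: (leP 0 y)%R => y0; first exact: up.
have dn T' : (0 <= T')%R -> (y + a_m * T' <= 0)%R ->
    \int[mu]_(r in `[0%R, T']) (log_speed (Phi r y))%:E = (Phi T' y - y)%:E.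
  move=> T0' yT; rewrite log_flow_le0 ?(ltW y0)// addrAC subrr add0r.
  (* The right end point is removed: if the trajectory is at 0 there, its speed is already [a_p]. *)
  rewrite -cst_int// -[LHS]integral_itv_bndo_bndc; last first.
    by apply: measurable_funTS; exact: (pos_meas_log_speed y).1.
  rewrite -[RHS]integral_itv_bndo_bndc; last first.
    by apply: measurable_funTS; exact: measurable_cst.
  apply: eq_integral => r; rewrite inE/= in_itv/= => /andP[r0 rT].
  have h : (y + a_m * r < 0)%R by apply: lt_le_trans yT; rewrite ltrD2l ltr_pM2l.
  by rewrite log_flow_le0 ?(ltW y0)// ?(ltW h)// /log_speed h.
case: (leP (y + a_m * T) 0)%R => yT; first exact: dn.
pose S := (- (y / a_m))%R; pose U := (T - S)%R.
have S0 : (0 <= S)%R by rewrite /S -mulNr divr_ge0// ?oppr_ge0 ltW.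
have yS : (y + a_m * S = 0)%R by rewrite /S; field; rewrite gt_eqF.
have U0 : (0 <= U)%R.
  have -> : U = ((y + a_m * T) / a_m)%R by rewrite /U /S; field; rewrite gt_eqF.
  by rewrite divr_ge0// ltW.
have TE : T = (S + U)%R by rewrite /U; ring.
have PS : Phi S y = 0%R by rewrite log_flow_le0 ?yS// ltW.
have PhiE r : Phi (S + r) y = Phi r 0 by rewrite -log_flowD// PS.
rewrite TE integral_itv_split//; last exact: pos_meas_log_speed.
rewrite dn ?yS// PS PhiE; under eq_integral do rewrite PhiE.
by rewrite up// -EFinD; congr EFin; ring.
Qed.

Lemma integral_log_speed_shift y S T (b : bool) : (0 <= T)%R ->
  \int[mu]_(s in [set` Interval (BLeft S) (BSide b (S + T)%R)]) (log_speed (Phi (s - S) y))%:E =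
  (Phi T y - y)%:E.
Proof.
move=> T0; have hps := pos_meas_log_speed y.
have hs : pos_meas (fun s : R => (log_speed (Phi (s - S) y))%:E).
  by apply: (pos_meas_comp (g := fun s : R => (s - S)%R)) hps; exact: measurable_funB.
have -> : \int[mu]_(s in [set` Interval (BLeft S) (BSide b (S + T)%R)]) (log_speed (Phi (s - S) y))%:E =
    \int[mu]_(s in `[S, (S + T)%R]) (log_speed (Phi (s - S) y))%:E.
  case: b => //; rewrite -integral_itv_bndo_bndc//.
  by apply: measurable_funTS; exact: hs.1.
rewrite -integral_log_speed// [LHS]integral_mkcond [RHS]integral_mkcond.
rewrite -(ge0_integral_shift S); last 2 first.
- by apply/measurable_restrict => //; apply: measurable_funTS; exact: hs.1.
- by move=> r; apply: erestrict_ge0 => z _; exact: hs.2.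
apply: eq_integral => r _; rewrite !patchE addrK; congr (if _ then _ else _).
by apply/idP/idP; rewrite !inE/= !in_itv/=; lra.
Qed.

End flow_displacement.

Section survival_of_waiting_time.
Context d (Omega : measurableType d) (R : realType) (P : probability Omega R).
Notation mu := (@lebesgue_measure R).
Variables (K : R) (tau : {RV P >-> R}).
Hypothesis K_gt0 : (0 < K)%R.
Hypothesis tau_law : forall A, measurable A ->
  distribution P tau A = exponential_prob K A.

Lemma exponential_cdf (u : R) : (0 <= u)%R ->
  distribution P tau `]-oo, u]%classic = (1 - expR (- (K * u)))%:E.
Proof.
move=> u0; rewrite tau_law// /exponential_prob.
have -> : `]-oo, u]%classic = `]-oo, 0%R[%classic `|` `[0%R, u]%classic :> set R.
  apply/seteqP; split => r /=; rewrite !in_itv/=.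
    by move=> ru; case: (ltP r 0)%R => r0; [left|right].
  by move=> [r0|/andP[]//]; rewrite (le_trans (ltW r0)).
have mpdf := @measurable_exponential_pdf R K.
rewrite ge0_integral_setU//; last 3 first.
- by apply/measurable_EFinP; exact: measurable_funTS.
- by move=> r _; rewrite lee_fin exponential_pdf_ge0// ltW.
- apply/disj_setPS => r /=; rewrite !in_itv/= => -[h1 /andP[h2 _]].
  by move: h1; rewrite ltNge h2.
rewrite [X in X + _](_ : _ = 0) ?add0e; last first.
  by apply: integral0_eq => r /=; rewrite in_itv/= => r0; rewrite lt0_exponential_pdf.
transitivity (\int[mu]_(r in `[0%R, u]) (K * expR (- (K * r)))%:E).
  apply: eq_integral => r; rewrite inE/= in_itv/= => /andP[r0 _].
  by rewrite exponential_pdfE// mulNr.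
have dE (r : R) : is_derive r (1%R : R) (fun r => - expR (- (K * r)))%R (K * expR (- (K * r)))%R.
  apply: is_derive_eq; rewrite !scaler1 /GRing.scale/=; ring.
rewrite (integral_derive u0 dE).
  by rewrite mulr0 oppr0 expR0 opprK addrC.
move=> r; apply: cvgM; first exact: cvg_cst.
apply: continuous_comp; last exact: continuous_expR.
apply: cvgN; apply: cvgM; [exact: cvg_cst|exact: cvg_id].
Qed.

Lemma exponential_tail (u : R) : (0 <= u)%R ->
  distribution P tau [set r | (u < r)%R] = (expR (- (K * u)))%:E.
Proof.
move=> u0; have -> : [set r | (u < r)%R] = ~` `]-oo, u]%classic.
  by apply/seteqP; split => r /=; rewrite in_itv/= ltNge => /negP.
transitivity (1 - distribution P tau `]-oo, u]%classic).
  exact: probability_setC.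
by rewrite exponential_cdf// -EFinB; congr EFin; ring.
Qed.

End survival_of_waiting_time.

(** * The exponential functional along a path *)

Section path.
Context d (Omega : measurableType d) (R : realType) (P : probability Omega R).
Notation mu := (@lebesgue_measure R).
Variables (a_p a_m : R) (phi : R -> R -> R) (rho : R -> R).
Variables (tau sigma : nat -> {RV P >-> R}).
Hypotheses (a_p_gt0 : (0 < a_p)%R) (a_p_lt_a_m : (a_p < a_m)%R).
Hypothesis phi_flow : is_flow (speed a_p a_m) phi.
Hypothesis jumps : jump_mechanism rho tau sigma.
Variables (x : R) (w : Omega).
Hypothesis x_gt0 : (0 < x)%R.

Notation Phi := (log_flow a_p a_m).
Notation S n := (jump_time tau n w).
Notation p n := (post_jump tau sigma phi x n w).
Notation c n := (chain a_p a_m tau sigma (ln x) n w).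

Lemma jump_timeS n : S n.+1 = (S n + tau n w)%R.
Proof. by rewrite /jump_time big_ord_recr. Qed.

Lemma jump_time0 : S 0 = 0%R.
Proof. by rewrite /jump_time big_ord0. Qed.

Lemma jump_time_lt n : (S n < S n.+1)%R.
Proof. by rewrite jump_timeS ltrDl (waiting_time_gt0 jumps). Qed.

Lemma jump_time_le m n : (m <= n)%N -> (S m <= S n)%R.
Proof.
elim: n => [|n IH]; first by rewrite leqn0 => /eqP ->.
rewrite leq_eqVlt => /orP[/eqP -> //|]; rewrite ltnS => /IH h.
exact: le_trans h (ltW (jump_time_lt n)).
Qed.

Lemma jump_time_ge0 n : (0 <= S n)%R.
Proof. by rewrite -jump_time0; exact: jump_time_le. Qed.

Lemma jump_index_unique m n t : (S m <= t < S m.+1)%R -> (S n <= t < S n.+1)%R -> m = n.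
Proof.
move=> /andP[m1 m2] /andP[n1 n2].
case: (ltngtP m n) => // /jump_time_le h.
  by move: n1; rewrite leNgt (lt_le_trans m2 h).
by move: m1; rewrite leNgt (lt_le_trans n2 h).
Qed.

Lemma post_jump_chain n :
  [/\ (c n).1.1 = S n, (0 < p n)%R, (c n).1.2 = ln (p n) & (0 < (c n).2)%R].
Proof.
elim: n => [|n [h1 h2 h3 h4]]; first by rewrite jump_time0 /= x_gt0 ltr01.
have tau0 : (0 <= tau n w)%R by rewrite ltW// (waiting_time_gt0 jumps).
have /andP[s0 s1] := factor_itv jumps n w.
have [f1 f2] := flowE a_p_gt0 a_p_lt_a_m phi_flow h2 tau0.
split; rewrite /= ?jump_timeS ?h1//.
- by rewrite mulr_gt0.
- by rewrite lnM ?posrE// f2 h3 addrC.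
- by rewrite mulr_gt0 ?expR_gt0.
Qed.

Lemma ln_weight n : ln (c n.+1).2 = (ln (c n).2 - ln (sigma n w))%R.
Proof.
have [_ _ _ h] := post_jump_chain n.
by rewrite /= lnM ?posrE ?expR_gt0// expRK.
Qed.

Lemma process_between n t : (jump_rate rho > 0)%R -> (S n <= t < S n.+1)%R ->
  (0 < process rho tau sigma phi x t w)%R /\
  ln (process rho tau sigma phi x t w) = Phi (t - S n) (c n).1.2.
Proof.
move=> K0 nt.
have cE : jump_count rho tau t w = n.
  rewrite /jump_count K0; case: xgetP => [m _ /= mt|/(_ n)//].
  exact: jump_index_unique mt nt.
rewrite /process cE; have [_ p0 -> _] := post_jump_chain n.
apply: flowE => //; case/andP: nt => h _; lra.
Qed.

Lemma speed_ratio (z : R) : (0 < z)%R ->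
  (speed a_p a_m z / z = log_speed a_p a_m (ln z))%R.
Proof.
move=> z0; rewrite /speed /log_speed.
have -> : (ln z < 0)%R = (z < 1)%R.
  case: (ltP z 1)%R => z1; first by rewrite ln_lt0// z0.
  by apply/negbTE; rewrite -leNgt ln_ge0.
by case: ifP => _; rewrite mulfK// gt_eqF.
Qed.

Let kappa s := (speed a_p a_m (process rho tau sigma phi x s w) /
  process rho tau sigma phi x s w)%R.

Lemma kappa_between n t : (jump_rate rho > 0)%R -> (S n <= t < S n.+1)%R ->
  kappa t = log_speed a_p a_m (Phi (t - S n) (c n).1.2).
Proof.
by move=> K0 nt; have [z0 zE] := process_between K0 nt; rewrite /kappa speed_ratio// zE.
Qed.

Let piece n (b : bool) T : (jump_rate rho > 0)%R -> (0 <= T)%R ->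
  (b -> S n + T <= S n.+1)%R -> (~~ b -> S n + T < S n.+1)%R ->
  measurable_fun [set` Interval (BLeft (S n)) (BSide b (S n + T)%R)] kappa /\
  \int[mu]_(s in [set` Interval (BLeft (S n)) (BSide b (S n + T)%R)]) (kappa s)%:E
  = (Phi T (c n).1.2 - (c n).1.2)%:E.
Proof.
move=> K0 T0 h1 h2.
have kE s : s \in [set` Interval (BLeft (S n)) (BSide b (S n + T)%R)] ->
    kappa s = log_speed a_p a_m (Phi (s - S n) (c n).1.2).
  rewrite inE/= => hs; apply: kappa_between => //.
  case: b h1 h2 hs => h1 h2; rewrite in_itv/= => /andP[-> hs] /=.
    exact: lt_le_trans hs (h1 isT).
  exact: le_lt_trans hs (h2 isT).
split.
  apply: (@eq_measurable_fun _ _ R R _ (fun s : R => log_speed a_p a_m (Phi (s - S n) (c n).1.2))).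
    by move=> s /kE ->.
  apply: measurable_funTS; apply: measurableT_comp; first exact: measurable_log_speed.
  apply: (measurableT_comp (measurable_log_flow1 a_p a_m (c n).1.2) (g := fun s : R => (s - S n)%R)).
  exact: measurable_funB.
rewrite -(integral_log_speed_shift a_p_gt0 a_p_lt_a_m _ (S n) b T0).
by apply: eq_integral => s /kE ->.
Qed.

Let kappa_ge0_lt n s : (jump_rate rho > 0)%R -> (0 <= s)%R -> (s < S n)%R -> (0 <= kappa s)%R.
Proof.
move=> K0 s0; elim: n => [|n IH] sn; first by move: sn; rewrite jump_time0 ltNge s0.
case: (ltP s (S n)) => sn'; first exact: IH.
by rewrite (@kappa_between n)// ?sn'//; exact: log_speed_ge0.
Qed.

Let interval_split (A B : R) (b : bool) : (0 <= A)%R -> (A <= B)%R ->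
  [set` Interval (BLeft 0%R) (BSide b B)] =
  `[0%R, A[%classic `|` [set` Interval (BLeft A) (BSide b B)] :> set R.
Proof.
move=> A0 AB; apply/seteqP; split => r /=; rewrite !in_itv/=.
  move=> /andP[r0 rT]; case: (ltP r A) => rS; [left|right] => //.
  by rewrite r0.
move=> [/andP[r0 rS]|/andP[rS ->]]; last by rewrite (le_trans A0 rS).
by rewrite r0/=; apply: lteifS; exact: lt_le_trans AB.
Qed.

Let integral_split (A B r1 r2 : R) (b : bool) : (0 <= A)%R -> (A <= B)%R ->
  (forall s, (0 <= s)%R -> (s < A)%R -> (0 <= kappa s)%R) ->
  (forall s, s \in [set` Interval (BLeft A) (BSide b B)] -> (0 <= kappa s)%R) ->
  measurable_fun (`[0%R, A[ : set R) kappa ->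
  measurable_fun [set` Interval (BLeft A) (BSide b B)] kappa ->
  \int[mu]_(s in `[0%R, A[) (kappa s)%:E = r1%:E ->
  \int[mu]_(s in [set` Interval (BLeft A) (BSide b B)]) (kappa s)%:E = r2%:E ->
  measurable_fun [set` Interval (BLeft 0%R) (BSide b B)] kappa /\
  \int[mu]_(s in [set` Interval (BLeft 0%R) (BSide b B)]) (kappa s)%:E = (r1 + r2)%:E.
Proof.
move=> A0 AB k1 k2 m1 m2 i1 i2; rewrite (@interval_split A)//.
have mU : measurable_fun (`[0%R, A[%classic `|` [set` Interval (BLeft A) (BSide b B)] : set R) kappa.
  exact/measurable_funU.
split => //; rewrite ge0_integral_setU//.
- by rewrite i1 i2 EFinD.
- exact/measurable_EFinP.
- move=> s [|hs]; last by rewrite lee_fin k2// inE.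
  by rewrite /= in_itv/= => /andP[s0 sA]; rewrite lee_fin k1.
- apply/disj_setPS => r /=; rewrite !in_itv/= => -[/andP[_ h1] /andP[h2 _]].
  by move: h1; rewrite ltNge h2.
Qed.

(** Up to the [n]-th jump, the displacement due to the flow is the net displacement plus what the
    jumps took away, and the latter is the logarithm of the weight. *)
Lemma integral_kappa_jump n : (jump_rate rho > 0)%R ->
  measurable_fun (`[0%R, S n[ : set R) kappa /\
  \int[mu]_(s in `[0%R, S n[) (kappa s)%:E = ((c n).1.2 - ln x + ln (c n).2)%:E.
Proof.
move=> K0; elim: n => [|n [IH1 IH2]].
  rewrite jump_time0 set_itv_ge ?bnd_simp ?ltxx//; split; first exact: measurable_fun_set0.
  by rewrite integral_set0 /= ln1 subrr addr0.
have T0 : (0 <= tau n w)%R by rewrite ltW// (waiting_time_gt0 jumps).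
have [||P1 P2] := @piece n true (tau n w) K0 T0; rewrite ?jump_timeS//.
have SS : (S n <= S n + tau n w)%R by rewrite lerDl.
have k1 s : (0 <= s)%R -> (s < S n)%R -> (0 <= kappa s)%R by exact: kappa_ge0_lt.
have k2 s : s \in [set` Interval (BLeft (S n)) (BSide true (S n + tau n w)%R)] -> (0 <= kappa s)%R.
  rewrite inE/= in_itv/= -jump_timeS => /andP[s1 s2].
  by apply: (@kappa_ge0_lt n.+1) => //; exact: le_trans (jump_time_ge0 n) s1.
have [Q1 Q2] := integral_split (jump_time_ge0 n) SS k1 k2 IH1 P1 IH2 P2.
split; first exact: Q1.
apply: etrans Q2 _; congr EFin; rewrite ln_weight /=; ring.
Qed.

(** The position [X_t] appears as a factor and cancels against the denominator of the Feynman-Kac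
    formula; only the weight of the chain is left. *)
Lemma multiplicative_functionalE n t : (jump_rate rho > 0)%R -> (S n <= t < S n.+1)%R ->
  multiplicative_functional rho tau sigma phi (speed a_p a_m) x t w =
  (process rho tau sigma phi x t w * (c n).2 / x)%R.
Proof.
move=> K0 nt; have [z0 zE] := process_between K0 nt.
have [_ _ _ q0] := post_jump_chain n.
case/andP: nt => nt1 nt2.
have T0 : (0 <= t - S n)%R by rewrite subr_ge0.
have [||P1 P2] := @piece n false (t - S n)%R K0 T0; rewrite ?(addrC (S n)) ?subrK//.
rewrite (addrC (S n)) subrK in P1 P2.
have k1 s : (0 <= s)%R -> (s < S n)%R -> (0 <= kappa s)%R by exact: kappa_ge0_lt.
have k2 s : s \in [set` Interval (BLeft (S n)) (BSide false t)] -> (0 <= kappa s)%R.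
  rewrite inE/= in_itv/= => /andP[s1 s2].
  apply: (@kappa_ge0_lt n.+1) => //; first exact: le_trans (jump_time_ge0 n) s1.
  exact: le_lt_trans nt2.
have [IH1 IH2] := integral_kappa_jump n K0.
have [Q1 Q2] := integral_split (jump_time_ge0 n) nt1 k1 k2 IH1 P1 IH2 P2.
rewrite /multiplicative_functional /Rintegral [X in fine X]Q2 /=.
rewrite -zE; set z := process _ _ _ _ _ _ _.
rewrite (_ : _ - _ + _ + _ = ln z + ln (c n).2 - ln x)%R; last by rewrite zE; ring.
by rewrite expRD expRN expRD !lnK ?posrE.
Qed.

End path.

(** * The kernel [J] built from [rho], its mass and its moments *)

Section fragmentation_kernel.
Context {R : realType}.
Notation mu := (@lebesgue_measure R).
Variables (rho : R -> R) (eps0 : R).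
Hypothesis rho_meas : measurable_fun (`[0%R, 1%R]%classic : set R) rho.
Hypothesis rho_ge0 : forall s : R, (0 <= s <= 1)%R -> (0 <= rho s)%R.
Hypothesis eps0_gt0 : (0 < eps0)%R.
Hypothesis rho_moment :
  \int[mu]_(s in `[0%R, 1%R]) (s `^ (- eps0) * rho s)%:E < +oo.

(** Extension of [rho] by 0 to the line. The point 0 is left out, so that [ln] has its true meaning
    on the support. *)
Definition frag_density (s : R) : R := if (0 < s <= 1)%R then rho s else 0%R.

Lemma measurable_frag_density : measurable_fun setT frag_density.
Proof.
have -> : frag_density = rho \_ `]0%R, 1%R]%classic.
  apply/funext => s; rewrite patchE /frag_density; congr (if _ then _ else _).
  by apply/idP/idP; rewrite inE/= in_itv.
apply/measurable_restrict => //; apply: measurable_funS rho_meas => //.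
by move=> s [_ /=]; rewrite !in_itv/= => /andP[s0 ->]; rewrite (ltW s0).
Qed.

Lemma frag_density_ge0 s : (0 <= frag_density s)%R.
Proof.
by rewrite /frag_density; case: ifP => // /andP[s0 s1]; rewrite rho_ge0// s1 ltW.
Qed.

Lemma frag_density_supp s : (s <= 0)%R -> frag_density s = 0%R.
Proof. by rewrite /frag_density => s0; rewrite ltNge s0. Qed.

Lemma frag_density_supp1 s : (1 < s)%R -> frag_density s = 0%R.
Proof. by rewrite /frag_density => s0; rewrite (leNgt s) s0 andbF. Qed.

Lemma integral_rho (h : R -> R) : measurable_fun setT h ->
  \int[mu]_(s in `[0%R, 1%R]) (h s * rho s)%:E = \int[mu]_s (h s * frag_density s)%:E.
Proof.
move=> mh; rewrite -integral_itv_obnd_cbnd; last first.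
  apply/measurable_EFinP; apply: measurable_funM; first exact: measurable_funTS.
  apply: measurable_funS rho_meas => //.
  by move=> s /=; rewrite !in_itv/= => /andP[s0 ->]; rewrite (ltW s0).
rewrite integral_mkcond; apply: eq_integral => s _; rewrite patchE /frag_density.
have -> : (s \in `]0%R, 1%R]%classic) = (0 < s <= 1)%R.
  by apply/idP/idP; rewrite inE/= in_itv.
by case: ifP => //; rewrite mulr0.
Qed.

Lemma frag_density_moment : \int[mu]_s (frag_density s * expR (- eps0 * ln s))%:E < +oo.
Proof.
move: rho_moment; rewrite integral_rho; last exact: measurable_powR.
congr (_ < _); apply: eq_integral => s _; case: (ltP 0 s)%R => s0; last first.
  by rewrite frag_density_supp// mulr0 mul0r.
by rewrite mulrC /powR gt_eqF.
Qed.

Lemma frag_density_fin : \int[mu]_s (frag_density s)%:E < +oo.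
Proof.
apply: le_lt_trans frag_density_moment; apply: ge0_le_integral => //.
- by move=> s _; rewrite lee_fin frag_density_ge0.
- by apply/measurable_EFinP; exact: measurable_frag_density.
- apply/measurable_EFinP/measurable_funM; first exact: measurable_frag_density.
  by apply: measurableT_comp => //; apply: measurable_funM => //; exact: measurable_ln.
- move=> s _; rewrite lee_fin /frag_density; case: ifP => [/andP[s0 s1]|]; last by rewrite mul0r.
  have h : (1 <= expR (- eps0 * ln s))%R.
    by rewrite -[leLHS]expR0 ler_expR mulr_le0// ?ln_le0// oppr_le0 ltW.
  by rewrite ler_peMr// rho_ge0// s1 ltW.
Qed.

Definition log_kernel : {finite_measure set R -> \bar R} :=
  log_jump_law measurable_frag_density frag_density_ge0 frag_density_fin.

Lemma integral_log_kernel f : pos_meas f ->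
  \int[log_kernel]_xi f xi = \int[mu]_s (f (ln s) * (frag_density s)%:E).
Proof. exact: integral_log_jump_law. Qed.

(** On the support [(0, 1]] only the point [s = 1] has a nonnegative logarithm, and a point is
    Lebesgue null. *)
Lemma log_kernel_ge0 : log_kernel `[0%R, +oo[%classic = 0.
Proof.
have -> : log_kernel `[0%R, +oo[%classic = \int[log_kernel]_xi (\1_(`[0%R, +oo[%classic : set R) xi)%:E.
  by rewrite integral_indic// setIT.
rewrite integral_log_kernel; last first.
  by apply: pos_meas_EFin => //; exact: measurable_indic.
rewrite -(integral_set1 (fun s => (frag_density s)%:E) 1%R) [RHS]integral_mkcond.
apply: eq_integral => s _; rewrite patchE indicE.
case: (ltP s 1)%R => s1.
  rewrite [X in if X then _ else _](_ : _ = false); last first.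
    by apply/negbTE/negP; rewrite inE/= => h; rewrite h ltxx in s1.
  case: (ltP 0 s)%R => s0; last by rewrite frag_density_supp// mule0.
  rewrite [X in (nat_of_bool X)%:R](_ : _ = false) ?mul0e//.
  by apply/negbTE/negP; rewrite inE/= in_itv/= andbT leNgt ln_lt0// s0.
move: s1; rewrite le_eqVlt => /orP[/eqP <-|s1].
  rewrite ln1 ifT; last exact: mem_set.
  rewrite (_ : (0%R \in _) = true) ?mul1e//.
  by apply: mem_set; rewrite /= in_itv/= lexx.
by rewrite frag_density_supp1// mule0; case: ifP.
Qed.

Lemma log_kernel_moment : \int[log_kernel]_xi (expR (- eps0 * xi))%:E < +oo.
Proof.
rewrite integral_log_kernel.
  move: frag_density_moment; congr (_ < _); apply: eq_integral => s _.
  by rewrite EFinM muleC.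
apply: pos_meas_EFin => [|xi]; last exact: expR_ge0.
by apply: measurableT_comp => //; exact: measurable_funM.
Qed.

Lemma integral_size_kernel :
  \int[mu]_s (s * frag_density s)%:E = (jump_rate rho)%:E.
Proof.
rewrite /jump_rate /Rintegral integral_rho; last exact: measurable_id.
rewrite fineK// ge0_fin_numE; last first.
  apply: integral_ge0 => s _; rewrite lee_fin; case: (leP s 0)%R => s0.
    by rewrite frag_density_supp// mulr0.
  by rewrite mulr_ge0 ?frag_density_ge0// ltW.
apply: le_lt_trans frag_density_fin; apply: ge0_le_integral => //.
- move=> s _; rewrite lee_fin; case: (leP s 0)%R => s0; first by rewrite frag_density_supp// mulr0.
  by rewrite mulr_ge0 ?frag_density_ge0// ltW.
- by apply/measurable_EFinP/measurable_funM => //; exact: measurable_frag_density.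
- by apply/measurable_EFinP; exact: measurable_frag_density.
- move=> s _; rewrite lee_fin /frag_density; case: ifP => [/andP[s0 s1]|]; last by rewrite mulr0.
  by rewrite ler_piMl ?rho_ge0 ?s1 ?ltW.
Qed.

Lemma rate_log_kernel : \int[mu]_s (frag_density s)%:E = (rate log_kernel)%:E.
Proof.
rewrite -rateE.
have -> : log_kernel setT = \int[log_kernel]_xi (cst 1 xi).
  by have -> := integral_cst log_kernel measurableT 1; rewrite mul1e.
rewrite integral_log_kernel; last by split.
by apply: eq_integral => s _; rewrite mul1e.
Qed.

(** Thus [lambda] is the difference of the two jump rates, exactly the exponent left over by the
    change of measure. *)
Lemma growth_rateE :
  (\int[mu]_(s in `[0%R, 1%R]) ((1 - s) * rho s))%R = (rate log_kernel - jump_rate rho)%R.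
Proof.
rewrite /Rintegral integral_rho; last exact: measurable_funB.
have mk := measurable_frag_density.
have h0 s : (0 <= s * frag_density s)%R.
  case: (leP s 0)%R => s0; first by rewrite frag_density_supp// mulr0.
  by rewrite mulr_ge0 ?frag_density_ge0// ltW.
have h1 s : (0 <= (1 - s) * frag_density s)%R.
  case: (leP s 1)%R => s1; first by rewrite mulr_ge0 ?frag_density_ge0// subr_ge0.
  by rewrite frag_density_supp1// mulr0.
suff E : \int[mu]_s ((1 - s) * frag_density s)%:E + (jump_rate rho)%:E = (rate log_kernel)%:E.
  by rewrite -(addeK (x := (jump_rate rho)%:E) (\int[mu]_s ((1 - s) * frag_density s)%:E))// E.
rewrite -integral_size_kernel -rate_log_kernel -ge0_integralD//.
- by apply: eq_integral => s _; rewrite -EFinD; congr EFin; ring.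
- by move=> s _; rewrite lee_fin.
- by apply/measurable_EFinP/measurable_funM => //; exact: measurable_funB.
- by move=> s _; rewrite lee_fin.
- by apply/measurable_EFinP/measurable_funM.
Qed.

(** The maximum keeps the integrand nonnegative for every [xi]. Finiteness comes from
    [- ln s <= eps0^-1 exp(- eps0 ln s)] and the moment hypothesis. *)
Lemma log_kernel_mean (m := (- \int[mu]_(s in `[0%R, 1%R]) (ln s * rho s))%R) :
  \int[log_kernel]_xi (Num.max 0 (- xi))%:E = m%:E.
Proof.
rewrite /m {m} /Rintegral integral_rho; last exact: measurable_ln.
have hp : pos_meas (fun xi : R => (Num.max 0 (- xi)%R)%:E).
  apply: pos_meas_EFin => [|xi]; last by rewrite le_max lexx.
  exact: measurable_maxr.
rewrite integral_log_kernel//.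
have E (s : R) : (Num.max 0 (- ln s)%R)%:E * (frag_density s)%:E = - (ln s * frag_density s)%:E.
  rewrite -EFinM -EFinN; congr EFin; rewrite /frag_density; case: ifP => [/andP[s0 s1]|]; last by rewrite !mulr0 oppr0.
  by rewrite max_r ?mulNr// oppr_ge0 ln_le0.
transitivity (\int[mu]_s (- (ln s * frag_density s)%:E)); first by apply: eq_integral => s _; exact: E.
have N0 : forall s, 0 <= - (ln s * frag_density s)%:E.
  by move=> s; rewrite -E mule_ge0// ?lee_fin ?frag_density_ge0// le_max lexx.
have mE : measurable_fun setT (fun s => - (ln s * frag_density s)%:E).
  apply: measurableT_comp => //; apply/measurable_EFinP/measurable_funM.
    exact: measurable_ln.
  exact: measurable_frag_density.
have NE : \int[mu]_s (ln s * frag_density s)%:E = - \int[mu]_s (- (ln s * frag_density s)%:E).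
  rewrite -[RHS]integral_ge0N//; first by apply: eq_integral => s _; rewrite oppeK.
rewrite NE fineN opprK fineK// ge0_fin_numE; last exact: integral_ge0.
have ae : (0 < eps0^-1)%R by rewrite invr_gt0.
have mom : pos_meas (fun s : R => (frag_density s * expR (- eps0 * ln s))%:E).
  apply: pos_meas_EFin => [|s]; last by rewrite mulr_ge0 ?frag_density_ge0 ?expR_ge0.
  apply: measurable_funM; first exact: measurable_frag_density.
  by apply: measurableT_comp => //; apply: measurable_funM => //; exact: measurable_ln.
apply: (@le_lt_trans _ _ (\int[mu]_s ((eps0^-1)%:E * (frag_density s * expR (- eps0 * ln s))%:E))); last first.
  rewrite (ge0_integralZl mu measurableT mom.1 (fun s _ => mom.2 s)) ?lee_fin ?(ltW ae)//.
  by rewrite lte_mul_pinfty ?lee_fin ?(ltW ae)//; exact: frag_density_moment.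
apply: ge0_le_integral => //.
  by apply: emeasurable_funM => //; exact: mom.1.
move=> s _; rewrite -EFinN -EFinM lee_fin.
apply: (@le_trans _ _ (eps0^-1 * (frag_density s * (1 + - eps0 * ln s)))%R).
  have -> : (eps0^-1 * (frag_density s * (1 + - eps0 * ln s)) = eps0^-1 * frag_density s - ln s * frag_density s)%R.
    by field; rewrite gt_eqF.
  by rewrite lerDr mulr_ge0 ?frag_density_ge0// ltW.
rewrite ler_wpM2l ?(ltW ae)// ler_wpM2l ?frag_density_ge0//; exact: expR_ge1Dx.
Qed.

End fragmentation_kernel.

(** * From the expectation over paths to [sg], for a positive jump rate *)

Section link.
Context d (Omega : measurableType d) (R : realType) (P : probability Omega R).
Notation mu := (@lebesgue_measure R).
Variables (a_p a_m : R) (rho : R -> R) (eps0 : R) (phi : R -> R -> R).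
Variables (tau sigma : nat -> {RV P >-> R}).
Hypotheses (a_p_gt0 : (0 < a_p)%R) (a_p_lt_a_m : (a_p < a_m)%R).
Hypothesis rho_meas : measurable_fun (`[0%R, 1%R]%classic : set R) rho.
Hypothesis rho_ge0 : forall s : R, (0 <= s <= 1)%R -> (0 <= rho s)%R.
Hypothesis eps0_gt0 : (0 < eps0)%R.
Hypothesis rho_moment :
  \int[mu]_(s in `[0%R, 1%R]) (s `^ (- eps0) * rho s)%:E < +oo.
Hypothesis phi_flow : is_flow (speed a_p a_m) phi.
Hypothesis jumps : jump_mechanism rho tau sigma.

Notation J := (log_kernel rho_meas rho_ge0 eps0_gt0 rho_moment).
Notation mg := (measurable_frag_density rho_meas).
Notation g0 := (frag_density_ge0 rho_ge0).
Notation gf := (frag_density_fin rho_meas rho_ge0 eps0_gt0 rho_moment).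
Notation L := (rate J).
Notation K := (jump_rate rho).
Notation Phi := (log_flow a_p a_m).
Notation iterop n := (iter n (step_op a_p a_m J)).

Section positive_rate.
Hypothesis K_gt0 : (0 < K)%R.

Let tau_law n A : measurable A -> distribution P (tau n) A = exponential_prob K A.
Proof. exact: (waiting_time_law jumps). Qed.

Let sigma_law n A : measurable A ->
  distribution P (sigma n) A = \int[mu]_(s in A) (K^-1 * (s * frag_density rho s))%:E.
Proof.
move=> mA; rewrite (factor_law jumps K_gt0)// integral_mkcondr.
apply: eq_integral => s _; rewrite patchE /frag_density.
case: ifPn => [/[!inE]/=|/negP]; first rewrite in_itv/= => /andP[s0 s1].
  move: s0; rewrite le_eqVlt => /orP[/eqP <-|s0]; last by rewrite s0 s1.
  by rewrite !mul0r.
move=> h; rewrite ifF ?mulr0//; apply/negbTE/negP => /andP[s0 s1]; apply: h.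
by apply: mem_set; rewrite /= in_itv/= s1 ltW.
Qed.

Variables (x t : R).
Hypotheses (x_gt0 : (0 < x)%R) (t_ge0 : (0 <= t)%R).

Notation c n w := (chain a_p a_m tau sigma (ln x) n w).

Definition alive (z : R * R * R) (r : R) : R := if (0 <= t - z.1.1 < r)%R then 1%R else 0%R.

Lemma measurable_alive : measurable_fun setT (fun z : R * R * R * R => alive z.1 z.2).
Proof.
apply: measurable_fun_if => //.
have m1 : measurable_fun setT (fun z : R * R * R * R => t - z.1.1.1)%R.
  by apply: measurable_funB => //; do 2 apply: measurableT_comp => //.
by apply: measurable_and; [exact: measurable_fun_ler|exact: measurable_fun_ltr].
Qed.

(** Contribution of the paths whose last jump before [t] is the one recorded in [z]; [r] is the
    waiting time that follows it. *)
Definition last_term (F : R -> \bar R) (z : R * R * R) (r : R) : \bar R :=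
  (`|z.2| * alive z r)%:E * F (Phi (t - z.1.1) z.1.2).

Lemma pos_meas_last_term F : pos_meas F ->
  pos_meas (fun z : R * R * R * R => last_term F z.1 z.2).
Proof.
move=> hF; apply: pos_measM.
  apply: pos_meas_EFin; last by move=> z; rewrite mulr_ge0// /alive; case: ifP.
  apply: measurable_funM; last exact: measurable_alive.
  by apply: measurableT_comp => //; apply: measurableT_comp.
apply: pos_meas_comp hF.
apply: (measurableT_comp (measurable_log_flow a_p a_m)
  (g := fun z : R * R * R * R => (t - z.1.1.1, z.1.1.2)%R)).
apply/measurable_fun_pair => /=.
  by apply: measurable_funB => //; do 2 apply: measurableT_comp => //.
by do 2 apply: measurableT_comp => //.
Qed.

(** Integrating out the next waiting time gives the tail [exp(- K (t - S_n))]; this is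
    [exp((L - K) t)] times the tilt of [weighted] times the survival at rate [L]. *)
Lemma integral_last_term F n : pos_meas F ->
  \int[P]_w last_term F (c n w) (tau n w) =
  (expR ((L - K) * t))%:E * iterop n (nojump a_p a_m J F) (t, ln x).
Proof.
move=> hF; have hlt := pos_meas_last_term hF.
have mz := measurable_chain a_p a_m tau sigma (ln x) n.
have hind := @chain_independent _ _ _ P a_p a_m tau sigma (jumps_independent jumps) (ln x) n.
have hn := pos_meas_nojump a_p a_m J hF.
have /= -> := integral_independent (i := inl n) mz hind (leqnn n) hlt.
have <- : \int[P]_w weighted K mg g0 gf (nojump a_p a_m J F) t (c n w) =
    iterop n (nojump a_p a_m J F) (t, ln x).
  exact: (integral_weighted_chain a_p a_m K_gt0 _ _ (@frag_density_supp R rho) _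
    tau_law sigma_law (jumps_independent jumps)).
have hwc := pos_meas_comp mz (pos_meas_weighted K mg g0 gf t hn).
have ce : 0 <= (expR ((L - K) * t))%:E by rewrite lee_fin expR_ge0.
apply: (etrans _ (ge0_integralZl P measurableT hwc.1 (fun w _ => hwc.2 w) ce)).
apply: eq_integral => w _; set z := c n w.
rewrite /last_term /weighted /nojump /= /survival.
case: (leP 0 (t - z.1.1))%R => tz; last first.
  rewrite mul0e !mule0; apply: integral0_eq => r _.
  by rewrite /alive leNgt tz mulr0 mul0e.
have F0 : 0 <= F (Phi (t - z.1.1) z.1.2) by exact: hF.2.
rewrite (eq_integral (fun r => (`|z.2|%:E * F (Phi (t - z.1.1) z.1.2)) *
    (\1_[set r : R | (t - z.1.1 < r)%R] r)%:E)); last first.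
  move=> r _; rewrite EFinM muleAC /alive tz indicE /=; congr (_ * _%:E).
  by case: ifPn => h; [rewrite mem_set|rewrite memNset//; exact/negP].
have mA : measurable [set r : R | (t - z.1.1 < r)%R].
  rewrite (_ : [set r | _] = `](t - z.1.1)%R, +oo[%classic); first exact: measurable_itv.
  by apply/seteqP; split => r /=; rewrite in_itv/= andbT.
have mI : measurable_fun setT (fun r : R => (\1_[set r : R | (t - z.1.1 < r)%R] r)%:E : \bar R).
  by apply/measurable_EFinP; exact: measurable_indic.
have cF : 0 <= `|z.2|%:E * F (Phi (t - z.1.1) z.1.2) by rewrite mule_ge0.
rewrite (ge0_integralZl _ measurableT mI (fun r _ => _) cF)//.
rewrite integral_indic// setIT.
have -> : `|z.2|%:E * F (Phi (t - z.1.1) z.1.2) *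
    (distribution P (tau n) [set r : R | (t - z.1.1 < r)%R]) =
    (`|z.2| * expR (- (K * (t - z.1.1))))%:E * F (Phi (t - z.1.1) z.1.2).
  by rewrite (exponential_tail K_gt0 (tau_law n) tz) muleAC -EFinM.
rewrite !muleA -!EFinM; congr (_%:E * _).
change (rate (log_jump_law mg g0 gf)) with L.
rewrite [RHS](_ : _ = `|z.2| * (expR ((L - K) * t) * expR (- (L - K) * z.1.1) *
  expR (- (L * (t - z.1.1)))))%R; last by ring.
by rewrite -!expRD; congr (_ * expR _)%R; ring.
Qed.

Definition explosion : set Omega := \bigcap_n [set w | (jump_time tau n w <= t)%R].

Lemma measurable_jump_time n : measurable_fun setT (jump_time tau n).
Proof. by rewrite /jump_time; apply: measurable_sum => i. Qed.

Lemma measurable_explosion : measurable explosion.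
Proof.
apply: bigcapT_measurable => n.
rewrite -[X in measurable X]setTI.
rewrite (_ : [set w | _] = jump_time tau n @^-1` `]-oo, t]%classic).
  exact: measurable_jump_time.
by apply/seteqP; split => w /=; rewrite in_itv.
Qed.

(** On this event every waiting time is at most [t], so by independence its probability is at most
    [(1 - exp(- K t))^n] for all [n]. *)
Lemma explosion0 : P explosion = 0.
Proof.
have bound n : P explosion <= ((1 - expR (- (K * t))) ^+ n)%:E.
  pose s : seq (nat + nat) := map inl (iota 0 n).
  have us : uniq s by rewrite map_inj_uniq ?iota_uniq// => i j [].
  pose A (i : nat + nat) : set R := `]-oo, t]%classic.
  have mA i : measurable (A i) by exact: measurable_itv.
  have := jumps_independent jumps us mA.
  have -> : \prod_(i <- s) P ((match i with inl n => tau n | inr n => sigma n end : {RV P >-> R}) @^-1` A i)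
      = ((1 - expR (- (K * t))) ^+ n)%:E.
    rewrite /s big_map; elim: (n) {s us} 0%N => [|k IH] m; first by rewrite big_nil expr0.
    rewrite /= big_cons IH exprS EFinM; congr (_ * _).
    exact: (exponential_cdf K_gt0 (tau_law m) t_ge0).
  move=> <-; apply: le_measure; rewrite ?inE.
  - exact: measurable_explosion.
  - exact: (measurable_jointly (fun i : nat + nat => match i with inl n => tau n | inr n => sigma n end) s mA).
  - move=> w hw i /= /mapP[k _ ->] /=; rewrite /A /= in_itv/=.
    apply: le_trans (hw k.+1 I); rewrite jump_timeS lerDr.
    exact: (jump_time_ge0 jumps).
have q1 : (`|1 - expR (- (K * t))| < 1)%R.
  rewrite ger0_norm; first by rewrite ltrBlDr ltrDl expR_gt0.
  by rewrite subr_ge0 -[leRHS]expR0 ler_expR oppr_le0 mulr_ge0// ltW.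
have cv : ((1 - expR (- (K * t))) ^+ n)%:E @[n --> \oo] --> 0%:E.
  by apply: cvg_EFin; [exact: nearW|exact: cvg_expr].
apply/le_anti/andP; split; last exact: measure_ge0.
apply: (@le_trans _ _ (limn (fun n => ((1 - expR (- (K * t))) ^+ n)%:E))).
  apply: lime_ge; last exact: nearW.
  by apply/cvg_ex; eexists; exact: cv.
by rewrite (cvg_lim _ cv).
Qed.

(** Off the explosion event exactly one term is alive, the one indexed by the number of jumps up to
    [t]. *)
Definition path_sum (F : R -> \bar R) (w : Omega) : \bar R :=
  \sum_(0 <= n <oo) last_term F (c n w) (tau n w).

Lemma pos_meas_last_term_path F n : pos_meas F ->
  pos_meas (fun w => last_term F (c n w) (tau n w)).
Proof.
move=> hF.
apply: (pos_meas_comp (g := fun w => (c n w, tau n w))) (pos_meas_last_term hF).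
apply/measurable_fun_pair => //; exact: measurable_chain.
Qed.

Lemma integral_path_sum F : pos_meas F ->
  \int[P]_w path_sum F w = (expR ((L - K) * t))%:E * sg a_p a_m J t F (ln x).
Proof.
move=> hF; have hn := pos_meas_nojump a_p a_m J hF.
rewrite /path_sum integral_nneseries//; last 2 first.
- by move=> n; exact: (pos_meas_last_term_path n hF).1.
- by move=> n w _; exact: (pos_meas_last_term_path n hF).2.
rewrite /sg /potential -nneseriesZl; last first.
  by move=> n _; exact: (pos_meas_iter a_p a_m J n hn).2.
by apply: eq_eseriesr => n _; exact: integral_last_term.
Qed.

Lemma path_sumE F w n : pos_meas F ->
  (jump_time tau n w <= t < jump_time tau n.+1 w)%R ->
  path_sum F w = ((c n w).2)%:E * F (Phi (t - jump_time tau n w) (c n w).1.2).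
Proof.
move=> hF nt; have pj k := post_jump_chain a_p_gt0 a_p_lt_a_m phi_flow jumps w x_gt0 k.
rewrite /path_sum (@nneseriesD1 _ _ n)//; last first.
  by move=> k _; exact: (pos_meas_last_term_path k hF).2.
rewrite [X in _ + X]eseries0 ?adde0.
  have [h1 _ _ h4] := pj n.
  rewrite /last_term /alive h1 ifT ?mulr1 ?gtr0_norm//.
  by move: nt; rewrite jump_timeS; lra.
move=> k _ kn; rewrite /last_term /alive; have [-> _ _ _] := pj k.
rewrite ifF ?mulr0 ?mul0e//; apply/negbTE/negP => h.
move/eqP: kn; apply; apply: (jump_index_unique jumps _ nt).
by rewrite jump_timeS; lra.
Qed.

Lemma jump_index_exists w : ~ explosion w ->
  exists n, (jump_time tau n w <= t < jump_time tau n.+1 w)%R.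
Proof.
move=> hw; have : exists n, (t < jump_time tau n w)%R.
  apply: contra_notP hw => hn n _ /=; rewrite leNgt; apply/negP => h.
  by apply: hn; exists n.
move=> ex; case: (ex_minnP ex) => [[|n] nt nmin].
  by move: nt; rewrite jump_time0 ltNge t_ge0.
exists n; rewrite nt andbT leNgt; apply/negP => /nmin.
by rewrite ltnn.
Qed.

End positive_rate.
End link.

(** * The growth-fragmentation semigroup expressed by [sg] *)

Section link.
Context d (Omega : measurableType d) (R : realType) (P : probability Omega R).
Notation mu := (@lebesgue_measure R).
Variables (a_p a_m : R) (rho : R -> R) (eps0 : R) (phi : R -> R -> R).
Variables (tau sigma : nat -> {RV P >-> R}).
Hypotheses (a_p_gt0 : (0 < a_p)%R) (a_p_lt_a_m : (a_p < a_m)%R).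
Hypothesis rho_meas : measurable_fun (`[0%R, 1%R]%classic : set R) rho.
Hypothesis rho_ge0 : forall s : R, (0 <= s <= 1)%R -> (0 <= rho s)%R.
Hypothesis eps0_gt0 : (0 < eps0)%R.
Hypothesis rho_moment :
  \int[mu]_(s in `[0%R, 1%R]) (s `^ (- eps0) * rho s)%:E < +oo.
Hypothesis phi_flow : is_flow (speed a_p a_m) phi.
Hypothesis jumps : jump_mechanism rho tau sigma.

Notation J := (log_kernel rho_meas rho_ge0 eps0_gt0 rho_moment).
Notation mg := (measurable_frag_density rho_meas).
Notation g0 := (frag_density_ge0 rho_ge0).
Notation gf := (frag_density_fin rho_meas rho_ge0 eps0_gt0 rho_moment).
Notation L := (rate J).
Notation K := (jump_rate rho).
Notation Phi := (log_flow a_p a_m).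
Notation iterop n := (iter n (step_op a_p a_m J)).

Definition positive_part_at (f : R -> R) (y : R) : \bar R := (Num.max 0 (f (expR y)))%:E.

Lemma pos_meas_positive_part (f : R -> R) : measurable_fun setT (f \o expR) ->
  pos_meas (positive_part_at f).
Proof.
move=> mf; apply: pos_meas_EFin => [|y]; last by rewrite le_max lexx.
exact: measurable_maxr.
Qed.

Lemma sg_positive_part_fin t (f : R -> R) y C : measurable_fun setT (f \o expR) ->
  (forall y, (f (expR y) <= C)%R) -> (0 <= C)%R -> (0 <= t)%R ->
  sg a_p a_m J t (positive_part_at f) y \is a fin_num.
Proof.
move=> mf fC C0 t0; have hf := pos_meas_positive_part mf.
rewrite ge0_fin_numE; last exact: (pos_meas_sg a_p a_m J t hf).2.
apply: (@le_lt_trans _ _ C%:E); last exact: ltry.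
apply: sg_le_cst => // z; rewrite lee_fin ge_max C0; exact: fC.
Qed.

Section positive.
Hypothesis K_gt0 : (0 < K)%R.
Variables (x t : R).
Hypotheses (x_gt0 : (0 < x)%R) (t_ge0 : (0 <= t)%R).

Let integrand (f : R -> R) w : R :=
  (multiplicative_functional rho tau sigma phi (speed a_p a_m) x t w *
   (f (process rho tau sigma phi x t w) / process rho tau sigma phi x t w))%R.

Lemma integral_positive_part (f : R -> R) : measurable_fun setT (f \o expR) ->
  \int[P]_w (Num.max 0 (integrand f w))%:E =
  (x^-1 * expR ((L - K) * t))%:E * sg a_p a_m J t (positive_part_at f) (ln x).
Proof.
move=> mf; have hf := pos_meas_positive_part mf.
have ix : (0 <= x^-1)%R by rewrite invr_ge0 ltW.
have hps : pos_meas (path_sum a_p a_m tau sigma x t (positive_part_at f)).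
  by apply: pos_meas_series => n; exact: pos_meas_last_term_path.
rewrite EFinM -muleA -(integral_path_sum a_p a_m rho_meas rho_ge0 eps0_gt0 rho_moment jumps K_gt0 x t hf).
rewrite -ge0_integralZl//; last 2 first.
- exact: hps.1.
- by move=> w _; exact: hps.2.
apply: (@ae_eq_integral_nonmeas _ _ _ P (explosion tau t)).
- exact: measurable_explosion.
- exact: (explosion0 jumps K_gt0 t_ge0).
- by apply: pos_measM.
- by move=> w; rewrite lee_fin le_max lexx.
move=> w /(jump_index_exists t_ge0) [n nt].
rewrite (path_sumE a_p_gt0 a_p_lt_a_m phi_flow jumps x_gt0 hf nt).
have [z0 zE] := process_between a_p_gt0 a_p_lt_a_m phi_flow jumps x_gt0 K_gt0 nt.
have [_ _ _ q0] := post_jump_chain a_p_gt0 a_p_lt_a_m phi_flow jumps w x_gt0 n.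
rewrite /integrand (multiplicative_functionalE a_p_gt0 a_p_lt_a_m phi_flow jumps x_gt0 K_gt0 nt).
rewrite /positive_part_at -zE lnK ?posrE//.
set z := process _ _ _ _ _ _ _ in z0 zE *; set q := (chain _ _ _ _ _ _ _).2 in q0 *.
rewrite -!EFinM; congr EFin.
rewrite (_ : z * q / x * (f z / z) = x^-1 * (q * f z))%R; last by field; rewrite !gt_eqF.
rewrite /Order.max.
have -> : (0 < x^-1 * (q * f z))%R = (0 < f z)%R by rewrite !pmulr_rgt0 ?invr_gt0.
by case: ifP => //; rewrite !mulr0.
Qed.

Lemma gf_semigroup_pos (f : R -> R) C : measurable_fun setT (f \o expR) ->
  (forall y, (`|f (expR y)| <= C)%R) ->
  (expR (- (L - K) * t) * gf_semigroup rho tau sigma phi (speed a_p a_m) t f x =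
   fine (sg a_p a_m J t (positive_part_at f) (ln x)) -
   fine (sg a_p a_m J t (positive_part_at (fun z => - f z)) (ln x)))%R.
Proof.
move=> mf fC.
have C0 : (0 <= C)%R by exact: le_trans (normr_ge0 _) (fC 0%R).
have mNf : measurable_fun setT ((fun z => - f z)%R \o expR).
  by apply: measurableT_comp mf.
have f1 : sg a_p a_m J t (positive_part_at f) (ln x) \is a fin_num.
  by apply: (@sg_positive_part_fin _ _ _ C) => // y; exact: le_trans (ler_norm _) (fC y).
have f2 : sg a_p a_m J t (positive_part_at (fun z => - f z)%R) (ln x) \is a fin_num.
  apply: (@sg_positive_part_fin _ _ _ C) => // y.
  by apply: le_trans (fC y); rewrite -normrN ler_norm.
rewrite /gf_semigroup unlock integralE.
rewrite (_ : \int[P]_w _^\+ w = \int[P]_w (Num.max 0 (integrand f w))%:E); last first.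
  by apply: eq_integral => w _; rewrite funeposE /= maxC -EFin_max.
rewrite (_ : \int[P]_w _^\- w = \int[P]_w (Num.max 0 (integrand (fun z => - f z)%R w))%:E); last first.
  apply: eq_integral => w _; rewrite funenegE /= maxC -EFin_max /integrand.
  by rewrite mulNr mulrN.
rewrite !integral_positive_part// -(fineK f1) -(fineK f2) -!EFinM -EFinB /=.
set u := fine _; set v := fine _.
rewrite (_ : x * _ = expR ((L - K) * t) * (u - v))%R; last by field; rewrite gt_eqF.
by rewrite mulrA -expRD mulNr addNr expR0 mul1r.
Qed.

End positive.

Lemma jump_rate_ge0 : (0 <= K)%R.
Proof.
rewrite -lee_fin -(integral_size_kernel rho_meas rho_ge0 eps0_gt0 rho_moment).
apply: integral_ge0 => s _; rewrite lee_fin; case: (leP s 0)%R => s0.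
  by rewrite frag_density_supp// mulr0.
by rewrite mulr_ge0 ?frag_density_ge0// ltW.
Qed.

(** [K = 0] makes [s rho(s)], hence [rho], vanish almost everywhere. *)
Lemma rate_eq0 : K = 0%R -> L = 0%R.
Proof.
move=> K0; have := integral_size_kernel rho_meas rho_ge0 eps0_gt0 rho_moment.
rewrite K0 => I0.
have mk := measurable_frag_density rho_meas.
have h0 s : (0 <= s * frag_density rho s)%R.
  case: (leP s 0)%R => s0; first by rewrite frag_density_supp// mulr0.
  by rewrite mulr_ge0 ?frag_density_ge0// ltW.
have ms : measurable_fun setT (fun s : R => (s * frag_density rho s)%:E).
  by apply/measurable_EFinP; exact: measurable_funM.
have : ae_eq mu setT (fun s : R => (s * frag_density rho s)%:E) (cst 0).
  apply/(ae_eq_integral_abs mu measurableT ms).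
  by rewrite -[RHS]I0; apply: eq_integral => s _; rewrite gee0_abs// lee_fin.
move=> ae; apply: EFin_inj.
rewrite -(rate_log_kernel rho_meas rho_ge0 eps0_gt0 rho_moment).
rewrite (@ae_eq_integral _ _ _ mu setT (cst 0))//.
- by rewrite integral0.
- exact/measurable_EFinP.
apply: filterS ae => s /= /(_ I) [] h _.
case: (leP s 0)%R => s0; first by rewrite frag_density_supp.
by move/eqP: h; rewrite mulf_eq0 gt_eqF//= => /eqP ->.
Qed.

Lemma sg_rate0 t F y : L = 0%R -> pos_meas F -> (0 <= t)%R ->
  sg a_p a_m J t F y = F (Phi t y).
Proof.
move=> L0 hF t0; rewrite sgE// L0 mul0r oppr0 expR0 mul1e.
rewrite integral0_eq ?adde0// => r _.
have J0 : J setT = 0 by rewrite rateE L0.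
have h : pos_meas (fun xi : R => sg a_p a_m J (t - r) F (Phi r y + xi)%R).
  apply: (pos_meas_comp (g := fun xi : R => (Phi r y + xi)%R)) (pos_meas_sg a_p a_m J (t - r) hF).
  exact: measurable_funD.
rewrite (ge0_negligible_integral (N := setT) measurableT measurableT h.1 (fun z _ => h.2 z) J0).
by rewrite setDv integral_set0 mule0.
Qed.

(** As [sg] acts on nonnegative functions, [f] is split into its two parts. When [K = 0] the laws of
    the jump variables are unspecified; both sides then reduce to the flow. *)
Theorem gf_semigroupE (f : R -> R) C x t : (0 < x)%R -> (0 <= t)%R ->
  measurable_fun setT (f \o expR) -> (forall y, (`|f (expR y)| <= C)%R) ->
  (expR (- (\int[mu]_(s in `[0, 1]) ((1 - s) * rho s)) * t) *
     gf_semigroup rho tau sigma phi (speed a_p a_m) t f x =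
   fine (sg a_p a_m J t (positive_part_at f) (ln x)) -
   fine (sg a_p a_m J t (positive_part_at (fun z => - f z)) (ln x)))%R.
Proof.
move=> x0 t0 mf fC; rewrite (growth_rateE rho_meas rho_ge0 eps0_gt0 rho_moment).
have := jump_rate_ge0; rewrite le_eqVlt => /orP[/eqP K0|K0]; last exact: gf_semigroup_pos fC.
have L0 := rate_eq0 (esym K0).
have mNf : measurable_fun setT ((fun z => - f z)%R \o expR).
  by apply: measurableT_comp mf.
rewrite !sg_rate0//; try exact: pos_meas_positive_part.
have jc s w : jump_count rho tau s w = 0%N by rewrite /jump_count -K0 ltxx.
have pr s w : process rho tau sigma phi x s w = phi x s.
  by rewrite /process jc /= jump_time0 subr0.
have fl s : (0 <= s)%R -> (0 < phi x s)%R /\ ln (phi x s) = Phi s (ln x).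
  by move=> s0; exact: flowE.
have [p0 pE] := fl t t0.
rewrite L0 -K0 subr0 oppr0 mul0r expR0 mul1r /positive_part_at -pE lnK ?posrE//=.
have mfE w : multiplicative_functional rho tau sigma phi (speed a_p a_m) x t w = (phi x t / x)%R.
  rewrite /multiplicative_functional /Rintegral.
  rewrite (_ : \int[mu]_(s in `[0%R, t]) _ = (Phi t (ln x) - ln x)%:E).
    by rewrite /= -pE expRD expRN !lnK ?posrE.
  rewrite -(integral_log_speed a_p_gt0 a_p_lt_a_m)//; apply: eq_integral => s.
  rewrite inE/= in_itv/= => /andP[s0 _]; rewrite pr; have [q0 <-] := fl s s0.
  by rewrite speed_ratio.
rewrite /gf_semigroup unlock.
rewrite (eq_integral (cst (f (phi x t) / x)%:E)); last first.
  move=> w _; rewrite /= pr mfE; congr EFin; field.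
  by rewrite !gt_eqF.
have -> := integral_cst P measurableT (f (phi x t) / x)%:E.
rewrite [X in (_ * X)%E](_ : _ = 1); last exact: probability_setT.
rewrite mule1 /= mulrC divfK ?gt_eqF//.
by case: (leP 0 (f (phi x t)))%R => h; rewrite ?(max_r h) ?(max_l h); case: leP => h'; lra.
Qed.

End link.

(** * Exponential moments of the jump measure *)

Section exponential_moments.
Context {R : realType}.
Variables (J : {finite_measure set R -> \bar R}) (eps0 m : R).
Hypothesis J_neg : J `[0%R, +oo[%classic = 0.
Hypothesis eps0_gt0 : (0 < eps0)%R.
Hypothesis J_moment : \int[J]_xi (expR (- eps0 * xi))%:E < +oo.
Hypothesis J_mean : \int[J]_xi (Num.max 0 (- xi)%R)%:E = m%:E.
Notation L := (rate J).

Lemma pos_meas_exp (q : R) : pos_meas (fun xi : R => (expR (q * xi))%:E).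
Proof.
apply: pos_meas_EFin => [|xi]; last exact: expR_ge0.
by apply: measurableT_comp => //; exact: measurable_funM.
Qed.

Lemma pos_meas_loss : pos_meas (fun xi : R => (Num.max 0 (- xi)%R)%:E).
Proof.
apply: pos_meas_EFin => [|xi]; last by rewrite le_max lexx.
exact: measurable_maxr.
Qed.

Lemma le_integral_neg (f g : R -> \bar R) : pos_meas f -> pos_meas g ->
  (forall xi, (xi < 0)%R -> f xi <= g xi) -> \int[J]_xi f xi <= \int[J]_xi g xi.
Proof.
move=> [mf f0] [mg g0] fg.
rewrite (ge0_negligible_integral _ _ mf _ J_neg)//.
rewrite [leRHS](ge0_negligible_integral _ _ mg _ J_neg)//.
have mD : measurable ([set: R] `\` `[0%R, +oo[) by exact: measurableD.
apply: ge0_le_integral => //; [exact: measurable_funTS..|].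
by move=> xi [_] /=; rewrite in_itv/= andbT => /negP; rewrite -ltNge; exact: fg.
Qed.

Definition mgf (q : R) : R := fine (\int[J]_xi (expR (q * xi))%:E).

Lemma mgf_fin (q : R) : (- eps0 <= q)%R -> \int[J]_xi (expR (q * xi))%:E = (mgf q)%:E.
Proof.
move=> q0; rewrite /mgf fineK// ge0_fin_numE; last exact: integral_ge0.
apply: le_lt_trans J_moment; apply: le_integral_neg; [exact: pos_meas_exp..|].
by move=> xi xi0; rewrite lee_fin ler_expR ler_wnM2r// ltW.
Qed.

Lemma mgf_ge0 q : (0 <= mgf q)%R.
Proof. by apply: fine_ge0; exact: integral_ge0. Qed.

(** Both signs follow from [expR v * (1 - v) <= 1], which is [1 + u <= expR u] at [u = - v]. *)
Lemma expR_taylor2 (v : R) : (expR v <= 1 + v + v ^+ 2 * expR `|v|)%R.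
Proof.
have h1 := expR_ge1Dx (- v).
have e0 : (0 < expR v)%R := expR_gt0 v.
have h2 : (expR v * (1 - v) <= 1)%R.
  have := ler_wpM2l (ltW e0) h1; by rewrite -expRD subrr expR0.
case: (leP 0 v)%R => v0; first by rewrite ger0_norm//; nra.
have h3 := expR_ge1Dx v; rewrite ltr0_norm//.
have h4 : (1 <= expR (- v))%R by rewrite -[leLHS]expR0 ler_expR; lra.
have h5 := ler_wpM2l (sqr_ge0 v) h4.
have h6 : (expR v - 1 <= v + v ^+ 2)%R.
  have v1 : (0 < 1 - v)%R by lra.
  have v3 : (0 <= - v * v ^+ 2)%R by rewrite mulr_ge0 ?sqr_ge0//; lra.
  rewrite -subr_ge0 -(pmulr_lge0 _ v1); nra.
lra.
Qed.

(** The inequality [x <= (4 / eps0) exp(eps0 x / 4)], squared. *)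
Lemma sqr_le_expR (x : R) : (0 <= x)%R -> (x ^+ 2 <= 16 / eps0 ^+ 2 * expR (eps0 / 2 * x))%R.
Proof.
move=> x0; have h := expR_ge1Dx (eps0 / 4 * x).
have e0 := eps0_gt0.
have -> : (eps0 / 2 * x = eps0 / 4 * x + eps0 / 4 * x)%R by field.
rewrite expRD -expr2.
have h2 : ((eps0 / 4 * x) ^+ 2 <= expR (eps0 / 4 * x) ^+ 2)%R.
  rewrite ler_sqr ?nnegrE ?expR_ge0//; first lra.
  by rewrite mulr_ge0// divr_ge0// ltW.
have -> : (x ^+ 2 = 16 / eps0 ^+ 2 * (eps0 / 4 * x) ^+ 2)%R by field; rewrite gt_eqF.
by rewrite ler_wpM2l// divr_ge0// sqr_ge0.
Qed.

(** Second order expansion at 0, with value [L] and slope [- m]. One half of the exponential moment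
    absorbs [exp(|q xi|)], the other half absorbs [xi^2]. *)
Lemma mgf_taylor : exists2 C : R, (0 <= C)%R &
  forall q, (`|q| <= eps0 / 2)%R -> (mgf q <= L - q * m + C * q ^+ 2)%R.
Proof.
have e0 := eps0_gt0; have M0 := mgf_ge0 (- eps0).
exists (16 / eps0 ^+ 2 * mgf (- eps0))%R.
  by rewrite mulr_ge0// divr_ge0// sqr_ge0.
move=> q q0.
have qe : (- eps0 <= q)%R by have := lerNnormlW q0; lra.
have M := mgf_fin (lexx (- eps0)%R); have Mq := mgf_fin qe.
set D : R := (16 / eps0 ^+ 2)%R.
have D0 : (0 <= D)%R by rewrite divr_ge0// sqr_ge0.
have pt xi : (xi < 0)%R -> (expR (q * xi) <= 1 + q * xi + D * q ^+ 2 * expR (- eps0 * xi))%R.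
  move=> xi0; apply: le_trans (expR_taylor2 _) _; rewrite lerD2l.
  rewrite normrM (ltr0_norm xi0).
  have h1 : (expR (`|q| * - xi) <= expR (eps0 / 2 * - xi))%R.
    by rewrite ler_expR ler_wpM2r//; lra.
  have h2 := @sqr_le_expR (- xi); rewrite sqrrN in h2.
  have -> : (- eps0 * xi = eps0 / 2 * - xi + eps0 / 2 * - xi)%R by field.
  rewrite expRD exprMn.
  apply: (@le_trans _ _ (q ^+ 2 * xi ^+ 2 * expR (eps0 / 2 * - xi)))%R.
    by rewrite ler_wpM2l// mulr_ge0// sqr_ge0.
  rewrite mulrA ler_wpM2r ?expR_ge0//.
  have h3 : (xi ^+ 2 <= D * expR (eps0 / 2 * - xi))%R by apply: h2; lra.
  by have := ler_wpM2l (sqr_ge0 q) h3; lra.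
have pe := pos_meas_exp q; have pe0 := pos_meas_exp (- eps0)%R; have pl := pos_meas_loss.
have Dq0 : (0 <= D * q ^+ 2)%R by rewrite mulr_ge0// sqr_ge0.
have i1 : \int[J]_xi (cst 1 xi) = L%:E.
  by have -> := integral_cst J measurableT 1; rewrite mul1e; exact: rateE.
have pce : pos_meas (fun xi : R => (D * q ^+ 2)%:E * (expR (- eps0 * xi))%:E).
  by apply: pos_measM => //; split.
have pc1 : pos_meas (cst 1 : R -> \bar R) by split.
have ice : \int[J]_xi ((D * q ^+ 2)%:E * (expR (- eps0 * xi))%:E) = (D * q ^+ 2 * mgf (- eps0))%:E.
  by rewrite (ge0_integralZl J measurableT pe0.1 (fun z _ => pe0.2 z)) ?lee_fin// M.
(* The linear term is put on the side where it is nonnegative, which depends on the sign of [q]. *)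
case: (leP 0 q)%R => qs.
  have pql : pos_meas (fun xi : R => q%:E * (Num.max 0 (- xi)%R)%:E).
    by apply: pos_measM => //; split.
  have : \int[J]_xi ((expR (q * xi))%:E + q%:E * (Num.max 0 (- xi)%R)%:E) <=
      \int[J]_xi (cst 1 xi + (D * q ^+ 2)%:E * (expR (- eps0 * xi))%:E).
    apply: le_integral_neg; [exact: pos_measD..|].
    move=> xi xi0; rewrite -!EFinM -!EFinD lee_fin max_r; last lra.
    by have := pt xi xi0; lra.
  rewrite (ge0_integralD J measurableT (fun z _ => pe.2 z) pe.1 (fun z _ => pql.2 z) pql.1).
  rewrite (ge0_integralD J measurableT (fun z _ => pc1.2 z) pc1.1 (fun z _ => pce.2 z) pce.1).
  rewrite i1 ice Mq (ge0_integralZl J measurableT pl.1 (fun z _ => pl.2 z)) ?lee_fin//.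
  by rewrite J_mean -!EFinM -!EFinD lee_fin; lra.
have pql : pos_meas (fun xi : R => (- q)%:E * (Num.max 0 (- xi)%R)%:E).
  by apply: pos_measM => //; split => // z; rewrite lee_fin; lra.
have pce2 : pos_meas (fun xi : R => cst 1 xi + (D * q ^+ 2)%:E * (expR (- eps0 * xi))%:E).
  exact: pos_measD.
have : \int[J]_xi ((expR (q * xi))%:E) <=
    \int[J]_xi (cst 1 xi + (D * q ^+ 2)%:E * (expR (- eps0 * xi))%:E + (- q)%:E * (Num.max 0 (- xi)%R)%:E).
  apply: le_integral_neg => //; first exact: pos_measD.
  move=> xi xi0; rewrite -!EFinM -!EFinD lee_fin max_r; last lra.
  by have := pt xi xi0; lra.
rewrite (ge0_integralD J measurableT (fun z _ => pce2.2 z) pce2.1 (fun z _ => pql.2 z) pql.1).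
rewrite (ge0_integralD J measurableT (fun z _ => pc1.2 z) pc1.1 (fun z _ => pce.2 z) pce.1).
rewrite i1 ice Mq (ge0_integralZl J measurableT pl.1 (fun z _ => pl.2 z)) ?lee_fin; last lra.
by rewrite J_mean -!EFinM -!EFinD lee_fin; lra.
Qed.

End exponential_moments.

(** * Exponential supersolutions with a gain *)

Section exponential_supersolution.
Context {R : realType}.
Variables (a_p a_m : R) (J : {finite_measure set R -> \bar R}).
Hypotheses (a_p_gt0 : (0 < a_p)%R) (a_p_lt_a_m : (a_p < a_m)%R).
Notation mu := (@lebesgue_measure R).
Notation L := (rate J).
Notation Phi := (log_flow a_p a_m).
Notation jump_op := (jump_op J).
Notation flow_op := (flow_op a_p a_m J).
Notation step_op := (step_op a_p a_m J).
Notation nojump := (nojump a_p a_m J).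
Notation sg := (sg a_p a_m J).

(* [a] is the speed on the half line under consideration, where the gain is [e * (1 - expR (c * z))] *)
Let profile (A q b k e c u z : R) : R :=
  (expR (- (b * u)) * (A * expR (q * z) - u * (e * (1 - expR (c * z)))) + k * u)%R.

(** [profile] with remaining time [s + T - r] along the trajectory [y + a r], discounted by
    survival; [dHr] is its derivative in [r]. *)
Let Hr (A q b k e c a s y T r : R) : R :=
  (expR (- (L * r)) * (expR (- (b * (s + T - r))) * (A * expR (q * (y + a * r)) - (s + T - r) * (e * (1 - expR (c * (y + a * r))))) + k * (s + T - r)))%R.

Let dHr (A q b k e c a s y T r : R) : R :=
  (- L * Hr A q b k e c a s y T r +
   expR (- (L * r)) * (expR (- (b * (s + T - r))) * (b * (A * expR (q * (y + a * r)) - (s + T - r) * (e * (1 - expR (c * (y + a * r))))) + A * q * a * expR (q * (y + a * r)) + e * (1 - expR (c * (y + a * r))) + (s + T - r) * (e * c * a * expR (c * (y + a * r)))) - k))%R.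

Let derive_Hr A q b k e c a s y T r :
  is_derive r (1%R : R) (Hr A q b k e c a s y T) (dHr A q b k e c a s y T r).
Proof.
rewrite /Hr /dHr /Hr; apply: is_derive_eq; rewrite /GRing.scale/=.
ring.
Qed.

Let continuous_dHr A q b k e c a s y T : continuous (dHr A q b k e c a s y T).
Proof.
move=> r; apply: differentiable_continuous; apply/derivable1_diffP.
rewrite /dHr /Hr; exact: ex_derive.
Qed.

Let drift (A q M b k e c a s y T : R) (w : R -> \bar R) : (0 <= T)%R ->
  measurable_fun setT w ->
  (forall r, (0 <= r <= T)%R -> 0 <= w r <=
     (expR (- (b * (s + T - r))) * (A * M * expR (q * (y + a * r))) + L * (k * (s + T - r)))%:E) ->
  (forall r, (0 <= r <= T)%R ->
     A * (a * q + M - L + b) * expR (q * (y + a * r)) +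
     ((s + T - r) * (L - b) + 1) * (e * (1 - expR (c * (y + a * r)))) + (s + T - r) * (e * c * a * expR (c * (y + a * r))) <=
     k * expR (b * (s + T - r)))%R ->
  \int[mu]_(r in `[0%R, T]) ((expR (- (L * r)))%:E * w r)
    + (expR (- (L * T)) * profile A q b k e c s (y + a * T))%:E
  <= (profile A q b k e c (s + T) y)%:E.
Proof.
move=> T0 mw wb hk.
have := @integral_le_derive _ _ _ (fun r => (expR (- (L * r)))%:E * w r) T T0
  (derive_Hr A q b k e c a s y T) (@continuous_dHr A q b k e c a s y T).
have -> : Hr A q b k e c a s y T T = (expR (- (L * T)) * profile A q b k e c s (y + a * T))%R.
  by rewrite /Hr /profile addrK.
have -> : Hr A q b k e c a s y T 0 = profile A q b k e c (s + T) y.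
  by rewrite /Hr /profile mulr0 oppr0 expR0 mul1r mulr0 !addr0.
apply.
  apply: measurable_funTS; apply: emeasurable_funM => //.
  apply/measurable_EFinP; exact: measurable_expRate.
move=> r hr; have /andP[w0 wle] := wb r hr.
rewrite mule_ge0 ?lee_fin ?expR_ge0//=.
apply: (@le_trans _ _ ((expR (- (L * r)))%:E * (expR (- (b * (s + T - r))) * (A * M * expR (q * (y + a * r))) + L * (k * (s + T - r)))%:E)).
  by apply: lee_wpmul2l => //; rewrite lee_fin expR_ge0.
rewrite -EFinM lee_fin /dHr /Hr.
have := hk r hr; move: (s + T - r)%R (y + a * r)%R => u z h.
have E : (expR (- (b * u)) * expR (b * u) = 1)%R by rewrite -expRD addNr expR0.
have := ler_wpM2l (expR_ge0 (- (b * u))) h.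
rewrite [X in (_ <= X)%R]mulrCA E mulr1 => h2.
have := ler_wpM2l (expR_ge0 (- (L * r))) h2.
move: (expR (- (L * r))) (expR (- (b * u))) (expR (q * z)) (expR (c * z)) => x1 x2 x3 x4; lra.
Qed.

(** The last two hypotheses say that the time derivative of the bound dominates the generator
    applied to it, on each half line with its own speed. The gain [chi] accumulates linearly in
    time, and [k] is the loss tolerated per unit of time. *)
Lemma exp_supersolution (A q M b k c ep em t1 : R) (chi : R -> R) : (0 <= A)%R -> (0 <= k)%R ->
  \int[J]_xi (expR (q * xi))%:E = M%:E ->
  measurable_fun setT chi -> (forall y, (0 <= chi y)%R) ->
  (forall y, (0 <= y)%R -> chi y = (ep * (1 - expR (c * y)))%R) ->
  (forall y, (y <= 0)%R -> chi y = (em * (1 - expR (c * y)))%R) ->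
  (forall y, t1 * chi y <= A * expR (q * y))%R ->
  (forall u y, 0 <= u <= t1 -> 0 <= y ->
     A * (a_p * q + M - L + b) * expR (q * y) +
     (u * (L - b) + 1) * (ep * (1 - expR (c * y))) + u * (ep * c * a_p * expR (c * y)) <= k * expR (b * u))%R ->
  (forall u y, 0 <= u <= t1 -> y <= 0 ->
     A * (a_m * q + M - L + b) * expR (q * y) +
     (u * (L - b) + 1) * (em * (1 - expR (c * y))) + u * (em * c * a_m * expR (c * y)) <= k * expR (b * u))%R ->
  forall t y, (0 <= t <= t1)%R ->
    sg t (fun z => (A * expR (q * z))%:E) y <=
    (expR (- (b * t)) * (A * expR (q * y) - t * chi y) + k * t)%:E.
Proof.
move=> A0 k0 qM mchi chi0 chip chim chi_le up dn t y ht.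
have hf : pos_meas (fun z : R => (A * expR (q * z))%:E).
  apply: pos_meas_EFin => [|z]; last by rewrite mulr_ge0 ?expR_ge0.
  by apply: measurable_funM => //; apply: measurableT_comp => //; exact: measurable_funM.
pose V (x : R * R) := (expR (- (b * x.1)) * (A * expR (q * x.2) - x.1 * chi x.2) + k * x.1)%R.
have V0 (x : R * R) : (0 <= x.1 <= t1)%R -> (0 <= V x)%R.
  move=> /andP[x0 x1]; rewrite /V addr_ge0 ?mulr_ge0 ?expR_ge0//.
  by rewrite subr_ge0; apply: le_trans (chi_le _); exact: ler_wpM2r.
have V_le (x : R * R) : (0 <= x.1)%R -> (V x <= expR (- (b * x.1)) * (A * expR (q * x.2)) + k * x.1)%R.
  move=> x0; rewrite /V lerD2r ler_wpM2l ?expR_ge0// lerBlDr lerDl mulr_ge0//.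
(* Beyond [t1] the gain could make [V] negative. The value [+oo] settles the inequality there, and
   it is never met from a time at most [t1], since remaining times decrease. *)
pose W (x : R * R) := if (0 <= x.1)%R then (if (x.1 <= t1)%R then (V x)%:E else +oo) else 0.
have hW : pos_meas W.
  split; last first.
    move=> x; rewrite /W; case: ifPn => // x0; case: ifPn => // x1.
    by rewrite lee_fin V0// x0.
  have mf1 : measurable_fun setT (fun x : R * R => x.1) by exact: measurable_fst.
  have mf2 : measurable_fun setT (fun x : R * R => x.2) by exact: measurable_snd.
  apply: measurable_fun_ifT => //.
    exact: (measurable_fun_ler (measurable_cst _) mf1).
  apply: measurable_fun_ifT => //; first exact: (measurable_fun_ler mf1 (measurable_cst _)).
  apply/measurable_EFinP; apply: measurable_funD; last exact: measurable_funM.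
  apply: measurable_funM.
    by apply: measurableT_comp => //; apply: measurableT_comp => //; exact: measurable_funM.
  apply: measurable_funB.
    by apply: measurable_funM => //; apply: measurableT_comp => //; exact: measurable_funM.
  apply: measurable_funM => //; exact: measurableT_comp.
have Wneg (s z : R) : (s < 0)%R -> W (s, z) = 0 by move=> s0; rewrite /W/= leNgt s0.
have hn := pos_meas_nojump a_p a_m J hf.
have hj := pos_meas_jump_op J hW.
have -> : (expR (- (b * t)) * (A * expR (q * y) - t * chi y) + k * t)%:E = W (t, y).
  by case/andP: ht => t0' t1'; rewrite /W/= t0' t1'.
apply: potential_min => // -[s z]; rewrite /W/=.
case: (leP 0 s)%R => [s0|s0]; last first.
  by rewrite /Submission.nojump/= /survival (lt_geF s0) mul0e add0e (@step_op_neg _ _ _ _ _ hW Wneg).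
case: (leP s t1)%R => s1; last by rewrite leey.
(* The gain is dropped inside the jump integral; the exponential that is left integrates to [M]. *)
have hje (u v : R) : (0 <= u <= t1)%R -> jump_op W (u, v) <=
    (expR (- (b * u)) * (A * M * expR (q * v)) + L * (k * u))%:E.
  move=> /andP[u0 u1].
  have p1 : pos_meas (fun xi : R => (expR (- (b * u)) * A * expR (q * v))%:E * (expR (q * xi))%:E).
    apply: pos_measM; last exact: pos_meas_exp.
    by split => // ?; rewrite lee_fin !mulr_ge0 ?expR_ge0.
  have p2 : pos_meas (fun xi : R => (k * u)%:E).
    by split => // ?; rewrite lee_fin mulr_ge0.
  apply: (@le_trans _ _ (\int[J]_xi ((expR (- (b * u)) * A * expR (q * v))%:E * (expR (q * xi))%:E + (k * u)%:E))).
    apply: ge0_le_integral => //.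
    - by move=> xi _; exact: hW.2.
    - by apply: measurableT_comp hW.1 _ => /=; apply/measurable_fun_pair => //=; exact: measurable_funD.
    - exact: (pos_measD p1 p2).1.
    - move=> xi _; rewrite /W/= u0 u1 -EFinM -EFinD lee_fin.
      by apply: le_trans (V_le _ _) _ => //=; rewrite mulrDr expRD; lra.
  rewrite (ge0_integralD J measurableT (fun z _ => p1.2 z) p1.1 (fun z _ => p2.2 z) p2.1).
  rewrite (ge0_integralZl J measurableT (pos_meas_exp q).1 (fun z _ => (pos_meas_exp q).2 z)); last first.
    by rewrite lee_fin !mulr_ge0 ?expR_ge0.
  have -> : \int[J]_xi (k * u)%:E = (k * u * L)%:E.
    by have -> := integral_cst J measurableT (k * u)%:E; rewrite [RHS]EFinM -(rateE J).
  by rewrite qM -!EFinM -EFinD lee_fin; lra.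
rewrite addeC /Submission.step_op flow_op_trunc//; last exact: jump_op_neg.
rewrite /Submission.nojump/= /survival s0 -EFinM.
have := @along_flow _ _ _ J a_p_gt0 a_p_lt_a_m 0 t1 (jump_op W) (fun u v => V (u, v)) hj.
move=> /(_ _ _ z s s0); rewrite !add0r => main.
have VE0 (v : R) : V (0%R, v) = (A * expR (q * v))%R.
  by rewrite /V/= mulr0 oppr0 expR0 mul1r mul0r subr0 mulr0 addr0.
rewrite VE0 in main; apply: main => //.
- move=> s' y' T' s'0 y'0 T'0 sT.
  have yT : (0 <= y' + a_p * T')%R by rewrite addr_ge0// mulr_ge0// ltW.
  have := @drift A q M b k ep c a_p s' y' T' (fun r : R => jump_op W (s' + T' - r, y' + a_p * r)%R) T'0.
  rewrite /profile /V/= !chip//; apply.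
  + apply: measurableT_comp hj.1 _; apply/measurable_fun_pair => /=.
      by apply: measurable_funB.
    by apply: measurable_funD => //; exact: measurable_funM.
  + move=> r /andP[r0 rT]; rewrite hj.2/=; apply: hje; apply/andP; split; lra.
  + move=> r /andP[r0 rT]; apply: up; first by apply/andP; split; lra.
    by rewrite addr_ge0// mulr_ge0// ltW.
- move=> s' y' T' s'0 y'0 T'0 yT sT.
  have := @drift A q M b k em c a_m s' y' T' (fun r : R => jump_op W (s' + T' - r, y' + a_m * r)%R) T'0.
  rewrite /profile /V/= !chim//; apply.
  + apply: measurableT_comp hj.1 _; apply/measurable_fun_pair => /=.
      by apply: measurable_funB.
    by apply: measurable_funD => //; exact: measurable_funM.
  + move=> r /andP[r0 rT]; rewrite hj.2/=; apply: hje; apply/andP; split; lra.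
  + move=> r /andP[r0 rT]; apply: dn; first by apply/andP; split; lra.
    have am0 := lt_trans a_p_gt0 a_p_lt_a_m.
    by have := ler_wpM2l (ltW am0) rT; lra.
Qed.

End exponential_supersolution.

(** * Lower bounds from paths with prescribed jumps *)

Section reachability.
Context {R : realType}.
Variables (a_p a_m : R) (J : {finite_measure set R -> \bar R}).
Hypotheses (a_p_gt0 : (0 < a_p)%R) (a_p_lt_a_m : (a_p < a_m)%R).
Notation mu := (@lebesgue_measure R).
Notation L := (rate J).
Notation Phi := (log_flow a_p a_m).
Notation sg := (sg a_p a_m J).

Let pos_meas_exp_sg t f y : pos_meas f ->
  pos_meas (fun r : R => (expR (- (L * r)))%:E * \int[J]_xi sg (t - r) f (Phi r y + xi)).
Proof.
move=> hf; apply: pos_measM.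
  by apply: pos_meas_EFin => [|r]; [exact: measurable_expRate|exact: expR_ge0].
have h : pos_meas (fun x : R * R => sg x.1 f x.2).
  have := pos_meas_potential a_p a_m J (pos_meas_nojump a_p a_m J hf).
  by rewrite [X in pos_meas X -> _](_ : _ = (fun x : R * R => sg x.1 f x.2))//;
    apply: funext => -[].
have := pos_meas_comp (measurable_flow_shift a_p a_m (t, y)) (pos_meas_jump_op J h).
by [].
Qed.

Lemma sg_flow_le (t : R) f y : pos_meas f -> (0 <= t)%R ->
  (expR (- (L * t)))%:E * f (Phi t y) <= sg t f y.
Proof.
move=> hf t0; rewrite sgE// leeDl// integral_ge0// => r _.
exact: (pos_meas_exp_sg t y hf).2.
Qed.

(** Only the paths with exactly one jump before [t] are kept. *)
Lemma sg_one_jump (t : R) f y : pos_meas f -> (0 <= t)%R ->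
  (expR (- (L * t)))%:E * \int[mu]_(r in `[0%R, t]) \int[J]_xi f (Phi (t - r) (Phi r y + xi))
  <= sg t f y.
Proof.
move=> hf t0; rewrite sgE//.
apply: (@le_trans _ _ (\int[mu]_(r in `[0%R, t])
      ((expR (- (L * r)))%:E * \int[J]_xi sg (t - r) f (Phi r y + xi)))); last first.
  by rewrite leeDr// mule_ge0// ?lee_fin ?expR_ge0//; exact: hf.2.
have m1 : measurable_fun setT (fun x : R * R => Phi (t - x.1) (Phi x.1 y + x.2)).
  have m2 : measurable_fun setT (fun x : R * R => (t - x.1, Phi x.1 y + x.2)%R).
    apply/measurable_fun_pair => /=; first exact: measurable_funB.
    apply: measurable_funD => //.
    exact: (measurableT_comp (measurable_log_flow1 a_p a_m y) measurable_fst).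
  exact: (measurableT_comp (measurable_log_flow a_p a_m) m2).
have h1 : pos_meas (fun r : R => \int[J]_xi f (Phi (t - r) (Phi r y + xi))).
  exact: (@pos_meas_int1 _ _ _ R R J _ (pos_meas_comp m1 hf)).
have c0 : 0 <= (expR (- (L * t)))%:E by rewrite lee_fin expR_ge0.
have mi : measurable (`[0%R, t] : set (measurableTypeR R)) by exact: measurable_itv.
have h1m : measurable_fun (`[0%R, t] : set (measurableTypeR R))
    (fun r : R => \int[J]_xi f (Phi (t - r) (Phi r y + xi))).
  by apply: measurable_funTS; exact: h1.1.
rewrite -(ge0_integralZl mu mi h1m (fun r _ => h1.2 r) c0).
apply: ge0_le_integral => //.
- by move=> r _; rewrite mule_ge0// ?lee_fin ?expR_ge0//; exact: h1.2.
- by apply: emeasurable_funM => //; exact: measurable_cst.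
- by apply: measurable_funTS; exact: (pos_meas_exp_sg t y hf).1.
move=> r; rewrite /= in_itv/= => /andP[r0 rt].
have -> : expR (- (L * t)) = (expR (- (L * r)) * expR (- (L * (t - r))))%R.
  by rewrite -expRD; congr expR; ring.
rewrite EFinM -muleA lee_wpmul2l ?lee_fin ?expR_ge0//.
have h2 : pos_meas (fun xi : R => f (Phi (t - r) (Phi r y + xi))).
  apply: pos_meas_comp hf; have := measurableT_comp m1 (pair1_measurable r).
  by [].
rewrite -(ge0_integralZl J measurableT h2.1 (fun x _ => h2.2 x)) ?lee_fin ?expR_ge0//.
have h3 : pos_meas (fun xi : R => sg (t - r) f (Phi r y + xi)).
  by apply: pos_meas_comp (pos_meas_sg a_p a_m J _ hf); exact: measurable_funD.
apply: ge0_le_integral => //.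
- by move=> xi _; rewrite mule_ge0 ?lee_fin ?expR_ge0//; exact: h2.2.
- by apply: emeasurable_funM => //; exact: h2.1.
- exact: h3.1.
- by move=> xi _; apply: sg_flow_le => //; rewrite subr_ge0.
Qed.

(** The part of [f] whose integer part is [n]. An unbounded finite function becomes a countable sum
    of bounded ones, to which the results for bounded functions apply. *)
Definition layer (f : R -> R) (n : nat) (z : R) : \bar R :=
  if (n%:R <= f z < n.+1%:R)%R then (f z)%:E else 0.

Lemma pos_meas_layer (f : R -> R) n : measurable_fun setT f -> (forall z, (0 <= f z)%R) ->
  pos_meas (layer f n).
Proof.
move=> mf f0; split; last by move=> z; rewrite /layer; case: ifP => // _; rewrite lee_fin.
apply: measurable_fun_ifT => //; last exact/measurable_EFinP.
apply: measurable_and; first exact: measurable_fun_ler.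
exact: measurable_fun_ltr.
Qed.

Lemma layer_le (f : R -> R) n z : layer f n z <= (n.+1%:R)%:E.
Proof. by rewrite /layer; case: ifPn => [/andP[_ h]|_]; rewrite lee_fin// ltW. Qed.

Lemma layer_sum (f : R -> R) z : (forall z, (0 <= f z)%R) ->
  (f z)%:E = \sum_(0 <= n <oo) layer f n z.
Proof.
move=> f0; have l0 n : 0 <= layer f n z.
  by rewrite /layer; case: ifP => // _; rewrite lee_fin.
have /andP[k1 k2] := truncn_itv (f0 z).
rewrite (@nneseriesD1 _ _ (Num.truncn (f z)))//.
rewrite eseries0 ?adde0; first by rewrite /layer k1 k2.
move=> n _ nk; rewrite /layer; case: ifPn => // /andP[n1 n2].
have := truncn_eq n (f0 z); rewrite n1 n2 => /eqP e.
by rewrite e eqxx in nk.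
Qed.

Lemma sg_semigroup_real (t u : R) (f : R -> R) y : measurable_fun setT f ->
  (forall z, (0 <= f z)%R) -> (0 <= t)%R -> (0 <= u)%R ->
  sg (t + u) (EFin \o f) y = sg t (sg u (EFin \o f)) y.
Proof.
move=> mf f0 t0 u0; have hg n := pos_meas_layer n mf f0.
have sgg v : sg v (EFin \o f) = (fun z => \sum_(0 <= n <oo) sg v (layer f n) z).
  apply: funext => z; rewrite -sg_series//; apply: sg_eq => w; exact: layer_sum.
rewrite sgg (sgg u) sg_series; last by move=> n; exact: pos_meas_sg.
apply: eq_eseriesr => n _.
by apply: (sg_semigroup J a_p_gt0 a_p_lt_a_m y (hg n) _ (layer_le f n)).
Qed.

Lemma log_flow_le_speed t y : (0 <= t)%R -> (Phi t y <= y + a_m * t)%R.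
Proof.
have am0 := lt_trans a_p_gt0 a_p_lt_a_m; have ap0 := a_p_gt0; have lt_a := a_p_lt_a_m.
move=> t0; case: (leP 0 y)%R => y0.
  by rewrite log_flow_ge0// lerD2l ler_wpM2r// ltW.
case: (leP (y + a_m * t) 0)%R => yt; first by rewrite log_flow_le0// ltW.
rewrite log_flow_cross ?(ltW y0) ?(ltW yt)//.
have -> : (a_p * (t + y / a_m) = a_p / a_m * (y + a_m * t))%R by field; rewrite gt_eqF.
by rewrite ger_pMl// ler_pdivrMr// mul1r ltW.
Qed.

Lemma log_flow_ge_start t y : (0 <= t)%R -> (y <= Phi t y)%R.
Proof.
have am0 := lt_trans a_p_gt0 a_p_lt_a_m; have ap0 := a_p_gt0.
move=> t0; case: (leP 0 y)%R => y0.
  by rewrite log_flow_ge0// lerDl mulr_ge0// ltW.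
case: (leP (y + a_m * t) 0)%R => yt.
  by rewrite log_flow_le0// ?(ltW y0)// lerDl mulr_ge0// ltW.
rewrite log_flow_cross ?(ltW y0) ?(ltW yt)//; apply: (le_trans (ltW y0)).
have -> : (a_p * (t + y / a_m) = a_p / a_m * (y + a_m * t))%R by field; rewrite gt_eqF.
by rewrite mulr_ge0 ?(ltW yt)// divr_ge0// ltW.
Qed.

Definition window (a b : R) : R -> \bar R := fun z => (\1_(`[a, b]%classic : set R) z)%:E.

Arguments window (a b)%_R _.

Lemma pos_meas_window a b : pos_meas (window a b).
Proof.
apply: pos_meas_EFin => [|z]; last by rewrite indicE.
exact: measurable_indic.
Qed.

Lemma window_le1 a b z : window a b z <= 1.
Proof. by rewrite /window indicE lee_fin lern1; case: (z \in _). Qed.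

Lemma windowT a b z : (a <= z <= b)%R -> window a b z = 1.
Proof. by move=> h; rewrite /window indicE mem_set//= in_itv. Qed.

Lemma windowF a b z : ~~ (a <= z <= b)%R -> window a b z = 0.
Proof. by move=> h; rewrite /window indicE memNset//= in_itv; exact/negP. Qed.

(** The duration [e] is so short that the drift gains at most [x1 / 2], while the jump loses between
    [x1] and [x2]: the upper end of the window drops by [x1 / 2], the lower end by at most [x2]. *)
Lemma window_descend (x1 x2 e a b y : R) : (0 < x1)%R -> (0 <= e)%R -> (a_m * e <= x1 / 2)%R ->
  (a <= y <= b + x1 / 2)%R ->
  (expR (- (L * e)))%:E * (e%:E * J `[(- x2)%R, (- x1)%R]%classic) <= sg e (window (a - x2) b) y.
Proof.
move=> x10 e0 ae /andP[ay yb]; apply: le_trans (sg_one_jump _ (pos_meas_window _ _) e0).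
rewrite lee_wpmul2l ?lee_fin ?expR_ge0//.
have mi : measurable (`[0%R, e] : set (measurableTypeR R)) by exact: measurable_itv.
apply: (@le_trans _ _ (\int[mu]_(r in `[0%R, e]) J `[(- x2)%R, (- x1)%R]%classic)).
  have := @integral_cst _ _ _ mu _ mi (J `[(- x2)%R, (- x1)%R]%classic); rewrite /cst => ->.
  have /= -> := @lebesgue_measure_itv R `[0%R, e].
  by rewrite lte_fin muleC; case: ltP => [_|e0']; [rewrite -EFinD subr0|have -> : e = 0%R by lra].
have m1 : measurable_fun setT (fun x : R * R => Phi (e - x.1) (Phi x.1 y + x.2)).
  have m2 : measurable_fun setT (fun x : R * R => (e - x.1, Phi x.1 y + x.2)%R).
    apply/measurable_fun_pair => /=; first exact: measurable_funB.
    apply: measurable_funD => //.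
    exact: (measurableT_comp (measurable_log_flow1 a_p a_m y) measurable_fst).
  exact: (measurableT_comp (measurable_log_flow a_p a_m) m2).
have hw := pos_meas_comp m1 (pos_meas_window (a - x2)%R b).
have h1 := @pos_meas_int1 _ _ _ R R J _ hw.
apply: ge0_le_integral => //.
  by apply: measurable_funTS; exact: h1.1.
move=> r; rewrite /= in_itv/= => /andP[r0 re].
have -> : J `[(- x2)%R, (- x1)%R]%classic = \int[J]_xi (\1_(`[(- x2)%R, (- x1)%R]%classic : set R) xi)%:E.
  by rewrite integral_indic ?setIT.
apply: ge0_le_integral => //.
- by apply/measurable_EFinP; exact: measurable_indic.
- by have := measurableT_comp hw.1 (pair1_measurable r).
move=> xi _; rewrite indicE; case: (boolP (xi \in _)) => [|_]; last exact: (pos_meas_window _ _).2.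
rewrite inE/= in_itv/= => /andP[xi2 xi1].
rewrite windowT//; apply/andP; split.
  have h2 := @log_flow_ge_start r y r0.
  have := @log_flow_ge_start (e - r)%R (Phi r y + xi)%R; rewrite subr_ge0 => /(_ re); lra.
have h2 := @log_flow_le_speed r y r0.
have := @log_flow_le_speed (e - r)%R (Phi r y + xi)%R; rewrite subr_ge0 => /(_ re); lra.
Qed.

Lemma window_descend_iter (x1 x2 e a b : R) n : (0 < x1)%R -> (0 < x2)%R -> (0 < e)%R ->
  (a_m * e <= x1 / 2)%R -> 0 < J `[(- x2)%R, (- x1)%R]%classic ->
  exists2 d : R, (0 < d)%R & forall y, (a <= y <= b + n%:R * (x1 / 2))%R ->
    d%:E <= sg (n%:R * e) (window (a - n%:R * x2) b) y.
Proof.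
move=> x10 x20 e0 ae J0.
have Jfin : J `[(- x2)%R, (- x1)%R]%classic = (fine (J `[(- x2)%R, (- x1)%R]%classic))%:E.
  by rewrite fineK// fin_num_measure.
pose c := (expR (- (L * e)) * (e * fine (J `[(- x2)%R, (- x1)%R]%classic)))%R.
have c0 : (0 < c)%R.
  by rewrite !mulr_gt0 ?expR_gt0// fine_gt0// J0 Jfin ltry.
elim: n a => [|n IH] a.
  exists 1%R => // y; rewrite !mul0r addr0 subr0 => h.
  apply: le_trans (sg_flow_le _ (pos_meas_window _ _) (lexx _)).
  by rewrite mulr0 oppr0 expR0 mul1e log_flow0// windowT.
have [d d0 hd] := IH (a - x2)%R.
exists (c * d)%R; first exact: mulr_gt0.
move=> y /andP[y1 y2].
have -> : (n.+1%:R * e = e + n%:R * e)%R by rewrite -natr1; ring.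
rewrite (sg_semigroup J a_p_gt0 a_p_lt_a_m (c := 1) y)//; last 4 first.
- exact: pos_meas_window.
- by move=> z; exact: window_le1.
- exact: ltW.
- by rewrite mulr_ge0// ltW.
have hW := pos_meas_window (a - x2)%R (b + n%:R * (x1 / 2))%R.
apply: (@le_trans _ _ (sg e (fun z => d%:E * window (a - x2) (b + n%:R * (x1 / 2)) z) y)).
  rewrite sgZ ?(ltW d0)// [leLHS]EFinM muleC lee_wpmul2l ?lee_fin ?(ltW d0)//.
  apply: le_trans (@window_descend x1 x2 e a (b + n%:R * (x1 / 2))%R y x10 (ltW e0) ae _).
    by rewrite /c !EFinM -Jfin.
  by rewrite y1/=; apply: le_trans y2 _; rewrite -natr1; lra.
apply: le_sg.
- by apply: pos_measM => //; split => // ?; rewrite lee_fin ltW.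
- by apply: pos_meas_sg; exact: pos_meas_window.
move=> z; case: (boolP (a - x2 <= z <= b + n%:R * (x1 / 2))%R) => hz.
  rewrite windowT// mule1; have := hd z hz.
  by rewrite (_ : (a - n.+1%:R * x2 = a - x2 - n%:R * x2)%R)// -natr1; ring.
by rewrite windowF// mule0; exact: (pos_meas_sg _ _ _ _ (pos_meas_window _ _)).2.
Qed.

End reachability.

(** * Spreading by one jump and a second passage through 0 *)

Section minorization.
Context {R : realType}.
Variables (a_p a_m : R) (J : {finite_measure set R -> \bar R}).
Hypotheses (a_p_gt0 : (0 < a_p)%R) (a_p_lt_a_m : (a_p < a_m)%R).
Hypotheses (J_neg : J `[0%R, +oo[%classic = 0) (J_gt0 : (0 < rate J)%R).
Notation mu := (@lebesgue_measure R).
Notation L := (rate J).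
Notation Phi := (log_flow a_p a_m).
Notation sg := (sg a_p a_m J).

(** The windows with [x1] a positive or negative power of [k] cover the negative half line; if all
    were null, [J] would vanish. *)
Lemma jump_window (k : R) : (1 < k)%R ->
  exists x1 : R, (0 < x1)%R /\ 0 < J `[(- (k * x1))%R, (- x1)%R]%classic.
Proof.
move=> k1; have k0 : (0 < k)%R by exact: lt_trans k1.
pose I x1 := (`[(- (k * x1))%R, (- x1)%R]%classic : set R).
apply: contrapT => H.
have I0 (x1 : R) : (0 < x1)%R -> J (I x1) = 0.
  move=> x10; apply/eqP; rewrite -measure_le0 leNgt; apply/negP => h.
  by apply: H; exists x1.
have : J setT <= J `[0%R, +oo[%classic + (\sum_(0 <= n <oo) J (I (k ^+ n)%R) + \sum_(0 <= n <oo) J (I (k ^- n.+1)%R)).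
  have mI x1 : measurable (I x1) by exact: measurable_itv.
  have mB1 : measurable (\bigcup_n I (k ^+ n)%R) by exact: bigcup_measurable.
  have mB2 : measurable (\bigcup_n I (k ^- n.+1)%R) by exact: bigcup_measurable.
  apply: (@le_trans _ _ (J (`[0%R, +oo[%classic `|` (\bigcup_n I (k ^+ n)%R `|` \bigcup_n I (k ^- n.+1)%R)))).
    apply: le_measure; rewrite ?inE//; first by apply: measurableU => //; exact: measurableU.
    move=> x _; case: (leP 0 x)%R => x0; first by left; rewrite /= in_itv/= x0.
    right; have lk : (0 < ln k)%R by rewrite ln_gt0.
    have nx0 : (0 < - x)%R by rewrite oppr_gt0.
    pose u := (ln (- x) / ln k)%R.
    have uE : (- x = expR (u * ln k))%R by rewrite /u divfK ?gt_eqF// lnK ?posrE.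
    have powE n : (k ^+ n = expR (n%:R * ln k))%R.
      by rewrite expRM_natl lnK ?posrE.
    case: (leP 0 u)%R => u0.
      left; have /andP[n1 n2] := truncn_itv u0; exists (Num.truncn u) => //.
      rewrite /I /= in_itv/= -exprS !powE lerNl lerNr uE !ler_expR !ler_pM2r//.
      by rewrite n1 ltW.
    right; have nu0 : (0 <= - u)%R by lra.
    have /andP[n1 n2] := truncn_itv nu0; exists (Num.truncn (- u)) => //.
    have -> : I (k ^- (Num.truncn (- u)).+1)%R =
        (`[(- (k ^- (Num.truncn (- u))))%R, (- (k ^- (Num.truncn (- u)).+1))%R]%classic : set R).
      by rewrite /I exprS invfM mulrA divff ?gt_eqF// mul1r.
    rewrite /= in_itv/= !powE -!expRN lerNl lerNr uE !ler_expR.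
    by apply/andP; split; rewrite -mulNr ler_pM2r//; lra.
  apply: le_trans (measureU2 _ _ _) _ => //; first exact: measurableU.
  rewrite leeD2l//; apply: le_trans (measureU2 _ _ _) _ => //.
  by apply: leeD; apply: (@measure_sigma_subadditive _ _ _ J) => //.
rewrite J_neg add0e !eseries0 ?adde0; last 2 first.
- by move=> n _ _; apply: I0; rewrite invr_gt0 exprn_gt0.
- by move=> n _ _; apply: I0; rewrite exprn_gt0.
by rewrite rateE lee_fin leNgt J_gt0.
Qed.

(** Reference measure of the Doeblin condition: a multiple of Lebesgue measure on [[0, a_p eta]],
    parametrized by the time [w] needed to go from 0 to [a_p w]. *)
Definition mass (eta : R) (f : R -> \bar R) : \bar R :=
  \int[mu]_w (window 0 eta w * f (a_p * w)%R).

(** The time before the jump is spent at speed [a_p], part of the time after it at speed [a_m]. As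
    the speeds differ, the final position moves linearly with the jump time [r], so its law inherits
    a density from that of [r], whatever the jump in the window. *)
Lemma minorization1 (x1 x2 eta t z : R) (f : R -> \bar R) : pos_meas f ->
  (0 < x1)%R -> (0 < eta)%R ->
  (eta + x2 / a_m <= t <= x1 / a_p - eta)%R -> (0 <= z <= eta)%R ->
  (expR (- (L * t)))%:E * (J `[(- x2)%R, (- x1)%R]%classic * mass eta f) <= sg t f (a_p * z).
Proof.
have am0 := lt_trans a_p_gt0 a_p_lt_a_m; have ap0 := a_p_gt0; have lt_a := a_p_lt_a_m.
move=> hf x10 eta0 /andP[t1 t2] /andP[z0 z1].
(* A negative [t] forces [x2 < 0]; the window is then empty and the left side is 0. *)
case: (leP 0 t)%R => t0; last first.
  have Jb : J `[(- x2)%R, (- x1)%R]%classic = 0.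
    rewrite set_itv_ge ?measure0// bnd_simp -ltNge ltrN2.
    have : (x2 / a_m < 0)%R by lra.
    by rewrite pmulr_llt0 ?invr_gt0// => x20; lra.
  rewrite Jb mul0e mule0; exact: (pos_meas_sg _ _ _ _ hf).2.
apply: le_trans (sg_one_jump a_p a_m J _ hf t0).
rewrite lee_wpmul2l ?lee_fin ?expR_ge0//.
pose F (x : R * R) : \bar R := f (Phi (t - x.1) (Phi x.1 (a_p * z) + x.2)).
have hF : pos_meas F.
  have m2 : measurable_fun setT (fun x : R * R => (t - x.1, Phi x.1 (a_p * z) + x.2)%R).
    apply/measurable_fun_pair => /=; first exact: measurable_funB.
    apply: measurable_funD => //.
    exact: (measurableT_comp (measurable_log_flow1 a_p a_m (a_p * z)) measurable_fst).
  exact: (pos_meas_comp (measurableT_comp (measurable_log_flow a_p a_m) m2) hf).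
have hg : pos_meas (fun w => window 0 eta w * f (a_p * w)%R).
  apply: pos_measM; first exact: pos_meas_window.
  by apply: pos_meas_comp hf; exact: measurable_funM.
have mass0 : 0 <= mass eta f by apply: integral_ge0 => w _; exact: hg.2.
pose G (x : R * R) : \bar R := window 0 t x.1 * F x.
have hG : pos_meas G.
  by apply: pos_measM => //; exact: (pos_meas_comp measurable_fst (pos_meas_window _ _)).
have -> : \int[mu]_(r in `[0%R, t]) \int[J]_xi f (Phi (t - r) (Phi r (a_p * z) + xi)) =
    \int[mu]_r \int[J]_xi G (r, xi).
  rewrite integral_mkcond; apply: eq_integral => r _.
  have h := pos_meas_comp (pair1_measurable r) hF.
  rewrite /G/= (ge0_integralZl J measurableT h.1 (fun x _ => h.2 x)) ?(pos_meas_window _ _).2//.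
  rewrite patchE /window indicE; case: ifPn => _; [by rewrite mul1e|by rewrite mul0e].
(* The jump is integrated last, so that the substitution in the jump time is made for a fixed
   jump. *)
rewrite (@fubini_tonelli _ _ (measurableTypeR R) R R mu J G hG.1 hG.2).
have mI : measurable (`[(- x2)%R, (- x1)%R]%classic : set R) by exact: measurable_itv.
have -> : J `[(- x2)%R, (- x1)%R]%classic * mass eta f =
    \int[J]_xi (mass eta f * (\1_(`[(- x2)%R, (- x1)%R]%classic : set R) xi)%:E).
  have h := pos_meas_window (- x2)%R (- x1)%R.
  rewrite (ge0_integralZl J measurableT h.1 (fun x _ => h.2 x) mass0).
  by rewrite integral_indic// setIT muleC.
have hGxi := pos_meas_int1 (T1 := R) mu (pos_meas_comp (@measurable_swap _ _ R R) hG).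
apply: ge0_le_integral => //.
- by move=> xi _; rewrite mule_ge0// lee_fin indicE.
- by apply: emeasurable_funM => //; apply/measurable_EFinP; exact: measurable_indic.
- exact: hGxi.1.
move=> xi _; rewrite indicE; case: (boolP (xi \in _)) => [|_]; last first.
  by rewrite mule0 integral_ge0// => r _; exact: hG.2.
rewrite inE/= in_itv/= mule1 => /andP[xi2 xi1].
(* After a jump [xi] at time [r] from the trajectory of [a_p z], the final position is
   [a_p (c - k r)]; the Jacobian [1 / k] is at least 1. *)
pose k := (1 - a_p / a_m)%R; pose c := (t + z + xi / a_m - k * z)%R.
have pm0 : (0 < a_p / a_m)%R by rewrite divr_gt0.
have pm1 : (a_p / a_m < 1)%R by rewrite ltr_pdivrMr// mul1r.
have k0 : (0 < k)%R by rewrite /k; lra.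
have k1 : (k <= 1)%R by rewrite /k; lra.
have hgo : pos_meas (fun w : R => window 0 eta (- w)%R * f (a_p * - w)%R).
  exact: pos_meas_comp hg.
have -> : mass eta f = k%:E * \int[mu]_r (window 0 eta (c - k * r)%R * f (a_p * (c - k * r))%R).
  rewrite /mass -(ge0_integral_opp hg.1 hg.2) -(ge0_integral_affine (- c)%R k0 hgo.1 hgo.2).
  congr (_ * _); apply: eq_integral => r _.
  by rewrite (_ : (- (k * r + - c) = c - k * r)%R)//; ring.
have hgc : pos_meas (fun r : R => window 0 eta (c - k * r)%R * f (a_p * (c - k * r))%R).
  by apply: pos_meas_comp hg; apply: measurable_funB => //; exact: measurable_funM.
apply: (@le_trans _ _ (1 * \int[mu]_r (window 0 eta (c - k * r)%R * f (a_p * (c - k * r))%R))).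
  by apply: lee_wpmul2r; [apply: integral_ge0 => r _; exact: hgc.2|rewrite lee_fin].
rewrite mul1e; apply: ge0_le_integral => //.
- by move=> r _; exact: hgc.2.
- exact: hgc.1.
- by have := measurableT_comp hG.1 (pair2_measurable xi).
move=> r _; case: (boolP (0 <= c - k * r <= eta)%R) => [/andP[c1 c2]|h]; last first.
  by rewrite windowF// mul0e hG.2.
have x2am : (- (xi / a_m) <= x2 / a_m)%R by rewrite -mulNr ler_pM2r ?invr_gt0//; lra.
have x1am : (x1 / a_m <= - (xi / a_m))%R by rewrite -mulNr ler_pM2r ?invr_gt0//; lra.
have kz : (k * z <= z)%R by apply: ler_piMl.
(* The lower bound on [t] gives [r >= 0]. The upper bound keeps the position before the jump at most
   [x1], so that the jump lands at or below 0 and a second passage follows. *)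
have r0 : (0 <= r)%R by rewrite -(pmulr_rge0 _ k0); move: c2; rewrite /c; lra.
have kzr : (k * (z + r) <= k * (x1 / a_p))%R.
  have -> : (k * (x1 / a_p) = x1 / a_p - x1 / a_m)%R by rewrite /k; field; rewrite !gt_eqF.
  by move: c1; rewrite /c; lra.
have zr : (z + r <= x1 / a_p)%R by move: kzr; rewrite ler_pM2l.
have zr' : (a_p * z + a_p * r <= x1)%R.
  by rewrite -mulrDr mulrC -ler_pdivlMr.
have wE : (c - k * r = t - r + (a_p * z + a_p * r + xi) / a_m)%R.
  by rewrite /c /k; field; rewrite gt_eqF.
have neg : ((a_p * z + a_p * r + xi) / a_m <= 0)%R.
  by rewrite pmulr_lle0 ?invr_gt0//; lra.
have rt : (r <= t)%R by move: c1; rewrite wE; lra.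
rewrite windowT ?c1// mul1e /G /F /= windowT ?r0// mul1e.
have azr : (0 <= a_p * z)%R by rewrite mulr_ge0// ltW.
have -> : Phi r (a_p * z) = (a_p * z + a_p * r)%R by rewrite log_flow_ge0.
have h1 : (a_p * z + a_p * r + xi <= 0)%R by lra.
have h2 : (0 <= a_p * z + a_p * r + xi + a_m * (t - r))%R.
  have := c1; rewrite wE -(pmulr_rge0 _ am0).
  have -> : (a_m * (t - r + (a_p * z + a_p * r + xi) / a_m) = a_m * (t - r) + (a_p * z + a_p * r + xi))%R.
    by field; rewrite gt_eqF.
  by lra.
by rewrite (log_flow_cross a_p_gt0 a_p_lt_a_m h1 h2) wE.
Qed.

End minorization.

(** * The Doeblin condition on bounded sets *)

Section doeblin.
Context {R : realType}.
Variables (a_p a_m : R) (J : {finite_measure set R -> \bar R}).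
Hypotheses (a_p_gt0 : (0 < a_p)%R) (a_p_lt_a_m : (a_p < a_m)%R).
Hypotheses (J_neg : J `[0%R, +oo[%classic = 0) (J_gt0 : (0 < rate J)%R).
Notation mu := (@lebesgue_measure R).
Notation L := (rate J).
Notation Phi := (log_flow a_p a_m).
Notation sg := (sg a_p a_m J).
Notation mass := (mass a_p).

Lemma pos_meas_mass_integrand (eta : R) (f : R -> \bar R) : pos_meas f ->
  pos_meas (fun w : R => window 0 eta w * f (a_p * w)%R).
Proof.
move=> hf; apply: pos_measM; first exact: pos_meas_window.
by apply: pos_meas_comp hf; exact: measurable_funM.
Qed.

Lemma mass_ge0 eta (f : R -> \bar R) : pos_meas f -> 0 <= mass eta f.
Proof. by move=> hf; apply: integral_ge0 => w _; exact: (pos_meas_mass_integrand eta hf).2. Qed.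

Lemma integral_window (b : R) : (0 <= b)%R -> \int[mu]_w window 0 b w = b%:E.
Proof.
move=> b0; have mi : measurable (`[0%R, b] : set (measurableTypeR R)) by exact: measurable_itv.
have := integral_indic mu measurableT mi; rewrite setIT => e.
apply: (etrans e); have /= -> := @lebesgue_measure_itv R `[0%R, b].
rewrite lte_fin; case: ltP => [_|h]; first by rewrite -EFinD subr0.
by congr EFin; apply/eqP; rewrite eq_le b0 h.
Qed.

Lemma mass_ge (eta : R) (f : R -> \bar R) c : pos_meas f -> (0 <= eta)%R -> 0 <= c ->
  (forall z, (0 <= z <= eta)%R -> c <= f (a_p * z)%R) -> c * eta%:E <= mass eta f.
Proof.
move=> hf eta0 c0 hc; have hw := pos_meas_window 0 eta.
rewrite -(integral_window eta0).
rewrite -(ge0_integralZl mu measurableT hw.1 (fun x _ => hw.2 x) c0).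
apply: ge0_le_integral => //.
- by move=> w _; rewrite mule_ge0//; exact: hw.2.
- by apply: emeasurable_funM; [exact: measurable_cst|exact: hw.1].
- exact: (pos_meas_mass_integrand eta hf).1.
move=> w _; case: (boolP (0 <= w <= eta)%R) => h.
  by rewrite windowT// mule1 mul1e hc.
by rewrite windowF// mule0 mul0e.
Qed.

(** Chaining [n + 1] passages multiplies the interval of admissible times by [n + 1]. Its length
    then exceeds any prescribed delay, which makes one common time possible for starting points that
    reach 0 at different moments. *)
Lemma minorization_iter (x1 x2 eta : R) n : (0 < x1)%R -> (0 < eta)%R ->
  (0 <= eta + x2 / a_m)%R -> 0 < J `[(- x2)%R, (- x1)%R]%classic ->
  exists2 d : R, (0 < d)%R & forall t z f, pos_meas f -> (forall y, f y <= 1) ->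
    (n.+1%:R * (eta + x2 / a_m) <= t <= n.+1%:R * (x1 / a_p - eta))%R -> (0 <= z <= eta)%R ->
    d%:E * mass eta f <= sg t f (a_p * z)%R.
Proof.
move=> x10 eta0 b10 J0.
set b1 := (eta + x2 / a_m)%R in b10 *; set b2 := (x1 / a_p - eta)%R.
have Jfin : J `[(- x2)%R, (- x1)%R]%classic = (fine (J `[(- x2)%R, (- x1)%R]%classic))%:E.
  by rewrite fineK// fin_num_measure.
have j0 : (0 < fine (J `[(- x2)%R, (- x1)%R]%classic))%R by rewrite fine_gt0// J0 Jfin ltry.
pose c := (expR (- (L * b2)) * fine (J `[(- x2)%R, (- x1)%R]%classic))%R.
have c0 : (0 < c)%R by rewrite mulr_gt0 ?expR_gt0.
have step t z f : pos_meas f -> (b1 <= t <= b2)%R -> (0 <= z <= eta)%R ->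
    c%:E * mass eta f <= sg t f (a_p * z)%R.
  move=> hf ht hz; apply: le_trans (@minorization1 _ _ _ J a_p_gt0 a_p_lt_a_m x1 x2 eta t z f hf x10 eta0 ht hz).
  rewrite muleA lee_wpmul2r ?mass_ge0// Jfin -EFinM lee_fin ler_pM2r// ler_expR lerN2.
  by apply: ler_wpM2l; [exact: rate_ge0|case/andP: ht].
elim: n => [|n [d d0 IH]].
  by exists c => // t z f hf _; rewrite !mul1r => h1 h2; exact: step hf h1 h2.
exists (c * (d * eta))%R; first by apply: mulr_gt0 => //; exact: mulr_gt0.
move=> t z f hf f1 /andP[t1 t2] hz.
have n0 : (0 < n.+2%:R :> R)%R by [].
(* All passages take the same time, which lies in the interval of a single passage. *)
pose u := (t / n.+2%:R)%R.
have tE : t = (u + n.+1%:R * u)%R.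
  by rewrite -[X in (X + _)%R]mul1r -mulrDl addrC natr1 /u mulrC divfK ?gt_eqF.
have hu : (b1 <= u <= b2)%R.
  by rewrite /u ler_pdivlMr// ler_pdivrMr// mulrC t1 mulrC t2.
have u0 : (0 <= u)%R by case/andP: hu => h _; exact: le_trans h.
have nu0 : (0 <= n.+1%:R * u)%R by rewrite mulr_ge0.
have c10 : (0 <= 1 :> R)%R by [].
rewrite tE (sg_semigroup J a_p_gt0 a_p_lt_a_m _ hf c10 f1 u0 nu0).
have hsf := pos_meas_sg a_p a_m J (n.+1%:R * u) hf.
apply: le_trans (step u z _ hsf hu hz).
rewrite EFinM -muleA lee_wpmul2l ?lee_fin ?(ltW c0)//.
have dm0 : 0 <= d%:E * mass eta f by rewrite mule_ge0 ?mass_ge0// lee_fin ltW.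
apply: le_trans (mass_ge hsf (ltW eta0) dm0 _).
  by rewrite EFinM muleAC.
move=> w hw; apply: IH => //.
by case/andP: hu => hu1 hu2; rewrite !ler_pM2l// hu1.
Qed.

(** From [|y| <= M], repeated jumps bring the position below 0, the flow carries it to 0, and
    [minorization_iter] uses the remaining time. *)
Lemma doeblin : exists2 eta : R, (0 < eta)%R &
  forall M T0 : R, (0 <= M)%R -> exists2 T : R, (T0 <= T)%R /\ (0 <= T)%R &
  exists2 d : R, (0 < d)%R & forall y f, (`|y| <= M)%R -> pos_meas f -> (forall y, f y <= 1) ->
    d%:E * mass eta f <= sg T f y.
Proof.
have am0 := lt_trans a_p_gt0 a_p_lt_a_m; have ap0 := a_p_gt0; have lt_a := a_p_lt_a_m.
have r1 : (1 < a_m / a_p)%R by rewrite ltr_pdivlMr// mul1r.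
(* A ratio [x2 / x1 = k < a_m / a_p] gives [x2 / a_m < x1 / a_p], so a passage has a nonempty
   interval of admissible times. *)
pose k := ((1 + a_m / a_p) / 2)%R.
have k1 : (1 < k)%R by rewrite /k; lra.
have kr : (k < a_m / a_p)%R by rewrite /k; lra.
have [x1 [x10 J0]] := jump_window J_neg J_gt0 k1.
set x2 := (k * x1)%R in J0.
have x20 : (0 < x2)%R by rewrite mulr_gt0//; lra.
have x21 : (x2 / a_m < x1 / a_p)%R.
  rewrite ltr_pdivrMr//; have := kr; rewrite -(ltr_pM2r x10) /x2; congr (_ < _)%R; field; lra.
(* One third of the gap: after both margins the interval of times still has length [eta]. *)
pose eta := ((x1 / a_p - x2 / a_m) / 3)%R.
have eta0 : (0 < eta)%R by rewrite /eta; lra.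
have x2am : (0 < x2 / a_m)%R by rewrite divr_gt0.
have b10 : (0 <= eta + x2 / a_m)%R by lra.
exists eta => // M T0 M0.
pose e := (x1 / (2 * a_m))%R.
have e0 : (0 < e)%R by rewrite divr_gt0// mulr_gt0.
have ae : (a_m * e <= x1 / 2)%R by rewrite /e le_eqVlt; apply/orP; left; apply/eqP; field; rewrite gt_eqF.
have arch (x y : R) : (0 < y)%R -> exists n : nat, (x <= n%:R * y)%R.
  move=> y0; exists (Num.truncn (`|x| / y)).+1; rewrite -ler_pdivrMr//.
  have h : (0 <= `|x| / y)%R by rewrite divr_ge0// ltW.
  have /andP[_ /ltW] := truncn_itv h; apply: le_trans.
  by rewrite ler_pM2r ?invr_gt0// ler_norm.
have x120 : (0 < x1 / 2)%R by lra.
have [n1 hn1] := arch M _ x120.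
have [d d0 hd] := @window_descend_iter _ _ _ J a_p_gt0 a_p_lt_a_m x1 x2 e (- M)%R 0%R n1 x10 x20 e0 ae J0.
(* Minus the lowest point of the descent; from there 0 is reached within time [B / a_m]. *)
pose B := (M + n1%:R * x2)%R.
have B0 : (0 <= B)%R by rewrite addr_ge0// mulr_ge0// ltW.
(* The freedom in time after [n + 1] passages covers both the delay [B / a_m] and the required lower
   bound [T0]. *)
have [n hn] := arch (B / a_m + `|T0|)%R _ eta0.
have [d' d'0 hd'] := @minorization_iter x1 x2 eta n x10 eta0 b10 J0.
pose T2 := (n.+1%:R * (x1 / a_p - eta))%R.
have T2E : (T2 = n.+1%:R * (eta + x2 / a_m) + n.+1%:R * eta)%R by rewrite /T2 /eta; field; rewrite !gt_eqF.
have n1eta : (B / a_m + `|T0| <= n.+1%:R * eta)%R by apply: le_trans hn _; rewrite ler_pM2r// ler_nat.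
have Bam : (0 <= B / a_m)%R by rewrite divr_ge0// ltW.
have nb10 : (0 <= n.+1%:R * (eta + x2 / a_m))%R by rewrite mulr_ge0.
have T00 := normr_ge0 T0; have T01 := ler_norm T0.
have n1e0 : (0 <= n1%:R * e)%R by rewrite mulr_ge0// ltW.
exists (n1%:R * e + T2)%R; first by split; lra.
pose c := (expR (- (L * (B / a_m))) * d')%R.
have c0 : (0 < c)%R by rewrite mulr_gt0 ?expR_gt0.
exists (c * d)%R; first exact: mulr_gt0.
move=> y f yM hf f1; have T20 : (0 <= T2)%R by lra.
have c10 : (0 <= 1 :> R)%R by [].
rewrite (sg_semigroup J a_p_gt0 a_p_lt_a_m _ hf c10 f1 n1e0 T20).
have low w : (- B <= w <= 0)%R -> c%:E * mass eta f <= sg T2 f w.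
  move=> /andP[w1 w0]; pose s0 := (- w / a_m)%R.
  have s00 : (0 <= s0)%R by rewrite divr_ge0 ?oppr_ge0// ltW.
  have s0B : (s0 <= B / a_m)%R by rewrite ler_pM2r ?invr_gt0//; lra.
  have Ts : (0 <= T2 - s0)%R by lra.
  rewrite -(subrKC s0 T2) (sg_semigroup J a_p_gt0 a_p_lt_a_m _ hf c10 f1 s00 Ts).
  have hsf := pos_meas_sg a_p a_m J (T2 - s0)%R hf.
  apply: le_trans (sg_flow_le a_p a_m J _ hsf s00).
  have ws : (w + a_m * s0 = 0)%R by rewrite /s0; field; rewrite gt_eqF.
  have -> : Phi s0 w = (a_p * 0)%R by rewrite log_flow_le0 ?ws ?mulr0.
  rewrite /c EFinM -muleA; apply: lee_pmul; rewrite ?lee_fin ?expR_ge0//.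
  - by rewrite mule_ge0 ?mass_ge0// lee_fin ltW.
  - by rewrite ler_expR lerN2 ler_wpM2l// rate_ge0.
  - by apply: hd' => //; apply/andP; split; rewrite -/T2//; lra.
have m0 := mass_ge0 eta hf.
have mfin : mass eta f \is a fin_num.
  rewrite ge0_fin_numE//; apply: (@le_lt_trans _ _ (\int[mu]_w window 0 eta w)).
    apply: ge0_le_integral => //.
    - by move=> w _; exact: (pos_meas_mass_integrand eta hf).2.
    - exact: (pos_meas_mass_integrand eta hf).1.
    - exact: (pos_meas_window _ _).1.
    - by move=> w _; rewrite -[leRHS]mule1 lee_wpmul2l//; exact: (pos_meas_window _ _).2.
  by rewrite integral_window ?ltry// ltW.
have mE : mass eta f = (fine (mass eta f))%:E by rewrite fineK.
have cm0 : (0 <= c * fine (mass eta f))%R by rewrite mulr_ge0 ?fine_ge0// ltW.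
apply: (@le_trans _ _ (sg (n1%:R * e) (fun z => (c * fine (mass eta f))%:E * window (- M - n1%:R * x2) 0 z) y)).
  rewrite sgZ//; last exact: pos_meas_window.
  rewrite mE -EFinM [leLHS](_ : _ = (c * fine (mass eta f))%:E * d%:E); last first.
    by rewrite -EFinM; congr EFin; ring.
  rewrite lee_wpmul2l ?lee_fin//; apply: hd.
  by move: yM; rewrite ler_norml => /andP[-> h] /=; lra.
apply: le_sg.
- by apply: pos_measM; [split => // ?; rewrite lee_fin|exact: pos_meas_window].
- exact: pos_meas_sg.
move=> z; case: (boolP (- M - n1%:R * x2 <= z <= 0)%R) => hz.
  rewrite windowT// mule1 EFinM -mE; apply: low.
  by move: hz; rewrite /B => /andP[h ->]; rewrite andbT; lra.
by rewrite windowF// mule0; exact: (pos_meas_sg _ _ _ _ hf).2.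
Qed.

End doeblin.

(** * The Lyapunov function *)

Section lyapunov.
Context {R : realType}.
Variables (a_p a_m : R) (J : {finite_measure set R -> \bar R}) (eps0 m : R).
Hypotheses (a_p_gt0 : (0 < a_p)%R) (a_p_lt_a_m : (a_p < a_m)%R).
Hypothesis J_neg : J `[0%R, +oo[%classic = 0.
Hypothesis eps0_gt0 : (0 < eps0)%R.
Hypothesis J_moment : \int[J]_xi (expR (- eps0 * xi))%:E < +oo.
Hypothesis J_mean : \int[J]_xi (Num.max 0 (- xi)%R)%:E = m%:E.
Notation L := (rate J).
Notation sg := (sg a_p a_m J).

Definition lyapunov (q y : R) : R := (expR (q * y) + expR (- q * y))%R.

Lemma measurable_lyapunov q : measurable_fun setT (lyapunov q).
Proof.
apply: measurable_funD; apply: measurableT_comp => //; exact: measurable_funM.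
Qed.

Lemma lyapunov_ge0 q y : (0 <= lyapunov q y)%R.
Proof. by rewrite addr_ge0// expR_ge0. Qed.

(** Each of the two exponentials contracts on the half line where it is large; on the other one it
    is at most 1 and costs a constant. *)
Lemma lyapunov_drift1 : (a_p < m)%R -> (m < a_m)%R ->
  exists q k b : R, [/\ (0 < q)%R, (0 <= k)%R, (0 < b)%R &
    forall t y, (0 <= t <= 1)%R ->
    sg t (EFin \o lyapunov q) y <= (expR (- (b * t)) * lyapunov q y + k)%:E].
Proof.
move=> apm mam; have ap0 := a_p_gt0; have e0 := eps0_gt0.
have [C C0 hC] := mgf_taylor J_neg eps0_gt0 J_moment J_mean.
pose D := Num.min (m - a_p)%R (a_m - m)%R.
have D0 : (0 < D)%R by rewrite lt_min !subr_gt0 apm.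
have D1 : (D <= m - a_p)%R by rewrite ge_min lexx.
have D2 : (D <= a_m - m)%R by rewrite ge_min lexx orbT.
(* So small that the quadratic error [C q^2] is at most [b = q D / 2], half of the linear gain
   [q D]. *)
pose q := Num.min (eps0 / 2)%R (D / (2 * (C + 1)))%R.
have C10 : (0 < 2 * (C + 1))%R by lra.
have q0 : (0 < q)%R by rewrite lt_min !divr_gt0.
have q1 : (q <= eps0 / 2)%R by rewrite ge_min lexx.
have q2 : (q * (2 * (C + 1)) <= D)%R by rewrite -ler_pdivlMr// ge_min lexx orbT.
pose b := (q * D / 2)%R.
have bE : (b * 2 = q * D)%R by rewrite /b; lra.
have b0 : (0 < b)%R by rewrite divr_gt0// mulr_gt0.
have Cq : (C * q ^+ 2 <= b)%R.
  have h : (q * (q * (2 * (C + 1))) <= q * D)%R by rewrite ler_pM2l.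
  have h2 := sqr_ge0 q; rewrite /b expr2 in h2 *; lra.
have nq : (`|q| <= eps0 / 2)%R by rewrite gtr0_norm.
have nqN : (`|- q| <= eps0 / 2)%R by rewrite normrN gtr0_norm.
have hq1 := hC q nq; have hq2 := hC (- q)%R nqN; rewrite sqrrN in hq2.
have M1 : \int[J]_xi (expR (q * xi))%:E = (mgf J q)%:E.
  by apply: (mgf_fin J_neg J_moment); clear -q0 q1 e0; lra.
have M2 : \int[J]_xi (expR (- q * xi))%:E = (mgf J (- q))%:E.
  by apply: (mgf_fin J_neg J_moment); clear -q0 q1 e0; lra.
have qD1 : (q * D <= q * (m - a_p))%R by rewrite ler_pM2l.
have qD2 : (q * D <= q * (a_m - m))%R by rewrite ler_pM2l.
have m1 := mgf_ge0 J q; have m2 := mgf_ge0 J (- q)%R; have L0 : (0 <= L)%R by exact: rate_ge0.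
pose k := (a_m * q + mgf J q + mgf J (- q) + b)%R.
have am0 := lt_trans a_p_gt0 a_p_lt_a_m.
have amq : (0 < a_m * q)%R by rewrite mulr_gt0.
have apq : (0 < a_p * q)%R by rewrite mulr_gt0.
have k0 : (0 <= k)%R by clear -amq m1 m2 b0; rewrite /k; lra.
have ebu u : (0 <= u <= 1)%R -> (1 <= expR (b * u))%R.
  by move=> /andP[u0 _]; rewrite -[leLHS]expR0 ler_expR mulr_ge0// ltW.
have bd (c w u : R) : (c <= k)%R -> (0 <= w <= 1)%R -> (0 <= u <= 1)%R -> (c * w <= k * expR (b * u))%R.
  move=> ck /andP[w0 w1] /ebu hu.
  apply: (@le_trans _ _ (k * w)%R); first exact: ler_wpM2r.
  by apply: ler_wpM2l => //; exact: le_trans hu.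
have bd0 (c w u : R) : (c <= 0)%R -> (0 <= w)%R -> (c * w <= k * expR (b * u))%R.
  by move=> c0 w0; apply: (@le_trans _ _ 0%R); [rewrite mulr_le0_ge0|rewrite mulr_ge0// expR_ge0].
exists q, (2 * k)%R, b; split => //; first by rewrite mulr_ge0.
move=> t y ht.
have S1 := @exp_supersolution _ a_p a_m J a_p_gt0 a_p_lt_a_m 1 q (mgf J q) b k 0 0 0 1 (fun=> 0%R) ler01 k0 M1 (measurable_cst _) (fun=> lexx _).
have S2 := @exp_supersolution _ a_p a_m J a_p_gt0 a_p_lt_a_m 1 (- q) (mgf J (- q)) b k 0 0 0 1 (fun=> 0%R) ler01 k0 M2 (measurable_cst _) (fun=> lexx _).
have {}S1 : sg t (fun z => (1 * expR (q * z))%:E) y <= (expR (- (b * t)) * expR (q * y) + k)%:E.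
  apply: le_trans (S1 _ _ _ _ _ t y ht) _.
  - by move=> z _; rewrite mul0r.
  - by move=> z _; rewrite mul0r.
  - by move=> z; rewrite mulr0 mul1r expR_ge0.
  - move=> u z hu z0; rewrite !mul0r !mulr0 !addr0 mul1r.
    by apply: bd0 (expR_ge0 _); clear -hq1 hq2 Cq bE qD1 qD2 L0 m1 m2 amq apq b0; lra.
  - move=> u z hu z0; rewrite !mul0r !mulr0 !addr0 mul1r.
    apply: bd => //; first by clear -hq1 hq2 Cq bE qD1 qD2 L0 m1 m2 amq apq b0; rewrite /k; lra.
    by rewrite expR_ge0 -[leRHS]expR0 ler_expR mulr_ge0_le0// ltW.
  - rewrite lee_fin mulr0 mul1r subr0 lerD2l.
    by apply: ler_piMr => //; case/andP: ht.
have {}S2 : sg t (fun z => (1 * expR (- q * z))%:E) y <= (expR (- (b * t)) * expR (- q * y) + k)%:E.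
  apply: le_trans (S2 _ _ _ _ _ t y ht) _.
  - by move=> z _; rewrite mul0r.
  - by move=> z _; rewrite mul0r.
  - by move=> z; rewrite mulr0 mul1r expR_ge0.
  - move=> u z hu z0; rewrite !mul0r !mulr0 !addr0 mul1r.
    apply: bd => //; first by clear -hq1 hq2 Cq bE qD1 qD2 L0 m1 m2 amq apq b0; rewrite /k; lra.
    by rewrite expR_ge0 -[leRHS]expR0 ler_expR mulNr oppr_le0 mulr_ge0// ltW.
  - move=> u z hu z0; rewrite !mul0r !mulr0 !addr0 mul1r.
    by apply: bd0 (expR_ge0 _); clear -hq1 hq2 Cq bE qD1 qD2 L0 m1 m2 amq apq b0; lra.
  - rewrite lee_fin mulr0 mul1r subr0 lerD2l.
    by apply: ler_piMr => //; case/andP: ht.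
have -> : sg t (EFin \o lyapunov q) y =
    sg t (fun z => (1 * expR (q * z))%:E + (1 * expR (- q * z))%:E) y.
  by apply: sg_eq => z; rewrite /= -EFinD !mul1r.
rewrite sgD; last 2 first.
- by have := pos_meas_exp q; under [X in _ -> pos_meas X]funext do rewrite mul1r.
- by have := pos_meas_exp (- q); under [X in _ -> pos_meas X]funext do rewrite mul1r.
apply: le_trans (leeD S1 S2) _; rewrite -EFinD lee_fin /lyapunov; clear; lra.
Qed.

Lemma lyapunov_drift : (a_p < m)%R -> (m < a_m)%R ->
  exists q K b : R, [/\ (0 < q)%R, (0 < K)%R, (0 < b)%R &
    forall t y, (0 <= t)%R ->
    sg t (EFin \o lyapunov q) y <= (expR (- (b * t)) * lyapunov q y + K)%:E].
Proof.
move=> apm mam; have [q [k [b [q0 k0 b0 H]]]] := lyapunov_drift1 apm mam.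
have eb1 : (expR (- b) < 1)%R by rewrite -[ltRHS]expR0 ltr_expR oppr_lt0.
have eb0 := expR_gt0 (- b)%R.
(* Solves [K = exp(- b) K + k + 1], so the bound reproduces itself over unit time steps; the added 1
   makes [K] positive. *)
pose K := ((k + 1) / (1 - expR (- b)))%R.
have KE : (K * (1 - expR (- b)) = k + 1)%R by rewrite /K divfK// gt_eqF// subr_gt0.
have K0 : (0 < K)%R by rewrite divr_gt0 ?subr_gt0//; lra.
have kK : (k <= K)%R.
  by have := mulr_gt0 K0 eb0; lra.
have mV := measurable_lyapunov q; have V0 := lyapunov_ge0 q.
have hV : pos_meas (EFin \o lyapunov q) by exact: pos_meas_EFin.
exists q, K, b; split => // t y t0.
have key n (u : R) : (0 <= u <= n%:R)%R ->
    sg u (EFin \o lyapunov q) y <= (expR (- (b * u)) * lyapunov q y + K)%:E.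
  elim: n u => [|n IH] u.
    move=> hu; apply: le_trans (H u y _) _; first by case/andP: hu => -> /le_trans; apply.
    by rewrite lee_fin lerD2l.
  case: (leP u 1%R) => u1 /andP[u0 un].
    by apply: le_trans (H u y _) _; [rewrite u0|rewrite lee_fin lerD2l].
  have u10 : (0 <= u - 1)%R by lra.
  have un1 : (0 <= u - 1 <= n%:R)%R by rewrite u10/=; move: un; rewrite -natr1; lra.
  have eK0 : (0 <= expR (- b))%R by exact: ltW.
  rewrite -(subrK 1%R u) sg_semigroup_real//.
  apply: (@le_trans _ _ (sg (u - 1) (fun z => (expR (- b))%:E * (EFin \o lyapunov q) z + k%:E * cst 1 z) y)).
    apply: le_sg; first exact: pos_meas_sg.
      apply: pos_measD; apply: pos_measM => //; split => // z; rewrite lee_fin//.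
    move=> z; rewrite /= mule1 -EFinM -EFinD; apply: le_trans (H 1%R z _) _; first by rewrite ler01 lexx.
    by rewrite mulr1.
  have h1 : pos_meas (cst 1 : R -> \bar R) by split.
  have h2 : pos_meas (fun z => (expR (- b))%:E * (EFin \o lyapunov q) z).
    by apply: pos_measM => //; split => // z; rewrite lee_fin.
  have h3 : pos_meas (fun z : R => k%:E * cst 1 z).
    by apply: pos_measM => //; split => // z; rewrite lee_fin.
  rewrite sgD// !sgZ// sg1// mule1.
  have := lee_wpmul2l (_ : 0 <= (expR (- b))%:E) (IH (u - 1)%R un1); rewrite lee_fin => /(_ eK0) h.
  apply: le_trans (leeD2r _ h) _; rewrite -EFinM -EFinD lee_fin mulrDr mulrA -expRD.
  have -> : (- b + - (b * (u - 1)) = - (b * u))%R by ring.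
  rewrite subrK; lra.
have /andP[_ /ltW tn] := truncn_itv t0.
by apply: (key (Num.truncn t).+1); rewrite t0.
Qed.

End lyapunov.

(** * Weighted oscillation contraction *)

Section harris.
Context {R : realType}.
Variables (a_p a_m : R) (J : {finite_measure set R -> \bar R}).
Hypotheses (a_p_gt0 : (0 < a_p)%R) (a_p_lt_a_m : (a_p < a_m)%R).
Notation mu := (@lebesgue_measure R).
Notation L := (rate J).
Notation sg := (sg a_p a_m J).
Notation mass := (mass a_p).

(** Each layer divided by [n + 1] is bounded by 1; the inequality is homogeneous and additive over
    layers. *)
Lemma minorization_real (eta T d : R) y : (0 <= d)%R ->
  (forall f, pos_meas f -> (forall y, f y <= 1) -> d%:E * mass eta f <= sg T f y) ->
  forall f : R -> R, measurable_fun setT f -> (forall z, (0 <= f z)%R) ->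
  d%:E * mass eta (EFin \o f) <= sg T (EFin \o f) y.
Proof.
move=> d0 H f mf f0; have hl n := pos_meas_layer n mf f0.
have hw := pos_meas_window 0 eta.
have -> : mass eta (EFin \o f) = \sum_(0 <= n <oo) mass eta (layer f n).
  rewrite /Submission.mass -integral_nneseries//; last 2 first.
  - by move=> n; exact: (pos_meas_mass_integrand a_p eta (hl n)).1.
  - by move=> n w _; exact: (pos_meas_mass_integrand a_p eta (hl n)).2.
  apply: eq_integral => w _; rewrite nneseriesZl; last by move=> n _; exact: (hl n).2.
  by rewrite /= layer_sum.
have -> : sg T (EFin \o f) y = \sum_(0 <= n <oo) sg T (layer f n) y.
  by rewrite -sg_series//; apply: sg_eq => w; exact: layer_sum.
rewrite -nneseriesZl; last by move=> n _; exact: mass_ge0.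
apply: lee_nneseries => n _; first by rewrite mule_ge0 ?lee_fin// mass_ge0.
have n0 : (0 <= n.+1%:R^-1 :> R)%R by rewrite invr_ge0.
pose g z := (n.+1%:R^-1)%:E * layer f n z.
have hg : pos_meas g by apply: pos_measM => //; split => // z; rewrite lee_fin.
have g1 z : g z <= 1.
  apply: (@le_trans _ _ ((n.+1%:R^-1)%:E * (n.+1%:R)%:E)).
    by rewrite lee_wpmul2l ?lee_fin// layer_le.
  by rewrite -EFinM mulVf// pnatr_eq0.
have := H g hg g1; rewrite /g sgZ//.
have -> : mass eta (fun z => (n.+1%:R^-1)%:E * layer f n z) = (n.+1%:R^-1)%:E * mass eta (layer f n).
  have h := pos_meas_mass_integrand a_p eta (hl n).
  rewrite /Submission.mass -(ge0_integralZl mu measurableT h.1 (fun x _ => h.2 x)) ?lee_fin//.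
  by apply: eq_integral => w _; rewrite muleCA.
by rewrite muleCA lee_pmul2l// lte_fin invr_gt0.
Qed.

Section contraction.
Variables (V : R -> R) (T K d eta : R).
Hypotheses (mV : measurable_fun setT V) (V0 : forall y, (0 <= V y)%R).
Hypotheses (T0 : (0 <= T)%R) (K0 : (0 < K)%R) (d0 : (0 < d)%R) (eta0 : (0 < eta)%R).
Hypothesis d1 : (d * eta <= 1)%R.
Hypothesis driftT : forall y, sg T (EFin \o V) y <= (V y / 4 + K)%:E.
Hypothesis minorT : forall y, (V y <= 16 * K)%R ->
  forall f : R -> R, measurable_fun setT f -> (forall z, (0 <= f z)%R) ->
  d%:E * mass eta (EFin \o f) <= sg T (EFin \o f) y.

(** The coefficient of [V] is such that the drift constant [K] costs half of what the minorization
    gains. *)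
Definition harris_weight (y : R) : R := (1 + d * eta / (2 * K) * V y)%R.
Notation w := harris_weight.
Definition harris_rate : R := (1 - d * eta / 2)%R.

(** The oscillation hypothesis says that [f] lies within [D w] of some constant [c]. The nonnegative
    functions [c + D w - f] and [f + D w - c] have sum at least [2 D], so the minorization, applied
    to the former at [x] and the latter at [y], gains a definite amount. *)
Lemma harris_step (f : R -> R) (D : R) : measurable_fun setT f ->
  (forall z, 0 <= f z <= 1)%R -> (0 <= D)%R ->
  (forall x y, f x - f y <= D * (w x + w y))%R ->
  forall x y, (fine (sg T (EFin \o f) x) - fine (sg T (EFin \o f) y) <=
    harris_rate * D * (w x + w y))%R.
Proof.
move=> mf f01 D0 osc x y.
have K0' := K0; have d0' := d0; have eta0' := eta0; have d1' := d1.
pose b := (d * eta / (2 * K))%R.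
have de0 : (0 < d * eta)%R by rewrite mulr_gt0.
have bK : (b * K * 2 = d * eta)%R by rewrite /b; field; rewrite gt_eqF.
have b0 : (0 < b)%R by rewrite divr_gt0// mulr_gt0.
have w0 z : (0 <= w z)%R by rewrite addr_ge0// mulr_ge0// ltW.
have mw : measurable_fun setT w by apply: measurable_funD => //; exact: measurable_funM.
pose E : set R := [set r | exists z, r = (f z + D * w z)%R].
(* The infimum [c] of [f + D w] is a centre: [f - D w <= c <= f + D w] everywhere. *)
have E_lb : lbound E 0%R by move=> r [z ->]; rewrite addr_ge0// ?mulr_ge0//; case/andP: (f01 z).
have hE : has_inf E by split; [exists (f 0%R + D * w 0%R)%R, 0%R|exists 0%R].
pose c := inf E.
have c_le z : (c <= f z + D * w z)%R by apply: (ge_inf hE.2); exists z.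
have c_ge z : (f z - D * w z <= c)%R.
  apply: lb_le_inf; first exact: hE.1.
  by move=> r [u ->]; have := osc z u; lra.
have c0 : (0 <= c)%R by apply: lb_le_inf => //; exact: hE.1.
pose gp z := (f z + D * w z - c)%R; pose gm z := (c + D * w z - f z)%R.
have gp0 z : (0 <= gp z)%R by rewrite subr_ge0.
have gm0 z : (0 <= gm z)%R by have := c_ge z; rewrite /gm; lra.
have mDw : measurable_fun setT (fun z => D * w z)%R by exact: measurable_funM.
have mgp : measurable_fun setT gp by apply: measurable_funB => //; exact: measurable_funD.
have mgm : measurable_fun setT gm by apply: measurable_funB => //; exact: measurable_funD.
have hgp : pos_meas (EFin \o gp) by exact: pos_meas_EFin.
have hgm : pos_meas (EFin \o gm) by exact: pos_meas_EFin.
have hf : pos_meas (EFin \o f) by apply: pos_meas_EFin => // z; case/andP: (f01 z).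
have hV : pos_meas (EFin \o V) by exact: pos_meas_EFin.
have h1 : pos_meas (cst 1 : R -> \bar R) by split.
have hc : pos_meas (fun z : R => c%:E * cst 1 z) by apply: pos_measM => //; split => // z; rewrite lee_fin.
have hD : pos_meas (fun z : R => D%:E * cst 1 z) by apply: pos_measM => //; split => // z; rewrite lee_fin.
have Db0 : (0 <= D * b)%R by rewrite mulr_ge0// ltW.
have hDb : pos_meas (fun z : R => (D * b)%:E * (EFin \o V) z).
  by apply: pos_measM => //; split => // z; rewrite lee_fin.
have fin_sgf z : sg T (EFin \o f) z = (fine (sg T (EFin \o f) z))%:E.
  rewrite fineK// ge0_fin_numE; last exact: (pos_meas_sg _ _ _ _ hf).2.
  apply: le_lt_trans (ltry 1); apply: sg_le_cst => // u.
  by rewrite lee_fin; case/andP: (f01 u).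
have fin_sgV z : sg T (EFin \o V) z = (fine (sg T (EFin \o V) z))%:E.
  rewrite fineK// ge0_fin_numE; last exact: (pos_meas_sg _ _ _ _ hV).2.
  exact: le_lt_trans (driftT z) (ltry _).
have drift z : (fine (sg T (EFin \o V) z) <= V z / 4 + K)%R.
  by rewrite -lee_fin -fin_sgV.
have eqp z : sg T (EFin \o gp) z + c%:E =
    (fine (sg T (EFin \o f) z) + D + D * b * fine (sg T (EFin \o V) z))%:E.
  have : sg T (fun u => (EFin \o gp) u + c%:E * cst 1 u) z =
      sg T (fun u => (EFin \o f) u + (D%:E * cst 1 u + (D * b)%:E * (EFin \o V) u)) z.
    apply: sg_eq => u; rewrite /= !mule1 -EFinM -!EFinD; congr EFin.
    by rewrite /gp /w -/b; ring.
  rewrite !sgD ?sgZ ?sg1//; last exact: pos_measD.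
  by rewrite !mule1 fin_sgf fin_sgV -EFinM -!EFinD addrA.
have eqm z : sg T (EFin \o gm) z + (fine (sg T (EFin \o f) z))%:E =
    (c + D + D * b * fine (sg T (EFin \o V) z))%:E.
  have : sg T (fun u => (EFin \o gm) u + (EFin \o f) u) z =
      sg T (fun u => c%:E * cst 1 u + (D%:E * cst 1 u + (D * b)%:E * (EFin \o V) u)) z.
    apply: sg_eq => u; rewrite /= !mule1 -EFinM -!EFinD; congr EFin.
    by rewrite /gm /w -/b; ring.
  rewrite !sgD ?sgZ ?sg1//; last exact: pos_measD.
  by rewrite !mule1 fin_sgV -EFinM -!EFinD addrA -fin_sgf.
have sp0 z : 0 <= sg T (EFin \o gp) z := (pos_meas_sg a_p a_m J T hgp).2 z.
have sm0 z : 0 <= sg T (EFin \o gm) z := (pos_meas_sg a_p a_m J T hgm).2 z.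
have finp z : sg T (EFin \o gp) z = (fine (sg T (EFin \o gp) z))%:E.
  rewrite fineK// ge0_fin_numE//; apply: le_lt_trans (ltry (fine (sg T (EFin \o f) z) + D + D * b * fine (sg T (EFin \o V) z))%R).
  by rewrite -eqp leeDl// lee_fin.
have finm z : sg T (EFin \o gm) z = (fine (sg T (EFin \o gm) z))%:E.
  rewrite fineK// ge0_fin_numE//; apply: le_lt_trans (ltry (c + D + D * b * fine (sg T (EFin \o V) z))%R).
  by rewrite -eqm leeDl// lee_fin fine_ge0//; exact: (pos_meas_sg _ _ _ _ hf).2.
have EP : (fine (sg T (EFin \o gp) y) + c = fine (sg T (EFin \o f) y) + D + D * b * fine (sg T (EFin \o V) y))%R.
  by apply: EFin_inj; rewrite -eqp [in RHS]finp.
have EM : (fine (sg T (EFin \o gm) x) + fine (sg T (EFin \o f) x) = c + D + D * b * fine (sg T (EFin \o V) x))%R.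
  by apply: EFin_inj; rewrite -eqm [in RHS]finm.
have P0 : (0 <= fine (sg T (EFin \o gp) y))%R by exact: fine_ge0.
have M0 : (0 <= fine (sg T (EFin \o gm) x))%R by exact: fine_ge0.
have dx := ler_wpM2l Db0 (drift x); have dy := ler_wpM2l Db0 (drift y).
have DbK : (D * b * K * 2 = D * (d * eta))%R by rewrite -bK; ring.
rewrite /harris_rate /w -/b.
have Vx0 := V0 x; have Vy0 := V0 y.
have DVx : (0 <= D * b * V x)%R by rewrite mulr_ge0.
have DVy : (0 <= D * b * V y)%R by rewrite mulr_ge0.
have Dd : (D * (d * eta) <= D)%R by apply: ler_piMr.
have Dd0 : (0 <= D * (d * eta))%R by rewrite mulr_ge0// ltW.
have dVx : (d * eta * (D * b * V x) <= D * b * V x)%R by apply: ler_piMl.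
have dVy : (d * eta * (D * b * V y) <= D * b * V y)%R by apply: ler_piMl.
(* If both values are small, the minorization gains [2 D d eta] against a drift cost of [D d eta].
   Otherwise the drift factor [1 / 4] contracts enough by itself; the threshold 16 is what this case
   needs given [d eta <= 1]. *)
case: (boolP ((V x <= 16 * K) && (V y <= 16 * K))%R) => [/andP[Vx Vy]|]; last first.
  rewrite negb_and -!ltNge => far.
  have big : (D * b * (16 * K) <= D * b * V x + D * b * V y)%R.
    case/orP: far => /ltW h.
      by have := ler_wpM2l Db0 h; lra.
    by have := ler_wpM2l Db0 h; lra.
  by move: EP EM; lra.
have minx := minorT Vx mgm gm0; have miny := minorT Vy mgp gp0.
have hp := pos_meas_mass_integrand a_p eta hgp; have hm := pos_meas_mass_integrand a_p eta hgm.
have msum : (2 * D * eta)%:E <= mass eta (EFin \o gp) + mass eta (EFin \o gm).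
  rewrite -(ge0_integralD mu measurableT (fun z _ => hp.2 z) hp.1 (fun z _ => hm.2 z) hm.1).
  rewrite [X in _ <= X](_ : _ = mass eta (fun z => (EFin \o gp) z + (EFin \o gm) z)); last first.
    by apply: eq_integral => z _; rewrite /= muleDr// ge0_adde_def// inE lee_fin.
  rewrite EFinM; apply: mass_ge => //; [exact: pos_measD|exact: ltW|by rewrite lee_fin mulr_ge0|].
  move=> z _; rewrite /= -EFinD lee_fin /gp /gm /w -/b.
  have : (0 <= D * b * V (a_p * z))%R by rewrite mulr_ge0.
  by lra.
have d0E : 0 <= d%:E by rewrite lee_fin ltW.
have := lee_wpmul2l d0E msum.
rewrite muleDr//; last by rewrite ge0_adde_def// inE; exact: mass_ge0.
move=> /le_trans /(_ (leeD miny minx)).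
rewrite finp finm -EFinM -EFinD lee_fin; move: EP EM; lra.
Qed.

End contraction.
End harris.

(** * Exponential mixing *)

Section mixing.
Context {R : realType}.
Variables (a_p a_m : R) (J : {finite_measure set R -> \bar R}) (eps0 m : R).
Hypotheses (a_p_gt0 : (0 < a_p)%R) (a_p_lt_a_m : (a_p < a_m)%R).
Hypothesis J_neg : J `[0%R, +oo[%classic = 0.
Hypothesis eps0_gt0 : (0 < eps0)%R.
Hypothesis J_moment : \int[J]_xi (expR (- eps0 * xi))%:E < +oo.
Hypothesis J_mean : \int[J]_xi (Num.max 0 (- xi)%R)%:E = m%:E.
Notation mu := (@lebesgue_measure R).
Notation L := (rate J).
Notation sg := (sg a_p a_m J).
Notation mass := (mass a_p).

Lemma rate_gt0 : (0 < m)%R -> (0 < L)%R.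
Proof.
move=> m0; rewrite lt_neqAle rate_ge0 andbT; apply/eqP => L0.
have J0 : J setT = 0 by rewrite rateE -L0.
have hl := @pos_meas_loss R.
have := J_mean; rewrite (ge0_negligible_integral measurableT _ hl.1 (fun z _ => hl.2 z) J0)//.
by rewrite setDv integral_set0 => -[] h; move: m0; rewrite -h ltxx.
Qed.

Let osc (w f : R -> R) (D : R) := forall x y, (f x - f y <= D * (w x + w y))%R.

Lemma harris_constants : (a_p < m)%R -> (m < a_m)%R ->
  exists (w : R -> R) (T al k : R),
  [/\ (0 < T)%R, (0 < al < 1)%R, (0 <= k)%R &
  [/\ measurable_fun setT w, forall y, (1 <= w y)%R,
    forall t y, (0 <= t)%R -> sg t (EFin \o w) y <= (w y + k)%:E &
    forall (f : R -> R) (D : R), measurable_fun setT f -> (forall z, 0 <= f z <= 1)%R -> (0 <= D)%R ->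
      osc w f D -> osc w (fun x => fine (sg T (EFin \o f) x)) (al * D)]].
Proof.
move=> apm mam; have ap0 := a_p_gt0.
have L0 : (0 < L)%R by apply: rate_gt0; lra.
have [q [K [b [q0 K0 b0 drift]]]] :=
  lyapunov_drift a_p_gt0 a_p_lt_a_m J_neg eps0_gt0 J_moment J_mean apm mam.
have [eta eta0 doeb] := doeblin a_p_gt0 a_p_lt_a_m J_neg L0.
pose V := lyapunov q; have mV : measurable_fun setT V := measurable_lyapunov q.
have V0 : forall y, (0 <= V y)%R := lyapunov_ge0 q.
(* Radius of a ball containing the sublevel set [V <= 16 K]; the added 1 keeps the logarithm
   nonnegative. *)
pose M := (ln (16 * K + 1) / q)%R.
have lK : (0 <= ln (16 * K + 1))%R by rewrite ln_ge0; lra.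
have M0 : (0 <= M)%R by rewrite divr_ge0// ltW.
have VM y : (V y <= 16 * K)%R -> (`|y| <= M)%R.
  move=> Vy; rewrite /M ler_pdivlMr// -ler_expR lnK ?posrE; last lra.
  have e1 := expR_ge0 (q * y); have e2 := expR_ge0 (- q * y).
  rewrite /V /lyapunov in Vy; case: (leP 0 y)%R => y0.
    by rewrite ger0_norm// mulrC; lra.
  by rewrite ltr0_norm// mulrC mulrN -mulNr; lra.
have l4 : (0 < ln (4 : R))%R by rewrite ln_gt0//; lra.
(* A time [T >= ln 4 / b] brings the drift factor down to [1 / 4], as [harris_step] requires. *)
have [T [TT0 T0] [d d0 hd]] := doeb M (ln 4 / b)%R M0.
have T00 : (0 < T)%R by apply: lt_le_trans TT0; rewrite divr_gt0.
(* Lowering [d] preserves the minorization and secures [d' eta <= 1]. *)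
pose d' := Num.min d (eta^-1)%R.
have d'0 : (0 < d')%R by rewrite lt_min d0 invr_gt0.
have d'1 : (d' * eta <= 1)%R by rewrite -ler_pdivlMr// div1r ge_min lexx orbT.
have driftT y : sg T (EFin \o V) y <= (V y / 4 + K)%:E.
  apply: le_trans (drift T y T0) _; rewrite lee_fin lerD2r mulrC ler_wpM2l//.
  rewrite expRN lef_pV2 ?posrE ?expR_gt0// -[leLHS]lnK ?posrE// ler_expR.
  by rewrite mulrC -ler_pdivrMr.
have minorT y : (V y <= 16 * K)%R ->
    forall f : R -> R, measurable_fun setT f -> (forall z, (0 <= f z)%R) ->
    d'%:E * mass eta (EFin \o f) <= sg T (EFin \o f) y.
  move=> /VM yM f mf f0; apply: le_trans (@minorization_real _ a_p a_m J eta T d y (ltW d0) _ f mf f0).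
    rewrite lee_wpmul2r ?mass_ge0//; first exact: pos_meas_EFin.
    by rewrite lee_fin ge_min lexx.
  by move=> g hg g1; exact: hd.
pose B := (d' * eta / (2 * K))%R.
have B0 : (0 < B)%R by rewrite divr_gt0// mulr_gt0.
have de0 : (0 < d' * eta)%R by rewrite mulr_gt0.
exists (harris_weight V K d' eta), T, (harris_rate d' eta), (B * K)%R; split => //.
- by rewrite /harris_rate; apply/andP; split; lra.
- by rewrite mulr_ge0// ltW.
split.
- by apply: measurable_funD => //; exact: measurable_funM.
- by move=> y; rewrite /harris_weight lerDl mulr_ge0// ltW.
- move=> t y t0.
  have hV : pos_meas (EFin \o V) by exact: pos_meas_EFin.
  have hBV : pos_meas (fun z => B%:E * (EFin \o V) z).
    by apply: pos_measM => //; split => // z; rewrite lee_fin ltW.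
  have h1 : pos_meas (cst 1 : R -> \bar R) by split.
  have -> : sg t (EFin \o harris_weight V K d' eta) y = sg t (fun z => cst 1 z + B%:E * (EFin \o V) z) y.
    by apply: sg_eq => z.
  rewrite sgD// sg1// sgZ// ?(ltW B0)//.
  have B0E : 0 <= B%:E by rewrite lee_fin ltW.
  have h := lee_wpmul2l B0E (drift t y t0).
  apply: le_trans (leeD2l _ h) _; rewrite -EFinM -EFinD lee_fin /harris_weight -/B mulrDr addrA lerD2r lerD2l.
  rewrite ler_wpM2l ?(ltW B0)//; apply: ler_piMl => //.
  by rewrite -[leRHS]expR0 ler_expR oppr_le0 mulr_ge0// ltW.
- move=> f D mf f01 D0 hosc x y.
  exact: (harris_step mV V0 T0 K0 d'0 eta0 d'1 driftT minorT mf f01 D0 hosc).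
Qed.

(** Contraction acts at multiples of [T]. For [t >= n T] the bound on [sg u w], uniform in [u] up to
    the constant [k], compares [F t x] with [F (n T) y] up to [al ^ n] times a function of [x] and
    [y]. *)
Lemma exponential_mixing : (a_p < m)%R -> (m < a_m)%R ->
  exists2 C : R -> R, (forall x, (0 <= C x)%R) & exists2 rho : R, (0 < rho)%R &
  forall f : R -> R, measurable_fun setT f -> (forall z, 0 <= f z <= 1)%R ->
  exists l : R, forall t x, (0 <= t)%R ->
    (`|fine (sg t (EFin \o f) x) - l| <= C x * expR (- (rho * t)))%R.
Proof.
move=> apm mam.
have [w [T [al [k [T0 /andP[al0 al1] k0 [mw w1 sgw step]]]]]] := harris_constants apm mam.
pose rho := (- ln al / T)%R.
have rho0 : (0 < rho)%R by rewrite divr_gt0// oppr_gt0 ln_lt0// al0.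
pose c (x y : R) := (w x + w y + k)%R.
have c0 x y : (0 <= c x y)%R by have := w1 x; have := w1 y; rewrite /c; lra.
exists (fun x => (c x 0 + c 0 0) / al)%R.
  by move=> x; apply: divr_ge0; [exact: addr_ge0|exact: ltW].
exists rho => // f mf f01.
have hf : pos_meas (EFin \o f) by apply: pos_meas_EFin => // z; case/andP: (f01 z).
have f1 z : (EFin \o f) z <= 1%:E by rewrite lee_fin; case/andP: (f01 z).
pose F t x := fine (sg t (EFin \o f) x).
have FE t x : (0 <= t)%R -> sg t (EFin \o f) x = (F t x)%:E.
  move=> t0; rewrite /F fineK// ge0_fin_numE; last exact: (pos_meas_sg _ _ _ _ hf).2.
  by apply: le_lt_trans (ltry 1); apply: sg_le_cst.
have F01 t z : (0 <= t)%R -> (0 <= F t z <= 1)%R.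
  move=> t0; rewrite -!lee_fin -FE// (pos_meas_sg _ _ _ _ hf).2/=.
  exact: sg_le_cst.
have mF t : measurable_fun setT (F t).
  by apply: measurableT_comp => //; exact: (pos_meas_sg _ _ _ _ hf).1.
have FD (t u x : R) : (0 <= t)%R -> (0 <= u)%R -> (F (t + u) x)%:E = sg t (EFin \o F u) x.
  move=> t0 u0; rewrite -FE ?addr_ge0// (sg_semigroup J a_p_gt0 a_p_lt_a_m _ hf ler01 f1 t0 u0).
  by apply: sg_eq => z; rewrite /= FE.
have nT0 n : (0 <= n%:R * T)%R by rewrite mulr_ge0// ltW.
have oscF n : osc w (F (n%:R * T)%R) (al ^+ n)%R.
  elim: n => [|n IH] x y.
    have h0 : (0 <= 0 * T)%R by rewrite mul0r.
    have /andP[x0 x1] := F01 (0 * T)%R x h0; have /andP[y0 y1] := F01 (0 * T)%R y h0.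
    by have := w1 x; have := w1 y; rewrite expr0; lra.
  have aln0 : (0 <= al ^+ n)%R by rewrite exprn_ge0// ltW.
  have := step _ _ (mF (n%:R * T)%R) (fun z => F01 _ z (nT0 n)) aln0 IH x y.
  rewrite -!FD ?(ltW T0)//= -exprS.
  by have -> : (T + n%:R * T = n.+1%:R * T)%R by rewrite -natr1; ring.
have main n t x y : (n%:R * T <= t)%R ->
    (F t x <= F (n%:R * T) y + al ^+ n * c x y)%R /\
    (F (n%:R * T) y <= F t x + al ^+ n * c x y)%R.
  move=> nt; pose u := (t - n%:R * T)%R; have u0 : (0 <= u)%R by rewrite subr_ge0.
  have aln0 : (0 <= al ^+ n)%R by rewrite exprn_ge0// ltW.
  pose D := (al ^+ n)%R; pose Fy := F (n%:R * T)%R y; pose G := F (n%:R * T)%R.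
  have /andP[Fy0 Fy1] := F01 _ y (nT0 n).
  have wy0 : (0 <= w y)%R by have := w1 y; lra.
  have wp z : (0 <= w z)%R by have := w1 z; lra.
  have hw : pos_meas (EFin \o w) by exact: pos_meas_EFin.
  have hG : pos_meas (EFin \o G) by apply: pos_meas_EFin => [|z]; [exact: mF|case/andP: (F01 _ z (nT0 n))].
  have h1 : pos_meas (cst 1 : R -> \bar R) by split.
  have Ft : (F t x)%:E = sg u (EFin \o G) x by rewrite -FD// /u subrK.
  have sgw' := sgw u x u0.
  have h0 : (0 <= D * w y)%R by rewrite mulr_ge0.
  have h00 : (0 <= Fy + D * w y)%R by rewrite addr_ge0.
  have hc1 : pos_meas (fun z : R => (Fy + D * w y)%:E * cst 1 z).
    by apply: pos_measM => //; split => // z; rewrite lee_fin.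
  have hc2 : pos_meas (fun z : R => (D * w y)%:E * cst 1 z).
    by apply: pos_measM => //; split => // z; rewrite lee_fin.
  have hc3 : pos_meas (fun z : R => Fy%:E * cst 1 z).
    by apply: pos_measM => //; split => // z; rewrite lee_fin.
  have hDw : pos_meas (fun z : R => D%:E * (EFin \o w) z).
    by apply: pos_measM => //; split => // z; rewrite lee_fin.
  have DE : 0 <= D%:E by rewrite lee_fin.
  have DW := lee_wpmul2l DE sgw'.
  split; rewrite -lee_fin.
    rewrite Ft; apply: (@le_trans _ _ (sg u (fun z => (Fy + D * w y)%:E * cst 1 z + D%:E * (EFin \o w) z) x)).
      apply: le_sg => //; first exact: pos_measD.
      by move=> z; rewrite /= mule1 -EFinM -EFinD lee_fin; have := oscF n z y; rewrite -/D -/Fy -/G; lra.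
    rewrite sgD// !sgZ// sg1// mule1; apply: le_trans (leeD2l _ DW) _.
    by rewrite -EFinM -EFinD lee_fin /c -/D -/Fy; lra.
  have : sg u (fun z => Fy%:E * cst 1 z) x <=
      sg u (fun z => (EFin \o G) z + ((D * w y)%:E * cst 1 z + D%:E * (EFin \o w) z)) x.
    apply: le_sg => //; first by apply: pos_measD => //; exact: pos_measD.
    by move=> z; rewrite /= !mule1 -EFinM -!EFinD lee_fin; have := oscF n y z; rewrite -/D -/Fy -/G; lra.
  rewrite !sgD ?sgZ ?sg1//; last exact: pos_measD.
  rewrite !mule1 -Ft => h; apply: le_trans h _.
  rewrite EFinD leeD2l//; apply: le_trans (leeD2l _ DW) _.
  by rewrite -EFinM -EFinD lee_fin /c -/D; lra.
(* The limit is the supremum of the lower bounds along multiples of [T]; every upper bound dominates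
   all of them, so the limit is squeezed. *)
pose S : set R := [set r | exists n : nat, r = (F (n%:R * T) 0 - al ^+ n * c 0 0)%R].
have Sub n : ubound S (F (n%:R * T) 0 + al ^+ n * c 0 0)%R.
  move=> r [i ->]; case: (leqP n i) => ni.
    have h : (n%:R * T <= i%:R * T)%R by rewrite ler_pM2r// ler_nat.
    have [h1 _] := main n _ 0%R 0%R h.
    have : (0 <= al ^+ i * c 0 0)%R by rewrite mulr_ge0// exprn_ge0// ltW.
    lra.
  have h : (i%:R * T <= n%:R * T)%R by rewrite ler_pM2r// ler_nat ltnW.
  have [_ h1] := main i _ 0%R 0%R h.
  have : (0 <= al ^+ n * c 0 0)%R by rewrite mulr_ge0// exprn_ge0// ltW.
  lra.
have hS : has_sup S.
  by split; [exists (F (0%:R * T) 0 - al ^+ 0 * c 0 0)%R, 0%N|exists (F (0%:R * T) 0 + al ^+ 0 * c 0 0)%R].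
exists (sup S) => t x t0.
have l1 n : (F (n%:R * T) 0 - al ^+ n * c 0 0 <= sup S)%R by apply: (ub_le_sup hS.2); exists n.
have l2 n : (sup S <= F (n%:R * T) 0 + al ^+ n * c 0 0)%R by apply: ge_sup => //; exact: hS.1.
have tT : (0 <= t / T)%R by rewrite divr_ge0// ltW.
have /andP[n1 n2] := truncn_itv tT; set n := Num.truncn (t / T) in n1 n2.
have nt : (n%:R * T <= t)%R by rewrite -ler_pdivlMr.
have [h1 h2] := main n t x 0%R nt.
(* [n] is the integer part of [t / T], so [al ^ n] exceeds [exp(- rho t)] by at most the factor
   [1 / al] included in the constant. *)
have aln : (al ^+ n <= expR (- (rho * t)) / al)%R.
  rewrite ler_pdivlMr// -exprSr.
  have -> : (al ^+ n.+1 = expR (n.+1%:R * ln al))%R by rewrite expRM_natl lnK ?posrE.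
  rewrite ler_expR /rho.
  have -> : (- (- ln al / T * t) = t / T * ln al)%R by ring.
  by rewrite ler_wnM2r ?ln_le0 ?ltW.
have cc : (0 <= c x 0 + c 0 0)%R by exact: addr_ge0.
have := ler_wpM2l cc aln.
have -> : ((c x 0 + c 0 0) * (expR (- (rho * t)) / al) = (c x 0 + c 0 0) / al * expR (- (rho * t)))%R by ring.
have := l1 n; have := l2 n; rewrite -/(F t x) ler_norml => *.
by apply/andP; split; lra.
Qed.

End mixing.

(** * The limit as a probability measure *)

Section limit_law.
Context {R : realType}.
Variables (a_p a_m : R) (J : {finite_measure set R -> \bar R}).
Notation sg := (sg a_p a_m J).
Variables (C : R -> R) (rho : R).
Hypotheses (C_ge0 : forall x, (0 <= C x)%R) (rho_gt0 : (0 < rho)%R).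

Let test (f : R -> R) := measurable_fun setT f /\ forall z, (0 <= f z <= 1)%R.
Let F (t : R) (f : R -> R) (x : R) := fine (sg t (EFin \o f) x).
Let close (f : R -> R) (l : R) :=
  forall t x : R, (0 <= t)%R -> (`|F t f x - l| <= C x * expR (- (rho * t)))%R.

Hypothesis mixing : forall f : R -> R, measurable_fun setT f ->
  (forall z, 0 <= f z <= 1)%R -> exists l : R, close f l.

Definition limit_value (f : R -> R) : R := xget 0%R (close f).

Let limit_valueP f : test f -> close f (limit_value f).
Proof. by move=> [mf f01]; have [l hl] := mixing mf f01; exact: (xgetPex 0%R (ex_intro _ l hl)). Qed.

Lemma limit_value_close (f : R -> R) t x : measurable_fun setT f -> (forall z, 0 <= f z <= 1)%R ->
  (0 <= t)%R ->
  (`|fine (sg t (EFin \o f) x) - limit_value f| <= C x * expR (- (rho * t)))%R.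
Proof. by move=> mf f01 t0; exact: (limit_valueP (conj mf f01)). Qed.

Let eq0_exp (r M : R) : (0 <= M)%R ->
  (forall t, (0 <= t)%R -> (r <= M * expR (- (rho * t)))%R) -> (r <= 0)%R.
Proof.
move=> M0 H; rewrite leNgt; apply/negP => r0.
have r0' := rho_gt0.
have M1 : (0 < M + r)%R by lra.
have rt : (rho * ((M + r) / r / rho) = (M + r) / r)%R by field; rewrite !gt_eqF.
have := H _ (ltW (divr_gt0 (divr_gt0 M1 r0) r0')); rewrite rt => h.
have h1 : (1 + (M + r) / r <= expR ((M + r) / r))%R by exact: expR_ge1Dx.
have e0 : (0 < expR ((M + r) / r))%R := expR_gt0 _.
have h2 : (r * expR ((M + r) / r) <= M)%R.
  by rewrite -ler_pdivlMr// -expRN.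
have h3 := ler_wpM2l (ltW r0) h1.
have : (r * ((M + r) / r) = M + r)%R by rewrite mulrC divfK ?gt_eqF.
by lra.
Qed.

Let testM f : test f -> pos_meas (EFin \o f).
Proof. by move=> [mf f01]; apply: pos_meas_EFin => // z; case/andP: (f01 z). Qed.

Let FE t f x : test f -> (0 <= t)%R -> sg t (EFin \o f) x = (F t f x)%:E.
Proof.
move=> tf t0; have hf := testM tf.
rewrite /F fineK// ge0_fin_numE; last exact: (pos_meas_sg _ _ _ _ hf).2.
apply: le_lt_trans (ltry 1); apply: sg_le_cst => // z.
by rewrite lee_fin; case/andP: (tf.2 z).
Qed.

Let F01 t f x : test f -> (0 <= t)%R -> (0 <= F t f x <= 1)%R.
Proof.
move=> tf t0; rewrite -!lee_fin -FE// (pos_meas_sg _ _ _ _ (testM tf)).2/=.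
by apply: sg_le_cst => //; [exact: testM|move=> z; rewrite lee_fin; case/andP: (tf.2 z)].
Qed.

Lemma limit_value01 (f : R -> R) : measurable_fun setT f -> (forall z, 0 <= f z <= 1)%R ->
  (0 <= limit_value f <= 1)%R.
Proof.
move=> mf f01; have tf : test f by split.
have c0 := C_ge0 0%R.
apply/andP; split; rewrite -subr_le0; apply: (eq0_exp c0) => t t0;
  have := limit_valueP tf 0%R t0; rewrite ler_norml => /andP[h1 h2];
  have /andP[h3 h4] := F01 0%R tf t0; lra.
Qed.

Let FD (t a b : R) (f g : R -> R) (x : R) : test f -> test g -> test (fun z => a * f z + b * g z)%R ->
  (0 <= a)%R -> (0 <= b)%R -> (0 <= t)%R ->
  (F t (fun z => a * f z + b * g z) x = a * F t f x + b * F t g x)%R.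
Proof.
move=> tf tg tfg a0 b0 t0; have hf := testM tf; have hg := testM tg.
have za : pos_meas (fun z => a%:E * (EFin \o f) z) by apply: pos_measM => //; split => // z; rewrite lee_fin.
have zb : pos_meas (fun z => b%:E * (EFin \o g) z) by apply: pos_measM => //; split => // z; rewrite lee_fin.
apply: EFin_inj; rewrite -FE// EFinD !EFinM -!FE// -!sgZ// -sgD//.
Qed.

Let limit_valueD (a b : R) (f g : R -> R) : test f -> test g -> test (fun z => a * f z + b * g z)%R ->
  (0 <= a)%R -> (0 <= b)%R ->
  (limit_value (fun z => a * f z + b * g z) = a * limit_value f + b * limit_value g)%R.
Proof.
move=> tf tg tfg a0 b0; have c0 := C_ge0 0%R.
have c1 : (0 <= C 0 * (1 + a + b))%R by rewrite mulr_ge0//; lra.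
have key t : (0 <= t)%R ->
    (`|limit_value (fun z => a * f z + b * g z) - (a * limit_value f + b * limit_value g)|
       <= C 0 * (1 + a + b) * expR (- (rho * t)))%R.
  move=> t0; have := limit_valueP tf 0%R t0; have := limit_valueP tg 0%R t0.
  have := limit_valueP tfg 0%R t0; rewrite FD//.
  rewrite !ler_norml => /andP[h1 h2] /andP[h3 h4] /andP[h5 h6].
  have := ler_wpM2l a0 h5; have := ler_wpM2l a0 h6.
  have := ler_wpM2l b0 h3; have := ler_wpM2l b0 h4 => *.
  by apply/andP; split; lra.
by apply/eqP; rewrite -subr_eq0 -normr_le0; exact: eq0_exp key.
Qed.

Let test_indic (A : set R) : measurable A -> test \1_A.
Proof.
move=> mA; split; first exact: measurable_indic.
by move=> z; rewrite indicE ler0n lern1; case: (z \in A).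
Qed.

(** The maximum keeps the value nonnegative on nonmeasurable sets, where [limit_value] is
    unconstrained. *)
Definition limit_law (A : set R) : \bar R := (Num.max 0%R (limit_value \1_A))%:E.

Let limit_lawE A : measurable A -> limit_law A = (limit_value \1_A)%:E.
Proof.
move=> mA; have [m1 m2] := test_indic mA.
by rewrite /limit_law max_r//; case/andP: (limit_value01 m1 m2).
Qed.

Let limit_value0 : limit_value (fun=> 0%R) = 0%R.
Proof.
have t0 : test (fun=> 0%R) by split => // z; rewrite lexx ler01.
have t00 : test (fun z : R => 0 * 0 + 0 * 0)%R by rewrite mul0r addr0.
by have := limit_valueD t0 t0 t00 (lexx _) (lexx _); rewrite !mul0r addr0.
Qed.

Let limit_law0 : limit_law set0 = 0.
Proof. by rewrite /limit_law indic0 -[X in limit_value X]/(fun=> 0%R) limit_value0 maxxx. Qed.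

Let limit_law_ge0 A : 0 <= limit_law A.
Proof. by rewrite lee_fin le_max lexx. Qed.

(** The rate of convergence is the same for all test functions: one time [t] makes the error at most
    [e / 3] for all partial sums at once, and at this [t] countable additivity is that of [sg]. *)
Let limit_law_sigma_additive : semi_sigma_additive limit_law.
Proof.
move=> A mA tA mU.
rewrite limit_lawE//.
have pE (z : R) : (\1_(\bigcup_n A n) z)%:E = \sum_(0 <= i <oo) (\1_(A i) z)%:E :> \bar R.
  exact: (measure_semi_bigcup (dirac z : {measure set R -> \bar R}) mA tA mU).
have testn n : test (fun z => \sum_(i < n) \1_(A i) z)%R.
  split.
    by apply: measurable_sum => i; exact: measurable_indic.
  move=> z; rewrite sumr_ge0/=; last by move=> i _; rewrite indicE.
  rewrite -lee_fin -sumEFin; apply: (@le_trans _ _ (\1_(\bigcup_n A n) z)%:E); last first.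
    by rewrite lee_fin; case/andP: ((test_indic mU).2 z).
  rewrite pE -(big_mkord xpredT (fun i => (\1_(A i) z)%:E)); apply: nneseries_lim_ge => i _ _.
  by rewrite lee_fin indicE.
have sumn n : limit_value (fun z => \sum_(i < n) \1_(A i) z)%R = (\sum_(i < n) limit_value \1_(A i))%R.
  elim: n => [|n IH].
    have e : (fun z : R => \sum_(i < 0) \1_(A i) z)%R = (fun=> 0%R) :> (R -> R).
      by apply: funext => z; rewrite big_ord0.
    by rewrite e limit_value0 big_ord0.
  have e : (fun z : R => \sum_(i < n.+1) \1_(A i) z)%R =
      (fun z : R => 1 * (\sum_(i < n) \1_(A i) z) + 1 * \1_(A n) z)%R :> (R -> R).
    by apply: funext => z; rewrite big_ord_recr/= !mul1r.
  have tn := testn n.+1; rewrite e in tn *.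
  by rewrite (limit_valueD (testn n) (test_indic (mA n)) tn ler01 ler01) IH !mul1r big_ord_recr.
have -> : (fun n => \sum_(0 <= i < n) limit_law (A i)) =
    EFin \o (fun n => limit_value (fun z => \sum_(i < n) \1_(A i) z)%R).
  apply: funext => n; rewrite /= sumn -sumEFin big_mkord.
  by apply: eq_bigr => i _; rewrite limit_lawE.
apply: cvg_EFin; first by near=> n.
apply/cvgrPdist_le => e e0.
have c0 := C_ge0 0%R; have r0 := rho_gt0.
pose t := (C 0 / (e / 3) / rho)%R.
have e30 : (0 < e / 3)%R by lra.
have t0 : (0 <= t)%R by rewrite !divr_ge0// ltW.
have small : (C 0 * expR (- (rho * t)) <= e / 3)%R.
  rewrite expRN ler_pdivrMr ?expR_gt0// mulrC -ler_pdivrMr//.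
  have -> : (rho * t = C 0 / (e / 3))%R by rewrite /t mulrC divfK ?gt_eqF.
  by have := expR_ge1Dx (C 0 / (e / 3))%R; lra.
have cv : (fun n => F t (fun z => \sum_(i < n) \1_(A i) z)%R 0%R) @ \oo --> F t \1_(\bigcup_n A n) 0%R.
  have hA i : pos_meas (EFin \o (\1_(A i) : R -> R)) by apply: testM; exact: test_indic.
  apply: fine_cvg; rewrite -FE//; last exact: test_indic.
  have -> : sg t (EFin \o \1_(\bigcup_n A n)) 0%R = \sum_(0 <= i <oo) sg t (EFin \o \1_(A i)) 0%R.
    by rewrite -sg_series//; apply: sg_eq => z; rewrite /= pE.
  have -> : (fun n => sg t (EFin \o (fun z => \sum_(i < n) \1_(A i) z)%R) 0%R) =
      (fun n => \sum_(0 <= i < n) sg t (EFin \o \1_(A i)) 0%R).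
    apply: funext; elim => [|n IH].
      rewrite big_nil -[RHS](mul0e (sg t (EFin \o \1_(A 0%N)) 0%R)) -sgZ//.
      by apply: sg_eq => z; rewrite /= big_ord0 mul0e.
    rewrite big_nat_recr//= -IH -sgD//; last exact: testM.
    by apply: sg_eq => z; rewrite /= big_ord_recr EFinD.
  apply: is_cvg_nneseries => i _ _; exact: (pos_meas_sg _ _ _ _ (hA i)).2.
near=> n.
have : (`|F t \1_(\bigcup_n A n) 0 - F t (fun z => \sum_(i < n) \1_(A i) z) 0| <= e / 3)%R.
  by near: n; move/cvgrPdist_le : cv; exact.
have := limit_valueP (testn n) 0%R t0; have := limit_valueP (test_indic mU) 0%R t0.
rewrite !ler_norml => /andP[h1 h2] /andP[h3 h4] /andP[h5 h6].
rewrite [(fine \o _) n]/=; by apply/andP; split; lra.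
Unshelve. all: by end_near. Qed.

HB.instance Definition _ := isMeasure.Build _ R R limit_law
  limit_law0 limit_law_ge0 limit_law_sigma_additive.

Let limit_law_setT : limit_law setT = 1.
Proof.
rewrite limit_lawE//; congr EFin.
have tT := test_indic (@measurableT _ R); have c0 := C_ge0 0%R.
apply/eqP; rewrite -subr_eq0 -normr_le0; apply: (eq0_exp c0) => t t0.
have := limit_valueP tT 0%R t0.
have -> : F t \1_setT 0 = 1%R; last by rewrite distrC.
by rewrite /F indicT -(_ : cst 1 = EFin \o cst 1%R)// sg1.
Qed.

HB.instance Definition _ := Measure_isProbability.Build _ _ _ limit_law limit_law_setT.

(** Binary expansion: [g] is the average of the indicator of [g >= 1 / 2] and of a function [h] with
    values in [[0, 1]]. On the indicator the identity is the definition of the law, so each digit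
    halves the error. *)
Lemma integral_limit_law (f : R -> R) : measurable_fun setT f ->
  (forall z, 0 <= f z <= 1)%R -> \int[limit_law]_z (f z)%:E = (limit_value f)%:E.
Proof.
move=> mf f01.
have fin_int (g : R -> R) : test g -> exists2 I : R, \int[limit_law]_z (g z)%:E = I%:E & (0 <= I <= 1)%R.
  move=> tg; have hg := testM tg.
  have i0 : 0 <= \int[limit_law]_z (g z)%:E by apply: integral_ge0 => z _; exact: hg.2.
  have i1 : \int[limit_law]_z (g z)%:E <= 1.
    apply: (@le_trans _ _ (\int[limit_law]_z cst 1 z)).
      apply: ge0_le_integral => //; first by move=> z _; exact: hg.2.
        exact: hg.1.
      by move=> z _; rewrite lee_fin; case/andP: (tg.2 z).
    by have -> := integral_cst limit_law measurableT 1; rewrite mul1e probability_le1.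
  have fI : \int[limit_law]_z (g z)%:E \is a fin_num by rewrite ge0_fin_numE// (le_lt_trans i1)// ltry.
  exists (fine (\int[limit_law]_z (g z)%:E)); first by rewrite fineK.
  by rewrite -!lee_fin fineK// i0.
have key n : forall g, test g -> forall I, \int[limit_law]_z (g z)%:E = I%:E ->
    (`|I - limit_value g| <= (1 / 2) ^+ n)%R.
  elim: n => [|n IH] g tg I hI.
    have [I' hI' /andP[i0 i1]] := fin_int g tg; move: hI; rewrite hI' => -[<-].
    have /andP[l0 l1] := limit_value01 tg.1 tg.2.
    by rewrite expr0 ler_norml; apply/andP; split; lra.
  pose A : set R := [set z | (1 / 2 <= g z)%R].
  have mA : measurable A.
    have -> : A = g @^-1` `[(1 / 2)%R, +oo[%classic.
      by apply/seteqP; split => z; rewrite /A /= in_itv/= andbT.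
    by rewrite -[_ @^-1` _]setTI; apply: tg.1 => //; exact: measurable_itv.
  pose h (z : R) : R := (2 * g z - \1_A z)%R.
  have th : test h.
    split; first by apply: measurable_funB; [apply: measurable_funM => //; exact: tg.1|exact: measurable_indic].
    move=> z; have /andP[g0 g1] := tg.2 z; rewrite /h.
    have [Az|Az] := boolP (1 / 2 <= g z)%R.
      have -> : \1_A z = 1%R :> R by rewrite indicE mem_set.
      by apply/andP; split; lra.
    have -> : \1_A z = 0%R :> R by rewrite indicE memNset// /A/=; exact/negP.
    by rewrite -ltNge in Az; apply/andP; split; lra.
  have tA := test_indic mA.
  have gE : g = (fun z => 1 / 2 * \1_A z + 1 / 2 * h z)%R.
    by apply: funext => z; rewrite /h; lra.
  have h20 : (0 <= 1 / 2 :> R)%R by lra.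
  have [IA hIA _] := fin_int _ tA; have [Ih hIh _] := fin_int _ th.
  have IAE : IA = limit_value \1_A.
    apply: EFin_inj; rewrite -hIA integral_indic ?setIT//; exact: limit_lawE.
  have IE : (I = 1 / 2 * IA + 1 / 2 * Ih)%R.
    apply: EFin_inj; rewrite -hI EFinD !EFinM -hIA -hIh.
    have pA := testM tA; have ph := testM th.
    rewrite -(ge0_integralZl limit_law measurableT pA.1 (fun x _ => pA.2 x)) ?lee_fin//.
    rewrite -(ge0_integralZl limit_law measurableT ph.1 (fun x _ => ph.2 x)) ?lee_fin//.
    have scaled (k : R -> R) : test k -> pos_meas (fun z : R => (1 / 2)%:E * (k z)%:E).
      move=> tk; apply: pos_measM; last exact: testM.
      by split => // z; rewrite lee_fin.
    have pA2 := scaled _ tA; have ph2 := scaled _ th.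
    rewrite -(ge0_integralD limit_law measurableT (fun z _ => pA2.2 z) pA2.1 (fun z _ => ph2.2 z) ph2.1).
    by apply: eq_integral => z _; rewrite [in LHS]gE EFinD !EFinM.
  have LE : (limit_value g = 1 / 2 * limit_value \1_A + 1 / 2 * limit_value h)%R.
    have tg' := tg; rewrite gE in tg'.
    by rewrite [in LHS]gE (limit_valueD tA th tg').
  have := IH h th Ih hIh; rewrite IE LE IAE exprS.
  by rewrite !ler_norml => /andP[u1 u2]; apply/andP; split; lra.
have [I hI _] := fin_int f (conj mf f01); rewrite hI; congr EFin.
apply/eqP; rewrite -subr_eq0 -normr_le0.
apply/ler_addgt0Pr => e e0; rewrite add0r.
have e1 : (0 <= 1 / e)%R by rewrite divr_ge0// ltW.
have /andP[_ n2] := truncn_itv e1; set n := (Num.truncn (1 / e)).+1 in n2.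
apply: le_trans (key n f (conj mf f01) I hI) _.
have p2 : (n%:R <= 2 ^+ n :> R)%R by rewrite -natrX ler_nat ltnW// ltn_expl.
rewrite expr_div_n expr1n ler_pdivrMr ?exprn_gt0// mulrC -ler_pdivrMr//.
by apply: ltW; exact: lt_le_trans p2.
Qed.

Definition limit_probability : probability R R := limit_law.

Lemma integral_limit_probability (f : R -> R) : measurable_fun setT f ->
  (forall z, 0 <= f z <= 1)%R -> \int[limit_probability]_z (f z)%:E = (limit_value f)%:E.
Proof. exact: integral_limit_law. Qed.

End limit_law.

(** * Test functions in the logarithmic coordinate *)

Section test_functions.
Context {R : realType}.

Lemma Cc_pos_log (f : R -> R) : Cc_pos f ->
  measurable_fun setT (f \o expR) /\ exists2 B : R, (0 < B)%R & forall y, (`|f (expR y)| <= B)%R.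
Proof.
move=> [cf [A [cA AD] fA]]; split.
  apply: continuous_measurable_fun => y; apply: continuous_comp; first exact: continuous_expR.
  by apply: cf; rewrite in_itv/= expR_gt0.
have cfA : {within A, continuous f}.
  apply: continuous_in_subspaceT => x; rewrite inE => /AD xD; exact: cf.
have [M [_ HM]] := compact_bounded (continuous_compact cfA cA).
exists (`|M| + 1)%R; first by rewrite ltr_wpDl.
move=> y; have [Ay|Ay] := pselect (A (expR y)).
  by apply: (HM (`|M| + 1)%R); [rewrite ltr_pwDr// ler_norm|exists (expR y)].
by rewrite fA ?expR_gt0// normr0 addr_ge0.
Qed.

(** [expR (ln x)] differs from [x] only on the nonpositive half line, which [nu] does not charge. *)
Lemma pairing_log (nu : {measure set R -> \bar R}) (f : R -> R) :
  nu `]-oo, 0%R]%classic = 0 -> measurable_fun setT (f \o expR) ->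
  pairing nu f = fine (\int[nu]_x (Num.max 0 (f (expR (ln x))))%:E
    - \int[nu]_x (Num.max 0 (- f (expR (ln x))))%:E).
Proof.
move=> nu0 mf.
have key (g : R -> R) : measurable_fun setT (g \o expR) ->
    \int[nu]_(x in `]0%R, +oo[) (Num.max 0 (g x))%:E = \int[nu]_x (Num.max 0 (g (expR (ln x))))%:E.
  move=> mg.
  have hg : pos_meas (fun x : R => (Num.max 0 (g (expR (ln x))))%:E).
    apply: pos_meas_EFin => [|x]; last by rewrite le_max lexx.
    apply: measurable_maxr => //.
    by apply: (measurableT_comp (f := g \o expR) mg); exact: measurable_ln.
  rewrite [RHS](ge0_negligible_integral _ measurableT hg.1 (fun x _ => hg.2 x) nu0)//.
  have -> : [set: R] `\` `]-oo, 0%R] = `]0%R, +oo[%classic.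
    apply/seteqP; split => x /=; rewrite !in_itv/= andbT.
      by move=> [_ /negP]; rewrite -ltNge.
    by move=> x0; split => //; apply/negP; rewrite -ltNge.
  by apply: eq_integral => x; rewrite inE/= in_itv/= andbT => x0; rewrite lnK ?posrE.
rewrite /pairing /Rintegral integralE; congr (fine (_ - _)).
  rewrite -key//; apply: eq_integral => x _.
  by rewrite funeposE -EFin_max maxC.
rewrite -(key (fun x => - f x)%R); last by apply: measurableT_comp mf; exact: oppr_measurable.
by apply: eq_integral => x _; rewrite funenegE -EFinN -EFin_max; congr EFin; exact: maxC.
Qed.

End test_functions.

(** * Exponential convergence *)

Section part1.
Context d (Omega : measurableType d) (R : realType) (P : probability Omega R).
Notation mu := (@lebesgue_measure R).
Variables (a_p a_m : R) (rho : R -> R) (eps0 : R) (phi : R -> R -> R).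
Variables (tau sigma : nat -> {RV P >-> R}).
Hypotheses (a_p_gt0 : (0 < a_p)%R) (a_p_lt_a_m : (a_p < a_m)%R).
Hypothesis rho_meas : measurable_fun (`[0%R, 1%R]%classic : set R) rho.
Hypothesis rho_ge0 : forall s : R, (0 <= s <= 1)%R -> (0 <= rho s)%R.
Hypothesis eps0_gt0 : (0 < eps0)%R.
Hypothesis rho_moment :
  \int[mu]_(s in `[0%R, 1%R]) (s `^ (- eps0) * rho s)%:E < +oo.
Hypothesis phi_flow : is_flow (speed a_p a_m) phi.
Hypothesis jumps : jump_mechanism rho tau sigma.
Notation J := (log_kernel rho_meas rho_ge0 eps0_gt0 rho_moment).
Notation m := (- \int[mu]_(s in `[0%R, 1%R]) (ln s * rho s))%R.

Lemma exponential_convergence : (a_p < m < a_m)%R ->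
  exists (nu : probability R R) (eps : R),
     [/\ nu `]-oo, 0%R]%classic = 0, (0 < eps)%R &
       forall f : R -> R, Cc_pos f -> forall x : R, (0 < x)%R ->
         ((expR (- (\int[mu]_(s in `[0%R, 1%R]) ((1 - s) * rho s)) * t) *
          gf_semigroup rho tau sigma phi (speed a_p a_m) t f x - pairing nu f) / expR (- eps * t)
           @[t --> +oo] --> (0 : R))%R].
Proof.
move=> /andP[apm mam].
have [C C0 [r r0 mix]] := exponential_mixing a_p_gt0 a_p_lt_a_m
  (log_kernel_ge0 rho_meas rho_ge0 eps0_gt0 rho_moment) eps0_gt0
  (log_kernel_moment rho_meas rho_ge0 eps0_gt0 rho_moment)
  (log_kernel_mean rho_meas rho_ge0 eps0_gt0 rho_moment) apm mam.
pose law : probability R R := limit_probability C0 r0 mix.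
pose X : {mfun R >-> R} := mfun_Sub (mem_set (@measurable_expR R) : expR \in mfun).
pose nu : probability R R := distribution law X.
have nu0 : nu `]-oo, 0%R]%classic = 0.
  have nuE A : nu A = law (expR @^-1` A) by [].
  rewrite nuE (_ : expR @^-1` _ = set0) ?measure0//.
  by apply/seteqP; split => // y /=; rewrite in_itv/= leNgt expR_gt0.
(* Half of the mixing rate, so that the quotient by [exp(- eps t)] still tends to 0. *)
exists nu, (r / 2)%R; split => //; first by rewrite divr_gt0.
move=> f hf x x0; have [mF [B B0 FB]] := Cc_pos_log hf.
(* [s = 1] and [s = -1] give the positive and negative parts of [f], scaled to values in
   [[0, 1]]. *)
pose G (s : R) (y : R) : R := (Num.max 0 (s * f (expR y)) / B)%R.
have mG s : measurable_fun setT (G s).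
  apply: measurable_funM => //; apply: measurable_maxr => //.
  by apply: measurable_funM.
have G01 s : (`|s| <= 1)%R -> forall y, (0 <= G s y <= 1)%R.
  move=> s1 y; rewrite /G divr_ge0 ?le_max ?lexx ?(ltW B0)//= ler_pdivrMr// mul1r ge_max (ltW B0)/=.
  apply: le_trans (ler_norm _) _; rewrite normrM -[leRHS]mul1r.
  by apply: ler_pM.
have BG s y : (B * G s y = Num.max 0 (s * f (expR y)))%R by rewrite /G mulrC divfK// gt_eqF.
have [mG1 mGN] : measurable_fun setT (G 1%R) /\ measurable_fun setT (G (-1)%R) by [].
have G1 := G01 1%R (_ : (`|1%R| <= 1)%R); rewrite normr1 in G1; have {}G1 := G1 (lexx _).
have GN := G01 (-1)%R (_ : (`|-1%R| <= 1)%R); rewrite normrN1 in GN; have {}GN := GN (lexx _).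
pose l s := limit_value a_p a_m J C r (G s).
have ints s : measurable_fun setT (G s) -> (forall y, 0 <= G s y <= 1)%R ->
    \int[nu]_x (Num.max 0 (s * f (expR (ln x))))%:E = (B * l s)%:E.
  move=> ms Gs.
  have hs : pos_meas (fun x : R => (Num.max 0 (s * f (expR (ln x))))%:E).
    apply: pos_meas_EFin => [|z]; last by rewrite le_max lexx.
    apply: measurable_maxr => //; apply: measurable_funM => //.
    by apply: (measurableT_comp (f := f \o expR) mF); exact: measurable_ln.
  rewrite (ge0_integral_distribution X hs.1 hs.2).
  have hG : pos_meas (EFin \o G s) by apply: pos_meas_EFin => // z; case/andP: (Gs z).
  rewrite EFinM /l -(integral_limit_probability C0 r0 mix ms Gs).
  rewrite -(ge0_integralZl law measurableT hG.1 (fun z _ => hG.2 z)) ?lee_fin ?(ltW B0)//.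
  by apply: eq_integral => y _; rewrite /= expRK -EFinM BG.
have pE : pairing nu f = (B * l 1 - B * l (-1))%R.
  rewrite pairing_log//.
  under eq_integral do rewrite -[f _]mul1r.
  rewrite ints//; under eq_integral do rewrite -mulN1r.
  by rewrite ints// -EFinB.
have closeG s : measurable_fun setT (G s) -> (forall y, 0 <= G s y <= 1)%R ->
    forall t y, (0 <= t)%R -> (`|fine (sg a_p a_m J t (EFin \o G s) y) - l s| <= C y * expR (- (r * t)))%R.
  by move=> ms Gs t y t0; exact: (limit_value_close mix).
have sgG s t y : measurable_fun setT (G s) -> (forall y, 0 <= G s y <= 1)%R -> (0 <= t)%R ->
    fine (sg a_p a_m J t (fun z => (Num.max 0 (s * f (expR z)))%:E) y) =
    (B * fine (sg a_p a_m J t (EFin \o G s) y))%R.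
  move=> ms Gs t0.
  have hG : pos_meas (EFin \o G s) by apply: pos_meas_EFin => // z; case/andP: (Gs z).
  have -> : sg a_p a_m J t (fun z => (Num.max 0 (s * f (expR z)))%:E) y =
      B%:E * sg a_p a_m J t (EFin \o G s) y.
    rewrite -sgZ ?(ltW B0)//; apply: sg_eq => z.
    by rewrite /= -EFinM BG.
  rewrite fineM// ge0_fin_numE; last exact: (pos_meas_sg _ _ _ _ hG).2.
  apply: le_lt_trans (ltry 1); apply: sg_le_cst => // z.
  by rewrite lee_fin; case/andP: (Gs z).
pose M := (2 * B * C (ln x))%R.
have bound t : (0 <= t)%R ->
    (`|expR (- (\int[mu]_(s in `[0%R, 1%R]) ((1 - s) * rho s)) * t) *
      gf_semigroup rho tau sigma phi (speed a_p a_m) t f x - pairing nu f|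
     <= M * expR (- (r * t)))%R.
  move=> t0.
  rewrite (gf_semigroupE a_p_gt0 a_p_lt_a_m rho_meas rho_ge0 eps0_gt0 rho_moment phi_flow jumps x0 t0 mF FB) pE.
  have -> : sg a_p a_m J t (positive_part_at f) (ln x) =
      sg a_p a_m J t (fun z => (Num.max 0 (1 * f (expR z)))%:E) (ln x).
    by apply: sg_eq => z; rewrite mul1r.
  have -> : sg a_p a_m J t (positive_part_at (fun z => - f z)%R) (ln x) =
      sg a_p a_m J t (fun z => (Num.max 0 (-1 * f (expR z)))%:E) (ln x).
    by apply: sg_eq => z; rewrite mulN1r.
  rewrite !sgG//.
  have := closeG 1%R mG1 G1 t (ln x) t0; have := closeG (-1)%R mGN GN t (ln x) t0.
  rewrite !ler_norml => /andP[h1 h2] /andP[h3 h4].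
  have B0' := ltW B0.
  have := ler_wpM2l B0' h1; have := ler_wpM2l B0' h2.
  have := ler_wpM2l B0' h3; have := ler_wpM2l B0' h4 => *.
  by rewrite /M; apply/andP; split; lra.
apply/cvgrPdist_le => e e0.
have M0 : (0 <= M)%R by rewrite /M !mulr_ge0// ltW.
near=> t.
have t0 : (0 <= t)%R by near: t; exact: nbhs_pinfty_ge.
rewrite sub0r normrN normrM normfV (ger0_norm (expR_ge0 _)) ler_pdivrMr ?expR_gt0//.
apply: le_trans (bound t t0) _.
have -> : expR (- (r * t)) = (expR (- (r / 2) * t) * expR (- (r / 2) * t))%R.
  by rewrite -expRD; congr expR; field.
rewrite mulrA ler_wpM2r ?expR_ge0// mulNr expRN ler_pdivrMr ?expR_gt0//.
rewrite mulrC -ler_pdivrMr//; apply: (@le_trans _ _ (1 + r / 2 * t)%R); last exact: expR_ge1Dx.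
have : (M / e / (r / 2) <= t)%R by near: t; apply: nbhs_pinfty_ge; rewrite num_real.
rewrite ler_pdivrMr ?divr_gt0// [(t * _)%R]mulrC; lra.
Unshelve. all: by end_near. Qed.

End part1.

(** * Cosine bumps and their jumps *)

Section cos_bump.
Context {R : realType}.
Variables (a_p a_m : R) (J : {finite_measure set R -> \bar R}).
Hypotheses (a_p_gt0 : (0 < a_p)%R) (a_p_lt_a_m : (a_p < a_m)%R).
Notation mu := (@lebesgue_measure R).
Notation L := (rate J).
Notation Phi := (log_flow a_p a_m).
Notation sg := (sg a_p a_m J).

Definition clamp (x : R) : R := (Num.max (- (pi / 2)) (Num.min (pi / 2) x))%R.

(** The clamp freezes the angle at [- pi / 2] and [pi / 2], where the cosine vanishes: the bump is
    continuous, nonnegative and of bounded support, hence an admissible test function. *)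
Definition cos_bump (q k y0 y : R) : R := (expR (q * y) * cos (clamp (k * (y - y0))))%R.

Lemma continuous_bump q k y0 : continuous (cos_bump q k y0).
Proof.
move=> y; apply: cvgM.
  apply: continuous_comp; last exact: continuous_expR.
  by apply: cvgM; [exact: cvg_cst|exact: cvg_id].
apply: continuous_comp; last exact: continuous_cos.
apply: (@continuous_max R R (fun=> - (pi / 2))%R (fun y => Num.min (pi / 2) (k * (y - y0))) y)%R.
  exact: cvg_cst.
apply: (@continuous_min R R (fun=> pi / 2)%R (fun y => k * (y - y0))%R y).
  exact: cvg_cst.
by apply: cvgM; [exact: cvg_cst|apply: cvgB; [exact: cvg_id|exact: cvg_cst]].
Qed.

Lemma clamp_itv (x : R) : (- (pi / 2) <= clamp x <= pi / 2)%R.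
Proof.
have p0 : (0 < pi :> R)%R := pi_gt0 R.
rewrite /clamp le_max lexx/= ge_max ge_min lexx/= andbT; lra.
Qed.

Lemma clampE (x : R) : (- (pi / 2) <= x <= pi / 2)%R -> clamp x = x.
Proof. by move=> /andP[h1 h2]; rewrite /clamp min_r// max_r. Qed.

Lemma bump_ge0 q k y0 y : (0 <= cos_bump q k y0 y)%R.
Proof. by rewrite mulr_ge0 ?expR_ge0// cos_ge0_pihalf// clamp_itv. Qed.

Lemma bump_out q k y0 y : (pi / 2 <= `|k * (y - y0)|)%R -> cos_bump q k y0 y = 0%R.
Proof.
have p0 : (0 < pi :> R)%R := pi_gt0 R.
move=> h; rewrite /cos_bump /clamp; case: (leP 0 (k * (y - y0)))%R => s.
  rewrite ger0_norm// in h; rewrite min_l// max_r; last lra.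
  by rewrite cos_pihalf mulr0.
rewrite ltr0_norm// in h; rewrite min_r; last lra.
by rewrite max_l; [rewrite cosN cos_pihalf mulr0|lra].
Qed.

(** A jump of length at most [1 / k] lowers the angle by at most 1. If it falls below [- pi / 2], it
    is still above [- 3 pi / 2], where the cosine is nonpositive. *)
Lemma bump_shift (q k y0 z xi : R) : (0 < k)%R ->
  (- (pi / 2) <= k * (z - y0) <= pi / 2)%R -> (- k^-1 <= xi <= 0)%R ->
  (expR (q * (z + xi)) * cos (k * (z - y0) + k * xi) <= cos_bump q k y0 (z + xi))%R.
Proof.
have p2 : (2 <= pi :> R)%R by exact: pi_ge2.
move=> k0 /andP[z1 z2] /andP[x1 x2].
have kx1 : (- 1 <= k * xi)%R by rewrite -ler_pdivrMl// mulrN1.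
have kx2 : (k * xi <= 0)%R by rewrite pmulr_rle0.
have e : (k * (z + xi - y0) = k * (z - y0) + k * xi)%R by ring.
case: (leP (- (pi / 2)) (k * (z - y0) + k * xi))%R => h.
  rewrite /cos_bump e clampE//; apply/andP; split; lra.
apply: le_trans (bump_ge0 _ _ _ _); rewrite mulr_ge0_le0 ?expR_ge0//.
set th := (k * (z - y0) + k * xi)%R in h *.
have -> : cos th = (- cos (th + pi))%R by rewrite cosDpi opprK.
have thE : th = (k * (z - y0) + k * xi)%R by [].
by rewrite oppr_le0 cos_ge0_pihalf//; apply/andP; split; lra.
Qed.

(** Jumps longer than [1 / k] are discarded, which can only lower the growth of the bump. The angle
    [- k xi] then stays in [[0, 1]], where sine and cosine are nonnegative, and the integrals are
    finite for every [q]. *)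
Definition trunc_sin (q k : R) (xi : R) : \bar R :=
  if (- k^-1 <= xi <= 0)%R then (expR (q * xi) * sin (- (k * xi)))%:E else 0.
Definition trunc_cos (q k : R) (xi : R) : \bar R :=
  if (- k^-1 <= xi <= 0)%R then (expR (q * xi) * cos (k * xi))%:E else 0.

Lemma trunc_angle (k xi : R) : (0 < k)%R -> (- k^-1 <= xi <= 0)%R -> (0 <= - (k * xi) <= 1)%R.
Proof.
move=> k0 /andP[x1 x2].
have kx1 : (- 1 <= k * xi)%R by rewrite -ler_pdivrMl// mulrN1.
have kx2 : (k * xi <= 0)%R by rewrite pmulr_rle0.
by apply/andP; split; lra.
Qed.

Lemma pos_meas_trunc_sin q k : (0 < k)%R -> pos_meas (trunc_sin q k).
Proof.
move=> k0; split.
  apply: measurable_fun_ifT => //.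
    by apply: measurable_and; exact: measurable_fun_ler.
  apply/measurable_EFinP; apply: measurable_funM.
    by apply: measurableT_comp => //; exact: measurable_funM.
  apply: (measurableT_comp (f := sin)); first by apply: continuous_measurable_fun; exact: continuous_sin.
  by apply: measurableT_comp; [exact: oppr_measurable|exact: measurable_funM].
move=> xi; rewrite /trunc_sin; case: ifPn => // h; rewrite lee_fin mulr_ge0 ?expR_ge0//.
have /andP[h1 h2] := trunc_angle k0 h; have p2 : (2 <= pi :> R)%R by exact: pi_ge2.
by rewrite sin_ge0_pi//; apply/andP; split; lra.
Qed.

Lemma pos_meas_trunc_cos q k : (0 < k)%R -> pos_meas (trunc_cos q k).
Proof.
move=> k0; split.
  apply: measurable_fun_ifT => //.
    by apply: measurable_and; exact: measurable_fun_ler.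
  apply/measurable_EFinP; apply: measurable_funM.
    by apply: measurableT_comp => //; exact: measurable_funM.
  apply: (measurableT_comp (f := cos)); first by apply: continuous_measurable_fun; exact: continuous_cos.
  exact: measurable_funM.
move=> xi; rewrite /trunc_cos; case: ifPn => // h; rewrite lee_fin mulr_ge0 ?expR_ge0//.
have /andP[h1 h2] := trunc_angle k0 h; have p2 : (2 <= pi :> R)%R by exact: pi_ge2.
by rewrite cos_ge0_pihalf//; apply/andP; split; lra.
Qed.

(* Expanding [cos (th + k xi)], the hypothesis on the sine integral makes the
   [sin th] terms coming from the drift and from the jumps cancel. *)
Lemma bump_jumps (q k y0 z a C : R) : (0 < k)%R ->
  (- (pi / 2) <= k * (z - y0) <= pi / 2)%R ->
  \int[J]_xi trunc_sin q k xi = (a * k)%:E -> \int[J]_xi trunc_cos q k xi = C%:E ->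
  (expR (q * z) * (cos (k * (z - y0)) * C + sin (k * (z - y0)) * (a * k)))%:E
    <= \int[J]_xi (cos_bump q k y0 (z + xi))%:E.
Proof.
move=> k0 hz sE cE; set th := (k * (z - y0))%R.
have hS := pos_meas_trunc_sin q k0; have hC := pos_meas_trunc_cos q k0.
have ez := expR_gt0 (q * z).
have hB : pos_meas (fun xi : R => (cos_bump q k y0 (z + xi))%:E).
  apply: pos_meas_EFin => [|xi]; last exact: bump_ge0.
  apply: (measurableT_comp (f := cos_bump q k y0)); last exact: measurable_funD.
  exact: continuous_measurable_fun (@continuous_bump _ _ _).
have c0 : (0 <= cos th)%R by exact: cos_ge0_pihalf.
have scal (c : R) g : (0 <= c)%R -> pos_meas g -> pos_meas (fun xi : R => c%:E * g xi).
  by move=> h hg; apply: pos_measM => //; split => // ?; rewrite lee_fin.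
have ec0 : (0 <= expR (q * z) * cos th)%R by rewrite mulr_ge0// ltW.
have pt xi : (- k^-1 <= xi <= 0)%R ->
    (expR (q * z) * (cos th * (expR (q * xi) * cos (k * xi)) + sin th * (expR (q * xi) * sin (- (k * xi)))) <= cos_bump q k y0 (z + xi))%R.
  move=> hx; apply: le_trans (bump_shift q k0 hz hx).
  by rewrite cosD -/th (mulrDr q) expRD sinN le_eqVlt; apply/orP; left; apply/eqP; ring.
(* The sine term is put on the side of the inequality where it is nonnegative. *)
case: (leP 0 (sin th))%R => s0.
  have es0 : (0 <= expR (q * z) * sin th)%R by rewrite mulr_ge0// ltW.
  have h1 := scal _ _ ec0 hC; have h2 := scal _ _ es0 hS.
  have : \int[J]_xi ((expR (q * z) * cos th)%:E * trunc_cos q k xi + (expR (q * z) * sin th)%:E * trunc_sin q k xi) <=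
      \int[J]_xi (cos_bump q k y0 (z + xi))%:E.
    apply: ge0_le_integral => //.
    - by move=> xi _; exact: (pos_measD h1 h2).2.
    - exact: (pos_measD h1 h2).1.
    - exact: hB.1.
    move=> xi _; rewrite /trunc_cos /trunc_sin; case: ifPn => hx.
      by rewrite -!EFinM -EFinD lee_fin; have := pt xi hx; lra.
    by rewrite !mule0 adde0 lee_fin bump_ge0.
  rewrite (ge0_integralD J measurableT (fun z _ => h1.2 z) h1.1 (fun z _ => h2.2 z) h2.1).
  rewrite (ge0_integralZl J measurableT hC.1 (fun z _ => hC.2 z)) ?lee_fin//.
  rewrite (ge0_integralZl J measurableT hS.1 (fun z _ => hS.2 z)) ?lee_fin//.
  rewrite sE cE -!EFinM -EFinD; apply: le_trans; rewrite lee_fin; lra.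
have es0 : (0 <= expR (q * z) * - sin th)%R by rewrite mulr_ge0 ?(ltW ez)// oppr_ge0 ltW.
have h1 := scal _ _ ec0 hC; have h2 := scal _ _ es0 hS.
have : \int[J]_xi ((expR (q * z) * cos th)%:E * trunc_cos q k xi) <=
    \int[J]_xi ((cos_bump q k y0 (z + xi))%:E + (expR (q * z) * - sin th)%:E * trunc_sin q k xi).
  apply: ge0_le_integral => //.
  - by move=> xi _; exact: h1.2.
  - exact: h1.1.
  - exact: (pos_measD hB h2).1.
  move=> xi _; rewrite /trunc_cos /trunc_sin; case: ifPn => hx.
    by rewrite -!EFinM -EFinD lee_fin; have := pt xi hx; lra.
  by rewrite !mule0 adde0 lee_fin bump_ge0.
rewrite (ge0_integralD J measurableT (fun z _ => hB.2 z) hB.1 (fun z _ => h2.2 z) h2.1).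
rewrite (ge0_integralZl J measurableT hC.1 (fun z _ => hC.2 z)) ?lee_fin//.
rewrite (ge0_integralZl J measurableT hS.1 (fun z _ => hS.2 z)) ?lee_fin//.
rewrite sE cE -!EFinM -leeBlDr// -EFinB; apply: le_trans; rewrite lee_fin; lra.
Qed.

End cos_bump.

(** * A real exponent obtained from the bumps as [k] tends to 0 *)

Section real_root.
Context {R : realType}.
Variables (J : {finite_measure set R -> \bar R}) (a b x1 : R).
Notation L := (rate J).
Hypothesis J_neg : J `[0%R, +oo[%classic = 0.
Hypotheses (a_gt0 : (0 < a)%R) (x1_gt0 : (0 < x1)%R).
Hypothesis J_window : 0 < J `[(- (2 * x1))%R, (- x1)%R]%classic.
Hypothesis bumps : forall k q C : R, (0 < k)%R -> \int[J]_xi trunc_sin q k xi = (a * k)%:E ->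
  \int[J]_xi trunc_cos q k xi = C%:E -> (a * q - L + C <= - b)%R.

Let D (k q : R) : R := fine (\int[J]_xi trunc_sin q k xi).

Let L_ge0 : (0 <= L)%R. Proof. exact: rate_ge0. Qed.

Lemma sin_le_id (y : R) : (0 <= y)%R -> (sin y <= y)%R.
Proof.
move=> y0; have [c _] := @MVT_segment R sin cos 0%R y y0 (fun x _ => is_derive_sin x)
  (continuous_subspaceT (@continuous_sin R)).
rewrite sin0 !subr0 => ->; apply: ler_piMl => //; exact: cos_le1.
Qed.

Let ae_le (f g : R -> \bar R) (c : R) : pos_meas f -> pos_meas g -> (0 <= c)%R ->
  (forall xi, f xi <= c%:E * g xi) -> \int[J]_xi f xi <= c%:E * \int[J]_xi g xi.
Proof.
move=> hf hg c0 fg; rewrite -(ge0_integralZl J measurableT hg.1 (fun x _ => hg.2 x)) ?lee_fin//.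
apply: ge0_le_integral => //; [by move=> x _; exact: hf.2|exact: hf.1|].
by apply: emeasurable_funM => //; exact: hg.1.
Qed.

Let bounded_fin (f : R -> \bar R) (c : R) : pos_meas f -> (0 <= c)%R ->
  (forall xi, f xi <= c%:E) -> \int[J]_xi f xi = (fine (\int[J]_xi f xi))%:E /\
  (fine (\int[J]_xi f xi) <= c * L)%R.
Proof.
move=> hf c0 fc; have h1 : pos_meas (cst 1 : R -> \bar R) by split.
have le : \int[J]_xi f xi <= (c * L)%:E.
  apply: le_trans (ae_le hf h1 c0 _) _; first by move=> xi; rewrite mule1.
  by have -> := integral_cst J measurableT 1; rewrite mul1e EFinM -(rateE J).
have fn : \int[J]_xi f xi \is a fin_num.
  by rewrite ge0_fin_numE ?(le_lt_trans le) ?ltry//; apply: integral_ge0 => x _; exact: hf.2.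
by split; [rewrite fineK|rewrite -lee_fin fineK].
Qed.

Let exp_window (q k xi : R) : (0 < k)%R -> (- k^-1 <= xi <= 0)%R -> (expR (q * xi) <= expR (`|q| / k))%R.
Proof.
move=> k0 /andP[h1 h2]; rewrite ler_expR; apply: le_trans (ler_norm _) _.
by rewrite normrM ler_wpM2l// ler0_norm//; lra.
Qed.

Let D_fin (k q : R) : (0 < k)%R -> \int[J]_xi trunc_sin q k xi = (D k q)%:E.
Proof.
move=> k0; apply: (bounded_fin (c := expR (`|q| / k)) (pos_meas_trunc_sin q k0) (expR_ge0 _) _).1.
move=> xi; rewrite /trunc_sin; case: ifPn => h; rewrite lee_fin ?expR_ge0//.
rewrite -[leRHS]mulr1; apply: ler_pM; rewrite ?expR_ge0 ?sin_le1 ?exp_window//.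
have /andP[h1 h2] := trunc_angle k0 h; have p2 : (2 <= pi :> R)%R by exact: pi_ge2.
by rewrite sin_ge0_pi//; apply/andP; split; lra.
Qed.

Let C_fin (k q : R) : (0 < k)%R -> exists C, \int[J]_xi trunc_cos q k xi = C%:E.
Proof.
move=> k0; eexists; apply: (bounded_fin (c := expR (`|q| / k)) (pos_meas_trunc_cos q k0) (expR_ge0 _) _).1.
move=> xi; rewrite /trunc_cos; case: ifPn => h; rewrite lee_fin ?expR_ge0//.
rewrite -[leRHS]mulr1; apply: ler_pM; rewrite ?expR_ge0 ?cos_le1 ?exp_window//.
have /andP[h1 h2] := trunc_angle k0 h; have p2 : (2 <= pi :> R)%R by exact: pi_ge2.
by rewrite cos_ge0_pihalf//; apply/andP; split; lra.
Qed.

Let D_compare (k k' q q' c : R) : (0 < k)%R -> (0 < k')%R -> (0 <= c)%R ->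
  (forall xi, trunc_sin q k xi <= c%:E * trunc_sin q' k' xi) -> (D k q <= c * D k' q')%R.
Proof.
move=> k0 k0' c0 h; rewrite -lee_fin EFinM -!D_fin//.
by apply: ae_le => //; exact: pos_meas_trunc_sin.
Qed.

Let sinp (k xi : R) : (0 < k)%R -> (- k^-1 <= xi <= 0)%R -> (0 <= sin (- (k * xi)))%R.
Proof.
move=> k0 h; have /andP[h1 h2] := trunc_angle k0 h; have p2 : (2 <= pi :> R)%R by exact: pi_ge2.
by rewrite sin_ge0_pi//; apply/andP; split; lra.
Qed.

(** On the window [|xi| <= 1 / k], so [D k] is nonincreasing and continuous in [q], with an explicit
    modulus. *)
Let D_decr (k q q' : R) : (0 < k)%R -> (q <= q')%R -> (D k q' <= D k q)%R /\ (D k q <= expR ((q' - q) / k) * D k q')%R.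
Proof.
move=> k0 qq; split.
  rewrite -[leRHS]mul1r; apply: D_compare => // xi; rewrite mul1e /trunc_sin; case: ifPn => // h.
  rewrite lee_fin ler_wpM2r ?sinp// ler_expR; apply: ler_wnM2r => //; by case/andP: h.
apply: (D_compare k0 k0 (expR_ge0 _)).
move=> xi; rewrite /trunc_sin; case: ifPn => h; last by rewrite mule0.
rewrite -EFinM lee_fin mulrA ler_wpM2r ?sinp// -expRD ler_expR.
have qq0 : (0 <= q' - q)%R by rewrite subr_ge0.
have := ler_wpM2l qq0 (proj1 (andP h)); lra.
Qed.

(** By [sin y <= y] and [u exp(- u) <= 1] the integrand is at most [k / q]. The resulting bound on
    the roots does not depend on [k]. *)
Let D_small (k q : R) : (0 < k)%R -> (a * k <= D k q)%R -> (q <= L / a)%R.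
Proof.
move=> k0 h; case: (leP q 0)%R => q0; first by apply: le_trans q0 _; rewrite divr_ge0// ltW.
have kq : (0 <= k / q)%R by rewrite divr_ge0// ltW.
have pt xi : trunc_sin q k xi <= (k / q)%:E.
  rewrite /trunc_sin; case: ifPn => hx; rewrite lee_fin//.
  have /andP[h1 h2] := trunc_angle k0 hx; have hs := sin_le_id h1.
  apply: (@le_trans _ _ (expR (q * xi) * - (k * xi)))%R; first by rewrite ler_wpM2l ?expR_ge0.
  rewrite ler_pdivlMr// -[(q * xi)%R]opprK expRN.
  have E := expR_ge1Dx (- (q * xi))%R; have Ep := expR_gt0 (- (q * xi))%R.
  have -> : ((expR (- (q * xi)))^-1 * - (k * xi) * q = k * (- (q * xi) / expR (- (q * xi))))%R by ring.
  by apply: ler_piMr; [exact: ltW|rewrite ler_pdivrMr// mul1r; lra].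
have [_ le] := bounded_fin (pos_meas_trunc_sin q k0) kq pt.
have := le_trans h le; rewrite ler_pdivlMr//.
have -> : (k / q * L = L / q * k)%R by ring.
by rewrite ler_pM2r// ler_pdivlMr// mulrC.
Qed.

(** The mass of [J] on the window makes [D k (- N)] grow at least linearly in [N]; here the window
    must lie within reach of the truncation at [1 / k]. *)
Let D_large (k : R) : (0 < k)%R -> (2 * x1 <= k^-1)%R -> exists q, (a * k <= D k q)%R.
Proof.
move=> k0 kx; have p2 : (2 <= pi :> R)%R by exact: pi_ge2.
have kx1 : (0 < k * x1)%R by rewrite mulr_gt0 ?x1_gt0.
have kx2 : (k * (2 * x1) <= 1)%R by rewrite -ler_pdivlMl// mulr1.
set I := `[(- (2 * x1))%R, (- x1)%R]%classic : set R.
have mI : measurable I by exact: measurable_itv.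
have Jfin : J I = (fine (J I))%:E by rewrite fineK// fin_num_measure.
have j0 : (0 < fine (J I))%R by rewrite fine_gt0// J_window Jfin ltry.
have s0 : (0 < sin (k * x1))%R by rewrite sin_gt0_pihalf// kx1/=; lra.
pose N := (a * k / (x1 * (sin (k * x1) * fine (J I))))%R.
have den : (0 < x1 * (sin (k * x1) * fine (J I)))%R by rewrite !mulr_gt0 ?x1_gt0.
have N0 : (0 <= N)%R.
  by apply: divr_ge0; [apply: mulr_ge0; apply: ltW => //; exact: a_gt0|exact: ltW].
exists (- N)%R.
have hI : pos_meas (fun xi : R => (\1_I xi : R)%:E).
  split; first by apply/measurable_EFinP; exact: measurable_indic.
  by move=> xi; rewrite lee_fin indicE.
have le : (expR (N * x1) * sin (k * x1))%:E * J I <= (D k (- N))%:E.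
  have -> : J I = \int[J]_xi (\1_I xi)%:E by rewrite integral_indic ?setIT.
  have c0 : (0 <= expR (N * x1) * sin (k * x1))%R by rewrite mulr_ge0 ?expR_ge0 ?ltW.
  rewrite -(ge0_integralZl J measurableT hI.1 (fun x _ => hI.2 x)) ?lee_fin//.
  rewrite -D_fin//; have hs := pos_meas_trunc_sin (- N) k0.
  apply: ge0_le_integral => //.
  - by move=> xi _; rewrite -EFinM lee_fin mulr_ge0// indicE.
  - by apply: emeasurable_funM => //; exact: hI.1.
  - exact: hs.1.
  move=> xi _; have [/andP[h1 h2]|hx] := boolP (- (2 * x1) <= xi <= - x1)%R; last first.
    rewrite indicE memNset; first by rewrite mule0; exact: hs.2.
    by rewrite /I /= in_itv; exact/negP.
  rewrite indicE mem_set ?mule1; last by rewrite /I /= in_itv/= h1 h2.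
  have x1p := x1_gt0; have hx : (- k^-1 <= xi <= 0)%R by apply/andP; split; lra.
  rewrite /trunc_sin hx lee_fin; apply: ler_pM; rewrite ?expR_ge0 ?(ltW s0)//.
    by rewrite ler_expR mulNr -mulrN ler_wpM2l//; lra.
  have /andP[t1 t2] := trunc_angle k0 hx.
  have kk : (k * x1 <= - (k * xi))%R by rewrite -mulrN ler_pM2l//; lra.
  rewrite leNgt ltr_sin; first by rewrite -leNgt.
    by rewrite in_itv/=; apply/andP; split; lra.
  by rewrite in_itv/=; apply/andP; split; lra.
rewrite -lee_fin; apply: le_trans le; rewrite Jfin -EFinM lee_fin.
have E := expR_ge1Dx (N * x1)%R.
have sj : (0 < sin (k * x1) * fine (J I))%R by rewrite mulr_gt0.
have := ler_wpM2r (ltW sj) E.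
have : (N * (x1 * (sin (k * x1) * fine (J I))) = a * k)%R by rewrite /N divfK// gt_eqF.
by rewrite -[(expR _ * _ * _)%R]mulrA; lra.
Qed.

Let le_of_exp (k A B : R) : (0 < k)%R -> (0 <= B)%R ->
  (forall d, (0 < d)%R -> (A <= expR (d / k) * B)%R) -> (A <= B)%R.
Proof.
move=> k0 B0 H; rewrite leNgt; apply/negP => BA.
have A0 : (0 < A)%R by exact: le_lt_trans BA.
pose d := (k * ((A - B) / (2 * A)))%R.
have d0 : (0 < d)%R by rewrite mulr_gt0// divr_gt0 ?subr_gt0// mulr_gt0.
have dk : (d / k = (A - B) / (2 * A))%R by rewrite /d; field; rewrite !gt_eqF.
have := H d d0; rewrite dk; set w := ((A - B) / (2 * A))%R => h.
have E := expR_ge1Dx (- w)%R; have Ep := expR_gt0 (- w)%R.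
have h2 : (A * expR (- w) <= B)%R.
  have := ler_wpM2l (ltW Ep) h; rewrite mulrA -expRD addNr expR0 mul1r mulrC; exact.
have h3 := ler_wpM2l (ltW A0) E.
have : (A * w = (A - B) / 2)%R by rewrite /w; field; rewrite gt_eqF.
lra.
Qed.

(** The exponent for which the sine integral balances the drift, so that [bumps] applies. *)
Let root k : R := sup [set q | (a * k <= D k q)%R].

Let has_sup_root (k : R) : (0 < k)%R -> (2 * x1 <= k^-1)%R -> has_sup [set q | (a * k <= D k q)%R].
Proof.
move=> k0 kx; split; first by have [q hq] := D_large k0 kx; exists q.
by exists (L / a)%R => q /= hq; exact: D_small hq.
Qed.

Let rootE (k : R) : (0 < k)%R -> (2 * x1 <= k^-1)%R -> D k (root k) = (a * k)%R.
Proof.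
move=> k0 kx; have hs := has_sup_root k0 kx.
have ak0 : (0 <= a * k)%R by rewrite mulr_ge0// ltW ?a_gt0.
have D0 q : (0 <= D k q)%R.
  by apply: fine_ge0; apply: integral_ge0 => x _; exact: (pos_meas_trunc_sin q k0).2.
apply/eqP; rewrite eq_le; apply/andP; split; apply: (le_of_exp k0) => // d d0.
  have h : (root k <= root k + d)%R by rewrite lerDl ltW.
  apply: le_trans (D_decr k0 h).2 _.
  rewrite (_ : root k + d - root k = d)%R; last by ring.
  rewrite ler_wpM2l ?expR_ge0// leNgt; apply/negP => /ltW h2.
  have := ub_le_sup hs.2 h2; rewrite -/(root k); lra.
have [q hq rq] := sup_adherent d0 hs; rewrite -/(root k) in rq.
have qr : (q <= root k)%R by exact: (ub_le_sup hs.2 hq).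
apply: le_trans hq _; apply: le_trans (D_decr k0 qr).2 _.
by rewrite ler_wpM2r// ler_expR ler_pM2r ?invr_gt0//; lra.
Qed.

(** Since [sin (2 y) <= 2 sin y] and the truncation is weaker for [k / 2], [D k q <= 2 D (k / 2) q]:
    halving [k] raises the root. *)
Let root_half (k : R) : (0 < k)%R -> (2 * x1 <= k^-1)%R -> (root k <= root (k / 2))%R.
Proof.
move=> k0 kx; have k20 : (0 < k / 2)%R by rewrite divr_gt0.
have kk : (k^-1 <= (k / 2)^-1)%R by rewrite lef_pV2 ?posrE//; lra.
apply: (ub_le_sup (has_sup_root k20 (le_trans kx kk)).2) => /=.
have h : (D k (root k) <= 2 * D (k / 2) (root k))%R.
  apply: D_compare => // xi; rewrite /trunc_sin; case: ifPn => hx; last first.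
    by rewrite mule_ge0// (pos_meas_trunc_sin (root k) k20).2.
  have hx2 : (- (k / 2)^-1 <= xi <= 0)%R.
    by case/andP: hx => u1 ->; rewrite andbT; apply: le_trans u1; rewrite lerN2.
  rewrite hx2 -EFinM lee_fin [leRHS]mulrCA ler_wpM2l ?expR_ge0//.
  have -> : (- (k * xi) = - (k / 2 * xi) *+ 2)%R by rewrite mulr2n; field.
  rewrite sin_mulr2n mulr2n.
  have sp := sinp k20 hx2; have c1 := cos_le1 (- (k / 2 * xi)).
  have := ler_wpM2r sp c1; lra.
by rewrite rootE// in h; lra.
Qed.

(** Along [k = 2^-n] the roots increase and stay below [L / a], so they converge to some [q]. The
    growth bound passes to the limit on each truncation of the exponential, and monotone convergence
    removes the truncation; this also proves that the integral at [q] is finite. *)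
Lemma real_root : exists q M : R, \int[J]_xi (expR (q * xi))%:E = M%:E /\ (a * q - L + M <= - b)%R.
Proof.
pose k n : R := (2 ^- n)%R.
have k0 n : (0 < k n)%R by rewrite invr_gt0 exprn_gt0.
have kS n : k n.+1 = (k n / 2)%R by rewrite /k exprSr invfM.
have kn n : (n%:R <= (k n)^-1)%R.
  by rewrite invrK -natrX ler_nat ltnW// ltn_expl.
have [n0 hn0] : exists n0 : nat, (2 * x1 <= n0%:R)%R.
  have h : (0 <= 2 * x1)%R by rewrite mulr_ge0// ltW ?x1_gt0.
  by have /andP[_ /ltW] := truncn_itv h; exists (Num.truncn (2 * x1)).+1.
have kx n : (n0 <= n)%N -> (2 * x1 <= (k n)^-1)%R.
  by move=> h; apply: le_trans (kn n); apply: le_trans hn0 _; rewrite ler_nat.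
pose r n := root (k (n0 + n)%N).
have rS n : (r n <= r n.+1)%R.
  by rewrite /r addnS kS; apply: root_half => //; apply: kx; exact: leq_addr.
have rmono i j : (i <= j)%N -> (r i <= r j)%R.
  by move=> ij; have /nondecreasing_seqP := rS; apply.
have hs : has_sup [set q | exists n, q = r n].
  split; first by exists (r 0%N), 0%N.
  exists (L / a)%R => q [n ->]; apply: ge_sup; first exact: (has_sup_root (k0 _) (kx _ (leq_addr _ _))).1.
  by move=> x /=; exact: D_small.
pose q := sup [set q | exists n, q = r n].
have rq n : (r n <= q)%R by apply: (ub_le_sup hs.2); exists n.
pose X := (L - b - a * q)%R.
pose G N : R -> \bar R := fun xi => if (- N%:R <= xi <= 0)%R then (expR (q * xi))%:E else 0.
have hG N : pos_meas (G N).
  split; last by move=> xi; rewrite /G; case: ifP => // _; rewrite lee_fin expR_ge0.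
  apply: measurable_fun_ifT => //.
    by apply: measurable_and; exact: measurable_fun_ler.
  by apply/measurable_EFinP; apply: measurableT_comp => //; exact: measurable_funM.
have GX N : \int[J]_xi G N xi <= X%:E.
  have [fG _] : \int[J]_xi G N xi = (fine (\int[J]_xi G N xi))%:E /\ (fine (\int[J]_xi G N xi) <= expR (`|q| * N%:R) * L)%R.
    apply: (bounded_fin (hG N) (expR_ge0 _)) => xi; rewrite /G; case: ifPn => [/andP[h1 h2]|_]; rewrite lee_fin ?expR_ge0//.
    rewrite ler_expR; apply: le_trans (ler_norm _) _; rewrite normrM ler_wpM2l//.
    by rewrite ler0_norm//; lra.
  rewrite fG lee_fin; set g := fine _ in fG *.
  have g0 : (0 <= g)%R by apply: fine_ge0; apply: integral_ge0 => x _; exact: (hG N).2.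
  apply/ler_addgt0Pr => e e0.
  have a0 := a_gt0.
  (* The share [e1] pays for replacing the cosine by 1 on [[- N, 0]], the share [a e1] for replacing
     the root by [q]. *)
  pose e1 := (e / (a + 1))%R.
  have e10 : (0 < e1)%R by rewrite divr_gt0//; lra.
  have e1E : (e1 * a + e1 = e)%R by rewrite /e1; field; rewrite gt_eqF//; lra.
  have [_ [i ->] hi] := sup_adherent e10 hs; rewrite -/q in hi.
  have Ng : (0 <= N%:R * g / e1)%R by apply: divr_ge0; [exact: mulr_ge0|exact: ltW].
  have /andP[_ /ltW t2] := truncn_itv Ng; set i2 := (Num.truncn (N%:R * g / e1)).+1 in t2.
  pose j := (i + i2 + N)%N.
  have ij : (i <= j)%N by rewrite /j -addnA leq_addr.
  have kj0 := k0 (n0 + j)%N; set kj := k (n0 + j)%N in kj0.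
  have kN : (N%:R <= kj^-1)%R by apply: le_trans (kn _); rewrite ler_nat /j addnA leq_addl.
  have ki2 : (i2%:R <= kj^-1)%R.
    apply: le_trans (kn _); rewrite ler_nat; apply: leq_trans (leq_addl n0 _).
    by rewrite /j; apply: leq_trans (leq_addr N _); exact: leq_addl.
  have kxj : (2 * x1 <= kj^-1)%R by apply: kx; exact: leq_addr.
  have [C hC] := C_fin (r j) kj0.
  have hD : \int[J]_xi trunc_sin (r j) kj xi = (a * kj)%:E by rewrite D_fin// -(rootE kj0 kxj).
  have := bumps kj0 hD hC.
  (* As [r j <= q] and [xi <= 0], [exp(q xi) <= exp(r j xi)]; the cosine is at least [1 - kj N] on
     the truncated window. *)
  have hc : ((1 - kj * N%:R) * g <= C)%R.
    have kN1 : (kj * N%:R <= 1)%R by rewrite -ler_pdivlMl// mulr1.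
    have c0 : (0 <= 1 - kj * N%:R)%R by rewrite subr_ge0.
    rewrite -lee_fin EFinM -fG -hC -(ge0_integralZl J measurableT (hG N).1 (fun x _ => (hG N).2 x)) ?lee_fin//.
    have ht := pos_meas_trunc_cos (r j) kj0.
    apply: ge0_le_integral => //.
    - by move=> xi _; rewrite mule_ge0 ?lee_fin//; exact: (hG N).2.
    - by apply: emeasurable_funM => //; exact: (hG N).1.
    - exact: ht.1.
    move=> xi _; rewrite /G; case: ifPn => [/andP[h1 h2]|_]; last by rewrite mule0 ht.2.
    have hx : (- kj^-1 <= xi <= 0)%R by apply/andP; split => //; lra.
    rewrite /trunc_cos hx -EFinM lee_fin mulrC; apply: ler_pM; rewrite ?expR_ge0//.
      by rewrite ler_expR; apply: ler_wnM2r.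
    have /andP[t3 t4] := trunc_angle kj0 hx.
    have kxN : (- (kj * xi) <= kj * N%:R)%R by rewrite -mulrN ler_pM2l//; lra.
    apply: (@le_trans _ _ (1 - - (kj * xi)))%R; first lra.
    rewrite -cosN; set y := (- (kj * xi))%R in t3 *.
    have [c _] := @MVT_segment R cos (fun x => - sin x)%R 0%R y t3 (fun x _ => is_derive_cos x)
      (continuous_subspaceT (@continuous_cos R)).
    rewrite cos0 subr0 => hcy.
    have := ler_wpM2r t3 (sin_le1 c); lra.
  have kg : (kj * N%:R * g <= e1)%R.
    have hk := le_trans t2 ki2; rewrite ler_pdivrMr// in hk.
    have := ler_wpM2l (ltW kj0) hk.
    by rewrite mulrA [leRHS]mulrA divff ?gt_eqF// mul1r.
  have := ler_wpM2l (ltW a0) (rmono _ _ ij); have := ler_wpM2l (ltW a0) (ltW hi).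
  rewrite /X => v1 v2 v3; lra.
have nd (x : R) : setT x -> nondecreasing_seq (G ^~ x).
  move=> _; apply/nondecreasing_seqP => N; rewrite /G.
  case: ifPn => [/andP[h1 h2]|_]; last by case: ifPn => // _; rewrite lee_fin expR_ge0.
  have -> : (- N.+1%:R <= x <= 0)%R; last by [].
  by rewrite h2 andbT; apply: le_trans h1; rewrite lerN2 ler_nat.
have mc := monotone_convergence J measurableT (fun N => (hG N).1) (fun N x _ => (hG N).2 x) nd.
have cvG x : cvgn (G ^~ x) by apply: ereal_nondecreasing_is_cvgn; exact: nd.
have limX : \int[J]_xi limn (G ^~ xi) <= X%:E.
  rewrite mc; apply: lime_le; last by near=> N.
  apply: ereal_nondecreasing_is_cvgn; apply/nondecreasing_seqP => N.
  apply: ge0_le_integral => //; [by move=> x _; exact: (hG N).2|exact: (hG N).1|exact: (hG N.+1).1|].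
  by move=> x _; have /nondecreasing_seqP := nd x I; apply.
have hlim : pos_meas (fun xi : R => limn (G ^~ xi)).
  split; last by move=> x; apply: lime_ge; [exact: cvG|near=> N; exact: (hG N).2].
  by apply: (emeasurable_fun_cvg G) => [N|x _]; [exact: (hG N).1|exact: cvG].
have le : \int[J]_xi (expR (q * xi))%:E <= X%:E.
  apply: le_trans limX; apply: le_integral_neg => //; first exact: pos_meas_exp.
  move=> xi xi0; apply: lime_ge; first exact: cvG.
  have hx : (0 <= - xi)%R by lra.
  have /andP[_ /ltW hN] := truncn_itv hx.
  exists (Num.truncn (- xi)).+1 => // N /= hNN; rewrite /G.
  have -> : (- N%:R <= xi <= 0)%R; last by [].
  rewrite (ltW xi0) andbT lerNl; apply: le_trans hN _; by rewrite ler_nat.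
have fin : \int[J]_xi (expR (q * xi))%:E \is a fin_num.
  rewrite ge0_fin_numE ?(le_lt_trans le) ?ltry//; apply: integral_ge0 => x _.
  by rewrite lee_fin expR_ge0.
exists q, (fine (\int[J]_xi (expR (q * xi))%:E)); split; first by rewrite fineK.
have : (fine (\int[J]_xi (expR (q * xi))%:E) <= X)%R by rewrite -lee_fin fineK.
by rewrite /X; lra.
Unshelve. all: by end_near. Qed.

End real_root.

(** * Telescoping against a supersolution with gain *)

Section telescoping.
Context {R : realType}.
Variables (a_p a_m : R) (J : {finite_measure set R -> \bar R}).
Hypotheses (a_p_gt0 : (0 < a_p)%R) (a_p_lt_a_m : (a_p < a_m)%R).
Notation sg := (sg a_p a_m J).

(** [sg n] is applied to the one-step bound, which is then multiplied by [exp(b (n + 1))]. The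
    alternative [k = 0] or [b = 0] prevents the slack from being amplified by that factor. *)
Lemma telescoping_bound (b k : R) (U chi : R -> R) (n : nat) y : (0 <= k)%R -> (k = 0 \/ b = 0)%R ->
  measurable_fun setT U -> (forall z, (0 <= U z)%R) ->
  measurable_fun setT chi -> (forall z, (0 <= chi z)%R) ->
  (forall z, sg 1 (EFin \o U) z <= (expR (- b) * (U z - chi z) + k)%:E) ->
  (expR (b * n%:R))%:E * sg n%:R (EFin \o U) y +
    \sum_(0 <= j < n) (expR (b * j%:R))%:E * sg j%:R (EFin \o chi) y <= (U y + n%:R * k)%:E.
Proof.
move=> k0 kb mU U0 mchi chi0 H.
have hU : pos_meas (EFin \o U) by exact: pos_meas_EFin.
have hchi : pos_meas (EFin \o chi) by exact: pos_meas_EFin.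
have h1 : pos_meas (cst 1 : R -> \bar R) by split.
elim: n => [|n IH].
  rewrite big_nil mulr0 expR0 mul1e adde0 mul0r addr0.
  have -> : sg 0 (EFin \o U) y = (U y)%:E; last by [].
  rewrite sgE// set_itv1 integral_set1 mulr0 oppr0 expR0 mul1e adde0.
  by rewrite log_flow0.
have scal (c : R) g : (0 <= c)%R -> pos_meas g -> pos_meas (fun z : R => c%:E * g z).
  by move=> h hg; apply: pos_measM => //; split => // ?; rewrite lee_fin.
have e0 := expR_gt0 (- b)%R; have e1 := expR_gt0 (b * n.+1%:R)%R.
have s1 := pos_meas_sg a_p a_m J 1 hU.
have sc := scal _ _ (ltW e0) hchi; have su := scal _ _ (ltW e0) hU; have sk := scal _ _ k0 h1.
have step : sg n%:R (fun z => sg 1 (EFin \o U) z + (expR (- b))%:E * (EFin \o chi) z) y <=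
    sg n%:R (fun z => (expR (- b))%:E * (EFin \o U) z + k%:E * cst 1 z) y.
  apply: le_sg; [exact: pos_measD|exact: pos_measD|] => z.
  rewrite /= mule1 -!EFinM -EFinD; apply: le_trans (leeD2r _ (H z)) _.
  by rewrite -EFinD lee_fin; lra.
rewrite !sgD// !sgZ ?(ltW e0)// sg1// mule1 in step.
rewrite -sg_semigroup_real// natr1 in step.
have ke : (expR (b * n.+1%:R) * k = k)%R.
  by case: kb => ->; rewrite ?mulr0// mul0r expR0 mul1r.
have ee : (expR (b * n.+1%:R) * expR (- b) = expR (b * n%:R))%R.
  by rewrite -expRD -natr1; congr expR; ring.
have e1E : 0 <= (expR (b * n.+1%:R))%:E by rewrite lee_fin ltW.
have := lee_wpmul2l e1E step.
have p1 : 0 <= sg n.+1%:R (EFin \o U) y by exact: (pos_meas_sg _ _ _ _ hU).2.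
have p2 : 0 <= sg n%:R (EFin \o chi) y by exact: (pos_meas_sg _ _ _ _ hchi).2.
have p3 : 0 <= sg n%:R (EFin \o U) y by exact: (pos_meas_sg _ _ _ _ hU).2.
have e00 : 0 <= (expR (- b))%:E by rewrite lee_fin ltW.
rewrite !ge0_muleDr ?mule_ge0 ?lee_fin// !muleA -!EFinM ke ee => {}step.
rewrite big_nat_recr//= (addeC (\sum_(0 <= i < n) _)) addeA.
apply: le_trans (leeD2r _ step) _.
rewrite addeAC -natr1 mulrDl mul1r addrA EFinD; exact: leeD2r.
Qed.

(* The supersolutions [U] make the sums of [exp (b j) sg_j chi] sublinear. *)
Lemma no_exponential_limit (b l c y : R) (s : nat) (v chi : R -> R) : (0 < l)%R -> (0 < c)%R ->
  measurable_fun setT v -> (forall z, (0 <= v z)%R) ->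
  measurable_fun setT chi -> (forall z, (0 <= chi z)%R) ->
  (forall z, (c * v z)%:E <= sg s%:R (EFin \o chi) z) ->
  (forall k : R, (0 < k)%R -> exists (U : R -> R) (k' : R),
    [/\ (0 <= k' <= k)%R, (k' = 0 \/ b = 0)%R, measurable_fun setT U, forall z, (0 <= U z)%R &
    forall z, sg 1 (EFin \o U) z <= (expR (- b) * (U z - chi z) + k')%:E]) ->
  ~ (\forall j \near \oo, l%:E <= (expR (b * j%:R))%:E * sg j%:R (EFin \o v) y).
Proof.
move=> l0 c0 mv v0 mchi chi0 reach super [n0 _ Hn0].
have hv : pos_meas (EFin \o v) by exact: pos_meas_EFin.
have hchi : pos_meas (EFin \o chi) by exact: pos_meas_EFin.
pose e := expR (b * s%:R); have e0 : (0 < e)%R := expR_gt0 _.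
(* Lower bound for the terms of the sum: the assumed bound for [v] is carried over to [chi] by
   [reach], at the price of a delay [s]. *)
pose g := (e * c * l)%R; have g0 : (0 < g)%R by rewrite !mulr_gt0.
have low j : (n0 <= j)%N -> g%:E <= (expR (b * (j + s)%:R))%:E * sg (j + s)%:R (EFin \o chi) y.
  move=> nj; rewrite natrD sg_semigroup_real//.
  have hs := pos_meas_sg a_p a_m J s%:R hchi.
  have : sg j%:R (fun z => c%:E * (EFin \o v) z) y <= sg j%:R (sg s%:R (EFin \o chi)) y.
    have hcv : pos_meas (fun z => c%:E * (EFin \o v) z).
      by apply: pos_measM => //; split => // ?; rewrite lee_fin ltW.
    by apply: le_sg => // z; have := reach z; rewrite EFinM.
  rewrite sgZ ?(ltW c0)// => h.
  have E0 : 0 <= (expR (b * (j%:R + s%:R)))%:E by rewrite lee_fin expR_ge0.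
  apply: le_trans (lee_wpmul2l E0 h).
  rewrite mulrDr expRD -/e.
  have -> : (expR (b * j%:R) * e)%:E * (c%:E * sg j%:R (EFin \o v) y) =
     (e * c)%:E * ((expR (b * j%:R))%:E * sg j%:R (EFin \o v) y).
    by rewrite !muleA -!EFinM; congr (_ * _); congr EFin; ring.
  rewrite /g EFinM lee_wpmul2l ?lee_fin ?mulr_ge0 ?(ltW e0) ?(ltW c0)//; exact: Hn0.
(* With slack at most [g / 2] per step, [i] terms of size [g] eventually exceed the telescoping
   bound. *)
have g20 : (0 < g / 2)%R by rewrite divr_gt0.
have [U [k [/andP[k0 kg] kb mU U0 HU]]] := super _ g20.
have term_ge0 j : 0 <= (expR (b * j%:R))%:E * sg j%:R (EFin \o chi) y.
  by rewrite mule_ge0 ?lee_fin ?expR_ge0//; exact: (pos_meas_sg _ _ _ _ hchi).2.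
have sumlow i : (g * i%:R)%:E <= \sum_(0 <= j < n0 + s + i) (expR (b * j%:R))%:E * sg j%:R (EFin \o chi) y.
  elim: i => [|i IH]; first by rewrite mulr0; apply: sume_ge0 => j _.
  rewrite addnS big_nat_recr//= -natr1 mulrDr mulr1 EFinD; apply: leeD => //.
  have := low (n0 + i)%N (leq_addr _ _).
  by rewrite (_ : (n0 + i + s = n0 + s + i)%N)// addnAC.
have bnd i : (g * i%:R <= U y + (n0 + s + i)%:R * k)%R.
  rewrite -lee_fin; apply: le_trans (sumlow i) _.
  apply: le_trans (telescoping_bound (n0 + s + i) y k0 kb mU U0 mchi chi0 HU).
  rewrite leeDr// mule_ge0 ?lee_fin ?expR_ge0//.
  exact: (pos_meas_sg _ _ _ _ (pos_meas_EFin mU U0)).2.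
pose X := ((U y + (n0 + s)%:R * k) / (g / 2))%R.
have X0 : (0 <= X)%R by rewrite divr_ge0 ?addr_ge0 ?mulr_ge0// ltW.
have /andP[_ n2] := truncn_itv X0; set i := (Num.truncn X).+1 in n2.
have := bnd i; rewrite natrD mulrDl.
have : (i%:R * k <= i%:R * (g / 2))%R by rewrite ler_wpM2l.
move: n2; rewrite /X ltr_pdivrMr//.
by move: ((n0 + s)%:R * k)%R (U y) => u v' h1 h2 h3; lra.
Qed.

End telescoping.

(** * Gains on one half line, and how they are reached *)

Section gain.
Context {R : realType}.
Variables (a_p a_m : R) (J : {finite_measure set R -> \bar R}).
Hypotheses (a_p_gt0 : (0 < a_p)%R) (a_p_lt_a_m : (a_p < a_m)%R).
Notation L := (rate J).
Notation Phi := (log_flow a_p a_m).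
Notation sg := (sg a_p a_m J).

(** Used with [c = 1], where it lives on [y < 0], and with [c = -1], where it lives on [y > 0]. It
    vanishes continuously at 0, so the two profiles agree there. *)
Definition gain (c y : R) : R := (Num.max 0 (1 - expR (c * y)))%R.

Lemma measurable_gain c : measurable_fun setT (gain c).
Proof.
apply: measurable_maxr => //; apply: measurable_funB => //.
by apply: measurableT_comp => //; exact: measurable_funM.
Qed.

Lemma gain_ge0 c y : (0 <= gain c y)%R.
Proof. by rewrite /gain le_max lexx. Qed.

Lemma gain_le1 c y : (gain c y <= 1)%R.
Proof. by rewrite /gain ge_max ler01/= gerBl expR_ge0. Qed.

Lemma gain_pos c y : (c * y <= 0)%R -> gain c y = (1 - expR (c * y))%R.
Proof. by move=> h; rewrite /gain max_r// subr_ge0 -[leRHS]expR0 ler_expR. Qed.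

Lemma gain_0 c y : (0 <= c * y)%R -> gain c y = 0%R.
Proof. by move=> h; rewrite /gain max_l// subr_le0 -[leLHS]expR0 ler_expR. Qed.

(** On [y >= 0] the exponential costs at most [k]. On [y <= 0] the larger speed and [q <= 0] bring
    the additional term [- D exp(q y)]; [D] pays for [k], for the gain and its decay, at most
    [L + 1], and for its transport by the flow, at most [a_m]. *)
Lemma gain_below (q M b A k D : R) : (q <= 0)%R -> (1 <= A)%R -> (0 <= b)%R -> (0 <= k)%R ->
  \int[J]_xi (expR (q * xi))%:E = M%:E ->
  (A * (a_p * q + M - L + b) <= k)%R -> (D = A * (a_m - a_p) * - q)%R -> (L + 1 + a_m + k <= D)%R ->
  forall y, sg 1 (fun z => (A * expR (q * z))%:E) y <= (expR (- b) * (A * expR (q * y) - gain 1 y) + k)%:E.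
Proof.
move=> q0 A1 b0 k0 qM wrong DE right y; have ap0 := a_p_gt0; have pm := a_p_lt_a_m.
have L0 : (0 <= L)%R by exact: rate_ge0.
have A0 : (0 <= A)%R by lra.
have ek u : (0 <= u <= 1)%R -> (k <= k * expR (b * u))%R.
  move=> /andP[u0 _]; rewrite -[leLHS]mulr1 ler_wpM2l// -[leLHS]expR0 ler_expR mulr_ge0//.
have := @exp_supersolution _ a_p a_m J a_p_gt0 a_p_lt_a_m A q M b k 1 0 1 1 (gain 1) A0 k0 qM
  (measurable_gain 1) (gain_ge0 1).
move=> S.
apply: le_trans (S _ _ _ _ _ 1%R y _) _.
- by move=> z z0; rewrite mul0r gain_0// mul1r.
- by move=> z z0; rewrite mul1r gain_pos// mul1r.
- move=> z; rewrite mul1r; case: (leP 0 z)%R => z0.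
    by rewrite gain_0 ?mul1r// mulr_ge0 ?expR_ge0.
  apply: le_trans (gain_le1 _ _) _; rewrite -[leLHS]mulr1; apply: ler_pM => //.
  by rewrite -[leLHS]expR0 ler_expR mulr_le0// ltW.
- move=> u z hu z0; rewrite !mul0r !mulr0 !addr0; apply: le_trans (ek u hu).
  have e1 : (expR (q * z) <= 1)%R by rewrite -[leRHS]expR0 ler_expR mulr_le0_ge0.
  have e0 := expR_ge0 (q * z).
  case: (leP 0 (A * (a_p * q + M - L + b)))%R => h.
    by apply: le_trans wrong; apply: ler_piMr.
  by apply: le_trans k0; rewrite mulr_le0_ge0// ltW.
- move=> u z hu z0; apply: le_trans (ek u hu); rewrite !mul1r.
  have e1 : (1 <= expR (q * z))%R by rewrite -[leLHS]expR0 ler_expR mulr_le0.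
  have e2 : (expR z <= 1)%R by rewrite -[leRHS]expR0 ler_expR.
  have e3 := expR_ge0 z; have /andP[u0 u1] := hu.
  have c1 : (A * (a_m * q + M - L + b) <= k - D)%R by rewrite DE; lra.
  have kD : (k - D <= 0)%R by lra.
  have c2 : (A * (a_m * q + M - L + b) * expR (q * z) <= k - D)%R.
    apply: (@le_trans _ _ ((k - D) * expR (q * z)))%R; first by rewrite ler_wpM2r ?expR_ge0.
    by have := ler_wnM2l kD e1; rewrite mulr1.
  have c3 : ((u * (L - b) + 1) * (1 - expR z) <= L + 1)%R.
    apply: (@le_trans _ _ ((L + 1) * (1 - expR z)))%R.
      rewrite ler_wpM2r ?subr_ge0// lerD2r.
      apply: (@le_trans _ _ (u * L))%R; first by rewrite ler_wpM2l//; lra.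
      exact: ler_piMl.
    by apply: ler_piMr; lra.
  have c4 : (u * (a_m * expR z) <= a_m)%R.
    rewrite mulrC -mulrA; apply: ler_piMr; first lra.
    by rewrite mulrC; apply: mulr_ile1.
  lra.
- by rewrite ler01 lexx.
- by rewrite lee_fin !mulr1 mul1r.
Qed.

(** The mirror case: the smaller speed on [y >= 0] and [q >= 0] provide the excess. Here the
    transport of the gain has a favourable sign, so [a_m] does not enter the condition on [D]. *)
Lemma gain_above (q M b A k D : R) : (0 <= q)%R -> (1 <= A)%R -> (0 <= b)%R -> (0 <= k)%R ->
  \int[J]_xi (expR (q * xi))%:E = M%:E ->
  (A * (a_m * q + M - L + b) <= k)%R -> (D = A * (a_m - a_p) * q)%R -> (L + 1 + k <= D)%R ->
  forall y, sg 1 (fun z => (A * expR (q * z))%:E) y <= (expR (- b) * (A * expR (q * y) - gain (-1) y) + k)%:E.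
Proof.
move=> q0 A1 b0 k0 qM wrong DE right y; have ap0 := a_p_gt0; have pm := a_p_lt_a_m.
have L0 : (0 <= L)%R by exact: rate_ge0.
have A0 : (0 <= A)%R by lra.
have ek u : (0 <= u <= 1)%R -> (k <= k * expR (b * u))%R.
  move=> /andP[u0 _]; rewrite -[leLHS]mulr1 ler_wpM2l// -[leLHS]expR0 ler_expR mulr_ge0//.
have := @exp_supersolution _ a_p a_m J a_p_gt0 a_p_lt_a_m A q M b k (-1) 1 0 1 (gain (-1)) A0 k0 qM
  (measurable_gain (-1)) (gain_ge0 (-1)).
move=> S.
apply: le_trans (S _ _ _ _ _ 1%R y _) _.
- by move=> z z0; rewrite mul1r gain_pos// mulN1r oppr_le0.
- by move=> z z0; rewrite mul0r gain_0// mulN1r oppr_ge0.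
- move=> z; rewrite mul1r; case: (leP 0 z)%R => z0; last first.
    by rewrite gain_0 ?mulN1r ?oppr_ge0 ?(ltW z0)// mulr_ge0 ?expR_ge0.
  apply: le_trans (gain_le1 _ _) _; rewrite -[leLHS]mulr1; apply: ler_pM => //.
  by rewrite -[leLHS]expR0 ler_expR mulr_ge0.
- move=> u z hu z0; apply: le_trans (ek u hu); rewrite !mul1r !mulN1r.
  have e1 : (1 <= expR (q * z))%R by rewrite -[leLHS]expR0 ler_expR mulr_ge0.
  have e2 : (expR (- z) <= 1)%R by rewrite -[leRHS]expR0 ler_expR oppr_le0.
  have e3 := expR_ge0 (- z)%R; have /andP[u0 u1] := hu.
  have c1 : (A * (a_p * q + M - L + b) <= k - D)%R by rewrite DE; lra.
  have kD : (k - D <= 0)%R by lra.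
  have c2 : (A * (a_p * q + M - L + b) * expR (q * z) <= k - D)%R.
    apply: (@le_trans _ _ ((k - D) * expR (q * z)))%R; first by rewrite ler_wpM2r ?expR_ge0.
    by have := ler_wnM2l kD e1; rewrite mulr1.
  have c3 : ((u * (L - b) + 1) * (1 - expR (- z)) <= L + 1)%R.
    apply: (@le_trans _ _ ((L + 1) * (1 - expR (- z))))%R.
      rewrite ler_wpM2r ?subr_ge0// lerD2r.
      apply: (@le_trans _ _ (u * L))%R; first by rewrite ler_wpM2l//; lra.
      exact: ler_piMl.
    by apply: ler_piMr; lra.
  have c4 : (0 <= u * (a_p * expR (- z)))%R by rewrite !mulr_ge0// ltW.
  lra.
- move=> u z hu z0; rewrite !mul0r !mulr0 !addr0; apply: le_trans (ek u hu).
  have e1 : (expR (q * z) <= 1)%R by rewrite -[leRHS]expR0 ler_expR mulr_ge0_le0.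
  have e0 := expR_ge0 (q * z).
  case: (leP 0 (A * (a_m * q + M - L + b)))%R => h.
    by apply: le_trans wrong; apply: ler_piMr.
  by apply: le_trans k0; rewrite mulr_le0_ge0// ltW.
- by rewrite ler01 lexx.
- by rewrite lee_fin !mulr1 mul1r.
Qed.

Lemma log_flow_ge_speed t y : (0 <= t)%R -> (y + a_p * t <= Phi t y)%R.
Proof.
have am0 := lt_trans a_p_gt0 a_p_lt_a_m; have ap0 := a_p_gt0; have lt_a := a_p_lt_a_m.
move=> t0; case: (leP 0 y)%R => y0; first by rewrite log_flow_ge0.
case: (leP (y + a_m * t) 0)%R => yt.
  by rewrite log_flow_le0// ?(ltW y0)// lerD2l ler_wpM2r// ltW.
rewrite log_flow_cross ?(ltW y0) ?(ltW yt)// mulrDr addrC lerD2l.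
have -> : (a_p * (y / a_m) = a_p / a_m * y)%R by ring.
rewrite -[leLHS]mul1r; apply: ler_wnM2r; first exact: ltW.
by rewrite ler_pdivrMr// mul1r ltW.
Qed.

Let gain1_gt0 : (0 < 1 - expR (-1) :> R)%R.
Proof. by rewrite subr_gt0 -[ltRHS]expR0 ltr_expR ltrN10. Qed.

(** The flow alone carries a bounded set above 1. *)
Lemma gain_above_reached (B : R) : exists2 c : R, (0 < c)%R & exists s : nat,
  forall y, (`|y| <= B)%R -> c%:E <= sg s%:R (EFin \o gain (-1)) y.
Proof.
have ap0 := a_p_gt0.
pose X := ((1 + `|B|) / a_p)%R.
have X0 : (0 <= X)%R by rewrite divr_ge0 ?addr_ge0// ltW.
have /andP[_ /ltW] := truncn_itv X0; set s := (Num.truncn X).+1 => hs.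
rewrite ler_pdivrMr// in hs.
exists (expR (- (L * s%:R)) * (1 - expR (-1)))%R; first by rewrite mulr_gt0 ?expR_gt0.
exists s => y yB.
have hg : pos_meas (EFin \o gain (-1)).
  by apply: pos_meas_EFin; [exact: measurable_gain|exact: gain_ge0].
apply: le_trans (sg_flow_le a_p a_m J y hg (ler0n _ s)).
rewrite -EFinM lee_fin ler_wpM2l ?expR_ge0//.
have h := @log_flow_ge_speed s%:R y (ler0n _ s).
have hB := ler_norm B; have := yB; rewrite ler_norml => /andP[y1 y2].
have P1 : (1 <= Phi s%:R y)%R by apply: le_trans h; lra.
rewrite gain_pos; last by rewrite mulN1r oppr_le0; lra.
by rewrite lerD2l lerN2 ler_expR mulN1r lerN2.
Qed.

(** Going down takes jumps. They are made in time slots of length [1 / N], with [N] large enough for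
    [window_descend], and [s N] of them fill an integer time. *)
Lemma gain_below_reached (x1 B : R) : (0 < x1)%R -> 0 < J `[(- (2 * x1))%R, (- x1)%R]%classic ->
  exists2 c : R, (0 < c)%R & exists s : nat,
  forall y, (`|y| <= B)%R -> c%:E <= sg s%:R (EFin \o gain 1) y.
Proof.
move=> x10 J0; have am0 := lt_trans a_p_gt0 a_p_lt_a_m.
have x20 : (0 < 2 * x1)%R by rewrite mulr_gt0.
have N0 : (0 <= 2 * a_m / x1)%R by rewrite divr_ge0 ?mulr_ge0// ltW.
have /andP[_ /ltW] := truncn_itv N0; set N := (Num.truncn (2 * a_m / x1)).+1 => hN.
have Np : (0 < N%:R :> R)%R by rewrite ltr0n.
have e0 : (0 < N%:R^-1 :> R)%R by rewrite invr_gt0.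
have ae : (a_m * N%:R^-1 <= x1 / 2)%R.
  rewrite ler_pdivrMr// in hN; rewrite ler_pdivrMr//; lra.
have X0 : (0 <= (`|B| + 1) / (x1 / 2))%R by rewrite divr_ge0 ?addr_ge0// divr_ge0// ltW.
have /andP[_ /ltW] := truncn_itv X0; set s := (Num.truncn ((`|B| + 1) / (x1 / 2))).+1 => hs.
have x12 : (0 < x1 / 2)%R by rewrite divr_gt0.
rewrite ler_pdivrMr// in hs.
have [d d0 hd] := @window_descend_iter _ _ _ J a_p_gt0 a_p_lt_a_m x1 (2 * x1)%R N%:R^-1%R (- `|B|)%R (-1)%R (s * N) x10 x20 e0 ae J0.
exists ((1 - expR (-1)) * d)%R; first by rewrite mulr_gt0.
exists s => y yB.
have tE : ((s * N)%:R * N%:R^-1 = s%:R :> R)%R by rewrite natrM mulfK// gt_eqF.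
rewrite tE in hd.
have hg : pos_meas (EFin \o gain 1).
  by apply: pos_meas_EFin; [exact: measurable_gain|exact: gain_ge0].
have hy : (- `|B| <= y <= -1 + (s * N)%:R * (x1 / 2))%R.
  have hB := ler_norm B; have := yB; rewrite ler_norml => /andP[y1 y2].
  have : (s%:R * (x1 / 2) <= (s * N)%:R * (x1 / 2))%R.
    by rewrite ler_pM2r// ler_nat leq_pmulr.
  by move=> h; apply/andP; split; lra.
have g1 := gain1_gt0.
have hw := pos_meas_window (- `|B| - (s * N)%:R * (2 * x1))%R (-1)%R.
apply: (@le_trans _ _ (sg s%:R (fun z => (1 - expR (-1))%:E * window (- `|B| - (s * N)%:R * (2 * x1)) (-1) z) y)).
  by rewrite sgZ ?(ltW g1)// EFinM lee_wpmul2l ?lee_fin ?(ltW g1)//; exact: hd.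
apply: le_sg => //.
  by apply: pos_measM => //; split => // ?; rewrite lee_fin ltW.
move=> z; case: (boolP (- `|B| - (s * N)%:R * (2 * x1) <= z <= -1)%R) => hz.
  have /andP[_ z1] := hz; rewrite windowT// mule1 lee_fin gain_pos ?mul1r; last by lra.
  by rewrite lerD2l lerN2 ler_expR.
by rewrite windowF// mule0 lee_fin gain_ge0.
Qed.

End gain.

(** * The tangent of the moment function at 0 *)

Section mgf_bound.
Context {R : realType}.
Variables (J : {finite_measure set R -> \bar R}) (m : R).
Hypothesis J_neg : J `[0%R, +oo[%classic = 0.
Hypothesis J_mean : \int[J]_xi (Num.max 0 (- xi)%R)%:E = m%:E.

(** Integration of [exp(q xi) >= 1 + q xi]. Combined with the bound from [real_root] it determines
    the sign of [q]. *)
Lemma mgf_ge_tangent (q M : R) : \int[J]_xi (expR (q * xi))%:E = M%:E -> (rate J - q * m <= M)%R.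
Proof.
move=> qM; have he := pos_meas_exp q; have hl := @pos_meas_loss R.
have h1 : pos_meas (cst 1 : R -> \bar R) by split.
have i1 : \int[J]_xi (cst 1 xi) = (rate J)%:E.
  by have -> := integral_cst J measurableT 1; rewrite mul1e; exact: rateE.
have hs : pos_meas (fun xi : R => `|q|%:E * (Num.max 0 (- xi)%R)%:E).
  by apply: pos_measM => //; split => // ?; rewrite lee_fin.
have iS : \int[J]_xi (`|q|%:E * (Num.max 0 (- xi)%R)%:E) = (`|q| * m)%:E.
  by rewrite (ge0_integralZl J measurableT hl.1 (fun z _ => hl.2 z)) ?lee_fin// J_mean.
case: (leP 0 q)%R => q0.
  have : \int[J]_xi (cst 1 xi) <= \int[J]_xi ((expR (q * xi))%:E + `|q|%:E * (Num.max 0 (- xi)%R)%:E).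
    apply: le_integral_neg => //; first exact: pos_measD.
    move=> xi xi0; rewrite -EFinM -EFinD lee_fin max_r ?ger0_norm//; last lra.
    by have := expR_ge1Dx (q * xi); lra.
  rewrite (ge0_integralD J measurableT (fun z _ => he.2 z) he.1 (fun z _ => hs.2 z) hs.1).
  by rewrite i1 iS qM -EFinD lee_fin ger0_norm//; lra.
have : \int[J]_xi (cst 1 xi + `|q|%:E * (Num.max 0 (- xi)%R)%:E) <= \int[J]_xi (expR (q * xi))%:E.
  apply: le_integral_neg => //; first exact: pos_measD.
  move=> xi xi0; rewrite -EFinM -EFinD lee_fin max_r ?ltr0_norm//; last lra.
  by have := expR_ge1Dx (q * xi); lra.
rewrite (ge0_integralD J measurableT (fun z _ => h1.2 z) h1.1 (fun z _ => hs.2 z) hs.1).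
by rewrite i1 iS qM -EFinD lee_fin ltr0_norm//; lra.
Qed.

End mgf_bound.

(** * A test function charged by the limit measure *)

Section plateau.
Context {R : realType}.

Definition plateau (n : nat) (y : R) : R := (Num.max 0 (Num.min 1 (n.+1%:R - `|y|)))%R.

Lemma continuous_plateau n : continuous (plateau n).
Proof.
move=> y.
apply: (@continuous_max R R (fun=> 0%R) (fun y => Num.min 1 (n.+1%:R - `|y|))%R y).
  exact: cvg_cst.
apply: (@continuous_min R R (fun=> 1%R) (fun y => n.+1%:R - `|y|)%R y).
  exact: cvg_cst.
by apply: cvgB; [exact: cvg_cst|exact: norm_continuous].
Qed.

Lemma plateau01 n y : (0 <= plateau n y <= 1)%R.
Proof. by rewrite /plateau le_max lexx/= ge_max ler01/= ge_min lexx. Qed.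

Lemma plateau1 n y : (`|y| <= n%:R)%R -> plateau n y = 1%R.
Proof. by move=> h; rewrite /plateau min_l ?max_r// -natr1; lra. Qed.

Lemma plateau0 n y : (n.+1%:R <= `|y|)%R -> plateau n y = 0%R.
Proof.
by move=> h; rewrite /plateau max_l// ge_min; apply/orP; right; rewrite subr_le0.
Qed.

Lemma Cc_pos_comp_ln (v : R -> R) (B : R) : continuous v ->
  (forall y, (B < `|y|)%R -> v y = 0%R) -> Cc_pos (v \o @ln R).
Proof.
move=> cv vB; split.
  move=> x; rewrite in_itv/= andbT => x0.
  by apply: continuous_comp; [exact: continuous_ln|exact: cv].
exists (`[expR (- B), expR B]%classic); first split.
- exact: segment_compact.
- move=> x /=; rewrite !in_itv/= andbT => /andP[h _]; exact: lt_le_trans (expR_gt0 _) h.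
move=> x x0 nx; apply: vB; rewrite ltNge; apply/negP => h; apply: nx.
rewrite /= in_itv/= -[X in (_ <= X <= _)%R](lnK (x := x)) ?posrE// !ler_expR.
by rewrite -ler_norml.
Qed.

Lemma norm_ln_le (x c : R) : (0 < x)%R -> (`|ln x| <= c)%R = (expR (- c) <= x <= expR c)%R.
Proof.
move=> x0; rewrite ler_norml -[X in _ = (_ <= X <= _)%R](lnK (x := x)) ?posrE//.
by rewrite !ler_expR.
Qed.

(** By countable subadditivity some interval [[exp(- n), exp(n)]] has positive mass. Local
    finiteness keeps the integral finite; an infinite one would make [pairing] take its default
    value 0. *)
Lemma plateau_charged (nu : {measure set R -> \bar R}) : radon_pos nu ->
  nu `]0%R, +oo[%classic <> 0 -> exists n, (0 < pairing nu (plateau n \o @ln R))%R.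
Proof.
move=> [nu0 nuK] nuD; pose A n := (`[expR (- n%:R), expR n%:R]%classic : set R).
have mA n : measurable (A n) by exact: measurable_itv.
have [n hn] : exists n, nu (A n) <> 0.
  apply: contrapT => H; apply: nuD; apply/eqP; rewrite -measure_le0.
  apply: (@le_trans _ _ (\sum_(0 <= n <oo) nu (A n))); last first.
    by rewrite eseries0// => n _ _; apply: contrapT => h; apply: H; exists n.
  apply: (@measure_sigma_subadditive _ _ _ nu); [by []|exact: measurable_itv|].
  move=> x /=; rewrite in_itv/= andbT => x0.
  have l0 : (0 <= `|ln x|)%R by [].
  have /andP[_ /ltW h] := truncn_itv l0; exists (Num.truncn `|ln x|).+1 => //.
  rewrite /A /= in_itv/= -[X in (_ <= X <= _)%R](lnK (x := x)) ?posrE// !ler_expR.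
  by rewrite -ler_norml.
exists n; set f := plateau n \o @ln R.
have mf : measurable_fun setT (f \o expR).
  have -> : f \o expR = plateau n by apply: funext => y; rewrite /f /= expRK.
  exact: continuous_measurable_fun (@continuous_plateau n).
rewrite pairing_log//.
have fE x : f (expR (ln x)) = plateau n (ln x) by rewrite /f /= expRK.
have -> : \int[nu]_x (Num.max 0 (- f (expR (ln x))))%:E = 0.
  rewrite -[RHS](integral0 nu setT); apply: eq_integral => x _; congr EFin.
  by rewrite fE max_l// oppr_le0; case/andP: (plateau01 n (ln x)).
rewrite sube0.
have -> : \int[nu]_x (Num.max 0 (f (expR (ln x))))%:E = \int[nu]_x (plateau n (ln x))%:E.
  apply: eq_integral => x _; congr EFin.
  by rewrite fE max_r//; case/andP: (plateau01 n (ln x)).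
have hp : pos_meas (fun x : R => (plateau n (ln x))%:E).
  apply: pos_meas_EFin => [|x]; last by case/andP: (plateau01 n (ln x)).
  apply: (measurableT_comp (f := plateau n)); last exact: measurable_ln.
  exact: continuous_measurable_fun (@continuous_plateau n).
have i0 : 0 <= \int[nu]_x (plateau n (ln x))%:E by apply: integral_ge0 => x _; exact: hp.2.
apply: fine_gt0; apply/andP; split.
  apply: (@lt_le_trans _ _ (nu (A n))); first by rewrite lt_neqAle eq_sym measure_ge0 andbT; apply/eqP.
  have -> : nu (A n) = \int[nu]_x (\1_(A n) x)%:E by rewrite integral_indic ?setIT.
  apply: ge0_le_integral => //.
  - by apply/measurable_EFinP; exact: measurable_indic.
  - exact: hp.1.
  move=> x _; rewrite indicE; case: (boolP (x \in A n)) => [|_]; last exact: hp.2.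
  rewrite inE /A/= in_itv/= => hx; have x0 : (0 < x)%R by case/andP: hx => h _; exact: lt_le_trans (expR_gt0 _) h.
  by rewrite plateau1// norm_ln_le.
pose N := (`]-oo, 0%R]%classic : set R).
have mN : measurable N by exact: measurable_itv.
have mU : measurable (A n.+1 `|` N) by exact: measurableU.
apply: (@le_lt_trans _ _ (nu (A n.+1 `|` N))); last first.
  apply: le_lt_trans (measureU2 _ _ _) _ => //; rewrite [X in _ + X < _](nu0 : nu N = 0) adde0; apply: nuK.
    exact: segment_compact.
  move=> x /=; rewrite !in_itv/= andbT => /andP[h _]; exact: lt_le_trans (expR_gt0 _) h.
have -> : nu (A n.+1 `|` N) = \int[nu]_x (\1_(A n.+1 `|` N) x)%:E by rewrite integral_indic ?setIT.
apply: ge0_le_integral => //.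
- by move=> x _; exact: hp.2.
- exact: hp.1.
- by apply/measurable_EFinP; exact: measurable_indic.
move=> x _; rewrite lee_fin indicE; case: (boolP (x \in _)) => [_|]; first by case/andP: (plateau01 n (ln x)).
rewrite notin_setE => nx; rewrite plateau0//.
have x0 : (0 < x)%R by rewrite ltNge; apply/negP => h; apply: nx; right; rewrite /N/= in_itv.
rewrite leNgt; apply/negP => /ltW; rewrite norm_ln_le// => h.
by apply: nx; left; rewrite /A/= in_itv.
Qed.

End plateau.

(** * Growth of the bumps *)

Section bump_growth.
Context {R : realType}.
Variables (a_p a_m : R) (J : {finite_measure set R -> \bar R}).
Notation mu := (@lebesgue_measure R).
Notation L := (rate J).
Notation Phi := (log_flow a_p a_m).
Notation sg := (sg a_p a_m J).

(** The bump along a trajectory without the clamp, hence differentiable; it agrees with the clamped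
    one while the angle stays in [[- pi / 2, pi / 2]]. *)
Let Hr (q k y0 a s r z u : R) : R :=
  (expR (- (L * u)) * expR (r * (s - u)) * (expR (q * (z + a * u)) * cos (k * (z + a * u - y0))))%R.

Let dHr (q k y0 a s r z u : R) : R :=
  (expR (- (L * u)) * expR (r * (s - u)) * (expR (q * (z + a * u)) *
    ((- L - r + a * q) * cos (k * (z + a * u - y0)) - sin (k * (z + a * u - y0)) * (a * k))))%R.

Let derive_Hr q k y0 a s r z u :
  is_derive u (1%R : R) (Hr q k y0 a s r z) (dHr q k y0 a s r z u).
Proof.
rewrite /Hr /dHr; apply: is_derive_eq; rewrite /GRing.scale/=.
ring.
Qed.

Let continuous_dHr q k y0 a s r z : continuous (dHr q k y0 a s r z).
Proof.
move=> u; apply: differentiable_continuous; apply/derivable1_diffP.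
rewrite /dHr; exact: ex_derive.
Qed.

(** [exp(r t) cos_bump] is a subsolution, bounded on each horizon: for this [r] the drift terms are
    exactly balanced by the lower bound [bump_jumps], sine terms included. The hypothesis on [Phi]
    says that the bump sits where the speed is [a]. *)
Lemma bump_growth (q k y0 a C r t y : R) : (0 < k)%R -> (0 < a)%R ->
  \int[J]_xi trunc_sin q k xi = (a * k)%:E -> \int[J]_xi trunc_cos q k xi = C%:E ->
  r = (a * q - L + C)%R ->
  (forall z u, (0 <= u)%R -> (- (pi / 2) <= k * (z - y0))%R -> (k * (z + a * u - y0) <= pi / 2)%R ->
    Phi u z = (z + a * u)%R) ->
  (0 <= t)%R -> (expR (r * t) * cos_bump q k y0 y)%:E <= sg t (EFin \o cos_bump q k y0) y.
Proof.
move=> k0 a0 sE cE rE flow t0.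
have p0 : (0 < pi :> R)%R := pi_gt0 R.
have mb : measurable_fun setT (cos_bump q k y0) := continuous_measurable_fun (@continuous_bump _ _ _ _).
have b0 := bump_ge0 q k y0.
have hb : pos_meas (EFin \o cos_bump q k y0) by exact: pos_meas_EFin.
pose V (x : R * R) : \bar R := if (0 <= x.1)%R then (expR (r * x.1) * cos_bump q k y0 x.2)%:E else 0.
have hV : pos_meas V.
  split; last by move=> x; rewrite /V; case: ifP => // _; rewrite lee_fin mulr_ge0// expR_ge0.
  apply: measurable_fun_ifT => //.
    exact: (measurable_fun_ler (measurable_cst _) measurable_fst).
  apply/measurable_EFinP; apply: measurable_funM.
    by apply: measurableT_comp => //; exact: measurable_funM.
  exact: measurableT_comp.
have Vneg (s z : R) : (s < 0)%R -> V (s, z) = 0 by move=> s0; rewrite /V/= leNgt s0.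
have hn := pos_meas_nojump a_p a_m J hb.
have hj := pos_meas_jump_op J hV.
have hst := pos_meas_step_op a_p a_m J hV.
pose B := expR (`|q| * (`|y0| + pi / 2 / k)).
have bB z : (cos_bump q k y0 z <= B)%R.
  case: (leP (pi / 2) `|k * (z - y0)|)%R => h; first by rewrite bump_out// expR_ge0.
  have hz : (`|z| <= `|y0| + pi / 2 / k)%R.
    rewrite normrM (gtr0_norm k0) mulrC -ltr_pdivlMr// in h.
    rewrite -[z](subrK y0) addrC; apply: le_trans (ler_normD _ _) _.
    by rewrite lerD2l ltW.
  rewrite /cos_bump -[leRHS]mulr1; apply: ler_pM; rewrite ?expR_ge0 ?cos_le1//.
    by rewrite cos_ge0_pihalf// clamp_itv.
  rewrite ler_expR; apply: le_trans (ler_norm _) _; rewrite normrM.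
  exact: ler_wpM2l.
have -> : (expR (r * t) * cos_bump q k y0 y)%:E = V (t, y) by rewrite /V/= t0.
apply: (@potential_sub _ _ _ _ _ _ t (expR (`|r| * t) * B)%R) => //.
- by rewrite mulr_ge0// expR_ge0.
- move=> s z st; rewrite /V/=; case: ifPn => s0; last by rewrite lee_fin mulr_ge0// expR_ge0.
  rewrite lee_fin; apply: ler_pM => //; rewrite ?expR_ge0// ler_expR.
  apply: le_trans (ler_norm _) _; rewrite normrM (ger0_norm s0); exact: ler_wpM2l.
move=> -[s z]; case: (ltP s 0)%R => s0; first by rewrite Vneg// adde_ge0// ?hn.2 ?hst.2.
case: (leP (pi / 2) `|k * (z - y0)|)%R => hz.
  by rewrite /V/= s0 bump_out// mulr0 adde_ge0// ?hn.2 ?hst.2.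
have hzz : (- (pi / 2) <= k * (z - y0) <= pi / 2)%R by rewrite -ler_norml ltW.
have /andP[z1 z2] := hzz.
(* Time at which the trajectory leaves the bump through its upper end. The comparison stops there,
   where the bump vanishes, or at [s] if that comes before. *)
pose e := ((pi / 2 - k * (z - y0)) / (k * a))%R.
have ka : (0 < k * a)%R by rewrite mulr_gt0.
have e0 : (0 <= e)%R by rewrite divr_ge0 ?(ltW ka)// subr_ge0.
have eE : (k * (z + a * e - y0) = pi / 2)%R.
  by rewrite /e; field; rewrite !gt_eqF.
pose T := Num.min s e; have T0 : (0 <= T)%R by rewrite le_min s0 e0.
have Ts : (T <= s)%R by rewrite ge_min lexx.
have Te : (T <= e)%R by rewrite ge_min lexx orbT.
have win u : (0 <= u <= T)%R -> (k * (z + a * u - y0) <= pi / 2)%R.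
  move=> /andP[u0 uT]; rewrite -eE ler_pM2l// lerD2r lerD2l ler_pM2l//; exact: le_trans Te.
have win2 u : (0 <= u)%R -> (- (pi / 2) <= k * (z + a * u - y0))%R.
  by move=> u0; apply: le_trans z1 _; rewrite ler_pM2l// lerD2r lerDl mulr_ge0// ltW.
have stepE : step_op a_p a_m J V (s, z) =
    \int[mu]_(u in `[0%R, s]) ((expR (- (L * u)))%:E * jump_op J V (s - u, Phi u z)%R).
  by rewrite /Submission.step_op flow_op_trunc//; exact: jump_op_neg.
have hint : pos_meas (fun u : R => (expR (- (L * u)))%:E * jump_op J V (s - u, Phi u z)%R).
  apply: pos_measM.
    by apply: pos_meas_EFin; [exact: measurable_expRate|move=> v; exact: expR_ge0].
  by have := pos_meas_comp (measurable_flow_shift a_p a_m (s, z)) hj.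
have main := @integral_ge_derive _ _ _ (fun u : R => (expR (- (L * u)))%:E * jump_op J V (s - u, Phi u z)%R) T T0
  (derive_Hr q k y0 a s r z) (@continuous_dHr q k y0 a s r z) (measurable_funTS hint.1).
have H0E : Hr q k y0 a s r z 0 = (expR (r * s) * cos_bump q k y0 z)%R.
  by rewrite /Hr /cos_bump mulr0 oppr0 expR0 mul1r mulr0 !addr0 clampE.
have VE : V (s, z) = (Hr q k y0 a s r z 0)%:E by rewrite /V/= s0 H0E.
rewrite VE; apply: le_trans (main _) _.
  move=> u hu; have /andP[u0 uT] := hu; split; first exact: hint.2.
  have us : (0 <= s - u)%R by rewrite subr_ge0; exact: le_trans uT Ts.
  have jE : jump_op J V (s - u, Phi u z)%R = (expR (r * (s - u)))%:E * \int[J]_xi (cos_bump q k y0 (Phi u z + xi))%:E.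
    have hbx : pos_meas (fun xi : R => (cos_bump q k y0 (Phi u z + xi))%:E).
      by apply: (pos_meas_comp _ hb); exact: measurable_funD.
    rewrite -(ge0_integralZl J measurableT hbx.1 (fun x _ => hbx.2 x)) ?lee_fin ?expR_ge0//.
    by apply: eq_integral => xi _; rewrite /V/= us EFinM.
  rewrite jE flow//; last exact: win.
  have hw : (- (pi / 2) <= k * (z + a * u - y0) <= pi / 2)%R by rewrite win2// win.
  have bj := bump_jumps k0 hw sE cE.
  rewrite muleA -EFinM.
  have E0 : 0 <= (expR (- (L * u)) * expR (r * (s - u)))%:E by rewrite lee_fin mulr_ge0 ?expR_ge0.
  apply: le_trans (lee_wpmul2l E0 bj).
  rewrite -EFinM lee_fin /dHr rE le_eqVlt; apply/orP; left; apply/eqP; ring.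
rewrite addeC; apply: leeD; last first.
  rewrite stepE; apply: ge0_subset_integral => //.
  - by apply: measurable_funTS; exact: hint.1.
  - by move=> u _; exact: hint.2.
  - by move=> u /=; rewrite !in_itv/= => /andP[-> /le_trans ->].
rewrite /Submission.nojump/= /survival s0 -EFinM lee_fin.
case: (leP s e)%R => se.
  have TE : T = s by rewrite /T min_l.
  have hs : (0 <= s <= T)%R by rewrite s0 TE lexx.
  rewrite TE flow//; last exact: win.
  rewrite /Hr subrr mulr0 expR0 mulr1 /cos_bump clampE//.
  by rewrite win2// win.
have TE : T = e by rewrite /T min_r// ltW.
by rewrite TE /Hr eE cos_pihalf !mulr0 mulr_ge0 ?expR_ge0.
Qed.

End bump_growth.

(** * Failure of the Malthusian behaviour *)

Section part2.
Context d (Omega : measurableType d) (R : realType) (P : probability Omega R).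
Notation mu := (@lebesgue_measure R).
Variables (a_p a_m : R) (rho : R -> R) (eps0 : R) (phi : R -> R -> R).
Variables (tau sigma : nat -> {RV P >-> R}).
Hypotheses (a_p_gt0 : (0 < a_p)%R) (a_p_lt_a_m : (a_p < a_m)%R).
Hypothesis rho_meas : measurable_fun (`[0%R, 1%R]%classic : set R) rho.
Hypothesis rho_ge0 : forall s : R, (0 <= s <= 1)%R -> (0 <= rho s)%R.
Hypothesis eps0_gt0 : (0 < eps0)%R.
Hypothesis rho_moment :
  \int[mu]_(s in `[0%R, 1%R]) (s `^ (- eps0) * rho s)%:E < +oo.
Hypothesis phi_flow : is_flow (speed a_p a_m) phi.
Hypothesis jumps : jump_mechanism rho tau sigma.
Notation J := (log_kernel rho_meas rho_ge0 eps0_gt0 rho_moment).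
Notation L := (rate J).
Notation sg := (sg a_p a_m J).
Notation Phi := (log_flow a_p a_m).
Notation m := (- \int[mu]_(s in `[0%R, 1%R]) (ln s * rho s))%R.
Notation lambda := (\int[mu]_(s in `[0%R, 1%R]) ((1 - s) * rho s))%R.

Let J_neg := log_kernel_ge0 rho_meas rho_ge0 eps0_gt0 rho_moment.
Let J_moment := log_kernel_moment rho_meas rho_ge0 eps0_gt0 rho_moment.
Let J_mean := log_kernel_mean rho_meas rho_ge0 eps0_gt0 rho_moment.

Section limit.
Variables (alpha : R) (nu : {measure set R -> \bar R}) (h : R -> R).
Hypothesis lim : forall f : R -> R, Cc_pos f -> forall x : R, (0 < x)%R ->
  ((expR (- alpha * t) * gf_semigroup rho tau sigma phi (speed a_p a_m) t f x)
     @[t --> +oo] --> (h x * pairing nu f : R))%R.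
Let b := (lambda - alpha)%R.

Let log_limit (v : R -> R) (B C y : R) : continuous v -> (forall z, (0 <= v z <= C)%R) ->
  (forall z, (B < `|z|)%R -> v z = 0%R) ->
  (fun t : R => expR (b * t) * fine (sg t (EFin \o v) y))%R @ +oo%R -->
    (h (expR y) * pairing nu (v \o @ln R))%R.
Proof.
move=> cv vC vB; have hf := Cc_pos_comp_ln cv vB.
have fE z : (v \o @ln R) (expR z) = v z by rewrite /= expRK.
have mf : measurable_fun setT ((v \o @ln R) \o expR).
  have -> : (v \o @ln R) \o expR = v by apply: funext => z; exact: fE.
  exact: continuous_measurable_fun.
have fC z : (`|(v \o @ln R) (expR z)| <= C)%R.
  by rewrite fE ger0_norm; case/andP: (vC z).
apply: cvg_trans (lim hf (expR_gt0 y)); apply: near_eq_cvg; near=> t.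
have t0 : (0 <= t)%R by near: t; exact: nbhs_pinfty_ge.
have := gf_semigroupE a_p_gt0 a_p_lt_a_m rho_meas rho_ge0 eps0_gt0 rho_moment phi_flow jumps (expR_gt0 y) t0 mf fC.
rewrite expRK.
have -> : sg t (positive_part_at (v \o @ln R)) y = sg t (EFin \o v) y.
  by apply: sg_eq => z; rewrite /positive_part_at fE max_r//; case/andP: (vC z).
have -> : sg t (positive_part_at (fun z => - (v \o @ln R) z)%R) y = 0.
  have h0 : pos_meas (cst 0 : R -> \bar R) by split.
  rewrite -[RHS](mul0e (sg t (cst 0) y)) -sgZ//; apply: sg_eq => z.
  by rewrite /positive_part_at fE max_l ?mul0e// oppr_le0; case/andP: (vC z).
rewrite subr0 => e; rewrite -e mulrA -expRD; congr (expR _ * _)%R.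
by rewrite /b; ring.
Unshelve. all: by end_near. Qed.

(** [sg t v] at [y0] is at least [exp(r t) v(y0)], so a finite limit of [exp(b t) sg t v] requires
    [b + r <= 0]. *)
Let rate_le (q k y0 a C : R) : (0 < k)%R -> (0 < a)%R ->
  \int[J]_xi trunc_sin q k xi = (a * k)%:E -> \int[J]_xi trunc_cos q k xi = C%:E ->
  (forall z u, (0 <= u)%R -> (- (pi / 2) <= k * (z - y0))%R -> (k * (z + a * u - y0) <= pi / 2)%R ->
    Phi u z = (z + a * u)%R) ->
  (a * q - L + C <= - b)%R.
Proof.
move=> k0 a0 sE cE flow; set r := (a * q - L + C)%R; rewrite leNgt; apply/negP => br.
have p0 : (0 < pi :> R)%R := pi_gt0 R.
pose v := cos_bump q k y0; pose B := (`|y0| + pi / 2 / k)%R.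
have vB z : (B < `|z|)%R -> v z = 0%R.
  move=> hz; apply: bump_out; rewrite leNgt; apply/negP => h'.
  move: hz; rewrite ltNge => /negP; apply.
  rewrite normrM (gtr0_norm k0) mulrC -ltr_pdivlMr// in h'.
  rewrite -[z](subrK y0) addrC; apply: le_trans (ler_normD _ _) _.
  by rewrite lerD2l ltW.
have vC z : (0 <= v z <= expR (`|q| * B))%R.
  rewrite bump_ge0/=; case: (ltP B `|z|)%R => hz; first by rewrite vB// expR_ge0.
  rewrite /v /cos_bump -[leRHS]mulr1; apply: ler_pM; rewrite ?expR_ge0 ?cos_le1//.
    by rewrite cos_ge0_pihalf// clamp_itv.
  by rewrite ler_expR; apply: le_trans (ler_norm _) _; rewrite normrM; exact: ler_wpM2l.
have cv := @log_limit v B (expR (`|q| * B)) y0 (@continuous_bump _ q k y0) vC vB.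
set l := (h _ * _)%R in cv.
have ll : (l < l + 1)%R by rewrite ltrDl.
have up0 := cvgr_lt l cv; have up := up0 _ _ ll.
pose v0 := expR (q * y0); have v00 : (0 < v0)%R := expR_gt0 _.
have vy0 : v y0 = v0 by rewrite /v /cos_bump subrr mulr0 clampE ?cos0 ?mulr1//; apply/andP; split; lra.
have hv : pos_meas (EFin \o v) by apply: pos_meas_EFin; [exact: continuous_measurable_fun (@continuous_bump _ q k y0)|exact: bump_ge0].
have br0 : (0 < b + r)%R by lra.
have [M [_ HM]] := up.
pose t := (`|M| + 1 + `|(l + 1) / v0| / (b + r))%R.
have t0 : (0 <= t)%R by rewrite !addr_ge0 ?divr_ge0// ltW.
have Mt : (M < t)%R.
  have := ler_norm M; have : (0 <= `|(l + 1) / v0| / (b + r))%R by rewrite divr_ge0// ltW.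
  by rewrite /t; lra.
have := HM t Mt; rewrite ltNge => /negP; apply.
have g := bump_growth y0 k0 a0 sE cE erefl flow t0; rewrite -/v -/r vy0 in g.
have sgfin : sg t (EFin \o v) y0 = (fine (sg t (EFin \o v) y0))%:E.
  rewrite fineK// ge0_fin_numE; last exact: (pos_meas_sg _ _ _ _ hv).2.
  apply: le_lt_trans (ltry (expR (`|q| * B))); apply: sg_le_cst => // z.
  by rewrite lee_fin; case/andP: (vC z).
rewrite sgfin lee_fin in g.
apply: (@le_trans _ _ (expR (b * t) * (expR (r * t) * v0))%R); last by rewrite ler_wpM2l ?expR_ge0.
rewrite mulrA -expRD -ler_pdivrMr//.
have E := expR_ge1Dx (b * t + r * t)%R; apply: le_trans E.
have h1 := ler_norm ((l + 1) / v0)%R.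
have h2 : ((b + r) * t = (b + r) * (`|M| + 1) + `|(l + 1) / v0|)%R.
  by rewrite /t mulrDr; congr (_ + _)%R; rewrite mulrC divfK// gt_eqF.
have h3 : (0 <= (b + r) * (`|M| + 1))%R by apply: mulr_ge0; [exact: ltW|exact: addr_ge0].
by lra.
Qed.

Lemma no_malthusian : radon_pos nu -> nu `]0%R, +oo[%classic <> 0 ->
  (forall x, (0 < x)%R -> (0 < h x)%R) -> ~ (a_p < m)%R \/ ~ (m < a_m)%R -> False.
Proof.
move=> rnu nuD h0 cas; have ap0 := a_p_gt0; have pm := a_p_lt_a_m.
have am0 := lt_trans a_p_gt0 a_p_lt_a_m.
have [n pn] := plateau_charged rnu nuD.
pose v := plateau (R := R) n.
have cv : continuous v by exact: continuous_plateau.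
have v01 := plateau01 n : forall y : R, (0 <= v y <= 1)%R.
have mv : measurable_fun setT v := continuous_measurable_fun cv.
have hv : pos_meas (EFin \o v) by apply: pos_meas_EFin => // y; case/andP: (v01 y).
have vB y : (n.+1%:R < `|y|)%R -> v y = 0%R by move=> /ltW; exact: plateau0.
have conv := @log_limit v n.+1%:R 1%R 0%R cv v01 vB.
set l := (h _ * _)%R in conv.
have l0 : (0 < l)%R by rewrite mulr_gt0// h0// expR_gt0.
have l20 : (0 < l / 2)%R by rewrite divr_gt0.
have ll : (l / 2 < l)%R by lra.
have low0 := cvgr_gt l conv; have [M [_ HM]] := low0 _ _ ll.
have sgfin t : (0 <= t)%R -> sg t (EFin \o v) 0%R = (fine (sg t (EFin \o v) 0%R))%:E /\ (fine (sg t (EFin \o v) 0%R) <= 1)%R.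
  move=> t0; have le1 : sg t (EFin \o v) 0%R <= 1%:E.
    by apply: sg_le_cst => // z; rewrite lee_fin; case/andP: (v01 z).
  have fn : sg t (EFin \o v) 0%R \is a fin_num.
    rewrite ge0_fin_numE; last exact: (pos_meas_sg _ _ _ _ hv).2.
    exact: le_lt_trans le1 (ltry _).
  by split; [rewrite fineK|rewrite -lee_fin fineK].
have M0 := ler_norm M.
(* For [b < 0] the factor [exp(b t)] tends to 0 while [sg t v <= 1], against the positive limit. *)
have b0 : (0 <= b)%R.
  rewrite leNgt; apply/negP => b0.
  pose t := (`|M| + 1 + 2 / l / - b)%R.
  have nb : (0 < - b)%R by lra.
  have x0 : (0 < 2 / l / - b)%R by rewrite !divr_gt0.
  have t0 : (0 <= t)%R by have := normr_ge0 M; rewrite /t; lra.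
  have Mt : (M < t)%R by rewrite /t; lra.
  have [_ s1] := sgfin t t0.
  have := HM t Mt; rewrite /= => h1.
  have e0 := expR_gt0 (b * t); have e1 := ler_wpM2l (ltW e0) s1.
  have E := expR_ge1Dx (- (b * t))%R.
  have ee : (expR (b * t) * expR (- (b * t)) = 1)%R by rewrite -expRD subrr expR0.
  have h2 : (2 / l <= - (b * t))%R.
    have : (- b * (2 / l / - b) = 2 / l)%R by rewrite mulrC divfK// gt_eqF.
    have : (0 <= - b * (`|M| + 1))%R by apply: mulr_ge0; [exact: ltW|exact: addr_ge0].
    by rewrite /t; lra.
  have h3 : (l / 2 * (2 / l) = 1)%R by field; rewrite gt_eqF.
  have h4 : (l / 2 * (2 / l) <= expR (b * t) * - (b * t))%R.
    apply: ler_pM => //; [exact: ltW|by rewrite divr_ge0// ltW|by lra].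
  have := ler_wpM2l (ltW e0) E; lra.
have /andP[_ /ltW] := truncn_itv (normr_ge0 M); set jM := (Num.truncn `|M|).+1 => hjM.
have low j : (jM < j)%N -> (l / 2)%:E <= (expR (b * j%:R))%:E * sg j%:R (EFin \o v) 0%R.
  move=> jj; have [-> _] := sgfin j%:R (ler0n _ j); rewrite -EFinM lee_fin ltW//.
  apply: (HM j%:R); apply: le_lt_trans M0 _; apply: le_lt_trans hjM _; by rewrite ltr_nat.
have near_low : \forall j \near \oo, (l / 2)%:E <= (expR (b * j%:R))%:E * sg j%:R (EFin \o v) 0%R.
  by exists jM.+1 => // j /=; exact: low.
(* Without jumps the flow carries 0 out of the support of [v] for good. *)
have L0 : (0 < L)%R.
  rewrite lt_neqAle rate_ge0 andbT; apply/eqP => Lz.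
  have J0 : J setT = 0 by rewrite rateE -Lz.
  have /andP[_ /ltW hX] := truncn_itv (divr_ge0 (ler0n R n.+1) (ltW ap0)).
  set X := (Num.truncn (n.+1%:R / a_p)).+1 in hX.
  have := low (jM.+1 + X)%N (leq_addr _ _); set j := (jM.+1 + X)%N.
  have vz : (EFin \o v) (Phi j%:R 0%R) = 0.
    have PE : Phi j%:R 0%R = (a_p * j%:R)%R by rewrite log_flow_ge0// add0r.
    have ajX : (n.+1%:R <= a_p * j%:R)%R.
      by rewrite mulrC -ler_pdivrMr//; apply: le_trans hX _; rewrite ler_nat leq_addl.
    rewrite /=; congr EFin; apply: plateau0; rewrite PE; apply: le_trans ajX _; exact: ler_norm.
  have I0 : \int[mu]_(r in `[0%R, j%:R]) ((expR (- (L * r)))%:E *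
      \int[J]_xi sg (j%:R - r) (EFin \o v) (Phi r 0 + xi)) = 0.
    apply: integral0_eq => r _.
    have hs : pos_meas (fun xi : R => sg (j%:R - r) (EFin \o v) (Phi r 0 + xi)).
      by apply: pos_meas_comp (pos_meas_sg a_p a_m J _ hv); exact: measurable_funD.
    rewrite (ge0_negligible_integral measurableT _ hs.1 (fun z _ => hs.2 z) J0)//.
    by rewrite setDv integral_set0 mule0.
  by rewrite sgE// vz mule0 add0e I0 mule0 lee_fin leNgt l20.
have lt12 : (1 < 2 :> R)%R by rewrite ltr1n.
have [x1 [x10 J1]] := jump_window J_neg L0 lt12.
(* Centred at [pi / (2 k)] the bump lives in [y >= 0]; in [region_m], centred at [- pi / (2 k)], it
   lives in [y <= 0]. *)
have region_p k q C : (0 < k)%R -> \int[J]_xi trunc_sin q k xi = (a_p * k)%:E ->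
    \int[J]_xi trunc_cos q k xi = C%:E -> (a_p * q - L + C <= - b)%R.
  move=> k0 sE cE; apply: (rate_le (y0 := pi / 2 / k) k0 ap0 sE cE) => z u u0 z1 _.
  rewrite log_flow_ge0// -(pmulr_rge0 _ k0).
  have : (k * (z - pi / 2 / k) = k * z - pi / 2)%R by field; rewrite gt_eqF.
  by move: z1 => /[swap] ->; lra.
have region_m k q C : (0 < k)%R -> \int[J]_xi trunc_sin q k xi = (a_m * k)%:E ->
    \int[J]_xi trunc_cos q k xi = C%:E -> (a_m * q - L + C <= - b)%R.
  move=> k0 sE cE; apply: (rate_le (y0 := - (pi / 2 / k)) k0 am0 sE cE) => z u u0 _ z2.
  have zu : (z + a_m * u <= 0)%R.
    rewrite -(pmulr_rle0 _ k0).
    have : (k * (z + a_m * u - - (pi / 2 / k)) = k * (z + a_m * u) + pi / 2)%R by field; rewrite gt_eqF.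
    by move: z2 => /[swap] ->; lra.
  have au : (0 <= a_m * u)%R by rewrite mulr_ge0// ltW.
  by rewrite log_flow_le0//; lra.
have [C C0 hC] := mgf_taylor J_neg eps0_gt0 J_moment J_mean.
have reachv c s g : (0 < c)%R -> (forall y, (`|y| <= n.+1%:R)%R -> c%:E <= sg s%:R (EFin \o g) y) ->
    measurable_fun setT g -> (forall y, (0 <= g y)%R) -> forall z, (c * v z)%:E <= sg s%:R (EFin \o g) z.
  move=> c0 H mg g0 z; have hg : pos_meas (EFin \o g) by exact: pos_meas_EFin.
  case: (leP `|z| n.+1%:R)%R => hz.
    apply: le_trans (H z hz); rewrite lee_fin; apply: ler_piMr; first exact: ltW.
    by case/andP: (v01 z).
  by rewrite vB// mulr0; exact: (pos_meas_sg _ _ _ _ hg).2.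
have mexp q A : measurable_fun setT (fun z : R => A * expR (q * z))%R.
  by apply: measurable_funM => //; apply: measurableT_comp => //; exact: measurable_funM.
have e0 := eps0_gt0; have L0' := ltW L0.
pose D := (a_m - a_p)%R; have D0 : (0 < D)%R by rewrite subr_gt0.
(* Scaling for [b = 0]: amplitude [N / s] and exponent [s] up to sign keep the excess equal to
   [N D = L + 2 + a_m], while the Taylor error becomes [N C s], as small as desired and at most
   1. *)
pose N := ((L + 2 + a_m) / D)%R; have N0 : (0 < N)%R by rewrite divr_gt0//; lra.
have ND : (N * D = L + 2 + a_m)%R by rewrite /N divfK// gt_eqF.
have small k : (0 < k)%R -> exists s, [/\ (0 < s)%R, (s <= N)%R, (s <= eps0 / 2)%R & (N * C * s <= Num.min k 1)%R].
  move=> k0; pose w := Num.min k 1%R; have w0 : (0 < w)%R by rewrite lt_min k0 ltr01.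
  exists (Num.min N (Num.min (eps0 / 2) (w / (N * C + 1))))%R.
  have NC : (0 < N * C + 1)%R by rewrite ltr_wpDl// mulr_ge0// ltW.
  split.
  - by rewrite !lt_min N0 !divr_gt0.
  - by rewrite ge_min lexx.
  - by rewrite ge_min; apply/orP; right; rewrite ge_min lexx.
  - set s := Num.min N _.
    have s1 : (s <= w / (N * C + 1))%R.
      by rewrite /s ge_min; apply/orP; right; rewrite ge_min lexx orbT.
    have s0 : (0 <= s)%R by rewrite !le_min (ltW N0) !divr_ge0 ?ltW.
    by rewrite ler_pdivlMr// in s1; move: s1; rewrite -/w; clear -a_p_gt0 a_p_lt_a_m rho_meas rho_ge0 eps0_gt0 rho_moment phi_flow jumps J_neg J_moment J_mean alpha nu h lim b log_limit rate_le s0; lra.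
(* For [b > 0] the exponent is imposed by the root, so the amplitude is enlarged until the excess
   pays for the gain. *)
have big q : (0 < q)%R -> exists A, (1 <= A)%R /\ (L + 1 + a_m + 0 <= A * D * q)%R.
  move=> q0; exists (1 + (L + 1 + a_m) / (D * q))%R.
  have Dq : (0 < D * q)%R by rewrite mulr_gt0.
  have x0 : (0 <= (L + 1 + a_m) / (D * q))%R by rewrite divr_ge0 ?ltW//; clear -a_p_gt0 a_p_lt_a_m rho_meas rho_ge0 eps0_gt0 rho_moment phi_flow jumps J_neg J_moment J_mean alpha nu h lim b log_limit rate_le L0' am0; lra.
  split; first by rewrite lerDl.
  rewrite -mulrA mulrDl mul1r divfK ?gt_eqF//; clear -a_p_gt0 a_p_lt_a_m rho_meas rho_ge0 eps0_gt0 rho_moment phi_flow jumps J_neg J_moment J_mean alpha nu h lim b log_limit rate_le Dq; lra.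
have mg c := @measurable_gain R c; have g0 c := @gain_ge0 R c.
(* For [m <= a_p] the exponents are negative and the gain lies on [y < 0]; for [a_m <= m] both are
   reversed. *)
case: cas => /negP; rewrite -leNgt => hm.
  have [c c0 [s hs]] := gain_below_reached a_p_gt0 a_p_lt_a_m n.+1%:R x10 J1.
  apply: (@no_exponential_limit _ a_p a_m J a_p_gt0 a_p_lt_a_m b (l / 2) c 0%R s v (gain 1) l20 c0 mv
    (fun z => proj1 (andP (v01 z))) (mg 1%R) (g0 1%R) (reachv _ _ _ c0 hs (mg 1%R) (g0 1%R)) _ near_low).
  move=> k k0; case: (ltP 0 b)%R => bpos.
    have [q [M' [qM qb]]] := real_root J_neg ap0 x10 J1 region_p.
    have tan := mgf_ge_tangent J_neg J_mean qM.
    (* The tangent bound and [qb] give [q (a_p - m) <= - b < 0]. *)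
    have q0 : (q < 0)%R.
      rewrite ltNge; apply/negP => q0.
      have : (0 <= q * (a_p - m))%R by rewrite mulr_ge0// subr_ge0.
      by clear -a_p_gt0 a_p_lt_a_m rho_meas rho_ge0 eps0_gt0 rho_moment phi_flow jumps J_neg J_moment J_mean alpha nu h lim b log_limit rate_le qb tan bpos; lra.
    have nq0 : (0 < - q)%R by rewrite oppr_gt0.
    have [A [A1 A2]] := big _ nq0.
    exists (fun z => A * expR (q * z))%R, 0%R; split; [by rewrite lexx ltW|by left|exact: mexp| |].
      by move=> z; apply: mulr_ge0; [clear -a_p_gt0 a_p_lt_a_m rho_meas rho_ge0 eps0_gt0 rho_moment phi_flow jumps J_neg J_moment J_mean alpha nu h lim b log_limit rate_le A1; lra|exact: expR_ge0].
    apply: (gain_below a_p_gt0 a_p_lt_a_m (ltW q0) A1 b0 (lexx _) qM _ (erefl _) A2).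
    by apply: mulr_ge0_le0; clear -a_p_gt0 a_p_lt_a_m rho_meas rho_ge0 eps0_gt0 rho_moment phi_flow jumps J_neg J_moment J_mean alpha nu h lim b log_limit rate_le A1 qb; lra.
  (* For [b = 0] the root could be [q = 0], which brings no excess. A small nonzero exponent is
     taken instead, at the price of the slack [N C s']. *)
  have bz : b = 0%R by apply/eqP; rewrite eq_le bpos b0.
  have [s' [s0 sN se sk]] := small k k0.
  have nq : (`|- s'| <= eps0 / 2)%R by rewrite normrN gtr0_norm.
  have qM : \int[J]_xi (expR (- s' * xi))%:E = (mgf J (- s'))%:E by apply: (mgf_fin J_neg J_moment); clear -a_p_gt0 a_p_lt_a_m rho_meas rho_ge0 eps0_gt0 rho_moment phi_flow jumps J_neg J_moment J_mean alpha nu h lim b log_limit rate_le se s0 e0; lra.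
  have hq := hC (- s')%R nq; rewrite sqrrN in hq.
  have k1 : (N * C * s' <= 1)%R by apply: le_trans sk _; rewrite ge_min lexx orbT.
  have kk : (N * C * s' <= k)%R by apply: le_trans sk _; rewrite ge_min lexx.
  have kge : (0 <= N * C * s')%R by rewrite mulr_ge0 ?(ltW s0)// mulr_ge0// ltW.
  have A0 : (0 <= N / s')%R by apply: divr_ge0; exact: ltW.
  exists (fun z => N / s' * expR (- s' * z))%R, (N * C * s')%R; split; [by rewrite kge kk|by right|exact: mexp| |].
    by move=> z; apply: mulr_ge0 => //; exact: expR_ge0.
  have DE : (L + 2 + a_m = N / s' * D * - - s')%R by rewrite -ND opprK; field; rewrite gt_eqF.
  have ns : (- s' <= 0)%R by clear -a_p_gt0 a_p_lt_a_m rho_meas rho_ge0 eps0_gt0 rho_moment phi_flow jumps J_neg J_moment J_mean alpha nu h lim b log_limit rate_le s0; lra.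
  have A1 : (1 <= N / s')%R by rewrite ler_pdivlMr// mul1r.
  have fin : (L + 1 + a_m + N * C * s' <= L + 2 + a_m)%R by clear -a_p_gt0 a_p_lt_a_m rho_meas rho_ge0 eps0_gt0 rho_moment phi_flow jumps J_neg J_moment J_mean alpha nu h lim b log_limit rate_le k1 am0; lra.
  apply: (gain_below a_p_gt0 a_p_lt_a_m ns A1 b0 kge qM _ DE fin).
  have -> : (N * C * s' = N / s' * (C * s' ^+ 2))%R by field; rewrite gt_eqF.
  have sm : (0 <= s' * (a_p - m))%R by apply: mulr_ge0; [exact: ltW|rewrite subr_ge0].
  by apply: ler_wpM2l => //; rewrite bz; clear -a_p_gt0 a_p_lt_a_m rho_meas rho_ge0 eps0_gt0 rho_moment phi_flow jumps J_neg J_moment J_mean alpha nu h lim b log_limit rate_le hq sm; lra.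
have [c c0 [s hs]] := gain_above_reached J a_p_gt0 a_p_lt_a_m n.+1%:R.
apply: (@no_exponential_limit _ a_p a_m J a_p_gt0 a_p_lt_a_m b (l / 2) c 0%R s v (gain (-1)) l20 c0 mv
  (fun z => proj1 (andP (v01 z))) (mg (-1)%R) (g0 (-1)%R) (reachv _ _ _ c0 hs (mg (-1)%R) (g0 (-1)%R)) _ near_low).
move=> k k0; case: (ltP 0 b)%R => bpos.
  have [q [M' [qM qb]]] := real_root J_neg am0 x10 J1 region_m.
  have tan := mgf_ge_tangent J_neg J_mean qM.
  have q0 : (0 < q)%R.
    rewrite ltNge; apply/negP => q0.
    have : (0 <= - q * (m - a_m))%R by rewrite mulr_ge0 ?oppr_ge0 ?subr_ge0.
    by clear -a_p_gt0 a_p_lt_a_m rho_meas rho_ge0 eps0_gt0 rho_moment phi_flow jumps J_neg J_moment J_mean alpha nu h lim b log_limit rate_le qb tan bpos; lra.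
  have [A [A1 A2]] := big q q0.
  have A2' : (L + 1 + 0 <= A * D * q)%R by clear -a_p_gt0 a_p_lt_a_m rho_meas rho_ge0 eps0_gt0 rho_moment phi_flow jumps J_neg J_moment J_mean alpha nu h lim b log_limit rate_le A2 am0; lra.
  exists (fun z => A * expR (q * z))%R, 0%R; split; [by rewrite lexx ltW|by left|exact: mexp| |].
    by move=> z; apply: mulr_ge0; [clear -a_p_gt0 a_p_lt_a_m rho_meas rho_ge0 eps0_gt0 rho_moment phi_flow jumps J_neg J_moment J_mean alpha nu h lim b log_limit rate_le A1; lra|exact: expR_ge0].
  apply: (gain_above a_p_gt0 a_p_lt_a_m (ltW q0) A1 b0 (lexx _) qM _ (erefl _) A2').
  by apply: mulr_ge0_le0; clear -a_p_gt0 a_p_lt_a_m rho_meas rho_ge0 eps0_gt0 rho_moment phi_flow jumps J_neg J_moment J_mean alpha nu h lim b log_limit rate_le A1 qb; lra.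
have bz : b = 0%R by apply/eqP; rewrite eq_le bpos b0.
have [s' [s0 sN se sk]] := small k k0.
have nq : (`|s'| <= eps0 / 2)%R by rewrite gtr0_norm.
have qM : \int[J]_xi (expR (s' * xi))%:E = (mgf J s')%:E by apply: (mgf_fin J_neg J_moment); clear -a_p_gt0 a_p_lt_a_m rho_meas rho_ge0 eps0_gt0 rho_moment phi_flow jumps J_neg J_moment J_mean alpha nu h lim b log_limit rate_le se s0 e0; lra.
have hq := hC s' nq.
have k1 : (N * C * s' <= 1)%R by apply: le_trans sk _; rewrite ge_min lexx orbT.
have kk : (N * C * s' <= k)%R by apply: le_trans sk _; rewrite ge_min lexx.
have kge : (0 <= N * C * s')%R by rewrite mulr_ge0 ?(ltW s0)// mulr_ge0// ltW.
have A0 : (0 <= N / s')%R by apply: divr_ge0; exact: ltW.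
exists (fun z => N / s' * expR (s' * z))%R, (N * C * s')%R; split; [by rewrite kge kk|by right|exact: mexp| |].
  by move=> z; apply: mulr_ge0 => //; exact: expR_ge0.
have DE : (L + 2 + a_m = N / s' * D * s')%R by rewrite -ND; field; rewrite gt_eqF.
have A1 : (1 <= N / s')%R by rewrite ler_pdivlMr// mul1r.
have fin : (L + 1 + N * C * s' <= L + 2 + a_m)%R by clear -a_p_gt0 a_p_lt_a_m rho_meas rho_ge0 eps0_gt0 rho_moment phi_flow jumps J_neg J_moment J_mean alpha nu h lim b log_limit rate_le k1 am0; lra.
apply: (gain_above a_p_gt0 a_p_lt_a_m (ltW s0) A1 b0 kge qM _ DE fin).
have -> : (N * C * s' = N / s' * (C * s' ^+ 2))%R by field; rewrite gt_eqF.
have sm : (0 <= s' * (m - a_m))%R by apply: mulr_ge0; [exact: ltW|rewrite subr_ge0].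
by apply: ler_wpM2l => //; rewrite bz; clear -a_p_gt0 a_p_lt_a_m rho_meas rho_ge0 eps0_gt0 rho_moment phi_flow jumps J_neg J_moment J_mean alpha nu h lim b log_limit rate_le hq sm; lra.
Qed.

End limit.
End part2.

Local Close Scope ereal_scope.

Theorem theorem1p1 (R : realType) (a_p a_m : R) (rho : R -> R) (eps0 : R)
    (phi : R -> R -> R)
    (d : measure_display) (Omega : measurableType d) (P : probability Omega R)
    (tau sigma : nat -> {RV P >-> R})
    (a_p_gt0 : 0 < a_p) (a_p_lt_a_m : a_p < a_m)
    (rho_meas : measurable_fun (`[0, 1]%classic : set R) rho)
    (rho_ge0 : forall s : R, 0 <= s <= 1 -> 0 <= rho s)
    (eps0_gt0 : 0 < eps0)
    (rho_moment : (\int[lebesgue_measure]_(s in `[0%R, 1%R])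
                     (s `^ (- eps0) * rho s)%:E < +oo)%E)
    (phi_flow : is_flow (speed a_p a_m) phi)
    (jumps : jump_mechanism rho tau sigma) :
  let T := gf_semigroup rho tau sigma phi (speed a_p a_m) in
  let lambda := \int[lebesgue_measure]_(s in `[0, 1]) ((1 - s) * rho s) in
  let m := - \int[lebesgue_measure]_(s in `[0, 1]) (ln s * rho s) in
  (a_p < m < a_m ->
   exists (nu : probability R R) (eps : R),
     [/\ nu `]-oo, 0]%classic = 0%E, 0 < eps &
       forall f : R -> R, Cc_pos f -> forall x : R, 0 < x ->
         (expR (- lambda * t) * T t f x - pairing nu f) / expR (- eps * t)
           @[t --> +oo] --> (0 : R)])
  /\
  (~ (a_p < m) \/ ~ (m < a_m) ->
   ~ exists (alpha : R) (nu : {measure set R -> \bar R}) (h : R -> R),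
     [/\ radon_pos nu, nu `]0, +oo[%classic <> 0%E, forall x : R, 0 < x -> 0 < h x &
       forall f : R -> R, Cc_pos f -> forall x : R, 0 < x ->
         expR (- alpha * t) * T t f x @[t --> +oo] --> h x * pairing nu f]).
Proof.
move=> T lambda m; split=> [hm|hm [alpha [nu [h [rnu nuD h0 lim]]]]].
  exact: (exponential_convergence a_p_gt0 a_p_lt_a_m rho_meas rho_ge0 eps0_gt0
    rho_moment phi_flow jumps hm).
exact: (no_malthusian a_p_gt0 a_p_lt_a_m rho_meas rho_ge0 eps0_gt0 rho_moment
  phi_flow jumps lim rnu nuD h0 hm).
Qed.
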